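(* Let $1\le j\le k$, $d\ge j+2$, $0<\lambda_0\le\lambda_1$ and $0<L\le\lambda_0$. Let $m_L:\mathbb{R}^d\to\mathbb{C}$ be a smooth function with $|m_L(\xi)|\le B\min\{1,L|\xi|\}$ for all $\xi$. For an admissible frame $y_1,\dots,y_{j-1}$ and $\lambda>0$ let $M_{L,\lambda}=M^{y_1,\dots,y_{j-1}}_{L,\lambda}$ be the Fourier multiplier operator $\widehat{M_{L,\lambda}f}(\xi)=\widehat f(\xi)\,m_L(\xi)\,\widehat{\sigma^{(d-j)}_{y_1,\dots,y_{j-1}}}(\lambda\xi)$, and define $$\mathcal{M}^{(j)}_L(f)(x)=\sup_{\lambda_0\le\lambda\le\lambda_1}\int\!\cdots\!\int|M_{L,\lambda}f(x)|\,d\sigma^{(d-j+1)}_{y_1,\dots,y_{j-2}}(y_{j-1})\cdots d\sigma^{(d-1)}(y_1).$$ Then for all Schwartz $f$, $$\int_{\mathbb{R}^d}|\mathcal{M}^{(j)}_L(f)(x)|^2\,dx\le C\Big(\frac{L}{\lambda_0}\Big)^{1/3}\int_{\mathbb{R}^d}|f(x)|^2\,dx,$$ with $C$ depending only on $d$, $\Delta$ and $B$.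
   Context: Fix a non-degenerate simplex $\Delta=\{0,v_1,\dots,v_k\}\subseteq\mathbb{R}^k\subseteq\mathbb{R}^d$ ($v_i$ linearly independent), normalized so $|v_1|=1$. An admissible frame is $y_1,\dots,y_{j-1}$ with $y_i\cdot y_{i'}=v_i\cdot v_{i'}$ for $1\le i\le i'\le j-1$. $\sigma^{(d-1)}$ is the normalized surface measure on $\{|y|=|v_1|\}$; for $j\ge2$, $\sigma^{(d-j)}_{y_1,\dots,y_{j-1}}$ is the normalized surface measure on the $(d-j)$-sphere $S^{d-1}(0,|v_j|)\cap S^{d-1}(y_1,|v_j-v_1|)\cap\cdots\cap S^{d-1}(y_{j-1},|v_j-v_{j-1}|)$, $S^{d-1}(x,r)=\{x':|x-x'|=r\}$; for $j=1$ it is $\sigma^{(d-1)}$. Integrals over frames are taken with $y_1\sim\sigma^{(d-1)}$, $y_2\sim\sigma^{(d-2)}_{y_1}$, etc. Fourier transforms: $\widehat f(\xi)=\int f(x)e^{-2\pi ix\cdot\xi}dx$, $\widehat\nu(\xi)=\int e^{-2\pi ix\cdot\xi}d\nu(x)$. *)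

(* Defs.v *)
From HB Require Import structures.
From mathcomp Require Import all_boot all_order all_algebra.
From mathcomp Require Import all_classical all_reals all_analysis.
From mathcomp Require Import complex.

Set Implicit Arguments.
Unset Strict Implicit.
Unset Printing Implicit Defensive.

Import Order.TTheory GRing.Theory Num.Theory.
Import numFieldNormedType.Exports.

Local Open Scope classical_set_scope.
Local Open Scope ring_scope.

Section Defs.
Variable R : realType.
Variable d : nat.

Definition dotv (x y : 'rV[R]_d) : R := \sum_(i < d) x 0 i * y 0 i.
Definition vnorm (x : 'rV[R]_d) : R := Num.sqrt (dotv x x).

(** Lebesgue integral on R^d, built as the iterated integral of the
    one-dimensional Lebesgue measure over the coordinates d-1, ..., 0
    (for nonnegative measurable or for integrable integrands this is the
    integral w.r.t. d-dimensional Lebesgue measure, by Tonelli/Fubini). *)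
Fixpoint iint (n : nat) (g : (nat -> R) -> \bar R) : \bar R :=
  match n with
  | 0 => g (fun _ => 0)
  | n'.+1 => (\int[@lebesgue_measure R]_(t in [set: R])
               iint n' (fun x => g (fun i => if i == n' then t else x i)))%E
  end.

Definition intRd (G : 'rV[R]_d -> \bar R) : \bar R :=
  iint d (fun x => G (\row_(i < d) x i)).

Definition cintRd (g : 'rV[R]_d -> R[i]) : R[i] :=
  (fine (intRd (fun x => (complex.Re (g x))%:E)) +i*
   fine (intRd (fun x => (complex.Im (g x))%:E)))%C.

Definition cabs (z : R[i]) : R :=
  Num.sqrt (complex.Re z ^+ 2 + complex.Im z ^+ 2).

Definition expi (t : R) : R[i] := (cos t +i* sin t)%C.

Definition fourier (f : 'rV[R]_d -> R[i]) (xi : 'rV[R]_d) : R[i] :=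
  cintRd (fun x => f x * expi (- (2 * pi * dotv x xi))).

Definition inv_fourier (g : 'rV[R]_d -> R[i]) (x : 'rV[R]_d) : R[i] :=
  cintRd (fun xi => g xi * expi (2 * pi * dotv x xi)).

Definition gaussd (x : 'rV[R]_d) : R :=
  expR (- (vnorm x ^+ 2) / 2) / (Num.sqrt (2 * pi)) ^+ d.

Fixpoint iterD (s : seq 'I_d) (g : 'rV[R]_d -> R) : 'rV[R]_d -> R :=
  match s with
  | [::] => g
  | i :: s' => fun x => ('D_(delta_mx 0 i) (iterD s' g)) x
  end.

Definition smoothR (g : 'rV[R]_d -> R) : Prop :=
  forall s : seq 'I_d, continuous (iterD s g) /\
    forall (i : 'I_d) (x : 'rV[R]_d), derivable (iterD s g) x (delta_mx 0 i).

Definition smoothC (g : 'rV[R]_d -> R[i]) : Prop :=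
  smoothR (fun x => complex.Re (g x)) /\ smoothR (fun x => complex.Im (g x)).

Definition rapidR (g : 'rV[R]_d -> R) : Prop :=
  forall (s : seq 'I_d) (N : nat), exists K : R, forall x : 'rV[R]_d,
    (1 + vnorm x) ^+ N * `|iterD s g x| <= K.

Definition schwartz (f : 'rV[R]_d -> R[i]) : Prop :=
  smoothC f /\ rapidR (fun x => complex.Re (f x)) /\ rapidR (fun x => complex.Im (f x)).

(** The simplex: v 1, ..., v k (v 0 = 0 is implicit). *)
Variable v : nat -> 'rV[R]_d.

Definition admissible (ys : seq 'rV[R]_d) : Prop :=
  forall i i' : nat, (i < size ys)%N -> (i' < size ys)%N ->
    dotv (nth 0 ys i) (nth 0 ys i') = dotv (v i.+1) (v i'.+1).

(** Geometry of the sphere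
      S(0,|v_{m+1}|) /\ S(y_1,|v_{m+1}-v_1|) /\ ... /\ S(y_m,|v_{m+1}-v_m|)
    for a frame ys = [:: y_1; ...; y_m]: it is the sphere of center [sph_center]
    and radius [sph_radius] in the affine subspace through the center
    orthogonal to span(y_1..y_m). *)
Definition frame_mx (ys : seq 'rV[R]_d) : 'M[R]_(size ys, d) :=
  \matrix_(i < size ys, c < d) (nth 0 ys i) 0 c.

Definition span_proj (ys : seq 'rV[R]_d) : 'M[R]_d :=
  (frame_mx ys)^T *m invmx (frame_mx ys *m (frame_mx ys)^T) *m frame_mx ys.

Definition sph_center (ys : seq 'rV[R]_d) : 'rV[R]_d :=
  (\row_(i < size ys) dotv (v (size ys).+1) (v i.+1))
    *m invmx (frame_mx ys *m (frame_mx ys)^T) *m frame_mx ys.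

Definition sph_radius (ys : seq 'rV[R]_d) : R :=
  Num.sqrt (vnorm (v (size ys).+1) ^+ 2 - vnorm (sph_center ys) ^+ 2).

Definition sph_point (ys : seq 'rV[R]_d) (x : 'rV[R]_d) : 'rV[R]_d :=
  let xp := x - x *m span_proj ys in
  sph_center ys + (sph_radius ys / vnorm xp) *: xp.

(** Integral against the normalized surface measure sigma^{(d-m-1)}_{ys} on
    that sphere (m = size ys), realized as the image of the standard Gaussian
    measure of R^d under x |-> center + radius * P x / |P x|, where P is the
    orthogonal projection onto span(ys)^perp (rotation invariance of the
    Gaussian makes this the uniform probability on the sphere). *)
Definition sph_int (ys : seq 'rV[R]_d) (g : 'rV[R]_d -> \bar R) : \bar R :=
  intRd (fun x => (g (sph_point ys x) * (gaussd x)%:E)%E).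

Definition sph_cint (ys : seq 'rV[R]_d) (g : 'rV[R]_d -> R[i]) : R[i] :=
  (fine (sph_int ys (fun z => (complex.Re (g z))%:E)) +i*
   fine (sph_int ys (fun z => (complex.Im (g z))%:E)))%C.

Definition sigma_hat (ys : seq 'rV[R]_d) (xi : 'rV[R]_d) : R[i] :=
  sph_cint ys (fun z => expi (- (2 * pi * dotv z xi))).

Fixpoint frame_int (n : nat) (ys : seq 'rV[R]_d)
    (G : seq 'rV[R]_d -> \bar R) : \bar R :=
  match n with
  | 0 => G ys
  | n'.+1 => sph_int ys (fun y => frame_int n' (rcons ys y) G)
  end.

Definition mult_op (mL : 'rV[R]_d -> R[i]) (ys : seq 'rV[R]_d) (lam : R)
    (f : 'rV[R]_d -> R[i]) : 'rV[R]_d -> R[i] :=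
  inv_fourier (fun xi => fourier f xi * mL xi * sigma_hat ys (lam *: xi)).

Definition max_op (j : nat) (lam0 lam1 : R) (mL : 'rV[R]_d -> R[i])
    (f : 'rV[R]_d -> R[i]) (x : 'rV[R]_d) : \bar R :=
  ereal_sup [set frame_int j.-1 [::]
                 (fun ys => (cabs (mult_op mL ys lam f x))%:E)
            | lam in `[lam0, lam1]].

End Defs.

(* Main.v *)
Require Import Defs.
From HB Require Import structures.
From mathcomp Require Import all_boot all_order all_algebra.
From mathcomp Require Import all_classical all_reals all_analysis.
From mathcomp Require Import measurable_realfun complex ring lra.

Set Implicit Arguments.
Unset Strict Implicit.
Unset Printing Implicit Defensive.

Import Order.TTheory GRing.Theory Num.Theory.
Import numFieldNormedType.Exports.

Local Open Scope classical_set_scope.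
Local Open Scope ring_scope.

(** The maximal operator is controlled by chaining in [lam]. On a dyadic block
    [a <= lam < 2 a] one expands along dyadic points, so that the square of the supremum
    is bounded by the square at [a] plus a weighted sum of squares of increments. Jensen
    moves the square inside the average over frames, and Tonelli together with the
    inequality [int |g^|^2 <= int |g|^2] reduces everything to the averages over frames of
    [|sigma_hat(lam xi)|^2] and of the squared increments of [sigma_hat].

    For the latter, let [p] be the length of the projection of [xi / |xi|] orthogonal to
    the frame. Writing the uniform measure on the sphere as the image of a Gaussian and
    isolating one coordinate [t], an integration by parts in [t] gives
    [|sigma_hat(lam xi)|^2 <= C (lam |xi|)^(-1/3) p^(-5/3)], and an increment of relative
    length [h] gains a further factor [h^(4/3)]. The weight [p^(-5/3)] has a finite average,
    because adding one vector to the frame multiplies [p^2] by [Q / (t^2 + Q)] with [t]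
    standard normal, [Q] independent of [t] and [E (Q^(-5/6)) < oo]; here [d >= j + 2] is used.
    Finally [|m_L|^2 <= B^2 (L |xi|)^(1/3)] absorbs [(lam |xi|)^(-1/3)], and the sums over
    increments and over blocks are geometric.

    The inequality [int |g^|^2 <= int |g|^2] comes from the weights [exp (- eps |x_i|)], whose
    Fourier transform is a positive kernel of mass one. *)

(** * Lebesgue and Gaussian measures on row vectors *)

(** The exponents are set by two competing demands. Integration by parts costs a factor of order
    [1/Q] when the Gaussian part [Q] orthogonal to the frame and to [xi] is small, so that only a
    power [theta] of its gain survives averaging. Two spare orthogonal directions bound [Q] below by
    a product of two independent Gaussian coordinates, and [|t|^(-theta)] is integrable for
    [theta < 1]. On the other side, keeping [(lam |xi|)^(-1/3)] from a squared increment leaves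
    [h^(2 theta - 1/3)], and the [2^r] increments with [h = 2^(-r)] are summable only if
    [2 theta - 1/3 > 1], that is [theta > 2/3]. The value [theta = 5/6] is the middle of this range;
    the dyadic sums then have exponents that are multiples of [1/6] and are written with integer
    powers of [q6 = 2^(1/6)].

    The weights are infinite in degenerate positions, for instance when [xi] lies in the span of the
    frame. Estimates are therefore kept in the extended reals, with value [+oo] there, so that no
    null set has to be singled out. *)

Section measurable_matrix.
Context {dsp : measure_display} {T : measurableType dsp}.
Variables m n : nat.

(** The product sigma-algebra of the entries, so that measurability is checked entrywise. The link
    with continuity is [continuous_measurable_rV]. *)
Definition mx_cylinders : set (set 'M[T]_(m, n)) :=
  <<s \bigcup_(ij : 'I_m * 'I_n)
        preimage_set_system setT (fun A : 'M[T]_(m, n) => A ij.1 ij.2) measurable >>.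

Let mx_set0 : mx_cylinders set0.
Proof. exact: sigma_algebra0. Qed.

Let mx_setC A : mx_cylinders A -> mx_cylinders (~` A).
Proof. exact: sigma_algebraC. Qed.

Let mx_bigcup (F : _^nat) : (forall i, mx_cylinders (F i)) ->
  mx_cylinders (\bigcup_i (F i)).
Proof. exact: sigma_algebra_bigcup. Qed.

HB.instance Definition _ := @isMeasurable.Build (measure_tuple_display dsp)
  'M[T]_(m, n) mx_cylinders mx_set0 mx_setC mx_bigcup.

Lemma measurable_coord (i : 'I_m) (j : 'I_n) :
  measurable_fun setT (fun A : 'M[T]_(m, n) => A i j).
Proof.
move=> _ Y mY; rewrite setTI; apply: sub_sigma_algebra.
by exists (i, j) => //=; exists Y => //; rewrite setTI.
Qed.

Lemma measurable_mxP {d' : measure_display} {U : measurableType d'} (f : U -> 'M[T]_(m, n)) :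
  (forall i j, measurable_fun setT (fun u => f u i j)) -> measurable_fun setT f.
Proof.
move=> mf.
apply: (@measurability _ _ _ _ setT f
  (\bigcup_(ij : 'I_m * 'I_n)
        preimage_set_system setT (fun A : 'M[T]_(m, n) => A ij.1 ij.2) measurable)) => //.
move=> _ -[_ [[i j] _ [B mB <-]] <-] /=.
rewrite !setTI.
have := mf i j measurableT B mB.
by rewrite setTI.
Qed.

End measurable_matrix.

Lemma sigma_finite_product (d1 d2 : measure_display) (T1 : measurableType d1)
    (T2 : measurableType d2) (R : realType)
    (m1 : {sigma_finite_measure set T1 -> \bar R})
    (m2 : {sigma_finite_measure set T2 -> \bar R}) :
  sigma_finite setT (m1 \x m2)%E.
Proof.
have /sigma_finiteP[F [TF ndF Foo]] := sigma_finiteT m1.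
have /sigma_finiteP[G [TG ndG Goo]] := sigma_finiteT m2.
exists (fun n => F n `*` G n).
  rewrite -setXTT TF TG predeqE => -[x y]; split; last by move=> [n _ []/= ? ?]; split; exists n.
  move=> [/= [n _ Fnx] [k _ Gky]]; exists (maxn n k) => //; split.
    by move: x Fnx; exact/subsetPset/ndF/leq_maxl.
  by move: y Gky; exact/subsetPset/ndG/leq_maxr.
move=> k; have [? ?] := Foo k; have [? ?] := Goo k.
split; first exact: measurableX.
by rewrite product_measure1E// lte_mul_pinfty// ge0_fin_numE.
Qed.

Section product_measure.
Context {R : realType}.

(** The new coordinate is put last because [iint] integrates the coordinate of largest index
    outermost; [row_snocE] matches the two conventions. *)
Definition row_snoc n (p : measurableTypeR R * 'rV[R]_n) : 'rV[R]_n.+1 :=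
  \row_i oapp (p.2 0) p.1 (unlift ord_max i).

Definition row_unsnoc n (y : 'rV[R]_n.+1) : measurableTypeR R * 'rV[R]_n :=
  (y 0 ord_max, \row_j y 0 (lift ord_max j)).

Lemma row_snocK n : cancel (@row_snoc n) (@row_unsnoc n).
Proof.
move=> [t x]; congr (_, _); first by rewrite mxE unlift_none.
by apply/rowP => j; rewrite !mxE liftK.
Qed.

Lemma measurable_row_snoc n : measurable_fun setT (@row_snoc n).
Proof.
apply: measurable_mxP => i j; rewrite /row_snoc.
under eq_fun do rewrite mxE.
case: unliftP => [k _|_] /=; last exact: measurable_fst.
exact: (measurableT_comp (measurable_coord 0 k) measurable_snd).
Qed.

Lemma measurable_row_unsnoc n : measurable_fun setT (@row_unsnoc n).
Proof.
apply/measurable_fun_pairP; split; first exact: measurable_coord.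
apply: measurable_mxP => i j /=.
under eq_fun do rewrite mxE.
exact: measurable_coord.
Qed.

Section snoc_measure.
Variables (nu : {sigma_finite_measure set (measurableTypeR R) -> \bar R}) (n : nat)
  (mu : {sigma_finite_measure set 'rV[R]_n -> \bar R}).

Definition snoc_measure : set 'rV[R]_n.+1 -> \bar R :=
  pushforward (nu \x mu)%E (@row_snoc n).

Let snoc0 : snoc_measure set0 = 0%E.
Proof. by rewrite /snoc_measure /pushforward preimage_set0 measure0. Qed.

Let snoc_ge0 A : (0 <= snoc_measure A)%E.
Proof. by rewrite /snoc_measure /pushforward. Qed.

Let snoc_sigma_additive : semi_sigma_additive snoc_measure.
Proof.
rewrite /snoc_measure; move: (@measurable_row_snoc n) => mphi.
exact: (@measure_semi_sigma_additive _ _ _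
  (measure_function_pushforward__canonical__measure_function_Measure (nu \x mu)%E mphi)).
Qed.

HB.instance Definition _ := isMeasure.Build _ _ _ snoc_measure
  snoc0 snoc_ge0 snoc_sigma_additive.

Let snoc_sigma_finite : sigma_finite setT snoc_measure.
Proof.
have [F UF mF] := sigma_finite_product nu mu.
exists (fun i => @row_unsnoc n @^-1` F i).
  by rewrite -preimage_bigcup -UF preimage_setT.
move=> i; have [mFi Fi] := mF i; split.
  rewrite -[X in measurable X]setTI.
  exact: measurable_row_unsnoc.
rewrite /snoc_measure /pushforward -comp_preimage.
rewrite (_ : _ \o _ = id) //.
by apply/funext => p /=; rewrite row_snocK.
Qed.

HB.instance Definition _ := Measure_isSigmaFinite.Build _ _ _ snoc_measure
  snoc_sigma_finite.

End snoc_measure.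

(** The one-dimensional factor is a parameter, so that Lebesgue measure ([leb]) and the Gaussian
    measure ([gam]) share one construction. *)
Fixpoint rV_measure (nu : {sigma_finite_measure set (measurableTypeR R) -> \bar R}) n :
    {sigma_finite_measure set 'rV[R]_n -> \bar R} :=
  match n with
  | 0 => \d_(0 : 'rV[R]_0)
  | n'.+1 => snoc_measure nu (rV_measure nu n')
  end.

End product_measure.

Section rV_measure_integral.
Context {R : realType}.
Local Open Scope ereal_scope.

Lemma ge0_integral_rV_snoc (nu : {sigma_finite_measure set (measurableTypeR R) -> \bar R}) n
    (f : 'rV[R]_n.+1 -> \bar R) :
  measurable_fun setT f -> (forall x, 0 <= f x) ->
  \int[rV_measure nu n.+1]_x f x =
  \int[nu]_t \int[rV_measure nu n]_x f (row_snoc (t, x)).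
Proof.
move=> mf f0.
rewrite /= /snoc_measure ge0_integral_pushforward//; last exact: measurable_row_snoc.
rewrite preimage_setT.
rewrite fubini_tonelli1//=.
by apply: measurableT_comp => //; exact: measurable_row_snoc.
Qed.

Lemma ge0_integral_rV0 (nu : {sigma_finite_measure set (measurableTypeR R) -> \bar R})
    (f : 'rV[R]_0 -> \bar R) : measurable_fun setT f ->
  \int[rV_measure nu 0]_x f x = f 0%R.
Proof. by move=> mf; rewrite /= integral_dirac// diracT mul1e. Qed.

(** The integral of a nonnegative function is a supremum over simple functions below it, which gives
    monotonicity for arbitrary functions. This matters at the very end: the supremum over [lam] is
    never shown to be measurable. *)
Lemma le_integralT (d : measure_display) (X : measurableType d) (mu : {measure set X -> \bar R})
    (f g : X -> \bar R) : (forall x, 0 <= f x) -> (forall x, f x <= g x) ->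
  \int[mu]_x f x <= \int[mu]_x g x.
Proof.
move=> f0 fg.
have g0 x : 0 <= g x by exact: le_trans (fg x).
rewrite !ge0_integralTE//.
by apply: le_ereal_sup => _ [h hf <-]; exists h => // x; exact: le_trans (fg x).
Qed.

Lemma row_snocE n (t : R) (z : nat -> R) :
  \row_(i < n.+1) (if i == n :> nat then t else z i) = row_snoc (t, \row_(i < n) z i).
Proof.
apply/rowP => i; rewrite !mxE; case: unliftP => [j ->|->] /=; last by rewrite eqxx.
rewrite mxE /bump leqNgt ltn_ord /= add0n.
by rewrite (ltn_eqF (ltn_ord j)).
Qed.

Lemma iint_ge0 n (g : (nat -> R) -> \bar R) : (forall z, 0 <= g z) -> 0 <= iint n g.
Proof.
elim: n g => [|n IH] g g0 /=; first exact: g0.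
by apply: integral_ge0 => t _; apply: IH.
Qed.

Lemma le_iint n (g h : (nat -> R) -> \bar R) :
  (forall z, 0 <= g z) -> (forall z, g z <= h z) -> iint n g <= iint n h.
Proof.
elim: n g h => [|n IH] g h g0 gh /=; first exact: gh.
apply: le_integralT => //= t; first exact: iint_ge0.
exact: IH.
Qed.

Lemma le_intRd d (g h : 'rV[R]_d -> \bar R) :
  (forall z, 0 <= g z) -> (forall z, g z <= h z) -> intRd g <= intRd h.
Proof. by move=> g0 gh; exact: le_iint. Qed.

Lemma eq_iint n (g h : (nat -> R) -> \bar R) : g =1 h -> iint n g = iint n h.
Proof. by move=> /funext ->. Qed.

(** The weight [w] is the density of [nu]: each step of the recursion in [iint] peels off one factor
    [w t], absorbed by the change of measure in the outer variable. *)
Lemma ge0_iintE (nu : {sigma_finite_measure set (measurableTypeR R) -> \bar R}) (w : R -> R) n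
    (G : 'rV[R]_n -> \bar R) :
  measurable_fun setT w -> (forall t, (0 <= w t)%R) ->
  (forall h : R -> \bar R, measurable_fun setT h -> (forall t, 0 <= h t) ->
    \int[nu]_t h t = \int[@lebesgue_measure R]_t (h t * (w t)%:E)) ->
  measurable_fun setT G -> (forall x, 0 <= G x) ->
  iint n (fun z => G (\row_(i < n) z i) * (\prod_(i < n) w (z i))%:E) =
  \int[rV_measure nu n]_x G x.
Proof.
move=> mw w0 nuw; elim: n G => [|n IH] G mG G0.
  rewrite ge0_integral_rV0//= big_ord0 mule1; congr G.
  by apply/rowP; case.
rewrite ge0_integral_rV_snoc// nuw; first last.
- by move=> t; apply: integral_ge0.
- apply: (measurable_fun_fubini_tonelli_F (m2 := rV_measure nu n) (G \o @row_snoc R n)) => //=.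
  by apply: measurableT_comp => //; exact: measurable_row_snoc.
apply: eq_integral => t _.
have mGt : measurable_fun setT (fun x => G (row_snoc (t, x))).
  apply: measurableT_comp => //; apply: measurableT_comp; first exact: measurable_row_snoc.
  exact: measurable_pair1.
have mGt' : measurable_fun setT (fun x => (w t)%:E * G (row_snoc (t, x))).
  exact: measurable_funeM.
rewrite muleC -ge0_integralZl//= -?IH//; last 2 first.
- by move=> x; rewrite mule_ge0 ?lee_fin.
- by rewrite lee_fin.
apply: eq_iint => z.
rewrite row_snocE big_ord_recr /= eqxx mulrC EFinM.
rewrite (eq_bigr (fun i : 'I_n => w (z i))); last first.
  by move=> i _; rewrite (ltn_eqF (ltn_ord i)).
by rewrite muleA; congr (_ * _); rewrite muleC.
Qed.

Definition leb1 : {sigma_finite_measure set (measurableTypeR R) -> \bar R} :=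
  @lebesgue_measure R.

Definition leb n : {sigma_finite_measure set 'rV[R]_n -> \bar R} :=
  rV_measure leb1 n.

Lemma ge0_intRdE n (G : 'rV[R]_n -> \bar R) :
  measurable_fun setT G -> (forall x, 0 <= G x) -> intRd G = \int[leb n]_x G x.
Proof.
move=> mG G0; rewrite /intRd /leb -(@ge0_iintE _ (cst 1%R))//; last first.
  by move=> h _ _; apply: eq_integral => t _; rewrite mule1.
by apply: eq_iint => z; rewrite prodr_const expr1n mule1.
Qed.

End rV_measure_integral.

(** * The Gaussian measure as a product measure with density *)

Section normal_density.
Context {R : realType}.
Local Open Scope ereal_scope.

Lemma ge0_integral_normal_prob (h : R -> \bar R) :
  measurable_fun setT h -> (forall t, 0 <= h t) ->
  \int[normal_prob 0 1]_t h t =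
  \int[@lebesgue_measure R]_t (h t * (normal_pdf 0 1 t)%:E).
Proof.
move=> mh h0.
have dom := @normal_prob_dominates R 0 1.
rewrite -(Radon_Nikodym_SigmaFinite.change_of_variables dom)//.
apply: ae_eq_integral => //.
- apply: emeasurable_funM => //.
  exact: measurable_int (Radon_Nikodym_SigmaFinite.f_integrable dom).
- apply: emeasurable_funM => //; apply/measurable_EFinP; exact: measurable_normal_pdf.
apply: ae_eqe_mul2l.
apply: integral_ae_eq => //.
- exact: Radon_Nikodym_SigmaFinite.f_integrable.
- apply/measurable_EFinP; exact: measurable_normal_pdf.
- by move=> A _ mA; rewrite -Radon_Nikodym_SigmaFinite.f_integral.
Qed.

Definition gam n : {sigma_finite_measure set 'rV[R]_n -> \bar R} :=
  rV_measure (normal_prob 0 1 : {sigma_finite_measure set (measurableTypeR R) -> \bar R}) n.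

Lemma gaussdE n (x : 'rV[R]_n) : gaussd x = (\prod_(i < n) normal_pdf 0 1 (x 0%R i))%R.
Proof.
rewrite /gaussd sqr_sqrtr; last first.
  by apply: sumr_ge0 => i _; rewrite -expr2 sqr_ge0.
rewrite normal_pdfE ?oner_neq0// big_split /= prodr_const card_ord.
rewrite [RHS]mulrC; congr (_ * _)%R; last first.
  by rewrite /normal_peak expr1n mul1r exprVn mulr_natl.
rewrite /normal_fun /dotv -expR_sum; congr expR.
rewrite -sumrN mulr_suml; apply: eq_bigr => i _.
by rewrite subr0 expr1n expr2.
Qed.

Lemma ge0_intRd_gauss n (G : 'rV[R]_n -> \bar R) :
  measurable_fun setT G -> (forall x, 0 <= G x) ->
  intRd (fun x => G x * (gaussd x)%:E) = \int[gam n]_x G x.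
Proof.
move=> mG G0; rewrite /gam -(@ge0_iintE _ _ (normal_pdf 0 1))//; last first.
- exact: ge0_integral_normal_prob.
- by move=> t; exact: normal_pdf_ge0.
- exact: measurable_normal_pdf.
apply: eq_iint => z; rewrite gaussdE; congr (_ * (_)%:E).
by apply: eq_bigr => i _; rewrite mxE.
Qed.

Lemma ge0_integral_rV_prod (nu : {sigma_finite_measure set (measurableTypeR R) -> \bar R})
    n (w : 'I_n -> R -> R) (c : 'I_n -> R) :
  (forall i, measurable_fun setT (w i)) -> (forall i t, (0 <= w i t)%R) ->
  (forall i, \int[nu]_t (w i t)%:E = (c i)%:E) ->
  \int[rV_measure nu n]_x (\prod_(i < n) w i (x 0%R i))%:E = (\prod_(i < n) c i)%:E.
Proof.
elim: n w c => [|n IH] w c mw w0 wc.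
  under eq_integral do rewrite big_ord0.
  by rewrite ge0_integral_rV0// big_ord0.
have mp : measurable_fun setT (fun x : 'rV[R]_n.+1 => (\prod_(i < n.+1) w i (x 0%R i))%:E).
  apply/measurable_EFinP; apply: measurable_prod => i _ /=.
  exact: (measurableT_comp (mw i) (measurable_coord _ _)).
rewrite ge0_integral_rV_snoc//; last first.
  by move=> x; rewrite lee_fin prodr_ge0.
transitivity (\int[nu]_t ((w ord_max t)%:E * (\prod_(i < n) c (widen_ord (leqnSn n) i))%:E)).
  apply: eq_integral => t _.
  rewrite -(IH (fun i => w (widen_ord (leqnSn n) i)))// -ge0_integralZl//=.
  - apply: eq_integral => x _; rewrite big_ord_recr /= -EFinM mulrC.
    rewrite mxE unlift_none /=; congr ((_ * _)%:E).
    apply: eq_bigr => i _; congr (w _ _).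
    rewrite mxE (_ : widen_ord _ i = lift ord_max i) ?liftK//.
    by apply: val_inj; rewrite /= /bump leqNgt ltn_ord.
  - apply/measurable_EFinP; apply: measurable_prod => i _ /=.
    exact: (measurableT_comp (mw _) (measurable_coord _ _)).
  - by move=> x _; rewrite lee_fin prodr_ge0.
  - by rewrite lee_fin.
rewrite ge0_integralZr//=.
- by rewrite wc -EFinM big_ord_recr /= mulrC.
- apply/measurable_EFinP; exact: mw.
- by move=> t _; rewrite lee_fin.
- rewrite lee_fin prodr_ge0// => i _.
  by rewrite -lee_fin -wc integral_ge0// => t _; rewrite lee_fin.
Qed.

Lemma integrable_snoc (nu : {sigma_finite_measure set (measurableTypeR R) -> \bar R}) n
    (G : 'rV[R]_n.+1 -> R) :
  measurable_fun setT G ->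
  (rV_measure nu n.+1).-integrable setT (EFin \o G) ->
  (nu \x rV_measure nu n).-integrable setT (fun p => (G (row_snoc p))%:E).
Proof.
move=> mG /integrableP[_ iG].
have mGs : measurable_fun setT (fun p => G (@row_snoc R n p)).
  by apply: measurableT_comp => //; exact: measurable_row_snoc.
apply/integrableP; split; first exact/measurable_EFinP.
move: iG; rewrite ge0_integral_rV_snoc//; last by apply: measurableT_comp => //; apply/measurable_EFinP.
rewrite fubini_tonelli1//=.
by apply/measurable_EFinP; exact: measurableT_comp.
Qed.

Lemma integral_rV_snoc (nu : {sigma_finite_measure set (measurableTypeR R) -> \bar R}) n
    (G : 'rV[R]_n.+1 -> R) :
  measurable_fun setT G ->
  (rV_measure nu n.+1).-integrable setT (EFin \o G) ->
  \int[rV_measure nu n.+1]_x (G x)%:E =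
  \int[nu]_t \int[rV_measure nu n]_x (G (row_snoc (t, x)))%:E.
Proof.
move=> mG iG; have iG' := integrable_snoc mG iG.
rewrite [LHS]/= /snoc_measure integral_pushforward//=.
- by rewrite preimage_setT [RHS](integral12_prod_meas1 iG').
- exact: measurable_row_snoc.
- exact/measurable_EFinP.
Qed.

Lemma dominated_integrable_rV n (G : 'rV[R]_n -> R) (w : R -> R) (K : R) :
  measurable_fun setT G -> measurable_fun setT w -> (forall t, (0 <= w t)%R) ->
  \int[@lebesgue_measure R]_t (w t)%:E < +oo ->
  (forall x, `|G x| <= K * \prod_(i < n) w (x 0 i))%R ->
  (leb n).-integrable setT (EFin \o G).
Proof.
move=> mG mw w0 iw GK.
have iwE : \int[@lebesgue_measure R]_t (w t)%:E = (fine (\int[@lebesgue_measure R]_t (w t)%:E))%:E.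
  rewrite fineK// ge0_fin_numE//; apply: integral_ge0 => t _; by rewrite lee_fin.
have mp : measurable_fun setT (fun x : 'rV[R]_n => (\prod_(i < n) w (x 0%R i))%:E).
  apply/measurable_EFinP; apply: measurable_prod => i _ /=.
  exact: (measurableT_comp mw (measurable_coord _ _)).
have p0 (x : 'rV[R]_n) : 0 <= (\prod_(i < n) w (x 0%R i))%:E.
  by rewrite lee_fin prodr_ge0.
apply/integrableP; split; first exact/measurable_EFinP.
apply: (@le_lt_trans _ _ (\int[leb n]_x (`|K|%:E * (\prod_(i < n) w (x 0%R i))%:E))).
  apply: le_integralT => // x /=; rewrite -EFinM lee_fin.
  apply: le_trans (GK x) _; apply: ler_wpM2r; [exact: prodr_ge0|exact: ler_norm].
rewrite ge0_integralZl//.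
rewrite (@ge0_integral_rV_prod _ n (fun=> w) (fun=> fine (\int[@lebesgue_measure R]_t (w t)%:E)))//.
by rewrite -EFinM ltry.
Qed.

(** A majorant in product form is inherited by slices: freezing the last coordinate at [t] only
    replaces the constant [K] by [K * w t]. This keeps the induction running for signed
    integrands. *)
Lemma dominated_intRdE n (G : 'rV[R]_n -> R) (w : R -> R) (K : R) :
  measurable_fun setT G -> measurable_fun setT w -> (forall t, (0 <= w t)%R) ->
  \int[@lebesgue_measure R]_t (w t)%:E < +oo ->
  (forall x, `|G x| <= K * \prod_(i < n) w (x 0 i))%R ->
  intRd (fun x => (G x)%:E) = \int[leb n]_x (G x)%:E.
Proof.
move=> mG mw w0 iw; elim: n G K mG => [|n IH] G K mG GK.
  rewrite /leb ge0_integral_rV0//; last exact/measurable_EFinP.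
  by rewrite /intRd /=; congr ((G _)%:E); apply/rowP; case.
rewrite [RHS]integral_rV_snoc//; last exact: dominated_integrable_rV GK.
rewrite /intRd; apply: eq_integral => t _.
rewrite -(IH (fun x => G (row_snoc (t, x))) (K * w t)%R); last 2 first.
- apply: measurableT_comp => //; apply: measurableT_comp; first exact: measurable_row_snoc.
  exact: measurable_pair1.
- move=> x; apply: le_trans (GK _) _; rewrite big_ord_recr /= mxE unlift_none /=.
  rewrite -mulrA [X in (_ <= _ * X)%R]mulrC le_eqVlt; apply/orP; left; apply/eqP.
  congr (_ * (_ * _))%R; apply: eq_bigr => i _; congr (w _).
  rewrite mxE (_ : widen_ord _ i = lift ord_max i) ?liftK//.
  by apply: val_inj; rewrite /= /bump leqNgt ltn_ord.
by apply: eq_iint => z; rewrite row_snocE.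
Qed.

End normal_density.

Section measurable_vectors.
Context {R : realType} {n : nat} {dsp : measure_display} {U : measurableType dsp}.
Implicit Types f g : U -> 'rV[R]_n.

Lemma measurable_fun_coord f i : measurable_fun setT f ->
  measurable_fun setT (fun u => f u 0 i).
Proof. by move=> mf; exact: (measurableT_comp (measurable_coord 0 i) mf). Qed.

Lemma measurable_dotv f g : measurable_fun setT f -> measurable_fun setT g ->
  measurable_fun setT (fun u => dotv (f u) (g u)).
Proof.
move=> mf mg; apply: measurable_sum => i.
by apply: measurable_funM; exact: measurable_fun_coord.
Qed.

Lemma measurable_vnorm f : measurable_fun setT f ->
  measurable_fun setT (fun u => vnorm (f u)).
Proof.
move=> mf; apply: (measurableT_comp (f := @Num.sqrt R)); last exact: measurable_dotv.
exact: continuous_measurable_fun (@sqrt_continuous R).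
Qed.

Lemma measurable_addv f g : measurable_fun setT f -> measurable_fun setT g ->
  measurable_fun setT (fun u => f u + g u).
Proof.
move=> mf mg; apply: measurable_mxP => i j; rewrite (ord1 i).
under eq_fun do rewrite mxE.
by apply: measurable_funD; exact: measurable_fun_coord.
Qed.

Lemma measurable_scalev (a : U -> R) f : measurable_fun setT a -> measurable_fun setT f ->
  measurable_fun setT (fun u => a u *: f u).
Proof.
move=> ma mf; apply: measurable_mxP => i j; rewrite (ord1 i).
under eq_fun do rewrite mxE.
by apply: measurable_funM => //; exact: measurable_fun_coord.
Qed.

Lemma measurable_oppv f : measurable_fun setT f -> measurable_fun setT (fun u => - f u).
Proof.
move=> mf; under eq_fun do rewrite -scaleN1r.
exact: measurable_scalev.
Qed.

Lemma measurable_subv f g : measurable_fun setT f -> measurable_fun setT g ->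
  measurable_fun setT (fun u => f u - g u).
Proof. by move=> mf mg; apply: measurable_addv => //; exact: measurable_oppv. Qed.

End measurable_vectors.

Section dotv_theory.
Context {R : realType} {n : nat}.
Implicit Types x y z : 'rV[R]_n.

Lemma dotvC x y : dotv x y = dotv y x.
Proof. by apply: eq_bigr => i _; rewrite mulrC. Qed.

Lemma dotvDl x y z : dotv (x + y) z = dotv x z + dotv y z.
Proof. by rewrite -big_split; apply: eq_bigr => i _; rewrite mxE mulrDl. Qed.

Lemma dotvZl a x y : dotv (a *: x) y = a * dotv x y.
Proof. by rewrite mulr_sumr; apply: eq_bigr => i _; rewrite mxE mulrA. Qed.

Lemma dotvDr x y z : dotv z (x + y) = dotv z x + dotv z y.
Proof. by rewrite dotvC dotvDl !(dotvC z). Qed.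

Lemma dotvZr a x y : dotv x (a *: y) = a * dotv x y.
Proof. by rewrite dotvC dotvZl dotvC. Qed.

Lemma dotvNl x y : dotv (- x) y = - dotv x y.
Proof. by rewrite -scaleN1r dotvZl mulN1r. Qed.

Lemma dotvNr x y : dotv x (- y) = - dotv x y.
Proof. by rewrite dotvC dotvNl dotvC. Qed.

Lemma dotvBl x y z : dotv (x - y) z = dotv x z - dotv y z.
Proof. by rewrite dotvDl dotvNl. Qed.

Lemma dotvBr x y z : dotv z (x - y) = dotv z x - dotv z y.
Proof. by rewrite dotvDr dotvNr. Qed.

Lemma dotv0l x : dotv 0 x = 0.
Proof. by rewrite -(scale0r 0) dotvZl mul0r. Qed.

Lemma dotv0r x : dotv x 0 = 0.
Proof. by rewrite dotvC dotv0l. Qed.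

Lemma dotv_ge0 x : 0 <= dotv x x.
Proof. by apply: sumr_ge0 => i _; rewrite -expr2 sqr_ge0. Qed.

Lemma vnorm_ge0 x : 0 <= vnorm x.
Proof. exact: sqrtr_ge0. Qed.

Lemma vnorm_sqr x : vnorm x ^+ 2 = dotv x x.
Proof. by rewrite sqr_sqrtr// dotv_ge0. Qed.

Lemma dotv_eq0 x : (dotv x x == 0) = (x == 0).
Proof.
apply/eqP/eqP => [|->]; last by rewrite dotv0l.
move=> /eqP; rewrite psumr_eq0; last by move=> i _; rewrite -expr2 sqr_ge0.
move=> /allP x0; apply/rowP => i; rewrite mxE; apply/eqP.
by have := x0 i (mem_index_enum _); rewrite /= mulf_eq0 orbb.
Qed.

Lemma vnorm_eq0 x : (vnorm x == 0) = (x == 0).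
Proof. by rewrite -sqrf_eq0 vnorm_sqr dotv_eq0. Qed.

Lemma vnormZ a x : vnorm (a *: x) = `|a| * vnorm x.
Proof.
rewrite /vnorm dotvZl dotvZr mulrA -expr2 sqrtrM ?sqr_ge0//.
by rewrite sqrtr_sqr.
Qed.

Lemma dotv_CS x y : dotv x y ^+ 2 <= dotv x x * dotv y y.
Proof.
have [->|y0] := eqVneq y 0; first by rewrite !dotv0r expr0n mulr0.
have yy : 0 < dotv y y by rewrite lt_neqAle dotv_ge0 eq_sym dotv_eq0 y0.
have := dotv_ge0 (x - (dotv x y / dotv y y) *: y).
rewrite dotvBl !dotvBr !dotvZl !dotvZr (dotvC y x).
set a := dotv x x; set b := dotv x y; set c := dotv y y in yy *.
have -> : a - b / c * b - (b / c * b - b / c * (b / c * c)) = a - b ^+ 2 / c.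
  by field; rewrite gt_eqF.
by rewrite subr_ge0 ler_pdivrMr.
Qed.

Lemma abs_dotv_le x y : `|dotv x y| <= vnorm x * vnorm y.
Proof.
rewrite -(@ler_pXn2r _ 2)// ?nnegrE ?mulr_ge0 ?vnorm_ge0//.
by rewrite real_normK ?num_real// exprMn !vnorm_sqr dotv_CS.
Qed.

End dotv_theory.

(** * Invariance of Lebesgue measure and splitting of the Gaussian along a direction *)

Section lebesgue_invariance.
Context {R : realType}.
Local Open Scope ereal_scope.
Local Notation mR := (measurableTypeR R).
Local Notation mu := (@lebesgue_measure R).

Lemma ge0_integral_shift (f : mR -> \bar R) (a : R) :
  measurable_fun setT f -> (forall t, 0 <= f t) ->
  \int[mu]_t f (t + a)%R = \int[mu]_t f t.
Proof.
move=> mf f0; pose phi := (fun t => t + a)%R : mR -> mR.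
have mphi : measurable_fun setT phi by apply: measurable_funD.
transitivity (\int[pushforward mu phi]_t f t).
  by rewrite ge0_integral_pushforward.
apply: eq_measure_integral => //= A mA _.
apply/esym/lebesgue_measure_unique => //= _ [[b c]] _ <-.
rewrite /pushforward /phi.
rewrite (_ : _ @^-1` _ = `](b - a)%R, (c - a)%R]%classic).
  rewrite !lebesgue_measure_itv/= !lte_fin ltrD2r; case: ifP => // _.
  by rewrite -!EFinB; congr (_%:E); ring.
by apply/seteqP; split => t /=; rewrite !in_itv/= ltrBlDr lerBrDr.
Qed.

Lemma ge0_integral_oppr (f : mR -> \bar R) :
  measurable_fun setT f -> (forall t, 0 <= f t) ->
  \int[mu]_t f (- t)%R = \int[mu]_t f t.
Proof.
move=> mf f0; transitivity (\int[pushforward mu (-%R : _ -> mR)]_t f t).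
  by rewrite ge0_integral_pushforward.
by apply: eq_measure_integral => //= A mA _; exact: lebesgue_measureN.
Qed.

Lemma row_snocD n t s (x y : 'rV[R]_n) :
  (row_snoc (t, x) + row_snoc (s, y))%R = row_snoc ((t + s)%R, (x + y)%R).
Proof.
by apply/rowP => i; rewrite !mxE; case: (unlift _ _) => [j|] //=; rewrite mxE.
Qed.

Lemma row_unsnocK n (y : 'rV[R]_n.+1) : row_snoc (row_unsnoc y) = y.
Proof.
apply/rowP => i; rewrite mxE; case: unliftP => [j ->|->] //=.
by rewrite mxE.
Qed.

Lemma ge0_integral_shiftv n (f : 'rV[R]_n -> \bar R) (c : 'rV[R]_n) :
  measurable_fun setT f -> (forall t, 0 <= f t) ->
  \int[leb n]_x f (x + c)%R = \int[leb n]_x f x.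
Proof.
elim: n f c => [|n IH] f c mf f0.
  by apply: eq_integral => x _; congr f; apply/rowP; case.
have mfc : measurable_fun setT (fun x : 'rV[R]_n.+1 => f (x + c)%R).
  by apply: measurableT_comp => //; apply: measurable_addv.
apply: (etrans (ge0_integral_rV_snoc leb1 mfc (fun x => f0 _))).
apply: esym; apply: (etrans (ge0_integral_rV_snoc leb1 mf f0)); apply: esym.
transitivity (\int[leb1]_t \int[leb n]_x f (row_snoc ((t + (row_unsnoc c).1)%R, x))).
  apply: eq_integral => t _.
  rewrite -(IH (fun x => f (row_snoc ((t + (row_unsnoc c).1)%R, x))) (row_unsnoc c).2)//; last first.
    apply: measurableT_comp => //; apply: measurableT_comp; first exact: measurable_row_snoc.
    exact: measurable_pair1.
  apply: eq_integral => x _.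
  by rewrite -row_snocD -surjective_pairing row_unsnocK.
apply: (ge0_integral_shift (f := fun t => \int[leb n]_x f (row_snoc (t, x)))).
  apply: (measurable_fun_fubini_tonelli_F (m2 := leb n) (f \o @row_snoc R n)) => //=.
  by apply: measurableT_comp => //; exact: measurable_row_snoc.
by move=> t; exact: integral_ge0.
Qed.

Section reflection.
Variables (n : nat) (e : 'rV[R]_n).
Hypothesis e1 : (dotv e e = 1)%R.

Definition intRR (H : mR * 'rV[R]_n -> \bar R) := \int[mu]_t \int[leb n]_x H (t, x).

Lemma intRR_shear1 (H : mR * 'rV[R]_n -> \bar R) :
  measurable_fun setT H -> (forall p, 0 <= H p) ->
  intRR (fun p => H (p.1, (p.2 + p.1 *: e)%R)) = intRR H.
Proof.
move=> mH H0; apply: eq_integral => t _ /=.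
rewrite (ge0_integral_shiftv (f := fun x => H (t, x)))//.
by apply: measurableT_comp => //; exact: measurable_pair1.
Qed.

Lemma intRR_shear2 (H : mR * 'rV[R]_n -> \bar R) :
  measurable_fun setT H -> (forall p, 0 <= H p) ->
  intRR (fun p => H ((p.1 - dotv p.2 e)%R, p.2)) = intRR H.
Proof.
move=> mH H0; rewrite /intRR.
rewrite (fubini_tonelli (m1 := leb1) (m2 := leb n) (fun p => H ((p.1 - dotv p.2 e)%R, p.2)))//=; last first.
  apply: measurableT_comp => //; apply: measurable_fun_pair => //=.
  by apply: measurable_funB => //; exact: measurable_dotv.
apply: esym; apply: (etrans (fubini_tonelli (m1 := leb1) (m2 := leb n) H mH H0)); apply: esym.
apply: eq_integral => x _.
apply: (ge0_integral_shift (f := fun t => H (t, x))) => //.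
by apply: measurableT_comp => //; exact: measurable_pair2.
Qed.

Lemma intRR_opp (H : mR * 'rV[R]_n -> \bar R) :
  measurable_fun setT H -> (forall p, 0 <= H p) ->
  intRR (fun p => H ((- p.1)%R, p.2)) = intRR H.
Proof.
move=> mH H0; rewrite /intRR.
apply: (ge0_integral_oppr (f := fun t => \int[leb n]_x H (t, x))).
  exact: measurable_fun_fubini_tonelli_F.
by move=> t; exact: integral_ge0.
Qed.

(* The reflection exchanging the extra axis with [e] is, up to a sign, a product of
   three shears, so it preserves Lebesgue measure. *)
Lemma intRR_reflection (H : mR * 'rV[R]_n -> \bar R) :
  measurable_fun setT H -> (forall p, 0 <= H p) ->
  intRR (fun p => H (dotv p.2 e, (p.2 - dotv p.2 e *: e + p.1 *: e)%R)) = intRR H.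
Proof.
move=> mH H0.
pose H1 (p : mR * 'rV[R]_n) := H ((- p.1)%R, p.2).
pose H2 (p : mR * 'rV[R]_n) := H1 (p.1, (p.2 + p.1 *: e)%R).
pose H3 (p : mR * 'rV[R]_n) := H2 ((p.1 - dotv p.2 e)%R, p.2).
have mS : measurable_fun setT (fun p : mR * 'rV[R]_n => (p.1, (p.2 + p.1 *: e)%R)).
  apply: measurable_fun_pair => //=; apply: measurable_addv => //.
  exact: measurable_scalev.
have mH1 : measurable_fun setT H1.
  apply: measurableT_comp => //; apply: measurable_fun_pair => //=.
  exact: measurableT_comp.
have mH2 : measurable_fun setT H2 by exact: measurableT_comp.
have mH3 : measurable_fun setT H3.
  apply: measurableT_comp => //; apply: measurable_fun_pair => //=.
  by apply: measurable_funB => //; exact: measurable_dotv.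
have E1 := intRR_opp mH H0.
have E2 := intRR_shear1 mH1 (fun p => H0 _).
have E3 := intRR_shear2 mH2 (fun p => H0 _).
have E4 := intRR_shear1 mH3 (fun p => H0 _).
apply: etrans E1; apply: etrans E2; apply: etrans E3; apply: etrans E4.
congr intRR; apply/funext => -[t x]; rewrite /H3 /H2 /H1 /=.
rewrite dotvDl dotvZl e1 mulr1; congr (H (_, _)); first by ring.
by apply/rowP => i; rewrite !mxE; ring.
Qed.

Local Notation N01 := (normal_prob (0 : R) 1).

Lemma gaussd_ge0 (x : 'rV[R]_n) : (0 <= gaussd x)%R.
Proof. by rewrite /gaussd divr_ge0 ?expR_ge0// exprn_ge0. Qed.

Lemma measurable_gaussd : measurable_fun setT (@gaussd R n).
Proof.
rewrite (_ : @gaussd R n = fun x => (\prod_(i < n) normal_pdf 0 1 (x 0%R i))%R); last first.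
  by apply/funext => x; exact: gaussdE.
apply: measurable_prod => i _ /=.
by apply: (measurableT_comp (measurable_normal_pdf 0 1)); exact: measurable_fun_coord.
Qed.

Lemma ge0_integral_gam (F : 'rV[R]_n -> \bar R) :
  measurable_fun setT F -> (forall x, 0 <= F x) ->
  \int[gam n]_x F x = \int[leb n]_x (F x * (gaussd x)%:E).
Proof.
move=> mF F0; rewrite -ge0_intRd_gauss// ge0_intRdE//.
  apply: emeasurable_funM => //; apply/measurable_EFinP; exact: measurable_gaussd.
by move=> x; rewrite mule_ge0// lee_fin gaussd_ge0.
Qed.

Lemma intRR_gauss (F : mR * 'rV[R]_n -> \bar R) :
  measurable_fun setT F -> (forall p, 0 <= F p) ->
  \int[N01]_t \int[gam n]_x F (t, x) =
  intRR (fun p => F p * (normal_pdf 0 1 p.1 * gaussd p.2)%:E).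
Proof.
move=> mF F0.
have mg : measurable_fun setT (fun x : 'rV[R]_n => (gaussd x)%:E).
  by apply/measurable_EFinP; exact: measurable_gaussd.
have mFt t : measurable_fun setT (fun x => F (t, x)).
  by apply: measurableT_comp => //; exact: measurable_pair1.
rewrite ge0_integral_normal_prob; first last.
- by move=> t; exact: integral_ge0.
- exact: (measurable_fun_fubini_tonelli_F (m2 := gam n) F).
apply: eq_integral => t _; rewrite ge0_integral_gam//.
rewrite -ge0_integralZr//.
- by apply: eq_integral => x _; rewrite /= -muleA -EFinM [in RHS]mulrC.
- exact: emeasurable_funM.
- by move=> x _; rewrite mule_ge0// lee_fin gaussd_ge0.
- by rewrite lee_fin normal_pdf_ge0.
Qed.

Lemma gauss_reflection (t : R) (x : 'rV[R]_n) :
  (normal_pdf 0 1 (dotv x e) * gaussd (x - dotv x e *: e + t *: e) =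
   normal_pdf 0 1 t * gaussd x)%R.
Proof.
rewrite !normal_pdfE ?oner_neq0// /normal_fun /gaussd !vnorm_sqr !subr0.
rewrite -!mulrA; congr (_ * _)%R; rewrite !mulrA -!expRD; congr (expR _ / _)%R.
rewrite expr1n !(dotvDl, dotvDr, dotvZl, dotvZr, dotvNl, dotvNr) (dotvC e x) e1.
by rewrite mulr2n; field.
Qed.

(** No rotation taking [e] to a coordinate axis is constructed. An independent normal variable [t]
    is adjoined and exchanged with [dotv x e] by the reflection, which preserves Lebesgue measure
    and the joint Gaussian density. The outcome is the independence of the component along [e] and
    of the orthogonal part. *)
Lemma gauss_split (G : mR * 'rV[R]_n -> \bar R) :
  measurable_fun setT G -> (forall p, 0 <= G p) ->
  \int[gam n]_x G (dotv x e, (x - dotv x e *: e)%R) =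
  \int[N01]_t \int[gam n]_x G (t, (x - dotv x e *: e)%R).
Proof.
move=> mG G0.
have mperp : measurable_fun setT (fun x : 'rV[R]_n => (x - dotv x e *: e)%R).
  apply: measurable_subv => //; apply: measurable_scalev => //.
  exact: measurable_dotv.
pose F (p : mR * 'rV[R]_n) := G (p.1, (p.2 - dotv p.2 e *: e)%R).
have mF : measurable_fun setT F.
  apply: measurableT_comp => //; apply: measurable_fun_pair => //=.
  exact: (measurableT_comp mperp).
have mw : measurable_fun setT (fun p : mR * 'rV[R]_n => (normal_pdf 0 1 p.1 * gaussd p.2)%:E).
  apply/measurable_EFinP; apply: measurable_funM.
    exact: (measurableT_comp (measurable_normal_pdf 0 1)).
  exact: (measurableT_comp measurable_gaussd).
have w0 (p : mR * 'rV[R]_n) : 0 <= (normal_pdf 0 1 p.1 * gaussd p.2)%:E.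
  by rewrite lee_fin mulr_ge0 ?normal_pdf_ge0 ?gaussd_ge0.
have mS : measurable_fun setT (fun p : mR * 'rV[R]_n =>
    (dotv p.2 e, (p.2 - dotv p.2 e *: e + p.1 *: e)%R)).
  apply: measurable_fun_pair; first exact: measurable_dotv.
  apply: measurable_addv; first exact: (measurableT_comp mperp).
  exact: measurable_scalev.
apply: esym; apply: (etrans (intRR_gauss mF (fun p => G0 _))).
apply: (etrans (esym (intRR_reflection (emeasurable_funM mF mw) _))).
  by move=> p /=; rewrite mule_ge0//; exact: G0.
pose F' (p : mR * 'rV[R]_n) := G (dotv p.2 e, (p.2 - dotv p.2 e *: e)%R).
have mF' : measurable_fun setT F'.
  apply: measurableT_comp => //; apply: measurable_fun_pair => //=.
    exact: measurable_dotv.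
  exact: (measurableT_comp mperp).
(* After the exchange the integrand no longer depends on the adjoined variable, which is integrated
   out with total mass one. *)
transitivity (intRR (fun p : mR * 'rV[R]_n => F' p * (normal_pdf 0 1 p.1 * gaussd p.2)%:E)).
  congr intRR; apply/funext => -[t x] /=; rewrite gauss_reflection; congr (G (_, _) * _).
  rewrite !(dotvDl, dotvZl, dotvNl) e1; apply/rowP => i; rewrite !mxE; ring.
rewrite -intRR_gauss//; last by move=> p; exact: G0.
by rewrite /F' /= integral_cst//= probability_setT mule1.
Qed.

End reflection.
End lebesgue_invariance.

(** * One-dimensional oscillatory integrals *)

Section ftc_unbounded.
Context {R : realType}.
Local Notation mu := (@lebesgue_measure R).
Local Open Scope ereal_scope.

Lemma cvg_integral_exhaustion (d : measure_display) (T : measurableType d)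
    (m : {measure set T -> \bar R}) (D : set T) (A : (set T)^nat) (f : T -> R) :
  measurable D -> (forall n, measurable (A n)) -> (forall n, A n `<=` D) ->
  (forall x, D x -> \forall n \near \oo, A n x) ->
  m.-integrable D (EFin \o f) ->
  \int[m]_(x in A n) (f x)%:E @[n --> \oo] --> \int[m]_(x in D) (f x)%:E.
Proof.
move=> mD mA AD Anear frame_avg; have mf := measurable_int m frame_avg.
have mfA n : measurable_fun D (patch (fun=> 0) (A n) (EFin \o f)).
  apply/(measurable_restrict _ (mA n) mD).
  by apply: measurable_funS mf => //; exact: subIset_l.
rewrite (_ : (fun n => _) = (fun n => \int[m]_(x in D) (patch (fun=> 0) (A n) (EFin \o f) x))); last first.
  apply/funext => n; rewrite [LHS]integral_mkcond [RHS]integral_mkcond.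
  apply: eq_integral => x _; rewrite !patchE.
  case: ifPn => xA; last by case: ifPn.
  by rewrite (mem_set (AD n x (set_mem xA))).
apply: (@dominated_cvg _ _ _ _ _ mD _ _ (abse \o (EFin \o f))) => //.
- move=> x Dx; apply: cvg_near_cst; near=> n.
  rewrite patchE mem_set//; near: n; exact: Anear.
- exact: integrable_abse.
- move=> n x Dx; rewrite patchE; case: ifP => // _.
  by rewrite /= normr0 lee_fin.
Unshelve. all: by end_near. Qed.

Section antiderivative.
Variables h H : R -> R.
Hypothesis dH : forall x : R, is_derive x (1%R : R) (H : R -> R) (h x).
Hypothesis ch : continuous h.

Lemma integral_derive_itv (a b : R) : (a < b)%R ->
  \int[mu]_(x in `[a, b]) (h x)%:E = (H b - H a)%:E.
Proof.
move=> ab; rewrite EFinB; apply: continuous_FTC2 => //.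
- exact: continuous_subspaceT.
- have cH x : {for x, continuous H}.
    apply: differentiable_continuous; apply/derivable1_diffP.
    by have [] := dH x.
  split.
  + by move=> x _; have [] := dH x.
  + exact: cvg_at_right_filter (cH a).
  + exact: cvg_at_left_filter (cH b).
- by move=> x _; rewrite derive1E; apply: derive_val.
Qed.

(** As [h] is integrable, its integral is the limit of the integrals over [[0, n + 1]]; the
    behaviour of [H] along the integers is thus enough. *)
Lemma integral_derive0y :
  mu.-integrable `[0%R, +oo[ (EFin \o h) ->
  H n%:R @[n --> \oo] --> (0%R : R) ->
  \int[mu]_(x in `[0%R, +oo[) (h x)%:E = (- H 0)%:E.
Proof.
move=> hint Hoo.
have := @cvg_integral_exhaustion _ _ mu `[0%R, +oo[ (fun n => `[0%R, n.+1%:R]%classic) h.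
have c0 : (H n.+1%:R - H 0%R)%:E @[n --> \oo] --> (- H 0)%:E.
  apply: cvg_EFin; first by near=> n.
  rewrite -[X in _ --> X]add0r; apply: cvgB; last exact: cvg_cst.
  by rewrite (@cvg_shiftS _ (fun n => H n%:R)).
move=> /(_ _ _ _ _ hint) H1.
apply: (cvg_unique _ (H1 _ _ _ _)) => //.
- by move=> n x /=; rewrite !in_itv/= andbT => /andP[].
- move=> x /=; rewrite in_itv/= andbT => x0; near=> n; rewrite /= in_itv/= x0/=.
  apply: (@le_trans _ _ n%:R); last by rewrite ler_nat.
  near: n; exact: nbhs_infty_ger.
- rewrite (_ : (fun n => _) = (fun n => (H n.+1%:R - H 0%R)%:E))//.
  by apply/funext => n; rewrite integral_derive_itv// ltr0Sn.
Unshelve. all: by end_near. Qed.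

Lemma integral_derive_eq0 :
  mu.-integrable setT (EFin \o h) ->
  H n%:R @[n --> \oo] --> (0%R : R) -> H (- n%:R) @[n --> \oo] --> (0%R : R) ->
  \int[mu]_x (h x)%:E = 0.
Proof.
move=> hint Hoo HNoo.
have := @cvg_integral_exhaustion _ _ mu setT (fun n => `[(- n.+1%:R)%R, n.+1%:R]%classic) h.
have c0 : (H n.+1%:R - H (- n.+1%:R))%:E @[n --> \oo] --> 0.
  apply: cvg_EFin; first by near=> n.
  rewrite -[X in _ --> X]subr0; apply: cvgB.
    by rewrite (@cvg_shiftS _ (fun n => H n%:R)).
  by rewrite (@cvg_shiftS _ (fun n => H (- n%:R))).
move=> /(_ _ _ _ _ hint) H1.
apply: (cvg_unique _ (H1 _ _ _ _)) => //.
- move=> x _; near=> n; rewrite /= in_itv/= -ler_norml.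
  apply: (@le_trans _ _ n%:R); last by rewrite ler_nat.
  near: n; exact: nbhs_infty_ger.
- rewrite (_ : (fun n => _) = (fun n => (H n.+1%:R - H (- n.+1%:R))%:E))//.
  apply/funext => n; rewrite integral_derive_itv//.
  by rewrite (@lt_trans _ _ 0%R)// ?ltr0Sn// oppr_lt0 ltr0Sn.
Unshelve. all: by end_near. Qed.

End antiderivative.
End ftc_unbounded.

Section real_calculus.
Context {R : realType}.
Local Notation mu := (@lebesgue_measure R).

Lemma lipschitz_of_derive (f df : R -> R) :
  (forall x : R, is_derive x (1 : R) f (df x)) -> (forall x, `|df x| <= 1) ->
  forall a b, `|f a - f b| <= `|a - b|.
Proof.
move=> fdf df1.
have cf (a b : R) : {within `[a, b], continuous f}.
  apply: continuous_subspaceT => x; apply: differentiable_continuous.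
  by apply/derivable1_diffP; have [] := fdf x.
have aux a b : a <= b -> `|f b - f a| <= `|b - a|.
  move=> ab; have [c _ ->] := MVT_segment ab (fun x _ => fdf x) (cf a b).
  by rewrite normrM ler_piMl.
move=> a b; have [ab|/ltW ba] := leP a b; last exact: aux.
by rewrite distrC (distrC a); exact: aux.
Qed.

Lemma lipschitz_cos (a b : R) : `|cos a - cos b| <= `|a - b|.
Proof.
apply: (lipschitz_of_derive (fun x => is_derive_cos x)) => x.
by rewrite normrN ler_norml sin_geN1 sin_le1.
Qed.

Lemma lipschitz_sin (a b : R) : `|sin a - sin b| <= `|a - b|.
Proof.
apply: (lipschitz_of_derive (fun x => is_derive_sin x)) => x.
by rewrite ler_norml cos_geN1 cos_le1.
Qed.

Lemma abs_cos_le1 (a : R) : `|cos a| <= 1.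
Proof. by rewrite ler_norml cos_geN1 cos_le1. Qed.

Lemma abs_sin_le1 (a : R) : `|sin a| <= 1.
Proof. by rewrite ler_norml sin_geN1 sin_le1. Qed.

Lemma integral_oneDsqrV :
  (\int[mu]_t ((1 + t ^+ 2)^-1)%:E = pi%:E)%E.
Proof.
rewrite ge0_symfun_integralT.
- rewrite -set_itvcy [X in (_ * X)%E](_ : _ = (pi / 2)%:E); last exact: (@integral0y_oneDsqr R).
  by rewrite -EFinM; congr (_%:E); rewrite mulrC divfK.
- by move=> t; rewrite invr_ge0 addr_ge0// sqr_ge0.
- exact: (@continuous_oneDsqrV R).
- by move=> t /=; rewrite sqrrN.
Qed.

Lemma measurable_oneDsqrV : measurable_fun setT (fun t : R => (1 + t ^+ 2)^-1).
Proof. exact: continuous_measurable_fun (@continuous_oneDsqrV R). Qed.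

Lemma integrable_oneDsqrV : mu.-integrable setT (EFin \o (fun t => (1 + t ^+ 2)^-1)).
Proof.
apply/integrableP; split; first by apply/measurable_EFinP; exact: measurable_oneDsqrV.
under eq_integral.
  move=> t _; rewrite /= ger0_norm ?invr_ge0 ?addr_ge0 ?sqr_ge0//; over.
by rewrite integral_oneDsqrV ltry.
Qed.

(* From [(1 + t^2/8)^4 <= exp (t^2/2)]. *)
Lemma normal_pdf_decay (t : R) : normal_pdf 0 1 t <= 8 ^+ 4 / (1 + t ^+ 2) ^+ 4.
Proof.
have t2 : 0 <= t ^+ 2 by exact: sqr_ge0.
have p2 : 1 <= (pi : R) *+ 2 by rewrite mulr2n; have := pi_ge2 R; lra.
have pk : normal_peak (1 : R) <= 1.
  rewrite /normal_peak expr1n mul1r invf_le1 ?sqrtr_gt0 ?(lt_le_trans ltr01)//.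
  by rewrite -[leLHS]sqrtr1 ler_sqrt// (le_trans ler01).
rewrite normal_pdfE ?oner_neq0// /normal_fun subr0 expr1n.
apply: (@le_trans _ _ (expR (- t ^+ 2 / 2%:R))).
  by rewrite ler_piMl ?expR_ge0.
rewrite mulNr expRN -[_ / _ ^+ _]invrK invf_div.
rewrite lef_pV2 ?posrE ?expR_gt0 ?divr_gt0 ?exprn_gt0 ?ltr_wpDr//.
rewrite ler_pdivrMr//.
have : (1 + t ^+ 2 / 8) ^+ 4 <= expR (t ^+ 2 / 2).
  have -> : t ^+ 2 / 2 = 4%:R * (t ^+ 2 / 8) :> R by field.
  rewrite expRM_natl lerXn2r ?nnegrE ?expR_ge0 ?addr_ge0 ?divr_ge0//.
  exact: expR_ge1Dx.
move=> h; apply: (@le_trans _ _ (8 ^+ 4 * (1 + t ^+ 2 / 8) ^+ 4)); last by rewrite mulrC ler_wpM2r.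
have -> : 8 ^+ 4 * (1 + t ^+ 2 / 8) ^+ 4 = (8 + t ^+ 2) ^+ 4 :> R by rewrite -exprMn; congr (_ ^+ 4); field.
by rewrite lerXn2r ?nnegrE ?addr_ge0// lerD2r ler1n.
Qed.

End real_calculus.

Section density_signed.
Context {R : realType} {dsp : measure_display} {T : measurableType dsp}.
Variables (mu nu : {measure set T -> \bar R}) (w : T -> R).
Hypothesis w0 : forall t, 0 <= w t.
Hypothesis nuw : forall h : T -> \bar R, measurable_fun setT h -> (forall t, 0 <= h t)%E ->
  (\int[nu]_t h t = \int[mu]_t (h t * (w t)%:E))%E.

Lemma integral_density (f : T -> R) : measurable_fun setT f ->
  (\int[nu]_t (f t)%:E = \int[mu]_t (f t * w t)%:E)%E.
Proof.
move=> mf; have mfE : measurable_fun setT (EFin \o f) by exact/measurable_EFinP.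
rewrite integralE [RHS]integralE !nuw//; last 2 first.
- exact: measurable_funeneg.
- exact: measurable_funepos.
have aux a t : (maxe a%:E 0 * (w t)%:E = maxe (a * w t)%:E 0)%E.
  by rewrite -!EFin_max -EFinM maxr_pMl// mul0r.
congr (_ - _)%E; apply: eq_integral => t _; rewrite ?funeposE ?funenegE /=; first exact: aux.
by rewrite aux mulNr.
Qed.

End density_signed.

(** * The oscillatory integral with phase [t / sqrt (t^2 + Q)] *)

Section oscillation.
Context {R : realType}.
Local Notation mu := (@lebesgue_measure R).
Local Notation N01 := (normal_prob (0 : R) 1).
Local Notation phi := (normal_pdf (0 : R) 1).

Lemma phi_ge0 t : 0 <= phi t. Proof. exact: normal_pdf_ge0. Qed.

Lemma quad_decay_cvg0 (H : R -> R) (C : R) : (forall t, `|H t| <= C / (1 + t ^+ 2)) ->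
  H n%:R @[n --> \oo] --> (0 : R) /\ H (- n%:R) @[n --> \oo] --> (0 : R).
Proof.
move=> HC.
have C0 : 0 <= C.
  by have := le_trans (normr_ge0 _) (HC 0); rewrite expr0n addr0 divr1.
have c0 : C / n.+1%:R @[n --> \oo] --> (0 : R).
  rewrite -[X in _ --> X](mulr0 C); apply: cvgM; first exact: cvg_cst.
  exact: cvg_harmonic.
have b n : C / (1 + n%:R ^+ 2) <= C / n.+1%:R :> R.
  rewrite ler_wpM2l// lef_pV2 ?posrE ?ltr0Sn// ?ltr_wpDr ?sqr_ge0//.
  rewrite -natr1 addrC lerD2l -natrX ler_nat.
  by case: n => // n; rewrite expnS expn1 leq_pmulr.
split; apply/norm_cvg0P; apply: (squeeze_cvgr _ (cvg_cst 0) c0); near=> n;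
  rewrite normr_ge0/= (le_trans (HC _))// ?sqrrN b//.
Unshelve. all: by end_near. Qed.

Lemma quad_dominated_integrable (h : R -> R) (C : R) : measurable_fun setT h ->
  (forall t, `|h t| <= C / (1 + t ^+ 2)) -> mu.-integrable setT (EFin \o h).
Proof.
move=> mh hC; apply: (le_integrable measurableT _ _ (integrableZl measurableT C integrable_oneDsqrV)).
  by apply/measurable_EFinP.
by move=> t _ /=; rewrite lee_fin (le_trans (hC t))// ler_norm.
Qed.

Section fixed_Q.
Variable Q : R.
Hypothesis Q0 : 0 < Q.

(** With [t] the component of a vector along a unit vector and [Q] the squared length of the rest,
    [hyp t] is the length of the vector and [tau t] the cosine of the angle. *)
Definition hyp (t : R) := Num.sqrt (t ^+ 2 + Q).
Definition tau (t : R) := t / hyp t.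
(** Chosen so that [phi * ibpk] is the derivative of [phi * hyp ^+ 3 / Q], the amplitude divided by
    [tau']; it is the factor left by one integration by parts. *)
Definition ibpk (t : R) := (3 * t * hyp t - t * hyp t ^+ 3) / Q.

Lemma hyp2 t : hyp t ^+ 2 = t ^+ 2 + Q.
Proof. by rewrite sqr_sqrtr// addr_ge0 ?sqr_ge0// ltW. Qed.

Lemma hyp_gt0 t : 0 < hyp t.
Proof. by rewrite sqrtr_gt0 ltr_wpDl ?sqr_ge0. Qed.

Lemma abs_le_hyp t : `|t| <= hyp t.
Proof.
rewrite -(@ler_pXn2r _ 2)// ?nnegrE ?(ltW (hyp_gt0 t))//.
by rewrite hyp2 real_normK ?num_real// lerDl ltW.
Qed.

Lemma abs_tau_le1 t : `|tau t| <= 1.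
Proof.
by rewrite normrM normfV (gtr0_norm (hyp_gt0 t)) ler_pdivrMr ?hyp_gt0// mul1r abs_le_hyp.
Qed.

Lemma hyp_le t : 1 + hyp t ^+ 2 <= (2 + Q) * (1 + t ^+ 2).
Proof.
rewrite hyp2 -subr_ge0 (_ : _ - _ = 1 + t ^+ 2 + Q * t ^+ 2); last by ring.
by have := mulr_ge0 (ltW Q0) (sqr_ge0 t); have := sqr_ge0 t; lra.
Qed.

Lemma abs_ibpk_le t : `|ibpk t| <= 4 * (2 + Q) ^+ 2 / Q * (1 + t ^+ 2) ^+ 2.
Proof.
rewrite /ibpk normrM normfV (gtr0_norm Q0) [leRHS]mulrAC ler_pM2r ?invr_gt0//.
apply: (@le_trans _ _ (4 * (1 + hyp t ^+ 2) ^+ 2)); last first.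
  rewrite -mulrA ler_wpM2l// -exprMn lerXn2r ?nnegrE//.
  - by rewrite addr_ge0// sqr_ge0.
  - by rewrite mulr_ge0// addr_ge0// ?sqr_ge0// ltW.
  - exact: hyp_le.
have := abs_le_hyp t; have := hyp_gt0 t; move: (hyp t) => w w0 tw.
apply: (le_trans (ler_normB _ _)); rewrite [`|3 * t * w|]normrM [`|3 * t|]normrM [`|t * _|]normrM normrX (ger0_norm (ltW w0)).
rewrite (ger0_norm (_ : 0 <= 3))//; have := normr_ge0 t; move: `|t| tw => u uw u0.
have -> : 4 * (1 + w ^+ 2) ^+ 2 = 4 + 8 * w ^+ 2 + 4 * w ^+ 4 by ring.
have : u * w ^+ 3 <= w ^+ 4 by rewrite [leRHS]exprS ler_wpM2r// exprn_ge0// ltW.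
have : 3 * u * w <= 3 * w ^+ 2 by rewrite -mulrA expr2; apply: ler_wpM2l => //; apply: ler_wpM2r => //; exact: ltW.
have := exprn_ge0 4 (ltW w0); have := sqr_ge0 w; lra.
Qed.

Lemma is_derive_hyp t : is_derive t (1 : R) hyp (t / hyp t).
Proof.
have d : is_derive t (1 : R) (fun t => t ^+ 2 + Q) (t *+ 2).
  by apply: is_derive_eq; rewrite addr0 /GRing.scale /= mulr1 mulr2n; ring.
have Q' : 0 < t ^+ 2 + Q by rewrite ltr_wpDl ?sqr_ge0.
have dd := @is_derive1_comp R (@Num.sqrt R) (fun t => t ^+ 2 + Q) t _ _ (is_derive1_sqrt Q') d.
apply: (is_derive_eq dd); rewrite -/(hyp t) mulr2n; field.
by rewrite gt_eqF ?hyp_gt0.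
Qed.

Lemma is_derive_tau t : is_derive t (1 : R) tau (Q / hyp t ^+ 3).
Proof.
have w0 : hyp t != 0 by rewrite gt_eqF ?hyp_gt0.
have dV := is_deriveV w0 (is_derive_hyp t).
have dd := is_deriveM (is_derive_id t 1) dV.
apply: (is_derive_eq dd); rewrite /= /GRing.scale /= mulr1.
have -> : Q = hyp t ^+ 2 - t ^+ 2 by rewrite hyp2; ring.
by field.
Qed.

Lemma is_derive_phi t : is_derive t (1 : R) phi (- t * phi t).
Proof.
rewrite normal_pdfE ?oner_neq0// /normal_fun.
have d : is_derive t (1 : R) (fun t => - (t - 0) ^+ 2 / (1 ^+ 2 *+ 2)) (- t).
  apply: is_derive_eq; rewrite /GRing.scale /= !subr0 expr1n.
  by rewrite mulr2n; field.
have d2 := @is_derive1_comp R expR (fun t => - (t - 0) ^+ 2 / (1 ^+ 2 *+ 2)) t _ _ (is_derive_expR _) d.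
have dd := is_deriveZ (normal_peak 1) d2.
by apply: (is_derive_eq dd); rewrite /GRing.scale /= [RHS]mulrC mulrA.
Qed.

Lemma continuous_of_derive (f df : R -> R) :
  (forall x : R, is_derive x (1 : R) f (df x)) -> continuous f.
Proof.
move=> fdf x; apply: differentiable_continuous.
by apply/derivable1_diffP; have [] := fdf x.
Qed.

Lemma continuous_tau : continuous tau.
Proof. exact: continuous_of_derive is_derive_tau. Qed.

Lemma continuous_hyp : continuous hyp.
Proof. exact: continuous_of_derive is_derive_hyp. Qed.

Lemma continuous_ibpk : continuous ibpk.
Proof.
move=> t; apply: cvgM; last exact: cvg_cst.
apply: cvgB; apply: cvgM.
- by apply: cvgM; [exact: cvg_cst|exact: cvg_id].
- exact: continuous_hyp.
- exact: cvg_id.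
- by apply: (cvg_comp hyp (fun y => y ^+ 3)); [exact: continuous_hyp|exact: exprn_continuous].
Qed.

Lemma continuous_sin_tau s : continuous (fun t => sin (s * tau t)).
Proof.
move=> t; apply: (cvg_comp (fun t => s * tau t) sin); last exact: continuous_sin.
by apply: cvgM; [exact: cvg_cst|exact: continuous_tau].
Qed.

Lemma continuous_cos_tau s : continuous (fun t => cos (s * tau t)).
Proof.
move=> t; apply: (cvg_comp (fun t => s * tau t) cos); last exact: continuous_cos.
by apply: cvgM; [exact: cvg_cst|exact: continuous_tau].
Qed.

(* As [tau' = Q / hyp^3], the function [ibpH s] is the primitive whose leading term is
   the oscillating integrand; the remainder carries the gain [s^-1]. *)
Definition ibpH s t := phi t * (hyp t ^+ 3 / (Q * s)) * sin (s * tau t).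
Definition ibph s t := phi t * cos (s * tau t) + s^-1 * (phi t * ibpk t * sin (s * tau t)).

Lemma is_derive_ibpH s t : 0 < s -> is_derive t (1 : R) (ibpH s) (ibph s t).
Proof.
move=> s0.
have dw3 : is_derive t (1 : R) (fun t => hyp t ^+ 3) (3 * t * hyp t).
  have dd : is_derive t (1 : R) (fun t => hyp t ^+ 3) _ := is_deriveX 3 (is_derive_hyp t).
  apply: (is_derive_eq dd); rewrite /GRing.scale /=.
  by field; rewrite gt_eqF ?hyp_gt0.
have dsin : is_derive t (1 : R) (fun t => sin (s * tau t)) (cos (s * tau t) * (s * (Q / hyp t ^+ 3))).
  exact: (@is_derive1_comp R sin (fun t => s * tau t) t _ _ (is_derive_sin _) (is_deriveZ s (is_derive_tau t))).
have d1 := is_deriveM dw3 (is_derive_cst ((Q * s)^-1) t 1).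
have dd := is_deriveM (is_deriveM (is_derive_phi t) d1) dsin.
apply: (is_derive_eq dd); rewrite /ibph /ibpk /GRing.scale /= !fctE.
by field; rewrite !gt_eqF ?hyp_gt0.
Qed.

Lemma Rintegral_norm_le (d : measure_display) (T : measurableType d)
    (m : {measure set T -> \bar R}) (f g : T -> R) :
  measurable_fun setT f -> m.-integrable setT (EFin \o g) ->
  (forall t, `|f t| <= g t) ->
  `|\int[m]_t f t| <= \int[m]_t g t.
Proof.
move=> mf ig fg.
have fi : m.-integrable setT (EFin \o f).
  apply: (le_integrable measurableT _ _ ig); first exact/measurable_EFinP.
  by move=> t _ /=; rewrite lee_fin (le_trans (fg t))// ler_norm.
apply: (le_trans (le_normr_Rintegral measurableT fi)).
apply: le_Rintegral => //.
have : m.-integrable setT (abse \o (EFin \o f)) by exact: integrable_abse.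
by [].
Qed.

Lemma continuous_phi : continuous phi.
Proof. by apply: continuous_normal_pdf; rewrite oner_neq0. Qed.

Lemma measurable_phi : measurable_fun setT phi.
Proof. exact: measurable_normal_pdf. Qed.

Definition gmom t := phi t * (1 + t ^+ 2) ^+ 2.

Lemma gmom_ge0 t : 0 <= gmom t.
Proof. by rewrite mulr_ge0 ?phi_ge0// sqr_ge0. Qed.

Lemma gmom_le t : `|gmom t| <= 8 ^+ 4 / (1 + t ^+ 2).
Proof.
have p : 0 < 1 + t ^+ 2 by rewrite ltr_wpDr ?sqr_ge0.
have p1 : 1 <= 1 + t ^+ 2 by rewrite lerDl sqr_ge0.
rewrite ger0_norm ?gmom_ge0// /gmom.
apply: (@le_trans _ _ (8 ^+ 4 / (1 + t ^+ 2) ^+ 4 * (1 + t ^+ 2) ^+ 2)).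
  by rewrite ler_wpM2r ?sqr_ge0// normal_pdf_decay.
rewrite -mulrA ler_wpM2l ?exprn_ge0//.
rewrite (_ : _ * _ = ((1 + t ^+ 2) ^+ 2)^-1); last by field; rewrite gt_eqF.
rewrite lef_pV2 ?posrE ?exprn_gt0//.
by rewrite expr2 ler_peMr// ltW.
Qed.

Lemma measurable_gmom : measurable_fun setT gmom.
Proof.
apply: measurable_funM; first exact: measurable_phi.
by apply: measurable_funX; apply: measurable_funD => //; exact: measurable_funX.
Qed.

Lemma integrable_gmom : mu.-integrable setT (EFin \o gmom).
Proof. exact: quad_dominated_integrable measurable_gmom gmom_le. Qed.

Definition c4 : R := \int[mu]_t gmom t.

Lemma integrable_phi : mu.-integrable setT (EFin \o phi).
Proof. exact: integrable_normal_pdf. Qed.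

Lemma Rintegral_phi : \int[mu]_t phi t = 1.
Proof. by rewrite /Rintegral integral_normal_pdf. Qed.

Lemma c4_ge1 : 1 <= c4.
Proof.
rewrite -Rintegral_phi; apply: le_Rintegral => //.
- exact: integrable_phi.
- exact: integrable_gmom.
move=> t _; rewrite /gmom ler_peMr ?phi_ge0// exprn_ege1// lerDl sqr_ge0 //.
Qed.

(** Bounds the Gaussian integral of [|ibpk|] through [abs_ibpk_le]. It is of order [1 / Q] for small
    [Q] and of order [Q] for large [Q], whence the two moments of [Q] in [Kq_powR]. *)
Definition Kq : R := 4 * (2 + Q) ^+ 2 / Q * c4.

Lemma Kq_ge1 : 1 <= Kq.
Proof.
rewrite /Kq; apply: (le_trans c4_ge1); rewrite ler_peMl ?(le_trans ler01 c4_ge1)//.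
rewrite ler_pdivlMr// mul1r.
have := Q0; move: (Q) => q q0; nra.
Qed.

(** Stated for any [f] dominated by [ibpk] since it is applied both to [ibpk * sin (s * tau)] and to
    the difference quotients of this function in [s]. *)
Lemma Kq_bound (f : R -> R) : measurable_fun setT f ->
  (forall t, `|f t| <= `|ibpk t|) ->
  mu.-integrable setT (EFin \o (fun t => phi t * f t)) /\
  `|\int[mu]_t (phi t * f t)| <= Kq.
Proof.
move=> mf fk.
have b t : `|phi t * f t| <= 4 * (2 + Q) ^+ 2 / Q * gmom t.
  rewrite normrM (ger0_norm (phi_ge0 t)) /gmom mulrCA ler_wpM2l ?phi_ge0//.
  exact: le_trans (fk t) (abs_ibpk_le t).
have ib : mu.-integrable setT (EFin \o (fun t => 4 * (2 + Q) ^+ 2 / Q * gmom t)).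
  exact: (integrableZl measurableT _ integrable_gmom).
have mpf : measurable_fun setT (fun t => phi t * f t).
  by apply: measurable_funM => //; exact: measurable_phi.
split.
  apply: (le_integrable measurableT _ _ ib); first by apply/measurable_EFinP.
  by move=> t _ /=; rewrite lee_fin (le_trans (b t))// ler_norm.
apply: (le_trans (Rintegral_norm_le _ ib b)) => //.
by rewrite RintegralZl//; exact: integrable_gmom.
Qed.

Lemma phi_bound (f : R -> R) (C : R) : measurable_fun setT f ->
  (forall t, `|f t| <= C) ->
  mu.-integrable setT (EFin \o (fun t => phi t * f t)) /\
  `|\int[mu]_t (phi t * f t)| <= C.
Proof.
move=> mf fC.
have b t : `|phi t * f t| <= C * phi t.
  by rewrite normrM (ger0_norm (phi_ge0 t)) [leRHS]mulrC ler_wpM2l ?phi_ge0.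
have ib : mu.-integrable setT (EFin \o (fun t => C * phi t)).
  exact: (integrableZl measurableT _ integrable_phi).
have mpf : measurable_fun setT (fun t => phi t * f t).
  by apply: measurable_funM => //; exact: measurable_phi.
split.
  apply: (le_integrable measurableT _ _ ib); first by apply/measurable_EFinP.
  by move=> t _ /=; rewrite lee_fin (le_trans (b t))// ler_norm.
apply: (le_trans (Rintegral_norm_le _ ib b)) => //.
by rewrite RintegralZl ?Rintegral_phi ?mulr1//; exact: integrable_phi.
Qed.

Definition zeta (s : R) : R := \int[mu]_t (phi t * cos (s * tau t)).
Definition ibpI (s : R) : R := \int[mu]_t (phi t * (ibpk t * sin (s * tau t))).

Lemma measurable_cos_tau s : measurable_fun setT (fun t => cos (s * tau t)).
Proof. apply: continuous_measurable_fun; exact: continuous_cos_tau s. Qed.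

Lemma measurable_ibpk_sin s : measurable_fun setT (fun t => ibpk t * sin (s * tau t)).
Proof.
apply: measurable_funM; first by apply: continuous_measurable_fun; exact: continuous_ibpk.
apply: continuous_measurable_fun; exact: continuous_sin_tau s.
Qed.

Lemma ibpk_sin_le s t : `|ibpk t * sin (s * tau t)| <= `|ibpk t|.
Proof. by rewrite normrM ler_piMr ?abs_sin_le1. Qed.

Lemma abs_zeta_le1 s : `|zeta s| <= 1.
Proof. by have [] := phi_bound (measurable_cos_tau s) (fun t => abs_cos_le1 _). Qed.

Lemma abs_ibpI_le s : `|ibpI s| <= Kq.
Proof. by have [] := Kq_bound (measurable_ibpk_sin s) (ibpk_sin_le s). Qed.

Lemma lipschitz_zeta s s' : `|zeta s - zeta s'| <= `|s - s'|.
Proof.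
have [i1 _] := phi_bound (measurable_cos_tau s) (fun t => abs_cos_le1 _).
have [i2 _] := phi_bound (measurable_cos_tau s') (fun t => abs_cos_le1 _).
rewrite /zeta -RintegralB//; under eq_Rintegral do rewrite -mulrBr.
have md : measurable_fun setT (fun t => cos (s * tau t) - cos (s' * tau t)).
  by apply: measurable_funB; exact: measurable_cos_tau.
apply: (phi_bound md _).2 => t; apply: (le_trans (lipschitz_cos _ _)).
by rewrite -mulrBl normrM ler_piMr// abs_tau_le1.
Qed.

Lemma lipschitz_ibpI s s' : `|ibpI s - ibpI s'| <= `|s - s'| * Kq.
Proof.
have [i1 _] := Kq_bound (measurable_ibpk_sin s) (ibpk_sin_le s).
have [i2 _] := Kq_bound (measurable_ibpk_sin s') (ibpk_sin_le s').
have [->|ss] := eqVneq s s'; first by rewrite !subrr normr0 mul0r.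
have ss0 : 0 < `|s - s'| by rewrite normr_gt0 subr_eq0.
rewrite /ibpI -RintegralB//; under eq_Rintegral do rewrite -mulrBr -mulrBr.
(* The difference quotient in [s]; it is dominated by [|ibpk|] because the sine is 1-Lipschitz and
   [|tau| <= 1]. *)
pose g t := `|s - s'|^-1 * (ibpk t * (sin (s * tau t) - sin (s' * tau t))).
have mg : measurable_fun setT g.
  apply: measurable_funM => //; apply: measurable_funM.
    apply: continuous_measurable_fun; exact: continuous_ibpk.
  by apply: measurable_funB; apply: continuous_measurable_fun; exact: continuous_sin_tau _.
have [t|ig bg] := Kq_bound mg.
  rewrite /g normrM normfV normr_id mulrC ler_pdivrMr// normrM ler_wpM2l//.
  apply: (le_trans (lipschitz_sin _ _)).
  by rewrite -mulrBl normrM ler_piMr// abs_tau_le1.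
rewrite (_ : \int[mu]_x _ = `|s - s'| * \int[mu]_t (phi t * g t)).
  by rewrite normrM normr_id ler_wpM2l.
rewrite -RintegralZl//; apply: eq_Rintegral => t _.
by rewrite /g; field; rewrite gt_eqF.
Qed.

Lemma zeta_ibp s : 0 < s -> zeta s = - s^-1 * ibpI s.
Proof.
move=> s0.
have [i1 _] := phi_bound (measurable_cos_tau s) (fun t => abs_cos_le1 _).
have [i2 _] := Kq_bound (measurable_ibpk_sin s) (ibpk_sin_le s).
have i3 : mu.-integrable setT (EFin \o (fun t => s^-1 * (phi t * (ibpk t * sin (s * tau t))))).
  exact: (integrableZl measurableT _ i2).
have hE : ibph s = (fun t => phi t * cos (s * tau t) + s^-1 * (phi t * (ibpk t * sin (s * tau t)))).
  by apply/funext => t; rewrite /ibph -(mulrA (phi t)).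
have ch : continuous (ibph s).
  move=> t; apply: cvgD; apply: cvgM.
  - exact: continuous_phi.
  - exact: continuous_cos_tau.
  - exact: cvg_cst.
  - apply: cvgM; last exact: continuous_sin_tau.
    by apply: cvgM; [exact: continuous_phi|exact: continuous_ibpk].
have ih : mu.-integrable setT (EFin \o ibph s).
  rewrite hE; exact: (integrableD measurableT i1 i3).
have Hb t : `|ibpH s t| <= (2 + Q) ^+ 2 / (Q * s) * 8 ^+ 4 / (1 + t ^+ 2).
  rewrite /ibpH normrM (le_trans (ler_piMr _ (abs_sin_le1 _)))//.
  have w0 := hyp_gt0 t.
  rewrite ger0_norm ?mulr_ge0 ?phi_ge0 ?invr_ge0 ?exprn_ge0 ?(ltW w0) ?(ltW s0) ?(ltW Q0)//; last first.
    by rewrite mulr_ge0// ltW.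
  (* Cubic growth fits under [(1 + w^2)^2] because [w^4 - w^3 + w^2 = w^2 (w^2 - w + 1)] is
     nonnegative; [gmom_le] then gives the decay of [ibpH] at infinity. *)
  have w3 : hyp t ^+ 3 <= (2 + Q) ^+ 2 * (1 + t ^+ 2) ^+ 2.
    rewrite -exprMn; apply: (@le_trans _ _ ((1 + hyp t ^+ 2) ^+ 2)).
      have := w0; move: (hyp t) => w wp.
      have : 0 <= w ^+ 2 * (w ^+ 2 - w + 1) by rewrite mulr_ge0 ?sqr_ge0//; have := sqr_ge0 (w - 2^-1); nra.
      move=> h1; have h2 := sqr_ge0 w; rewrite -subr_ge0.
      rewrite (_ : _ - _ = w ^+ 2 * (w ^+ 2 - w + 1) + w ^+ 2 + 1); last by ring.
      lra.
    rewrite lerXn2r ?nnegrE ?hyp_le ?addr_ge0 ?sqr_ge0//.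
    by rewrite mulr_ge0 ?addr_ge0 ?sqr_ge0// ltW.
  apply: (@le_trans _ _ (phi t * ((2 + Q) ^+ 2 * (1 + t ^+ 2) ^+ 2 / (Q * s)))).
    by rewrite ler_wpM2l ?phi_ge0// ler_pM2r ?invr_gt0 ?mulr_gt0.
  rewrite (_ : phi t * _ = (2 + Q) ^+ 2 / (Q * s) * gmom t); last first.
    by rewrite /gmom; field; rewrite !gt_eqF.
  rewrite -[leRHS]mulrA; apply: ler_wpM2l; first by rewrite divr_ge0 ?sqr_ge0 ?mulr_ge0 ?(ltW s0) ?(ltW Q0).
  exact: le_trans (ler_norm _) (gmom_le t).
have [H1 H2] := quad_decay_cvg0 Hb.
have := integral_derive_eq0 (fun t => is_derive_ibpH t s0) ch ih H1 H2.
move=> /(congr1 fine) /=; rewrite -[LHS]/(\int[mu]_t ibph s t) hE RintegralD// RintegralZl//.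
by rewrite -/(zeta s) -/(ibpI s) => /eqP; rewrite addr_eq0 => /eqP ->; rewrite mulNr.
Qed.

Lemma zeta_le s : 0 < s -> `|zeta s| <= Num.min 1 (Kq / s).
Proof.
move=> s0; rewrite le_min abs_zeta_le1/= zeta_ibp// normrM normrN normfV (gtr0_norm s0).
by rewrite mulrC ler_pM2r ?invr_gt0// abs_ibpI_le.
Qed.

(** Both gains have to appear at once. For [s >= 1] a short increment is treated by subtracting the
    two formulas of [zeta_ibp], in which [ibpI] is bounded and Lipschitz. For [s < 1] the last
    factor equals 1, because [Kq >= 1], and the Lipschitz bound on [zeta] suffices. *)
Lemma zeta_diff_le s s' : 0 < s -> s <= s' ->
  `|zeta s - zeta s'| <= 2 * (Num.min 1 (s' - s) * Num.min 1 (Kq / s)).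
Proof.
move=> s0 ss'; have s'0 : 0 < s' by exact: lt_le_trans ss'.
have K1 := Kq_ge1; have K0 : 0 < Kq by exact: lt_le_trans K1.
have d0 : 0 <= s' - s by rewrite subr_ge0.
have b1 : `|zeta s - zeta s'| <= s' - s.
  by apply: (le_trans (lipschitz_zeta _ _)); rewrite distrC ger0_norm.
have b2 : `|zeta s - zeta s'| <= 2.
  by apply: (le_trans (ler_normB _ _)); apply: lerD; exact: abs_zeta_le1.
have b3 : `|zeta s - zeta s'| <= 2 * (Kq / s).
  apply: (le_trans (ler_normB _ _)).
  have := zeta_le s0; rewrite le_min => /andP[_ h1].
  have := zeta_le s'0; rewrite le_min => /andP[_ h2].
  have : Kq / s' <= Kq / s by rewrite ler_pM2l// lef_pV2.
  lra.
have b4 : 1 <= s -> `|zeta s - zeta s'| <= 2 * ((s' - s) * (Kq / s)).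
  move=> s1; rewrite !zeta_ibp//.
  have -> : - s^-1 * ibpI s - - s'^-1 * ibpI s' =
      - ((s' - s) / (s * s') * ibpI s) - s'^-1 * (ibpI s - ibpI s').
    by field; rewrite !gt_eqF.
  apply: (le_trans (ler_normB _ _)); rewrite normrN !normrM !normfV normrM.
  rewrite (ger0_norm d0) (gtr0_norm s0) (gtr0_norm s'0).
  rewrite (_ : 2 * _ = (s' - s) * (Kq / s) + (s' - s) * (Kq / s)); last by ring.
  apply: lerD.
    rewrite -mulrA ler_wpM2l// mulrC ler_pM ?invr_ge0 ?mulr_ge0 ?(ltW s0) ?(ltW s'0) ?abs_ibpI_le//.
    rewrite lef_pV2 ?posrE ?mulr_gt0// ler_peMr ?(ltW s0)//.
    exact: le_trans s1 ss'.
  rewrite mulrCA; apply: (@le_trans _ _ (s'^-1 * (`|s - s'| * Kq))).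
    by rewrite ler_wpM2l ?invr_ge0 ?(ltW s'0)// lipschitz_ibpI.
  rewrite distrC (ger0_norm d0) (_ : Kq * _ = s^-1 * ((s' - s) * Kq)); last by ring.
  apply: ler_wpM2r; first by rewrite mulr_ge0// ltW.
  by rewrite lef_pV2.
have [s1|s1] := leP 1 s.
  have := b4 s1; case: (leP 1 (s' - s)) => h1; case: (leP 1 (Kq / s)) => h2; rewrite ?mul1r ?mulr1 => b5 //.
  by apply: (le_trans b1); have := d0; lra.
have -> : Num.min 1 (Kq / s) = 1.
  by apply/min_idPl; rewrite ler_pdivlMr// mul1r (le_trans (ltW s1)).
rewrite mulr1; case: (leP 1 (s' - s)) => h1; first by rewrite mulr1.
by apply: (le_trans b1); have := d0; lra.
Qed.

End fixed_Q.
End oscillation.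

(** * A negative moment of the standard normal law *)

Section negative_power.
Context {R : realType}.
Local Notation mu := (@lebesgue_measure R).
Local Notation N01 := (normal_prob (0 : R) 1).
Local Notation mR := (measurableTypeR R).

Lemma nneseries_geometric (a z : R) : 0 <= a -> 0 <= z -> z < 1 ->
  (\sum_(0 <= i <oo) (a * z ^+ i)%:E = (a / (1 - z))%:E)%E.
Proof.
move=> a0 z0 z1; apply/cvg_lim => //.
have -> : (fun n => (\sum_(0 <= i < n) (a * z ^+ i)%:E)%E) =
    (fun n => (series (geometric a z) n)%:E).
  by apply/funext => n; rewrite sumEFin.
apply: cvg_EFin; first by near=> n.
by apply: cvg_geometric_series; rewrite ger0_norm.
Unshelve. all: by end_near. Qed.

Definition q6 : R := 2 `^ (6^-1).

Lemma q6_gt0 : 0 < q6.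
Proof. by rewrite powR_gt0. Qed.

Lemma q6_expn6 : q6 ^+ 6 = 2.
Proof. by rewrite -powR_mulrn ?powR_ge0// -powRrM mulVf// powRr1. Qed.

Lemma q6_gt1 : 1 < q6.
Proof.
rewrite ltNge; apply/negP => q1.
have := @exprn_ile1 R 6 q6 (ltW q6_gt0) q1.
by rewrite q6_expn6 lern1.
Qed.

Lemma q6V_lt1 : q6^-1 < 1.
Proof. by rewrite invf_lt1 ?q6_gt0 ?q6_gt1. Qed.

Lemma powR2_sixth (m : nat) : 2 `^ (m%:R / 6) = q6 ^+ m :> R.
Proof. by rewrite mulrC powRrM powR_mulrn ?powR_ge0. Qed.

(** The weight [x^(-5/6)], meant for squared lengths. The real power of 0 with a negative exponent
    would be 0; the value [+oo] instead keeps [pw] antitone and multiplicative, and makes the bounds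
    trivial in degenerate positions. *)
Definition pw (x : R) : \bar R := if x == 0 then +oo%E else (x `^ (- (5 / 6)))%:E.

Lemma pw_gt0 x : 0 <= x -> (0 < pw x)%E.
Proof.
move=> x0; rewrite /pw; case: eqVneq => [_|xn]; first exact: lt0y.
by rewrite lte_fin powR_gt0// lt_neqAle eq_sym xn.
Qed.

Lemma pw_ge0 x : (0 <= pw x)%E.
Proof. by rewrite /pw; case: eqVneq => // _; rewrite lee_fin powR_ge0. Qed.

Lemma pw_anti x y : 0 <= x -> x <= y -> (pw y <= pw x)%E.
Proof.
move=> x0 xy; rewrite /pw; have [_|xn] := eqVneq x 0; first exact: leey.
have xp : 0 < x by rewrite lt_neqAle eq_sym xn.
have yp : 0 < y by exact: lt_le_trans xy.
rewrite gt_eqF// lee_fin !powRN lef_pV2 ?posrE ?powR_gt0//.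
by apply: ge0_ler_powR => //; rewrite nnegrE ltW.
Qed.

Lemma pwM x y : 0 <= x -> 0 <= y -> (pw (x * y) = pw x * pw y)%E.
Proof.
move=> x0 y0; rewrite /pw mulf_eq0.
have [xE|xn] /= := eqVneq x 0.
  by have := pw_gt0 y0; rewrite /pw => h; rewrite gt0_mulye.
have := pw_gt0 x0; rewrite /pw (negbTE xn) => hx.
have [yE|yn] := eqVneq y 0; first by rewrite gt0_muley.
by rewrite -EFinM powRM.
Qed.

Lemma pw1 : pw 1 = 1%E.
Proof. by rewrite /pw oner_eq0 powR1. Qed.

Lemma measurable_pw : measurable_fun setT pw.
Proof.
apply: measurable_fun_ifT.
- exact: measurable_fun_eqr.
- exact: measurable_cst.
- apply/measurable_EFinP; exact: measurable_powR.
Qed.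

(** If [2^-(n+1) <= |t| < 2^-n], the term of index [n] alone dominates [|t|^(-5/6)]; at [t = 0]
    every indicator is 1 and the series diverges. Integrating [pw] is thereby reduced to the mass of
    small intervals. *)
Lemma pw_dyadic_le (t : R) :
  (pw `|t| <= 1 + \sum_(0 <= k <oo) (q6 ^+ (5 * k.+1))%:E * (\1_(`[- (2 ^- k), 2 ^- k]%classic) t)%:E)%E.
Proof.
pose u k : \bar R := ((q6 ^+ (5 * k.+1))%:E * (\1_(`[- (2 ^- k), 2 ^- k]%classic) t)%:E)%E.
change (pw `|t| <= 1 + \sum_(0 <= k <oo) u k)%E.
have u0 k : (0 <= u k)%E by rewrite mule_ge0// lee_fin// exprn_ge0// ltW// q6_gt0.
have s0 : (0 <= \sum_(0 <= k <oo) u k)%E by exact: nneseries_ge0.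
have [t0|tn] := eqVneq t 0.
  suff -> : (\sum_(0 <= k <oo) u k = +oo)%E by rewrite addey ?leey.
  apply/eqyP => M M0.
  have [n Mn] : exists n : nat, M <= n%:R.
    by exists (Num.truncn M).+1; rewrite ltW// Num.Theory.truncnS_gt.
  apply: (@le_trans _ _ (\sum_(0 <= k < n) u k)%E); last exact: nneseries_lim_ge.
  apply: (@le_trans _ _ (\sum_(0 <= k < n) (1%E : \bar R))%E).
    by rewrite sumEFin lee_fin sumr_const_nat subn0.
  apply: lee_sum => k _; rewrite /u indicE mem_set/= ?mule1 ?lee_fin ?exprn_ege1// ?(ltW q6_gt1)//.
  by rewrite t0 in_itv/= oppr_le0 invr_ge0 exprn_ge0.
have tp : 0 < `|t| by rewrite normr_gt0.
have ex : exists n, 2 ^- n <= `|t|.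
  have [n hn] : exists n : nat, `|t|^-1 <= n%:R.
    by exists (Num.truncn `|t|^-1).+1; rewrite ltW// Num.Theory.truncnS_gt.
  exists n; rewrite -[leRHS]invrK lef_pV2 ?posrE ?exprn_gt0 ?invr_gt0//.
  by rewrite (le_trans hn)// -natrX ler_nat ltnW// ltn_expl.
have [n ntn nmin] := ex_minnP ex.
have pwn : (pw `|t| <= (q6 ^+ (5 * n))%:E)%E.
  apply: (le_trans (pw_anti _ ntn)); first by rewrite invr_ge0 exprn_ge0.
  rewrite /pw gt_eqF ?invr_gt0 ?exprn_gt0// lee_fin powRN.
  rewrite -[X in _ <= X]invrK lef_pV2 ?posrE ?powR_gt0 ?invr_gt0 ?exprn_gt0 ?q6_gt0//.
  have qV0 : 0 <= q6^-1 by rewrite invr_ge0 ltW ?q6_gt0.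
  rewrite -q6_expn6 -exprM -!exprVn -(powR_mulrn (6 * n)) // -powRrM.
  rewrite (_ : (6 * n)%:R * (5 / 6) = (5 * n)%:R) ?powR_mulrn//.
  by rewrite !natrM; field.
case: n => [|n] in ntn nmin pwn *.
  by apply: (le_trans pwn); rewrite muln0 expr0 leeDl.
apply: (le_trans pwn); apply: (@le_trans _ _ (\sum_(0 <= k <oo) u k)%E); last by rewrite leeDr.
apply: (@le_trans _ _ (\sum_(0 <= k < n.+1) u k)%E); last exact: nneseries_lim_ge.
rewrite big_nat_recr//=; apply: (@le_trans _ _ (u n)); last first.
  by rewrite leeDr// sume_ge0.
rewrite /u indicE mem_set/= ?mule1//.
rewrite in_itv/= -ler_norml leNgt; apply/negP => h.
by have := nmin n (ltW h); rewrite ltnn.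
Qed.

Lemma N01_itv_le (a : R) : 0 <= a -> (N01 `[(- a)%R, a]%classic <= (2 * a)%:E)%E.
Proof.
move=> a0; rewrite /normal_prob.
apply: (@le_trans _ _ (\int[mu]_(x in `[(- a)%R, a]) (cst 1%:E x))%E).
  apply: ge0_le_integral => //=.
  - by move=> x _; rewrite lee_fin normal_pdf_ge0.
  - by apply/measurable_EFinP; apply: measurable_funTS; exact: measurable_normal_pdf.
  - move=> x _; rewrite lee_fin.
    rewrite (le_trans (normal_pdf_ub _ _ _)) ?oner_neq0//.
    have p2 : 1 <= (pi : R) *+ 2 by rewrite mulr2n; have := pi_ge2 R; lra.
    rewrite /normal_peak expr1n mul1r invf_le1 ?sqrtr_gt0 ?(lt_le_trans ltr01)//.
    by rewrite -[leLHS]sqrtr1 ler_sqrt// (le_trans ler01).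
rewrite integral_cst//= mul1e lebesgue_measure_itv/= lte_fin.
case: ifP => _; last by rewrite lee_fin mulr_ge0.
by rewrite -EFinB lee_fin; lra.
Qed.

Definition c56 : \bar R := (\int[N01]_t pw `|t|)%E.

Lemma measurable_pw_norm : measurable_fun setT (fun t : mR => pw `|t|).
Proof. by apply: (measurableT_comp measurable_pw); exact: normr_measurable. Qed.

Lemma c56_lty : (c56 < +oo)%E.
Proof.
have mterm k : measurable_fun setT (fun t : mR =>
    ((q6 ^+ (5 * k.+1))%:E * (\1_(`[- (2 ^- k), 2 ^- k]%classic) t)%:E)%E).
  by apply/measurable_EFinP; apply: measurable_funM.
have term0 k (t : mR) : (0 <= (q6 ^+ (5 * k.+1))%:E * (\1_(`[- (2 ^- k), 2 ^- k]%classic) t)%:E)%E.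
  by rewrite mule_ge0// lee_fin// exprn_ge0// ltW// q6_gt0.
(* An interval of mass at most [2 * 2^-k] carries the weight [2^(5 (k + 1) / 6)]; the ratio
   [2^(5/6) / 2] is [q6^-1 < 1]. *)
apply: (@le_lt_trans _ _ (1 + \sum_(0 <= k <oo) ((2 * q6 ^+ 5) * q6^-1 ^+ k)%:E)%E); last first.
  by rewrite nneseries_geometric ?q6V_lt1 ?mulr_ge0 ?invr_ge0 ?exprn_ge0 ?(ltW q6_gt0)// ltry.
rewrite /c56; apply: le_trans.
  by apply: le_integralT => t; [exact: pw_ge0|exact: pw_dyadic_le].
rewrite ge0_integralD//; last 2 first.
- by move=> t _; apply: nneseries_ge0.
- exact: ge0_emeasurable_sum.
rewrite [X in (X + _ <= _)%E](_ : _ = 1%E); last first.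
  by rewrite integral_cst//= mul1e; exact: (@probability_setT _ _ _ N01).
rewrite leeD2l//.
rewrite integral_nneseries//; apply: lee_nneseries.
  by move=> k _ _; apply: integral_ge0 => t _.
move=> k _; rewrite ge0_integralZl//; last by rewrite lee_fin exprn_ge0// ltW// q6_gt0.
  rewrite integral_indic// setIT.
  apply: (@le_trans _ _ ((q6 ^+ (5 * k.+1))%:E * (2 * 2 ^- k)%:E)%E).
    rewrite lee_wpmul2l ?lee_fin ?exprn_ge0 ?(ltW q6_gt0)//.
    by apply: N01_itv_le; rewrite invr_ge0 exprn_ge0.
  rewrite -EFinM lee_fin -{2}q6_expn6 -exprM exprVn.
  have qn : q6 != 0 by rewrite gt_eqF ?q6_gt0.
  rewrite mulnS exprD (_ : (6 * k)%N = (5 * k + k)%N) ?exprD; last by rewrite -addn1 mulnDl mul1n.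
  by rewrite le_eqVlt; apply/orP; left; apply/eqP; field; rewrite ?expf_neq0.
by apply/measurable_EFinP.
Qed.

End negative_power.

(** * Gaussian moments in independent directions *)

Section gauss_moments.
Context {R : realType} {n : nat}.
Local Notation N01 := (normal_prob (0 : R) 1).
Local Notation mR := (measurableTypeR R).
Local Open Scope ereal_scope.

Lemma integral_gam_cst (r : \bar R) : \int[@gam R n]_x r = r.
Proof.
suff h : \int[@gam R n]_x (cst 1 x) = 1.
  rewrite integral_cst//; move: h; rewrite integral_cst// mul1e => ->.
  by rewrite mule1.
have := @ge0_integral_rV_prod R (normal_prob 0 1 : {sigma_finite_measure set mR -> \bar R}) n
  (fun _ _ => 1%R) (fun=> 1%R) _ _ _.
rewrite !big_const_idem/= ?mulr1//.
by apply => // _; rewrite integral_cst// mul1e; exact: (@probability_setT _ _ _ N01).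
Qed.

Lemma bounded_integrable_gam (f : 'rV[R]_n -> R) (K : R) : measurable_fun setT f ->
  (forall x, `|f x| <= K)%R -> (gam n).-integrable setT (EFin \o f).
Proof.
move=> mf fK; apply/integrableP; split; first exact/measurable_EFinP.
apply: (@le_lt_trans _ _ (\int[@gam R n]_x K%:E)); last by rewrite integral_gam_cst ltry.
by apply: le_integralT => // x /=; rewrite lee_fin.
Qed.

Lemma gauss_coord (e : 'rV[R]_n) (g : mR -> \bar R) : (dotv e e = 1)%R ->
  measurable_fun setT g -> (forall t, 0 <= g t) ->
  \int[gam n]_x g (dotv x e) = \int[N01]_t g t.
Proof.
move=> e1 mg g0; have := @gauss_split R n e e1 (g \o fst).
move=> /= ->//; last exact: measurableT_comp.
by apply: eq_integral => t _; rewrite integral_gam_cst.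
Qed.

(** The summand 1 is kept because [1 + t^2] is the loss that occurs in [pw_ratio_le]. *)
Definition m2 : \bar R := \int[N01]_t (1 + t ^+ 2)%:E.

Lemma m2_lty : m2 < +oo.
Proof.
rewrite /m2 ge0_integral_normal_prob; last 2 first.
- by apply/measurable_EFinP; apply: measurable_funD => //; exact: measurable_funX.
- by move=> t; rewrite lee_fin addr_ge0// sqr_ge0.
have /integrableP[_] := @integrable_gmom R; apply: le_lt_trans.
apply: le_integralT => t.
  by rewrite mule_ge0// lee_fin ?normal_pdf_ge0// addr_ge0// sqr_ge0.
rewrite /= ger0_norm ?gmom_ge0// lee_fin /gmom mulrC ler_wpM2l ?normal_pdf_ge0//.
by rewrite expr2 ler_peMr ?lerDl ?sqr_ge0// addr_ge0// sqr_ge0.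
Qed.

Lemma m2_ge0 : 0 <= m2.
Proof. by apply: integral_ge0 => t _; rewrite lee_fin addr_ge0// sqr_ge0. Qed.

Lemma c56_ge0 : 0 <= (c56 : \bar R).
Proof. by apply: integral_ge0 => t _; exact: pw_ge0. Qed.

Lemma measurable_pw_dotv (e : 'rV[R]_n) :
  measurable_fun setT (fun x => pw `|dotv x e|%R).
Proof. by apply: (measurableT_comp measurable_pw_norm); exact: measurable_dotv. Qed.

Section orthonormal.
Variables e1 e2 e3 : 'rV[R]_n.
Hypotheses (e11 : (dotv e1 e1 = 1)%R) (e22 : (dotv e2 e2 = 1)%R) (e33 : (dotv e3 e3 = 1)%R).
Hypotheses (e12 : (dotv e1 e2 = 0)%R) (e13 : (dotv e1 e3 = 0)%R) (e23 : (dotv e2 e3 = 0)%R).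

(** Independence through [gauss_split] along [e2]: removing the component along [e2] does not change
    the one along [e3]. *)
Lemma gauss_pw2 : \int[gam n]_x (pw `|dotv x e2|%R * pw `|dotv x e3|%R) = c56 * c56.
Proof.
pose G (p : mR * 'rV[R]_n) := pw `|p.1|%R * pw `|dotv p.2 e3|%R.
have mG : measurable_fun setT G.
  apply: emeasurable_funM; first exact: (measurableT_comp measurable_pw_norm).
  exact: (measurableT_comp (measurable_pw_dotv e3)).
have := @gauss_split R n e2 e22 G mG.
rewrite /G /= => /(_ (fun p => mule_ge0 (pw_ge0 _) (pw_ge0 _))).
under eq_integral do rewrite dotvBl dotvZl e23 mulr0 subr0.
move=> ->.
transitivity (\int[N01]_t (pw `|t|%R * c56)).
  apply: eq_integral => t _.
  under eq_integral do rewrite dotvBl dotvZl e23 mulr0 subr0.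
  rewrite ge0_integralZl ?pw_ge0//.
  - by rewrite (gauss_coord e33 measurable_pw_norm)// => u; exact: pw_ge0.
  - exact: measurable_pw_dotv.
  - by move=> x _; exact: pw_ge0.
rewrite ge0_integralZr ?c56_ge0//; first exact: measurable_pw_norm.
by move=> t _; exact: pw_ge0.
Qed.

Lemma gauss_pw3 :
  \int[gam n]_x ((1 + dotv x e1 ^+ 2)%:E * (pw `|dotv x e2|%R * pw `|dotv x e3|%R)) =
  m2 * (c56 * c56).
Proof.
pose G (p : mR * 'rV[R]_n) := (1 + p.1 ^+ 2)%:E * (pw `|dotv p.2 e2|%R * pw `|dotv p.2 e3|%R).
have mG : measurable_fun setT G.
  apply: emeasurable_funM.
    by apply/measurable_EFinP; apply: measurable_funD => //; exact: measurable_funX.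
  by apply: emeasurable_funM; [exact: (measurableT_comp (measurable_pw_dotv e2))|
    exact: (measurableT_comp (measurable_pw_dotv e3))].
have G0 p : 0 <= G p.
  by rewrite !mule_ge0 ?pw_ge0// lee_fin addr_ge0// sqr_ge0.
have := @gauss_split R n e1 e11 G mG G0.
rewrite /G /=.
under eq_integral do rewrite !dotvBl !dotvZl e12 e13 !mulr0 !subr0.
move=> ->.
transitivity (\int[N01]_t ((1 + t ^+ 2)%:E * (c56 * c56))).
  apply: eq_integral => t _.
  under eq_integral do rewrite !dotvBl !dotvZl e12 e13 !mulr0 !subr0.
  rewrite ge0_integralZl ?gauss_pw2//.
  - by apply: emeasurable_funM; exact: measurable_pw_dotv.
  - by move=> x _; rewrite mule_ge0 ?pw_ge0.
  - by rewrite lee_fin addr_ge0// sqr_ge0.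
rewrite ge0_integralZr ?mule_ge0 ?c56_ge0//.
- by apply/measurable_EFinP; apply: measurable_funD => //; exact: measurable_funX.
- by move=> t _; rewrite lee_fin addr_ge0// sqr_ge0.
Qed.

(** The inequality [a^2 + b^2 >= |a b|] spreads the singularity over two independent coordinates,
    each with exponent [5/6 < 1]. A single coordinate would leave [|a|^(-5/3)], which is not
    integrable; this is why two directions besides [e] are required. *)
Lemma pw_sum_sqr_le (Q a b : R) : (a ^+ 2 + b ^+ 2 <= Q)%R -> pw Q <= pw `|a|%R * pw `|b|%R.
Proof.
move=> abQ; rewrite -pwM//; apply: pw_anti; first by rewrite mulr_ge0.
apply: le_trans abQ; rewrite -normrM.
have := sqr_ge0 (a - b); have := sqr_ge0 (a + b).
rewrite sqrrD sqrrB !mulr2n => h1 h2; rewrite ler_norml; apply/andP; split; nra.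
Qed.

End orthonormal.

Lemma gauss_norm2 : \int[gam n]_x (dotv x x)%:E <= n%:R%:E * m2.
Proof.
have Exi (i : 'I_n) : \int[gam n]_x (x 0%R i * x 0%R i)%:E <= m2.
  have d1 : (dotv (delta_mx 0 i : 'rV[R]_n) (delta_mx 0 i) = 1)%R.
    rewrite /dotv (bigD1 i)//= !mxE !eqxx mulr1 big1 ?addr0// => j ji.
    by rewrite !mxE (negbTE ji) andbF mulr0.
  have dE (x : 'rV[R]_n) : (dotv x (delta_mx 0 i) = x 0 i)%R.
    rewrite /dotv (bigD1 i)//= mxE !eqxx mulr1 big1 ?addr0// => j ji.
    by rewrite !mxE (negbTE ji) andbF mulr0.
  have mg : measurable_fun setT (fun t : mR => (t * t)%:E).
    by apply/measurable_EFinP; exact: measurable_funM.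
  have := gauss_coord d1 mg.
  under eq_integral do rewrite dE.
  move=> ->; last by move=> t; rewrite lee_fin -expr2 sqr_ge0.
  apply: le_integralT => t; first by rewrite lee_fin -expr2 sqr_ge0.
  by rewrite lee_fin -expr2 lerDr.
under eq_integral do rewrite /dotv -sumEFin.
rewrite ge0_integral_sum//.
- apply: (@le_trans _ _ (\sum_(i < n) m2)); first by apply: lee_sum => i _.
  have -> : m2 = (fine m2)%:E by rewrite fineK// ge0_fin_numE ?m2_lty// m2_ge0.
  by rewrite sumEFin -EFinM lee_fin sumr_const card_ord mulr_natl.
- move=> i; apply/measurable_EFinP; apply: measurable_funM; exact: measurable_coord.
- by move=> i x _; rewrite lee_fin -expr2 sqr_ge0.
Qed.

End gauss_moments.

(** * Frames and averages over frames *)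

Section frame_algebra.
Context {R : realType} {d : nat}.
Implicit Types (a : nat -> 'rV[R]_d) (x y z : 'rV[R]_d) (m : nat).

(** Frames are functions on [nat] with a separate length [m], so that the length does not enter
    their type. [gmx] is the Gram matrix and [pmx] the orthogonal projection onto the span;
    [sph_pointE] returns to sequences. *)
Definition fmx m a : 'M[R]_(m, d) := \matrix_(i < m, c < d) (a i) 0 c.
Definition gmx m a : 'M[R]_m := fmx m a *m (fmx m a)^T.
Definition pmx m a : 'M[R]_d := (fmx m a)^T *m invmx (gmx m a) *m fmx m a.
Definition perp m a x : 'rV[R]_d := x - x *m pmx m a.

Lemma dotvE x y : dotv x y = (x *m y^T) 0 0.
Proof. by rewrite mxE; apply: eq_bigr => i _; rewrite mxE. Qed.

Lemma mul_fmxT m a x (i : 'I_m) : (x *m (fmx m a)^T) 0 i = dotv x (a i).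
Proof. by rewrite mxE; apply: eq_bigr => c _; rewrite !mxE. Qed.

Lemma gmxE m a (i i' : 'I_m) : gmx m a i i' = dotv (a i) (a i').
Proof. by rewrite mxE; apply: eq_bigr => c _; rewrite !mxE. Qed.

Lemma mul_fmx m a (u : 'rV[R]_m) : u *m fmx m a = \sum_(i < m) u 0 i *: a i.
Proof.
rewrite mulmx_sum_row; apply: eq_bigr => i _; congr (_ *: _).
by apply/rowP => c; rewrite !mxE.
Qed.

Lemma gmx_sym m a : (gmx m a)^T = gmx m a.
Proof. by rewrite /gmx trmx_mul trmxK. Qed.

Lemma pmx_sym m a : (pmx m a)^T = pmx m a.
Proof. by rewrite /pmx !trmx_mul trmxK trmx_inv gmx_sym mulmxA. Qed.

Lemma dotv_pmx m a x y : dotv (x *m pmx m a) y = dotv x (y *m pmx m a).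
Proof. by rewrite !dotvE -mulmxA trmx_mul pmx_sym. Qed.

Lemma dotv_perp m a x y : dotv (perp m a x) y = dotv x (perp m a y).
Proof. by rewrite /perp dotvBl dotvBr dotv_pmx. Qed.

Lemma perpD m a x y : perp m a (x + y) = perp m a x + perp m a y.
Proof. by rewrite /perp mulmxDl; apply/rowP => i; rewrite !mxE; ring. Qed.

Lemma perpZ m a c x : perp m a (c *: x) = c *: perp m a x.
Proof. by rewrite /perp -scalemxAl scalerBr. Qed.

Lemma perpB m a x y : perp m a (x - y) = perp m a x - perp m a y.
Proof. by rewrite perpD -scaleN1r perpZ scaleN1r. Qed.

Section unit_gram.
Variables (m : nat) (a : nat -> 'rV[R]_d).
Hypothesis ga : gmx m a \in unitmx.

Lemma perp_orth x i : (i < m)%N -> dotv (perp m a x) (a i) = 0.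
Proof.
move=> im; rewrite -(mul_fmxT a _ (Ordinal im)) /perp mulmxBl /pmx.
by rewrite -!mulmxA -/(gmx m a) mulVmx// mulmx1 subrr mxE.
Qed.

Lemma pmx_span x : exists c : nat -> R, x *m pmx m a = \sum_(i < m) c i *: a i.
Proof.
rewrite /pmx !mulmxA mul_fmx.
set u := _ *m invmx _.
exists (fun i => if insub i is Some j then u 0 j else 0).
by apply: eq_bigr => i _; rewrite valK.
Qed.

(** The orthogonal projection is determined by lying in the span and leaving an orthogonal
    remainder; the explicit projections below are identified in this way. *)
Lemma perp_unique x z (c : nat -> R) : z = \sum_(i < m) c i *: a i ->
  (forall i, (i < m)%N -> dotv (x - z) (a i) = 0) -> x *m pmx m a = z.
Proof.
move=> zE xz.
have zE' : z = (\row_(i < m) c i) *m fmx m a.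
  by rewrite mul_fmx zE; apply: eq_bigr => i _; rewrite mxE.
have w0 : (x - z) *m (fmx m a)^T = 0.
  by apply/rowP => i; rewrite mul_fmxT mxE; exact: xz.
have -> : x = (x - z) + z by rewrite subrK.
have wP : (x - z) *m pmx m a = 0 by rewrite /pmx !mulmxA w0 !mul0mx.
rewrite mulmxDl wP add0r {1}zE' /pmx !mulmxA -(mulmxA _ (fmx m a)) -/(gmx m a).
by rewrite -(mulmxA _ (gmx m a)) mulmxV// mulmx1.
Qed.

Lemma perp_id x : (forall i, (i < m)%N -> dotv x (a i) = 0) -> perp m a x = x.
Proof.
move=> xa; rewrite /perp (@perp_unique x 0 (fun=> 0)) ?subr0//.
by rewrite big1// => i _; rewrite scale0r.
Qed.

Lemma perp_perp x : perp m a (perp m a x) = perp m a x.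
Proof. by apply: perp_id => i im; exact: perp_orth. Qed.

Lemma dotv_perp_perp x y : dotv (perp m a x) (perp m a y) = dotv x (perp m a y).
Proof. by rewrite dotv_perp perp_perp. Qed.

Lemma dotv_perp_le x : dotv (perp m a x) (perp m a x) <= dotv x x.
Proof.
have := dotv_ge0 (x - perp m a x).
rewrite (dotvBl x (perp m a x)) !(dotvBr x (perp m a x)) dotv_perp_perp (dotvC (perp m a x) x); lra.
Qed.

End unit_gram.

Lemma exists_orth_unit (s : seq 'rV[R]_d) : (size s < d)%N ->
  exists2 z : 'rV[R]_d, dotv z z = 1 & forall i, (i < size s)%N -> dotv z (nth 0 s i) = 0.
Proof.
move=> sd; pose A := fmx (size s) (nth 0 s).
have : kermx A^T != 0.
  rewrite -mxrank_eq0 mxrank_ker subn_eq0 -ltnNge.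
  by rewrite (leq_ltn_trans _ sd)// (leq_trans (rank_leq_col _)).
move=> /rowV0Pn[z /sub_kermxP zA z0].
have zz : 0 < dotv z z by rewrite lt_neqAle dotv_ge0 eq_sym dotv_eq0 z0.
have nz : vnorm z != 0 by rewrite vnorm_eq0.
exists ((vnorm z)^-1 *: z).
  by rewrite dotvZl dotvZr -vnorm_sqr; field.
move=> i im; rewrite dotvZl -(mul_fmxT (nth 0 s) z (Ordinal im)) -/A zA mxE mulr0.
by [].
Qed.

Definition updf a m y : nat -> 'rV[R]_d := fun i => if i == m then y else a i.

End frame_algebra.

(** * Admissible frames and the sphere of the next vector *)

Section admissible_frames.
Context {R : realType} {d k : nat}.
Variable v : nat -> 'rV[R]_d.
Hypothesis vfree : row_free (\matrix_(i < k) v i.+1).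
Implicit Types (a : nat -> 'rV[R]_d) (x y z : 'rV[R]_d) (m : nat).

(** A shift of index: the vertices of the simplex are numbered from 1, the vectors of a frame from
    0. *)
Definition vv : nat -> 'rV[R]_d := fun i => v i.+1.

Definition adm m a := forall i i', (i < m)%N -> (i' < m)%N -> dotv (a i) (a i') = dotv (vv i) (vv i').

Lemma vv_free m (c : nat -> R) : (m <= k)%N -> \sum_(i < m) c i *: vv i = 0 ->
  forall i, (i < m)%N -> c i = 0.
Proof.
move=> mk cv i im.
pose u : 'rV[R]_k := \row_j (if (j < m)%N then c j else 0).
have u0 : u *m (\matrix_(i < k) v i.+1) = 0.
  rewrite mulmx_sum_row -[RHS]cv.
  rewrite (big_ord_widen_cond k xpredT (fun i => c i *: vv i) mk) [RHS]big_mkcond.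
  apply: eq_bigr => j _; rewrite mxE rowK /=; case: ifP => //.
  by rewrite scale0r.
have /eqP : u = 0 by apply/eqP; rewrite -(mulmx_free_eq0 _ vfree) u0.
have ik : (i < k)%N by exact: leq_trans mk.
by move=> /eqP/rowP/(_ (Ordinal ik)); rewrite !mxE /= im.
Qed.

(** A row [u] killed by the Gram matrix satisfies [|u F|^2 = u G u^T = 0], so it is a linear
    relation between the vertices. *)
Lemma gmx_vv_unit m : (m <= k)%N -> gmx m vv \in unitmx.
Proof.
move=> mk; rewrite -row_free_unit -kermx_eq0; apply/rowV0P => u /sub_kermxP uG.
have uF : u *m fmx m vv = 0.
  apply/eqP; rewrite -dotv_eq0 dotvE trmx_mul mulmxA -(mulmxA u) -/(gmx m vv) uG.
  by rewrite mul0mx mxE.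
pose c i := if insub i is Some j then u 0 j else 0.
apply/rowP => i; rewrite mxE.
have := @vv_free m c mk; rewrite (_ : \sum_(i < m) _ = 0); last first.
  by rewrite -[RHS]uF mul_fmx; apply: eq_bigr => j _; rewrite /c valK.
by move=> /(_ erefl i (ltn_ord i)); rewrite /c valK.
Qed.

Lemma adm_gmx m a : adm m a -> gmx m a = gmx m vv.
Proof. by move=> am; apply/matrixP => i j; rewrite !gmxE; apply: am. Qed.

Lemma adm_unit m a : (m <= k)%N -> adm m a -> gmx m a \in unitmx.
Proof. by move=> mk /adm_gmx ->; exact: gmx_vv_unit. Qed.

Definition crow m : 'rV[R]_m := \row_(i < m) dotv (vv m) (vv i).
Definition centr m a : 'rV[R]_d := crow m *m invmx (gmx m a) *m fmx m a.

Lemma centr_orth m a i : (m <= k)%N -> adm m a -> (i < m)%N ->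
  dotv (centr m a) (a i) = dotv (vv m) (vv i).
Proof.
move=> mk am im; rewrite -(mul_fmxT a _ (Ordinal im)) /centr -mulmxA -/(gmx m a).
by rewrite -mulmxA mulVmx ?adm_unit// mulmx1 mxE.
Qed.

Lemma centr_span m a : exists c : nat -> R, centr m a = \sum_(i < m) c i *: a i.
Proof.
rewrite /centr mul_fmx; set u := _ *m invmx _.
exists (fun i => if insub i is Some j then u 0 j else 0).
by apply: eq_bigr => i _; rewrite valK.
Qed.

Lemma centr_norm m a : adm m a -> dotv (centr m a) (centr m a) = dotv (centr m vv) (centr m vv).
Proof.
move=> am; rewrite !dotvE /centr !trmx_mul (adm_gmx am).
rewrite !mulmxA -!(mulmxA _ (fmx m a)) -!(mulmxA _ (fmx m vv)).
by rewrite -/(gmx m a) -/(gmx m vv) (adm_gmx am).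
Qed.

Lemma perp_centr m a : (m <= k)%N -> adm m a -> perp m a (centr m a) = 0.
Proof.
move=> mk am; have [c cE] := centr_span m a.
rewrite /perp (perp_unique (adm_unit mk am) cE) ?subrr// => i im.
by rewrite ?subrr dotv0l.
Qed.

(** Squared radius of the next sphere. It depends on the frame only through its Gram matrix, common
    to all admissible frames, and is therefore computed on the vertices themselves. *)
Definition rad2 m : R := dotv (vv m) (vv m) - dotv (centr m vv) (centr m vv).

Lemma centr_vv m : (m <= k)%N -> centr m vv = vv m *m pmx m vv.
Proof.
move=> mk; have [c cE] := centr_span m vv.
rewrite (perp_unique (gmx_vv_unit mk) cE)// => i im.
by rewrite dotvBl centr_orth// subrr.
Qed.

Lemma rad2E m : (m <= k)%N -> rad2 m = dotv (perp m vv (vv m)) (perp m vv (vv m)).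
Proof.
move=> mk; have gu := gmx_vv_unit mk.
have c0 : dotv (vv m *m pmx m vv) (perp m vv (vv m)) = 0.
  by rewrite -dotv_perp -centr_vv// perp_centr ?dotv0l.
rewrite /rad2 centr_vv// dotv_perp_perp//.
move: c0; rewrite /perp !dotvBr => /eqP; rewrite subr_eq0 => /eqP <-.
by rewrite dotvC.
Qed.

(** A zero radius would put the next vertex in the span of the previous ones, against linear
    independence. *)
Lemma rad2_gt0 m : (m < k)%N -> 0 < rad2 m.
Proof.
move=> mk; rewrite rad2E ?(ltnW mk)// lt_neqAle dotv_ge0 andbT eq_sym dotv_eq0.
apply/eqP => p0; have [c cE] := pmx_span m vv (vv m).
have := @vv_free m.+1 (fun i => if i == m then 1 else - c i) mk.
rewrite big_ord_recr /= eqxx scale1r.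
rewrite (eq_bigr (fun i : 'I_m => - (c i *: vv i))); last first.
  by move=> i _; rewrite (ltn_eqF (ltn_ord i)) scaleNr.
rewrite sumrN -cE addrC -/(perp m vv (vv m)) p0 => /(_ erefl m (ltnSn m)).
by rewrite eqxx => /eqP; rewrite oner_eq0.
Qed.

Lemma centr_le m a : (m <= k)%N -> adm m a -> dotv (centr m a) (centr m a) <= dotv (vv m) (vv m).
Proof.
by move=> mk /centr_norm ->; rewrite -subr_ge0 -/(rad2 m) rad2E// dotv_ge0.
Qed.

(** When [perp m a x = 0] the division by 0 yields 0 and the value is the centre of the sphere, not
    a point on it. Hence the hypothesis [perp m a x != 0] below, and the care taken with this case
    in [integral_pw_next]. *)
Definition fpoint m a x : 'rV[R]_d :=
  centr m a + (Num.sqrt (vnorm (vv m) ^+ 2 - vnorm (centr m a) ^+ 2) / vnorm (perp m a x)) *: perp m a x.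

Lemma sph_pointE (ys : seq 'rV[R]_d) x : sph_point v ys x = fpoint (size ys) (nth 0 ys) x.
Proof. by []. Qed.

Lemma fpointE m a x : adm m a ->
  fpoint m a x = centr m a + (Num.sqrt (rad2 m) / vnorm (perp m a x)) *: perp m a x.
Proof. by move=> am; rewrite /fpoint !vnorm_sqr (centr_norm am). Qed.

Section next_frame.
Variables (m : nat) (a : nat -> 'rV[R]_d) (x : 'rV[R]_d).
Hypotheses (mk : (m < k)%N) (am : adm m a) (x0 : perp m a x != 0).
Let y := fpoint m a x.
Let w := (vnorm (perp m a x))^-1 *: perp m a x.
Let r := Num.sqrt (rad2 m).

Let gu : gmx m a \in unitmx.
Proof. exact: adm_unit (ltnW mk) am. Qed.

Let ww : dotv w w = 1.
Proof.
have nz : vnorm (perp m a x) != 0 by rewrite vnorm_eq0.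
by rewrite dotvZl dotvZr -vnorm_sqr; field.
Qed.

Let wa i : (i < m)%N -> dotv w (a i) = 0.
Proof. by move=> im; rewrite dotvZl perp_orth// mulr0. Qed.

Let yE : y = centr m a + r *: w.
Proof. by rewrite /y fpointE// scalerA. Qed.

Let r0 : 0 < r.
Proof. by rewrite sqrtr_gt0 rad2_gt0. Qed.

Let cw : dotv (centr m a) w = 0.
Proof. by rewrite dotvZr -dotv_perp perp_centr ?dotv0l ?mulr0// ltnW. Qed.

Lemma adm_next : adm m.+1 (updf a m y).
Proof.
have ya i : (i < m)%N -> dotv y (a i) = dotv (vv m) (vv i).
  by move=> im; rewrite yE dotvDl dotvZl wa// mulr0 addr0 centr_orth// ltnW.
have yy : dotv y y = dotv (vv m) (vv m).
  rewrite yE dotvDl !dotvDr !(dotvZl r w) !(dotvZr r _ w) (dotvC w (centr m a)) cw ww !mulr0 addr0 add0r mulr1.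
  by rewrite -expr2 sqr_sqrtr ?(ltW (rad2_gt0 mk))// /rad2 (centr_norm am) addrC subrK.
move=> i i'; rewrite !ltnS /updf => im i'm.
case: eqVneq => [->|ni]; case: eqVneq => [->|ni'] //.
- by rewrite ya// ltn_neqAle ni'.
- by rewrite dotvC ya ?(dotvC (vv m))// ltn_neqAle ni.
- by apply: am; rewrite ltn_neqAle ?ni ?ni'.
Qed.

(** A Gram-Schmidt step: [y = centr + r w] with [centr] in the old span and [w] a unit vector
    orthogonal to it, so the span grows exactly by the line of [w]. *)
Lemma perp_next z : perp m.+1 (updf a m y) z = perp m a z - dotv z w *: w.
Proof.
have gu' : gmx m.+1 (updf a m y) \in unitmx by exact: adm_unit mk adm_next.
have [c cE] := pmx_span m a z; have [c' c'E] := centr_span m a.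
have wE : w = r^-1 *: (y - centr m a).
  by rewrite yE addrC addKr scalerA mulVf ?scale1r// gt_eqF.
have upd_lt (i : 'I_m) : updf a m y (widen_ord (leqnSn m) i) = a i.
  by rewrite /updf /= (ltn_eqF (ltn_ord i)).
(* The coefficients in the enlarged frame come from [w = (y - centr) / r], where [centr] is expanded
   in the old frame. *)
rewrite /perp (@perp_unique _ _ _ _ gu' z (z *m pmx m a + dotv z w *: w)
  (fun i => if i == m then dotv z w * r^-1 else c i - dotv z w * r^-1 * c' i)).
- by rewrite opprD addrA.
- rewrite big_ord_recr /= eqxx {2}/updf eqxx.
  under eq_bigr do rewrite upd_lt (ltn_eqF (ltn_ord _)) scalerBl -scalerA.
  rewrite sumrB -cE -scaler_sumr -c'E.
  have -> : dotv z w *: w = (dotv z w * r^-1) *: (y - centr m a) by rewrite -scalerA -wE.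
  by rewrite (scalerBr _ y) addrA addrAC.
- move=> i; rewrite ltnS leq_eqVlt => /orP[/eqP ->|im].
    rewrite /updf eqxx yE opprD addrA -/(perp m a z) (dotvBl (perp m a z)) (dotvZl _ w) !dotvDr !(dotvZr r _ w) ww.
    rewrite (dotvC w (centr m a)) cw dotv_perp perp_centr ?(ltnW mk)// dotv0r.
    have -> : dotv (perp m a z) w = dotv z w by rewrite dotv_perp perpZ perp_perp.
    by ring.
  rewrite /updf (ltn_eqF im) opprD addrA -/(perp m a z) (dotvBl (perp m a z)) (dotvZl _ w) wa//.
  by rewrite perp_orth// mulr0 subr0.
Qed.

Lemma perp_next_norm z : dotv (perp m.+1 (updf a m y) z) (perp m.+1 (updf a m y) z) =
  dotv (perp m a z) (perp m a z) - dotv z w ^+ 2.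
Proof.
rewrite perp_next (dotvBl (perp m a z)) !(dotvBr (perp m a z)) !(dotvZl _ w) !(dotvZr _ _ w) ww (dotvC w).
have -> : dotv (perp m a z) w = dotv z w by rewrite dotv_perp perpZ perp_perp.
by ring.
Qed.

End next_frame.
End admissible_frames.

(** * Measurability of matrix operations and of frames *)

Section measurable_matrix_algebra.
Context {R : realType} {dsp : measure_display} {U : measurableType dsp}.

Lemma measurable_invr (f : U -> R) : measurable_fun setT f ->
  measurable_fun setT (fun u => (f u)^-1).
Proof.
move=> mf; rewrite (_ : (fun u => _) = (fun u => f u * (f u ^+ 2) `^ (-1))); last first.
  apply/funext => u; rewrite powR_inv1 ?sqr_ge0//.
  have [->|f0] := eqVneq (f u) 0; first by rewrite invr0 mul0r.
  by field.
apply: measurable_funM => //; apply: (measurableT_comp (measurable_powR _)).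
exact: measurable_funX.
Qed.

Lemma measurable_mx_entry m n (A : U -> 'M[R]_(m, n)) i j : measurable_fun setT A ->
  measurable_fun setT (fun u => A u i j).
Proof. by move=> mA; exact: (measurableT_comp (measurable_coord i j) mA). Qed.

Lemma measurable_mulmx m n p (A : U -> 'M[R]_(m, n)) (B : U -> 'M[R]_(n, p)) :
  measurable_fun setT A -> measurable_fun setT B ->
  measurable_fun setT (fun u => A u *m B u).
Proof.
move=> mA mB; apply: measurable_mxP => i j; under eq_fun do rewrite mxE.
by apply: measurable_sum => l; apply: measurable_funM; exact: measurable_mx_entry.
Qed.

Lemma measurable_trmx m n (A : U -> 'M[R]_(m, n)) : measurable_fun setT A ->
  measurable_fun setT (fun u => (A u)^T).
Proof.
move=> mA; apply: measurable_mxP => i j; under eq_fun do rewrite mxE.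
exact: measurable_mx_entry.
Qed.

Lemma measurable_det m (A : U -> 'M[R]_m) : measurable_fun setT A ->
  measurable_fun setT (fun u => \det (A u)).
Proof.
move=> mA; apply: measurable_sum => s; apply: measurable_funM => //.
by apply: measurable_prod => i _; exact: measurable_mx_entry.
Qed.

Lemma measurable_invmx m (A : U -> 'M[R]_m) : measurable_fun setT A ->
  measurable_fun setT (fun u => invmx (A u)).
Proof.
move=> mA; apply: measurable_mxP => i j.
(* Cramer's formula; by convention [invmx] returns a singular matrix unchanged. *)
rewrite (_ : (fun u => _) = (fun u => if \det (A u) == 0 then A u i j else
   (\det (A u))^-1 * cofactor (A u) j i)); last first.
  apply/funext => u; rewrite /invmx unitmxE unitfE.
  by case: eqVneq => //= _; rewrite !mxE.
apply: measurable_fun_ifT.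
- by apply: measurable_fun_eqr => //; exact: measurable_det.
- exact: measurable_mx_entry.
- apply: measurable_funM; first by apply: measurable_invr; exact: measurable_det.
  rewrite /cofactor; apply: measurable_funM => //; apply: measurable_det.
  apply: measurable_mxP => i' j'; under eq_fun do rewrite !mxE.
  exact: measurable_mx_entry.
Qed.

End measurable_matrix_algebra.

Section frame_space.
Context {R : realType} {d : nat}.

(* The size of a frame is passed separately; entries beyond it are ignored. *)
Definition frames := nat -> 'rV[R]_d.

HB.instance Definition _ := Pointed.copy frames (nat -> 'rV[R]_d).

Definition frame_cylinders : set (set frames) :=
  <<s \bigcup_(i : nat) preimage_set_system setT (fun a : frames => a i) measurable >>.

Let frames_set0 : frame_cylinders set0.
Proof. exact: sigma_algebra0. Qed.

Let frames_setC A : frame_cylinders A -> frame_cylinders (~` A).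
Proof. exact: sigma_algebraC. Qed.

Let frames_bigcup (F : _^nat) : (forall i, frame_cylinders (F i)) ->
  frame_cylinders (\bigcup_i (F i)).
Proof. exact: sigma_algebra_bigcup. Qed.

HB.instance Definition _ := @isMeasurable.Build (measure_tuple_display default_measure_display)
  frames frame_cylinders frames_set0 frames_setC frames_bigcup.

Lemma measurable_frame_proj (i : nat) : measurable_fun setT (fun a : frames => a i).
Proof.
move=> _ Y mY; rewrite setTI; apply: sub_sigma_algebra.
by exists i => //=; exists Y => //; rewrite setTI.
Qed.

Lemma measurable_framesP {dsp : measure_display} {U : measurableType dsp} (f : U -> frames) :
  (forall i, measurable_fun setT (fun u => f u i)) -> measurable_fun setT f.
Proof.
move=> mf; apply: (@measurability _ _ _ _ setT f
  (\bigcup_(i : nat) preimage_set_system setT (fun a : frames => a i) measurable)) => //.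
move=> _ -[_ [i _ [B mB <-]] <-] /=; rewrite !setTI.
by have := mf i measurableT B mB; rewrite setTI.
Qed.

End frame_space.
Arguments frames : clear implicits.

Section measurable_frames.
Context {R : realType} {d : nat} (v : nat -> 'rV[R]_d).
Context {dsp : measure_display} {U : measurableType dsp}.
Variables (m : nat) (a : U -> frames R d) (x : U -> 'rV[R]_d).
Hypotheses (ma : measurable_fun setT a) (mx : measurable_fun setT x).

Let mai i : measurable_fun setT (fun u => a u i).
Proof. exact: (measurableT_comp (measurable_frame_proj i) ma). Qed.

Lemma measurable_fmx : measurable_fun setT (fun u => fmx m (a u)).
Proof.
apply: measurable_mxP => i j; under eq_fun do rewrite mxE.
exact: measurable_mx_entry.
Qed.

Lemma measurable_gmx : measurable_fun setT (fun u => gmx m (a u)).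
Proof.
by apply: measurable_mulmx; [|apply: measurable_trmx]; exact: measurable_fmx.
Qed.

Lemma measurable_perp : measurable_fun setT (fun u => perp m (a u) (x u)).
Proof.
apply: measurable_subv => //; apply: measurable_mulmx => //.
apply: measurable_mulmx; last exact: measurable_fmx.
apply: measurable_mulmx; first by apply: measurable_trmx; exact: measurable_fmx.
by apply: measurable_invmx; exact: measurable_gmx.
Qed.

Lemma measurable_centr : measurable_fun setT (fun u => centr v m (a u)).
Proof.
apply: measurable_mulmx; last exact: measurable_fmx.
apply: measurable_mulmx; first exact: measurable_cst.
by apply: measurable_invmx; exact: measurable_gmx.
Qed.

Lemma measurable_fpoint : measurable_fun setT (fun u => fpoint v m (a u) (x u)).
Proof.
have mc := measurable_centr; have mp := measurable_perp.
apply: measurable_addv => //; apply: measurable_scalev => //.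
apply: measurable_funM; last by apply: measurable_invr; exact: measurable_vnorm.
apply: (measurableT_comp (f := @Num.sqrt R)).
  exact: continuous_measurable_fun (@sqrt_continuous R).
by apply: measurable_funB => //; apply: measurable_funX; exact: measurable_vnorm.
Qed.

Lemma measurable_updf (y : U -> 'rV[R]_d) : measurable_fun setT y ->
  measurable_fun setT (fun u => updf (a u) m (y u) : frames R d).
Proof.
move=> my; apply: measurable_framesP => i; rewrite /updf.
by case: eqVneq.
Qed.

End measurable_frames.

(** * Iterated averages over frames *)

Section frame_integral.
Context {R : realType} {d : nat} (v : nat -> 'rV[R]_d).
Local Open Scope ereal_scope.
Implicit Types (n m : nat) (a : frames R d).

(** The counterpart of [frame_int] written with [gam], on frames seen as functions, for which
    measurability in the frame makes sense; [frame_intE] relates the two. *)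
Fixpoint frame_avg n m a (G : frames R d -> \bar R) : \bar R :=
  match n with
  | 0 => G a
  | n'.+1 => \int[gam d]_x frame_avg n' m.+1 (updf a m (fpoint v m a x)) G
  end.

Lemma frame_avg_ge0 n m a G : (forall b, 0 <= G b) -> 0 <= frame_avg n m a G.
Proof.
move=> G0; elim: n m a => [|n IH] m a //=.
by apply: integral_ge0 => x _; exact: IH.
Qed.

Lemma le_frame_avg n m a G H : (forall b, 0 <= G b) -> (forall b, G b <= H b) ->
  frame_avg n m a G <= frame_avg n m a H.
Proof.
move=> G0 GH; elim: n m a => [|n IH] m a //=.
by apply: le_integralT => x //; exact: frame_avg_ge0.
Qed.

Lemma measurable_next (dsp : measure_display) (T : measurableType dsp) m :
  measurable_fun setT (fun p : (T * frames R d) * 'rV[R]_d =>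
    (p.1.1, (updf p.1.2 m (fpoint v m p.1.2 p.2) : frames R d))).
Proof.
have m12 : measurable_fun setT (fun p : (T * frames R d) * 'rV[R]_d => p.1.2).
  exact: (measurableT_comp measurable_snd measurable_fst).
apply: measurable_fun_pair; first exact: (measurableT_comp measurable_fst measurable_fst).
by apply: measurable_updf => //; exact: measurable_fpoint.
Qed.

(** The parameter [T] is carried along because Tonelli's theorem asks for measurability jointly in
    the frame and in the remaining variables, and the induction changes the initial frame. *)
Lemma measurable_frame_avg (dsp : measure_display) (T : measurableType dsp) n m
    (H : T * frames R d -> \bar R) :
  measurable_fun setT H -> (forall p, 0 <= H p) ->
  measurable_fun setT (fun p : T * frames R d => frame_avg n m p.2 (fun b => H (p.1, b))).
Proof.
move=> mH H0; elim: n m => [|n IH] m /=.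
  by under eq_fun do rewrite -surjective_pairing.
apply: (measurable_fun_fubini_tonelli_F (m2 := gam d)
  (fun p : (T * frames R d) * 'rV[R]_d =>
     frame_avg n m.+1 (updf p.1.2 m (fpoint v m p.1.2 p.2)) (fun b => H (p.1.1, b)))).
  exact (measurableT_comp (IH m.+1) (@measurable_next _ T m)).
by move=> p; exact: frame_avg_ge0.
Qed.

Lemma measurable_frame_avg1 n m a G : measurable_fun setT G -> (forall b, 0 <= G b) ->
  measurable_fun setT (fun x => frame_avg n m.+1 (updf a m (fpoint v m a x)) G).
Proof.
move=> mG G0.
have mH : measurable_fun setT (fun p : unit * frames R d => G p.2) by exact: measurableT_comp.
have := measurable_frame_avg (T := unit) n m.+1 mH (fun p => G0 p.2).
move=> mF; apply: (measurableT_comp mF (g := fun x => (tt, updf a m (fpoint v m a x) : frames R d))).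
apply: measurable_fun_pair => //; apply: measurable_updf => //.
exact: measurable_fpoint.
Qed.

Lemma frame_avgD n m a G H : measurable_fun setT G -> measurable_fun setT H ->
  (forall b, 0 <= G b) -> (forall b, 0 <= H b) ->
  frame_avg n m a (fun b => G b + H b) = frame_avg n m a G + frame_avg n m a H.
Proof.
move=> mG mH G0 H0; elim: n m a => [|n IH] m a //=.
under eq_integral do rewrite IH.
by rewrite ge0_integralD//; do ?[exact: measurable_frame_avg1|by move=> x _; exact: frame_avg_ge0].
Qed.

Lemma frame_avgZl n m a (c : R) G : (0 <= c)%R -> measurable_fun setT G -> (forall b, 0 <= G b) ->
  frame_avg n m a (fun b => c%:E * G b) = c%:E * frame_avg n m a G.
Proof.
move=> c0 mG G0; elim: n m a => [|n IH] m a //=.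
under eq_integral do rewrite IH.
by rewrite ge0_integralZl//; do ?[exact: measurable_frame_avg1|by move=> x _; exact: frame_avg_ge0].
Qed.

Lemma frame_avg_cst n m a (r : \bar R) : frame_avg n m a (fun=> r) = r.
Proof.
elim: n m a => [|n IH] m a //=.
by under eq_integral do rewrite IH; exact: integral_gam_cst.
Qed.

Lemma frame_avg_tonelli (dsp : measure_display) (T : measurableType dsp)
    (mu : {sigma_finite_measure set T -> \bar R}) n m a (H : T * frames R d -> \bar R) :
  measurable_fun setT H -> (forall p, 0 <= H p) ->
  \int[mu]_t frame_avg n m a (fun b => H (t, b)) = frame_avg n m a (fun b => \int[mu]_t H (t, b)).
Proof.
move=> mH H0; elim: n m a => [|n IH] m a //=.
under [RHS]eq_integral do rewrite -IH.
rewrite (fubini_tonelli (m1 := mu) (m2 := gam d)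
  (fun p : T * 'rV[R]_d => frame_avg n m.+1 (updf a m (fpoint v m a p.2)) (fun b => H (p.1, b))))//=.
  apply: (measurableT_comp (measurable_frame_avg n m.+1 mH H0)
    (g := fun p : T * 'rV[R]_d => (p.1, updf a m (fpoint v m a p.2) : frames R d))).
  apply: measurable_fun_pair => //; apply: measurable_updf => //.
  exact: measurable_fpoint.
by move=> p; exact: frame_avg_ge0.
Qed.

Lemma nth_rcons_updf (ys : seq 'rV[R]_d) y : nth 0%R (rcons ys y) = updf (nth 0%R ys) (size ys) y.
Proof.
apply/funext => i; rewrite nth_rcons /updf; case: ltngtP => // si.
by rewrite nth_default// ltnW.
Qed.

(** [G] receives the length separately, since [nth 0 zs] does not remember it. *)
Lemma frame_intE n (ys : seq 'rV[R]_d) (G : nat -> frames R d -> \bar R) :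
  (forall m, measurable_fun setT (G m)) -> (forall m b, 0 <= G m b) ->
  frame_int v n ys (fun zs => G (size zs) (nth 0%R zs)) =
  frame_avg n (size ys) (nth 0%R ys) (G (size ys + n)%N).
Proof.
move=> mG G0; elim: n ys => [|n IH] ys /=; first by rewrite addn0.
rewrite /sph_int -ge0_intRd_gauss; first last.
- by move=> x; exact: frame_avg_ge0.
- exact: measurable_frame_avg1.
congr intRd; apply/funext => x; congr (_ * _).
by rewrite IH size_rcons nth_rcons_updf sph_pointE addSnnS.
Qed.

End frame_integral.

(** * Decay of the spherical Fourier transform *)

Section gauss_signed.
Context {R : realType} {n : nat}.
Local Notation N01 := (normal_prob (0 : R) 1).
Local Notation mR := (measurableTypeR R).
Local Notation mu := (@lebesgue_measure R).

Lemma bounded_intRd_gauss (f : 'rV[R]_n -> R) (K : R) : measurable_fun setT f ->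
  (forall x, `|f x| <= K) ->
  intRd (fun x => ((f x)%:E * (gaussd x)%:E)%E) = (\int[gam n]_x (f x)%:E)%E.
Proof.
move=> mf fK.
have -> : (fun x => ((f x)%:E * (gaussd x)%:E)%E) = (fun x => (f x * gaussd x)%:E).
  by apply/funext => x; rewrite EFinM.
rewrite (@dominated_intRdE _ _ _ (normal_pdf 0 1) K).
- rewrite [RHS](integral_density (mu := leb n) (w := @gaussd R n))//.
  + by move=> x; exact: gaussd_ge0.
  + by move=> h mh h0; rewrite ge0_integral_gam.
- by apply: measurable_funM => //; exact: measurable_gaussd.
- exact: measurable_normal_pdf.
- by move=> t; exact: normal_pdf_ge0.
- by rewrite integral_normal_pdf ltry.
- by move=> x; rewrite normrM -gaussdE (ger0_norm (gaussd_ge0 x)) ler_wpM2r ?gaussd_ge0.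
Qed.

Lemma bounded_integrable_N01 (f : mR -> R) (K : R) : measurable_fun setT f ->
  (forall x, `|f x| <= K) -> N01.-integrable setT (EFin \o f).
Proof.
move=> mf fK; apply/integrableP; split; first exact/measurable_EFinP.
apply: (@le_lt_trans _ _ (\int[N01]_x K%:E)%E).
  by apply: le_integralT => // x /=; rewrite lee_fin.
by rewrite integral_cst//= [X in (_ * X)%E](@probability_setT _ _ _ N01) mule1 ltry.
Qed.

Lemma Rintegral_N01 (f : mR -> R) : measurable_fun setT f ->
  \int[N01]_t f t = \int[mu]_t (normal_pdf 0 1 t * f t).
Proof.
move=> mf; rewrite /Rintegral (integral_density (mu := mu) (w := normal_pdf 0 1))//.
- by congr fine; apply: eq_integral => t _; rewrite mulrC.
- by move=> t; exact: normal_pdf_ge0.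
- exact: ge0_integral_normal_prob.
Qed.

Section split_bounded.
Variables (e : 'rV[R]_n) (f : mR * 'rV[R]_n -> R).
Hypothesis e1 : dotv e e = 1.
Hypotheses (mf : measurable_fun setT f) (f1 : forall p, `|f p| <= 1).

Let f1_ge0 p : 0 <= 1 + f p.
Proof. by have := f1 p; rewrite ler_norml => /andP[h _]; rewrite -lerBlDl sub0r. Qed.

Let mft x : measurable_fun setT (fun t => f (t, x)).
Proof. by apply: measurableT_comp => //; exact: measurable_pair2. Qed.

Definition condN x : R := \int[N01]_t f (t, x).

Let m1f : measurable_fun setT (fun p => (1 + f p)%:E).
Proof. by apply/measurable_EFinP; apply: measurable_funD. Qed.

Lemma condNE x : (\int[N01]_t (1 + f (t, x))%:E = (1 + condN x)%:E)%E.
Proof.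
have i1 : N01.-integrable setT (EFin \o cst (1 : R)).
  by apply: (@bounded_integrable_N01 _ 1) => // t; rewrite normr1.
have i2 := @bounded_integrable_N01 _ 1 (mft x) (fun t => f1 _).
under eq_integral do rewrite EFinD.
rewrite integralD// EFinD; congr (_ + _)%E.
  by rewrite integral_cst//= [X in (_ * X)%E](@probability_setT _ _ _ N01) mule1.
by rewrite /condN /Rintegral fineK//; exact: integrable_fin_num i2.
Qed.

Lemma measurable_condN : measurable_fun setT condN.
Proof.
have := measurable_fun_fubini_tonelli_G
  (m1 := (N01 : {sigma_finite_measure set mR -> \bar R})) (fun p => (1 + f p)%:E) m1f _.
move=> /(_ (fun p => f1_ge0 p)) h.
have {}h : measurable_fun setT (fun x => (1 + condN x)%:E).
  by move: h; rewrite /fubini_G; under eq_fun do rewrite condNE.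
move/measurable_EFinP in h.
rewrite (_ : condN = (fun x => (1 + condN x) - 1)); first exact: measurable_funB.
by apply/funext => x; ring.
Qed.

Lemma abs_condN_le1 x : `|condN x| <= 1.
Proof.
rewrite /condN.
have i2 := @bounded_integrable_N01 _ 1 (mft x) (fun t => f1 _).
have i1 : N01.-integrable setT (EFin \o cst (1 : R)).
  by apply: (@bounded_integrable_N01 _ 1) => // t; rewrite normr1.
apply: (le_trans (Rintegral_norm_le (g := cst 1) (mft x) i1 (fun t => f1 _))).
rewrite Rintegral_cst//.
by rewrite [X in fine X](@probability_setT _ _ _ N01) mulr1.
Qed.

(** Adding 1 to a function bounded by 1 makes it nonnegative, and all measures involved have mass
    one, so the identity is inherited from [gauss_split]. *)
Lemma gauss_split_bounded :
  \int[gam n]_x f (dotv x e, x - dotv x e *: e) = \int[gam n]_x condN (x - dotv x e *: e).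
Proof.
have mperp : measurable_fun setT (fun x : 'rV[R]_n => x - dotv x e *: e).
  apply: measurable_subv => //; apply: measurable_scalev => //.
  exact: measurable_dotv.
have mte : measurable_fun setT (fun x => f (dotv x e, x - dotv x e *: e)).
  apply: (measurableT_comp mf); apply: measurable_fun_pair => //.
  exact: measurable_dotv.
have mc : measurable_fun setT (fun x : 'rV[R]_n => condN (x - dotv x e *: e)).
  exact: (measurableT_comp measurable_condN).
have i1 : (gam n).-integrable setT (EFin \o cst (1 : R)).
  by apply: (@bounded_integrable_gam _ _ _ 1) => // t; rewrite normr1.
have i2 := bounded_integrable_gam mte (fun x => f1 _).
have i3 := bounded_integrable_gam mc (fun x => abs_condN_le1 _).
have aux (g : 'rV[R]_n -> R) : (gam n).-integrable setT (EFin \o g) ->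
    (\int[gam n]_x (1 + g x)%:E = (1 + \int[gam n]_x g x)%:E)%E.
  move=> ig; under eq_integral do rewrite EFinD.
  rewrite integralD// integral_gam_cst EFinD; congr (_ + _)%E.
  by rewrite /Rintegral fineK//; exact: integrable_fin_num ig.
have := gauss_split e1 m1f (fun p => f1_ge0 p).
rewrite /= aux// => h.
suff : (1 + \int[gam n]_x f (dotv x e, (x - dotv x e *: e)%R))%:E =
       (1 + \int[gam n]_x condN (x - dotv x e *: e))%:E.
  by move=> [] /addrI.
rewrite h -aux//.
rewrite (fubini_tonelli (m1 := (N01 : {sigma_finite_measure set mR -> \bar R})) (m2 := gam n)
  (fun p : mR * 'rV[R]_n => (1 + f (p.1, p.2 - dotv p.2 e *: e))%:E))//=.
- by apply: eq_integral => x _; rewrite condNE.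
- apply/measurable_EFinP; apply: measurable_funD => //; apply: (measurableT_comp mf).
  by apply: measurable_fun_pair => //; exact: (measurableT_comp mperp).
- by move=> p; rewrite lee_fin.
Qed.

End split_bounded.
End gauss_signed.

Section power_bounds.
Context {R : realType}.

(** Interpolation between the trivial bound 1 and the bound [a]: any exponent in [(0, 1]] may be
    kept. *)
Lemma min1_le_powR (a th : R) : 0 <= a -> 0 < th -> th <= 1 -> Num.min 1 a <= a `^ th.
Proof.
move=> a0 th0 th1; have [a1|a1] := leP 1 a.
  rewrite -[leLHS](powRr0 a); exact: ler_powR (ltW th0).
have [->|an] := eqVneq a 0; first by rewrite powR0 ?gt_eqF.
have ap : 0 < a by rewrite lt_neqAle eq_sym an.
rewrite -[leLHS]powRr1//; apply: ger_powR => //.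
by rewrite ap ltW.
Qed.

(** [Kq] equals [16 c4 (1/Q + 1 + Q/4)], and the bracket is at most [3/Q] for [Q <= 1] and [3 Q] for
    [Q > 1]; hence [48 = 16 * 3]. The factor [48 c4], being at least 1, may be taken out of the
    power. *)
Lemma Kq_powR (Q : R) : 0 < Q -> (((Kq Q) `^ (5 / 6))%:E <= (48 * c4 : R)%:E * (pw Q + Q%:E))%E.
Proof.
move=> Q0; have c1 := @c4_ge1 R; have c0 : 0 <= (c4 : R) by exact: le_trans c1.
have KE : Kq Q = 16 * c4 * (Q^-1 / 1 + 1 + Q / 4) by rewrite /Kq; field; rewrite gt_eqF.
have A1 : 1 <= 16 * (c4 : R) by have := c1; lra.
rewrite /pw gt_eqF// -EFinD -EFinM lee_fin.
have powA (A B : R) : 1 <= A -> 0 <= B -> (A * B) `^ (5 / 6) <= A * B `^ (5 / 6).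
  move=> hA hB; rewrite powRM ?(le_trans ler01 hA)// ler_wpM2r ?powR_ge0//.
  rewrite -[leRHS](powRr1 (le_trans ler01 hA)); apply: ler_powR => //; lra.
have QV : 0 < Q^-1 by rewrite invr_gt0.
have pQ := powR_ge0 Q (- (5 / 6)).
have [Q1|Q1] := leP Q 1.
  have h : Q^-1 / 1 + 1 + Q / 4 <= 3 * Q^-1.
    have : 1 <= Q^-1 by rewrite invf_ge1.
    rewrite divr1; have := Q0; lra.
  rewrite KE; apply: (@le_trans _ _ ((16 * c4 * (3 * Q^-1)) `^ (5 / 6))).
    apply: ge0_ler_powR; rewrite ?nnegrE; first by lra.
    - by rewrite mulr_ge0 ?(le_trans ler01 A1)//; have := Q0; have := QV; lra.
    - by rewrite mulr_ge0 ?(le_trans ler01 A1)//; have := QV; lra.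
    - by rewrite ler_wpM2l// (le_trans ler01 A1).
  rewrite mulrA; apply: (le_trans (powA _ _ _ _)); first by have := A1; lra.
    exact: ltW.
  rewrite (_ : 16 * c4 * 3 = 48 * c4); last by ring.
  rewrite ler_wpM2l ?mulr_ge0// -powR_inv1 ?(ltW Q0)// -powRrM mulN1r.
  by have := Q0; lra.
have h : Q^-1 / 1 + 1 + Q / 4 <= 3 * Q.
  have : Q^-1 <= 1 by rewrite invf_le1// ltW.
  rewrite divr1; have := Q1; lra.
rewrite KE; apply: (@le_trans _ _ ((16 * c4 * (3 * Q)) `^ (5 / 6))).
  apply: ge0_ler_powR; rewrite ?nnegrE; first by lra.
  - by rewrite mulr_ge0 ?(le_trans ler01 A1)//; have := Q0; have := QV; lra.
  - by rewrite mulr_ge0 ?(le_trans ler01 A1)//; have := Q0; lra.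
  - by rewrite ler_wpM2l// (le_trans ler01 A1).
rewrite mulrA; apply: (le_trans (powA _ _ _ _)); first by have := A1; lra.
  exact: ltW.
rewrite (_ : 16 * c4 * 3 = 48 * c4); last by ring.
rewrite ler_wpM2l ?mulr_ge0//.
have : Q `^ (5 / 6) <= Q.
  by rewrite -[leRHS](powRr1 (ltW Q0)); apply: ler_powR; [exact: ltW|lra].
lra.
Qed.

End power_bounds.

Section odd_part.
Context {R : realType}.
Local Notation N01 := (normal_prob (0 : R) 1).
Local Notation mR := (measurableTypeR R).
Local Notation mu := (@lebesgue_measure R).
Local Notation phi := (normal_pdf (0 : R) 1).

Lemma measurable_tau_comp (dsp : measure_display) (U : measurableType dsp) (Q t : U -> R) :
  measurable_fun setT Q -> measurable_fun setT t ->
  measurable_fun setT (fun u => tau (Q u) (t u)).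
Proof.
move=> mQ mt; apply: measurable_funM => //; apply: measurable_invr.
apply: (measurableT_comp (f := @Num.sqrt R)).
  exact: continuous_measurable_fun (@sqrt_continuous R).
by apply: measurable_funD => //; exact: measurable_funX.
Qed.

Lemma measurable_cos_comp (dsp : measure_display) (U : measurableType dsp) (f : U -> R) :
  measurable_fun setT f -> measurable_fun setT (fun u => cos (f u)).
Proof.
move=> mf; apply: (measurableT_comp (f := @cos R)) => //.
exact: continuous_measurable_fun (@continuous_cos R).
Qed.

Lemma measurable_sin_comp (dsp : measure_display) (U : measurableType dsp) (f : U -> R) :
  measurable_fun setT f -> measurable_fun setT (fun u => sin (f u)).
Proof.
move=> mf; apply: (measurableT_comp (f := @sin R)) => //.
exact: continuous_measurable_fun (@continuous_sin R).
Qed.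

(** [1 + f] and [1 - f] are nonnegative and exchanged by [t -> -t], so they have the same integral;
    the change of variable is only made for nonnegative integrands. *)
Lemma N01_odd (f : mR -> R) : measurable_fun setT f -> (forall t, `|f t| <= 1) ->
  (forall t, f (- t) = - f t) -> \int[N01]_t f t = 0.
Proof.
move=> mf f1 fodd.
have i1 : N01.-integrable setT (EFin \o cst (1 : R)).
  by apply: (@bounded_integrable_N01 _ _ 1) => // t; rewrite normr1.
have aux (g : mR -> R) : measurable_fun setT g -> (forall t, `|g t| <= 1) ->
    (\int[N01]_t (1 + g t)%:E = (1 + \int[N01]_t g t)%:E)%E.
  move=> mg g1; have ig := bounded_integrable_N01 mg g1.
  under eq_integral do rewrite EFinD.
  rewrite integralD// EFinD; congr (_ + _)%E.
    by rewrite integral_cst//= [X in (_ * X)%E](@probability_setT _ _ _ N01) mule1.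
  by rewrite /Rintegral fineK//; exact: integrable_fin_num ig.
have mNf : measurable_fun setT (fun t => - f t) by exact: measurableT_comp.
have Nf1 t : `|- f t| <= 1 by rewrite normrN.
have E1 := aux f mf f1; have E2 := aux _ mNf Nf1.
have f0 t : 0 <= 1 + f t by have := f1 t; rewrite ler_norml => /andP[h _]; lra.
have Nf0 t : 0 <= 1 + - f t by have := f1 t; rewrite ler_norml => /andP[_ h]; lra.
have mw : measurable_fun setT (fun t : mR => (phi t)%:E).
  by apply/measurable_EFinP; exact: measurable_normal_pdf.
have m1f : measurable_fun setT (fun t => (1 + f t)%:E).
  by apply/measurable_EFinP; exact: measurable_funD.
have phiN t : phi (- t) = phi t.
  by rewrite !normal_pdfE ?oner_neq0// /normal_fun !subr0 sqrrN.
have : (\int[N01]_t (1 + f t)%:E = \int[N01]_t (1 + - f t)%:E)%E.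
  rewrite !ge0_integral_normal_prob//; last first.
    by apply/measurable_EFinP; exact: measurable_funD.
  rewrite -(ge0_integral_oppr (f := fun t => ((1 + f t)%:E * (phi t)%:E)%E)).
  - by apply: eq_integral => t _; rewrite fodd phiN.
  - exact: emeasurable_funM.
  - by move=> t; rewrite mule_ge0// lee_fin// normal_pdf_ge0.
rewrite E1 E2 => -[] /addrI.
have -> : \int[N01]_t - f t = - \int[N01]_t f t.
  under eq_Rintegral do rewrite -mulN1r.
  by rewrite RintegralZl ?mulN1r//; exact: bounded_integrable_N01 f1.
by move=> /eqP; rewrite -addr_eq0 -mulr2n mulrn_eq0 => /eqP.
Qed.

End odd_part.

(** * Decay for a fixed frame and a fixed direction *)

Section sphere_decay.
Context {R : realType} {d k : nat}.
Variable v : nat -> 'rV[R]_d.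
Hypothesis vfree : row_free (\matrix_(i < k) v i.+1).
Local Notation N01 := (normal_prob (0 : R) 1).
Local Notation mR := (measurableTypeR R).
Variables (m : nat) (a : frames R d).
Hypotheses (mk : (m < k)%N) (md : (m + 3 <= d)%N) (am : adm v m a).
Variable e : 'rV[R]_d.
Hypotheses (e1 : dotv e e = 1) (ea : perp m a e = e).

Let gu : gmx m a \in unitmx.
Proof. exact (adm_unit vfree (ltnW mk) am). Qed.

Definition Qf (z : 'rV[R]_d) : R := dotv (perp m a z) (perp m a z).
(* The cosine of the angle between [e] and [perp m a x], see [sTE]. *)
Definition sT (x : 'rV[R]_d) : R := tau (Qf (x - dotv x e *: e)) (dotv x e).

Lemma Qf_split x : Qf (x - dotv x e *: e) = dotv (perp m a x) (perp m a x) - dotv x e ^+ 2.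
Proof.
rewrite /Qf perpB perpZ ea (dotvBl (perp m a x)) !(dotvBr (perp m a x)) !(dotvZl _ e) !(dotvZr _ _ e) e1.
rewrite (dotvC e (perp m a x)).
have -> : dotv (perp m a x) e = dotv x e by rewrite dotv_perp ea.
by ring.
Qed.

Lemma sTE x : sT x = dotv x e / vnorm (perp m a x).
Proof. by rewrite /sT /tau /hyp Qf_split addrC subrK. Qed.

(** The complement of the frame has dimension at least [d - m >= 3]; with [m = j - 1] this is the
    condition [d >= j + 2]. One dimension is taken by [e], two are left for bounding [Q] from
    below. *)
Lemma exists_orthonormal3 : exists e2 e3 : 'rV[R]_d,
  [/\ dotv e2 e2 = 1, dotv e3 e3 = 1, dotv e e2 = 0, dotv e e3 = 0 &
   [/\ dotv e2 e3 = 0, perp m a e2 = e2 & perp m a e3 = e3]].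
Proof.
pose s := mkseq a m; have ss : size s = m by rewrite size_mkseq.
have sz1 : (size (e :: s) < d)%N.
  by rewrite /= ss; apply: leq_trans md; rewrite -addn2 leq_add2l.
have [e2 e22 h2] := exists_orth_unit sz1.
have sz2 : (size [:: e, e2 & s] < d)%N by rewrite /= ss; apply: leq_trans md; rewrite -addn3.
have [e3 e33 h3] := exists_orth_unit sz2.
exists e2, e3; split => //; [by rewrite dotvC; exact: (h2 0%N)|by rewrite dotvC; exact: (h3 0%N)|split].
- by rewrite dotvC; exact: (h3 1%N).
- apply: perp_id => // i im.
  by have := h2 i.+1; rewrite /= ss ltnS im nth_mkseq//; apply.
- apply: perp_id => // i im.
  by have := h3 i.+2; rewrite /= ss !ltnS im nth_mkseq//; apply.
Qed.

(** Bessel's inequality for the projection of [x] and the orthonormal vectors [e], [e2], [e3], with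
    the component along [e] moved to the other side. *)
Lemma Qf_ge e2 e3 x : dotv e2 e2 = 1 -> dotv e3 e3 = 1 -> dotv e e2 = 0 -> dotv e e3 = 0 ->
  dotv e2 e3 = 0 -> perp m a e2 = e2 -> perp m a e3 = e3 ->
  dotv x e2 ^+ 2 + dotv x e3 ^+ 2 <= Qf (x - dotv x e *: e).
Proof.
move=> e22 e33 e12 e13 e23 p2 p3; rewrite Qf_split.
set w := perp m a x.
have w1 : dotv w e = dotv x e by rewrite dotv_perp ea.
have w2 : dotv w e2 = dotv x e2 by rewrite dotv_perp p2.
have w3 : dotv w e3 = dotv x e3 by rewrite dotv_perp p3.
move: w w1 w2 w3 => w w1 w2 w3.
have := dotv_ge0 (w - (dotv x e *: e + dotv x e2 *: e2 + dotv x e3 *: e3)).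
rewrite (dotvBl w) !(dotvBr w) !(dotvDl, dotvDr) !(dotvZl _ e, dotvZl _ e2, dotvZl _ e3).
rewrite !(dotvZr _ _ e, dotvZr _ _ e2, dotvZr _ _ e3).
rewrite (dotvC e w) (dotvC e2 w) (dotvC e3 w) (dotvC e2 e) (dotvC e3 e) (dotvC e3 e2).
rewrite w1 w2 w3 e1 e22 e33 e12 e13 e23 => h.
rewrite -subr_ge0; apply: (le_trans h); rewrite le_eqVlt; apply/orP; left; apply/eqP; ring.
Qed.

Lemma Qf_ge0 z : 0 <= Qf z. Proof. exact: dotv_ge0. Qed.

Lemma measurable_Qf (dsp : measure_display) (U : measurableType dsp) (f : U -> 'rV[R]_d) :
  measurable_fun setT f -> measurable_fun setT (fun u => Qf (f u)).
Proof.
move=> mf; apply: measurable_dotv; exact: (measurable_perp m (a := fun=> a)).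
Qed.

Let mperp_e : measurable_fun setT (fun x : 'rV[R]_d => x - dotv x e *: e).
Proof.
apply: measurable_subv => //; apply: measurable_scalev => //.
exact: measurable_dotv.
Qed.

Lemma measurable_sT : measurable_fun setT sT.
Proof.
apply: measurable_tau_comp; first exact: measurable_Qf.
exact: measurable_dotv.
Qed.

Definition Zf (s : R) : R := \int[gam d]_x cos (s * sT x).

Let mtau2 (s : R) : measurable_fun setT (fun p : mR * 'rV[R]_d => s * tau (Qf p.2) p.1).
Proof.
apply: measurable_funM => //; apply: measurable_tau_comp => //.
exact: measurable_Qf.
Qed.

Let mtau1 (Q s : R) : measurable_fun setT (fun t : mR => s * tau Q t).
Proof. by apply: measurable_funM => //; exact: measurable_tau_comp. Qed.

(** Once the part of [x] orthogonal to [e] is fixed, [Q] is fixed while [dotv x e] remains standard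
    normal, so the one-dimensional bounds on [zeta] apply conditionally. *)
Lemma ZfE s : Zf s = \int[gam d]_x zeta (Qf (x - dotv x e *: e)) s.
Proof.
have := @gauss_split_bounded R d e (fun p => cos (s * tau (Qf p.2) p.1)) e1
  (measurable_cos_comp (mtau2 s)) (fun p => abs_cos_le1 _).
rewrite /= -/(Zf s) => ->; apply: eq_Rintegral => x _.
by rewrite /condN Rintegral_N01//=; exact: (measurable_cos_comp (mtau1 _ _)).
Qed.

(** [sT] is odd in the component along [e]. The transform of the sphere, once centred, is therefore
    real and given by [Zf]. *)
Lemma Zf_sin s : \int[gam d]_x sin (s * sT x) = 0.
Proof.
have := @gauss_split_bounded R d e (fun p => sin (s * tau (Qf p.2) p.1)) e1
  (measurable_sin_comp (mtau2 s)) (fun p => abs_sin_le1 _).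
move=> /= ->.
rewrite (_ : (fun x => _) = cst 0); first by rewrite Rintegral_cst// mul0r.
apply/funext => x /=; rewrite /condN /= N01_odd//.
- exact: (measurable_sin_comp (mtau1 _ _)).
- by move=> t; exact: abs_sin_le1.
- by move=> t; rewrite /tau /hyp sqrrN mulNr mulrN sinN.
Qed.

Lemma condN_zeta s (x : 'rV[R]_d) :
  condN (fun p => cos (s * tau (Qf p.2) p.1)) x = zeta (Qf x) s.
Proof. by rewrite /condN Rintegral_N01//=; exact: (measurable_cos_comp (mtau1 _ _)). Qed.

Lemma abs_zeta_Qf s (x : 'rV[R]_d) : `|zeta (Qf x) s| <= 1.
Proof.
rewrite -condN_zeta; apply: abs_condN_le1; first exact: (measurable_cos_comp (mtau2 s)).
by move=> p; exact: abs_cos_le1.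
Qed.

Lemma integrable_zeta s :
  (gam d).-integrable setT (EFin \o (fun x => zeta (Qf (x - dotv x e *: e)) s)).
Proof.
have mc := @measurable_condN R d (fun p => cos (s * tau (Qf p.2) p.1))
  (measurable_cos_comp (mtau2 s)) (fun p => abs_cos_le1 _).
apply: (@bounded_integrable_gam _ _ _ 1) => [|x]; last exact: abs_zeta_Qf.
under eq_fun do rewrite -condN_zeta.
exact: (measurableT_comp mc).
Qed.

(** An upper bound for the expectation of [48 c4 (pw Q + Q)]: the first term is controlled by two
    independent factors [c56], the second by the mean of [|x|^2]. *)
Definition decay_moment : \bar R := ((48 * c4 : R)%:E * (c56 * c56 + d%:R%:E * m2))%E.

Lemma decay_moment_fin : decay_moment = (fine decay_moment)%:E.
Proof.
have f1 : (c56 : \bar R) \is a fin_num by rewrite ge0_fin_numE ?c56_lty ?c56_ge0.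
have f2 : (m2 : \bar R) \is a fin_num by rewrite ge0_fin_numE ?m2_lty ?m2_ge0.
by rewrite fineK// fin_numM// fin_numD !fin_numM.
Qed.

(** The bound on [zeta] requires [Q > 0], so the integrand is set to [+oo] where [Q = 0]. This costs
    nothing, because the majorant [pw Q] coming from [Kq_powR] is infinite there too and still has a
    finite integral. *)
Lemma EKq_le s : 0 < s ->
  (\int[gam d]_x (if (Qf (x - dotv x e *: e) == 0)%R then +oo else
     (Num.min 1 (Kq (Qf (x - dotv x e *: e)) / s))%:E) <= (s `^ (- (5 / 6)))%:E * decay_moment)%E.
Proof.
move=> s0.
have c0 : 0 <= 48 * (c4 : R) by rewrite mulr_ge0// (le_trans ler01)// c4_ge1.
have [e2 [e3 [e22 e33 e12 e13 [e23 p2 p3]]]] := exists_orthonormal3.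
have mpp : measurable_fun setT (fun x : 'rV[R]_d => (pw `|dotv x e2| * pw `|dotv x e3|)%E).
  by apply: emeasurable_funM; exact: measurable_pw_dotv.
have mxx : measurable_fun setT (fun x : 'rV[R]_d => (dotv x x)%:E).
  by apply/measurable_EFinP; exact: measurable_dotv.
have pp0 x : (0 <= pw `|dotv x e2| * pw `|dotv x e3|)%E by rewrite mule_ge0// pw_ge0.
apply: (@le_trans _ _ (\int[gam d]_x ((s `^ (- (5 / 6)))%:E * ((48 * c4 : R)%:E *
   (pw `|dotv x e2| * pw `|dotv x e3| + (dotv x x)%:E))))%E).
  apply: le_integralT => x; set Q := Qf _.
    case: eqVneq => // _; rewrite lee_fin le_min ler01/=.
    have [Q0|Q0] := leP Q 0.
      have -> : Q = 0 by apply/eqP; rewrite eq_le Q0 Qf_ge0.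
      by rewrite /Kq invr0 mulr0 !mul0r.
    by rewrite divr_ge0 ?(le_trans ler01 (Kq_ge1 Q0)) ?ltW.
  have Qge := Qf_ge x e22 e33 e12 e13 e23 p2 p3.
  have Qle : Q <= dotv x x.
    rewrite /Q Qf_split; have := dotv_perp_le gu x; have := sqr_ge0 (dotv x e); lra.
  have bnd : (pw Q + Q%:E <= pw `|dotv x e2| * pw `|dotv x e3| + (dotv x x)%:E)%E.
    by apply: leeD; [exact: pw_sum_sqr_le|rewrite lee_fin].
  have sp : 0 < s `^ (- (5 / 6)) by exact: powR_gt0.
  apply: (@le_trans _ _ ((s `^ (- (5 / 6)))%:E * ((48 * c4 : R)%:E * (pw Q + Q%:E)))%E); last first.
    by rewrite !lee_wpmul2l// lee_fin ltW.
  case: eqVneq => [Q0|Qn].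
    rewrite /pw Q0 eqxx addye// gt0_muley ?gt0_muley ?lte_fin// mulr_gt0//.
    exact: lt_le_trans (c4_ge1).
  have Q0 : 0 < Q by rewrite lt_neqAle eq_sym Qn Qf_ge0.
  have K0 : 0 <= Kq Q by exact: le_trans ler01 (Kq_ge1 Q0).
  apply: (@le_trans _ _ ((s `^ (- (5 / 6)))%:E * ((Kq Q) `^ (5 / 6))%:E)%E).
    rewrite -EFinM lee_fin; apply: (le_trans (@min1_le_powR _ _ (5 / 6) _ _ _)).
    - by rewrite divr_ge0// ltW.
    - by lra.
    - by lra.
    rewrite powRM ?invr_ge0 ?(ltW s0)// mulrC -(powR_inv1 (ltW s0)) -powRrM mulN1r.
    exact: lexx.
  by rewrite lee_wpmul2l ?lee_fin ?(ltW sp)//; exact: Kq_powR.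
rewrite ge0_integralZl ?lee_fin ?powR_ge0//; last 2 first.
- by apply: measurable_funeM; exact: emeasurable_funD.
- by move=> x _; rewrite mule_ge0 ?lee_fin ?adde_ge0// lee_fin dotv_ge0.
rewrite lee_wpmul2l ?lee_fin ?powR_ge0//.
rewrite ge0_integralZl ?lee_fin//; last 2 first.
- exact: emeasurable_funD.
- by move=> x _; rewrite adde_ge0// lee_fin dotv_ge0.
rewrite /decay_moment lee_wpmul2l ?lee_fin// ge0_integralD//; last by move=> x _; rewrite lee_fin dotv_ge0.
by apply: leeD; [rewrite gauss_pw2|exact: gauss_norm2].
Qed.

Definition decay_cst : R := fine decay_moment.

Lemma Zf_le s : 0 < s -> `|Zf s| <= Num.min 1 (s `^ (- (5 / 6)) * decay_cst).
Proof.
move=> s0; rewrite le_min; apply/andP; split.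
  rewrite ZfE; have iz := integrable_zeta s; have mz := measurable_int _ iz.
  move/measurable_EFinP in mz.
  have i1 : (gam d).-integrable setT (EFin \o cst (1 : R)).
    by apply: (@bounded_integrable_gam _ _ _ 1) => // t; rewrite normr1.
  apply: (le_trans (Rintegral_norm_le (g := cst 1) mz i1 (fun x => abs_zeta_Qf _ _))).
  by rewrite /Rintegral (integral_gam_cst 1%:E).
rewrite -lee_fin EFinM /decay_cst -decay_moment_fin; apply: le_trans (EKq_le s0).
rewrite ZfE; have iz := integrable_zeta s.
apply: (@le_trans _ _ (\int[gam d]_x `|(zeta (Qf (x - dotv x e *: e)) s)%:E|)%E).
  rewrite [leLHS](_ : _ = `|\int[gam d]_x (zeta (Qf (x - dotv x e *: e)) s)%:E|%E).
    by apply: le_abse_integral => //; exact: measurable_int iz.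
  by rewrite /Rintegral -[in RHS](fineK (integrable_fin_num measurableT iz)).
apply: le_integralT => // x; case: eqVneq => [_|Qn]; first exact: leey.
by rewrite lee_fin; apply: zeta_le => //; rewrite lt_neqAle eq_sym Qn Qf_ge0.
Qed.

Lemma Zf_diff_le s s' : 0 < s -> s <= s' ->
  `|Zf s - Zf s'| <= 2 * Num.min 1 (s' - s) * (s `^ (- (5 / 6)) * decay_cst).
Proof.
move=> s0 ss'; have d0 : 0 <= s' - s by rewrite subr_ge0.
have m0 : 0 <= 2 * Num.min 1 (s' - s) by rewrite mulr_ge0// le_min ler01.
rewrite -lee_fin EFinM (EFinM (s `^ _)) /decay_cst -decay_moment_fin.
apply: (@le_trans _ _ ((2 * Num.min 1 (s' - s))%:E * \int[gam d]_x (if (Qf (x - dotv x e *: e) == 0)%R then +oo else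
     (Num.min 1 (Kq (Qf (x - dotv x e *: e)) / s))%:E))%E); last first.
  by rewrite lee_wpmul2l ?lee_fin//; exact: EKq_le.
have iz := integrable_zeta s; have iz' := integrable_zeta s'.
have izz : (gam d).-integrable setT (EFin \o (fun x => zeta (Qf (x - dotv x e *: e)) s - zeta (Qf (x - dotv x e *: e)) s')).
  exact: (integrableB measurableT iz iz').
have mz := measurable_int _ izz.
rewrite !ZfE -RintegralB//.
apply: (@le_trans _ _ (\int[gam d]_x `|(zeta (Qf (x - dotv x e *: e)) s - zeta (Qf (x - dotv x e *: e)) s')%:E|)%E).
  rewrite [leLHS](_ : _ = `|\int[gam d]_x (zeta (Qf (x - dotv x e *: e)) s - zeta (Qf (x - dotv x e *: e)) s')%:E|%E).
    by apply: le_abse_integral.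
  by rewrite /Rintegral -[in RHS](fineK (integrable_fin_num measurableT izz)).
(* A zero factor would turn the value [+oo] at [Q = 0] into 0 and spoil the pointwise comparison; it
   occurs only for [s = s'], where the difference vanishes. *)
have [dd|dn] := eqVneq (2 * Num.min 1 (s' - s)) 0.
  have sE : s = s'.
    move/eqP: dd; rewrite mulf_eq0 pnatr_eq0/= => /eqP; rewrite /Num.min.
    by case: ifP => _ /eqP; rewrite ?oner_eq0// subr_eq0 => /eqP.
  rewrite dd mul0e sE integral0_eq// => x _.
  by rewrite subrr abse0.
have dp : 0 < 2 * Num.min 1 (s' - s) by rewrite lt_neqAle eq_sym dn.
have mpos : measurable_fun setT (fun x : 'rV[R]_d => if (Qf (x - dotv x e *: e) == 0)%R then +oo%E else
     (Num.min 1 (Kq (Qf (x - dotv x e *: e)) / s))%:E).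
  apply: measurable_fun_ifT => //.
    by apply: measurable_fun_eqr => //; exact: measurable_Qf.
  apply/measurable_EFinP; apply: measurable_minr => //.
  apply: measurable_funM => //; apply: measurable_funM => //; apply: measurable_funM.
    apply: measurable_funM => //; apply: measurable_funX; apply: measurable_funD => //.
    exact: measurable_Qf.
  by apply: measurable_invr; exact: measurable_Qf.
rewrite -ge0_integralZl//; last first.
  move=> x _; case: eqVneq => // Qn; rewrite lee_fin le_min ler01/=.
  have Q0 : 0 < Qf (x - dotv x e *: e) by rewrite lt_neqAle eq_sym Qn Qf_ge0.
  by rewrite divr_ge0 ?(le_trans ler01 (Kq_ge1 Q0)) ?ltW.
apply: le_integralT => // x; case: eqVneq => [_|Qn]; first by rewrite gt0_muley ?lte_fin// leey.
rewrite /= -EFinM lee_fin -mulrA; apply: zeta_diff_le => //.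
by rewrite lt_neqAle eq_sym Qn Qf_ge0.
Qed.

End sphere_decay.

Section sigma_hat_bounds.
Context {R : realType} {d k : nat}.
Variable v : nat -> 'rV[R]_d.
Hypothesis vfree : row_free (\matrix_(i < k) v i.+1).
Implicit Types (m : nat) (a : frames R d) (xi x u : 'rV[R]_d).

Definition shR m a xi : R := \int[gam d]_x cos (2 * pi * dotv (fpoint v m a x) xi).
Definition shI m a xi : R := - \int[gam d]_x sin (2 * pi * dotv (fpoint v m a x) xi).

Lemma measurable_sph_phase m a xi :
  measurable_fun setT (fun x => 2 * pi * dotv (fpoint v m a x) xi).
Proof.
apply: measurable_funM => //; apply: measurable_dotv => //.
exact: (measurable_fpoint v m (a := fun=> a)).
Qed.

Lemma sigma_hatE (ys : seq 'rV[R]_d) xi :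
  sigma_hat v ys xi = (shR (size ys) (nth 0 ys) xi +i* shI (size ys) (nth 0 ys) xi)%C.
Proof.
rewrite /sigma_hat /sph_cint /sph_int /=; congr (_ +i* _)%C.
  rewrite (@bounded_intRd_gauss _ _ (fun x => cos (- (2 * pi * dotv (sph_point v ys x) xi))) 1).
  - by rewrite /shR /Rintegral; congr fine; apply: eq_integral => x _; rewrite cosN sph_pointE.
  - apply: measurable_cos_comp; apply: measurableT_comp => //.
    exact: measurable_sph_phase.
  - by move=> x; exact: abs_cos_le1.
rewrite (@bounded_intRd_gauss _ _ (fun x => sin (- (2 * pi * dotv (sph_point v ys x) xi))) 1).
- rewrite /shI -mulN1r -RintegralZl//.
    by rewrite /Rintegral; congr fine; apply: eq_integral => x _; rewrite sinN mulN1r sph_pointE.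
  apply: (@bounded_integrable_gam _ _ _ 1) => [|x]; last exact: abs_sin_le1.
  by apply: measurable_sin_comp; exact: measurable_sph_phase.
- apply: measurable_sin_comp; apply: measurableT_comp => //.
  exact: measurable_sph_phase.
- by move=> x; exact: abs_sin_le1.
Qed.

Section one_frame.
Variables (m : nat) (a : frames R d) (xi : 'rV[R]_d).
Hypotheses (mk : (m < k)%N) (md : (m + 3 <= d)%N) (am : adm v m a).
Hypothesis pxi : perp m a xi != 0.

Let gu : gmx m a \in unitmx.
Proof. exact (adm_unit vfree (ltnW mk) am). Qed.

Let p := vnorm (perp m a xi).
Let e := p^-1 *: perp m a xi.
Let r := Num.sqrt (rad2 v m).
Let beta := 2 * pi * dotv (centr v m a) xi.

Let p0 : 0 < p.
Proof. by rewrite lt_neqAle vnorm_ge0 eq_sym vnorm_eq0 pxi. Qed.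

Let e1 : dotv e e = 1.
Proof. by rewrite dotvZl dotvZr -vnorm_sqr -/p; field; rewrite gt_eqF. Qed.

Let ea : perp m a e = e.
Proof. by rewrite /e perpZ perp_perp. Qed.

(** The centre contributes a phase independent of [x]; the moving part of the point is orthogonal to
    the frame and only sees the projection of [xi], of length [p]. *)
Lemma sph_phase_split lam x :
  2 * pi * dotv (fpoint v m a x) (lam *: xi) =
  lam * beta + (2 * pi * lam * r * p) * sT m a e x.
Proof.
rewrite sTE// fpointE// dotvZr dotvDl (dotvZl _ (perp m a x)).
have -> : dotv (perp m a x) xi = p * dotv x e.
  by rewrite dotv_perp dotvZr mulrA mulfV ?mul1r// gt_eqF.
by rewrite /beta -/r; ring.
Qed.

Let iC s : (gam d).-integrable setT (EFin \o (fun x => cos (s * sT m a e x))).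
Proof.
apply: (@bounded_integrable_gam _ _ _ 1) => [|x]; last exact: abs_cos_le1.
by apply: measurable_cos_comp; apply: measurable_funM => //; exact: measurable_sT.
Qed.

Let iS s : (gam d).-integrable setT (EFin \o (fun x => sin (s * sT m a e x))).
Proof.
apply: (@bounded_integrable_gam _ _ _ 1) => [|x]; last exact: abs_sin_le1.
by apply: measurable_sin_comp; apply: measurable_funM => //; exact: measurable_sT.
Qed.

Lemma shRE lam : shR m a (lam *: xi) =
  cos (lam * beta) * Zf m a e (2 * pi * lam * r * p).
Proof.
rewrite /shR; under eq_Rintegral do rewrite sph_phase_split cosD.
rewrite RintegralB//; last 2 first.
- exact: (integrableZl measurableT _ (iC _)).
- exact: (integrableZl measurableT _ (iS _)).
by rewrite !RintegralZl// Zf_sin// mulr0 subr0.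
Qed.

Lemma shIE lam : shI m a (lam *: xi) =
  - (sin (lam * beta) * Zf m a e (2 * pi * lam * r * p)).
Proof.
rewrite /shI; under eq_Rintegral do rewrite sph_phase_split sinD.
rewrite RintegralD//; last 2 first.
- exact: (integrableZl measurableT _ (iC _)).
- exact: (integrableZl measurableT _ (iS _)).
by rewrite !RintegralZl// Zf_sin// mulr0 addr0.
Qed.

Let r0 : 0 < r.
Proof. by rewrite sqrtr_gt0 (rad2_gt0 vfree). Qed.

(** Multiplied by [|xi|], a common Lipschitz constant in [lam] for the phase of the centre and for
    the argument [2 pi lam r p] of [Zf]. *)
Definition phase_lip : R := 2 * pi * (vnorm (vv v m) + Num.sqrt (rad2 v m)).

Lemma sh_sqr_le lam : 0 < lam ->
  shR m a (lam *: xi) ^+ 2 + shI m a (lam *: xi) ^+ 2 <=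
  Num.min 1 ((2 * pi * lam * r * p) `^ (- (5 / 6)) * decay_cst (d := d)) ^+ 2.
Proof.
move=> l0; have s0 : 0 < 2 * pi * lam * r * p by rewrite !mulr_gt0// pi_gt0.
rewrite shRE shIE sqrrN !exprMn -mulrDl cos2Dsin2 mul1r.
rewrite -[leLHS]real_normK ?num_real// lerXn2r ?nnegrE//.
- by rewrite (le_trans (normr_ge0 _) (Zf_le vfree mk md am e1 ea s0)).
- exact: (Zf_le vfree mk md am e1 ea s0).
Qed.

(** The transform is a unimodular factor times [Zf], and an increment is split as
    [(c - c') Z + c' (Z - Z')]. With [q] the minimum and [M] the decay bound, the two parts
    contribute [2 * (2 * (2 q)^2) M^2] and [2 * (2 q M)^2], whence [24 = 16 + 8]. *)
Lemma sh_diff_le lam lam' : 0 < lam -> lam <= lam' ->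
  (shR m a (lam *: xi) - shR m a (lam' *: xi)) ^+ 2 +
  (shI m a (lam *: xi) - shI m a (lam' *: xi)) ^+ 2 <=
  24 * Num.min 1 (phase_lip * vnorm xi * (lam' - lam)) ^+ 2 *
    ((2 * pi * lam * r * p) `^ (- (5 / 6)) * decay_cst (d := d)) ^+ 2.
Proof.
move=> l0 ll'; have s0 : 0 < 2 * pi * lam * r * p by rewrite !mulr_gt0// pi_gt0.
have ss' : 2 * pi * lam * r * p <= 2 * pi * lam' * r * p.
  by rewrite !ler_wpM2r ?(ltW p0) ?(ltW r0)// ler_wpM2l// mulr_ge0// pi_ge0.
have dl : 0 <= lam' - lam by rewrite subr_ge0.
have pxile : p <= vnorm xi.
  rewrite /p /vnorm ler_sqrt ?dotv_ge0//; exact: dotv_perp_le.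
have cle : `|dotv (centr v m a) xi| <= vnorm (vv v m) * vnorm xi.
  apply: (le_trans (abs_dotv_le _ _)); rewrite ler_wpM2r ?vnorm_ge0//.
  by rewrite /vnorm ler_sqrt ?dotv_ge0// (centr_le vfree (ltnW mk) am).
set D := phase_lip * vnorm xi * (lam' - lam).
have D0 : 0 <= D.
  by rewrite !mulr_ge0 ?pi_ge0 ?vnorm_ge0// addr_ge0 ?vnorm_ge0 ?sqrtr_ge0.
have sD : 2 * pi * lam' * r * p - 2 * pi * lam * r * p <= D.
  rewrite (_ : _ - _ = 2 * pi * (r * p) * (lam' - lam)); last by ring.
  rewrite /D /phase_lip ler_wpM2r// -[leRHS]mulrA; apply: ler_wpM2l; first by rewrite mulr_ge0 ?pi_ge0.
  rewrite mulrDl -/r; apply: (@le_trans _ _ (r * vnorm xi)).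
    by rewrite ler_wpM2l// ltW.
  by rewrite lerDr mulr_ge0 ?vnorm_ge0.
have bD : `|lam' * beta - lam * beta| <= D.
  rewrite -mulrBl normrM (ger0_norm dl) mulrC /D ler_wpM2r// /beta normrM.
  rewrite (ger0_norm (_ : 0 <= 2 * pi)) ?mulr_ge0 ?pi_ge0// /phase_lip -[leRHS]mulrA ler_wpM2l ?mulr_ge0 ?pi_ge0//.
  by apply: (le_trans cle); rewrite ler_wpM2r ?vnorm_ge0// lerDl sqrtr_ge0.
have Z1 := Zf_le vfree mk md am e1 ea s0.
have Z2 := Zf_diff_le vfree mk md am e1 ea s0 ss'.
rewrite !shRE !shIE.
set s := 2 * pi * lam * r * p in s0 ss' sD Z1 Z2 *.
set s' := 2 * pi * lam' * r * p in ss' sD Z2 *.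
set M := s `^ (- (5 / 6)) * decay_cst in Z1 Z2 *.
set Z := Zf m a e s in Z1 Z2 *; set Z' := Zf m a e s' in Z2 *.
set q := Num.min 1 D.
have q0 : 0 <= q by rewrite le_min ler01.
have M0 : 0 <= M.
  by move: Z1; rewrite le_min => /andP[_]; exact: le_trans.
have ZM : `|Z| <= M by move: Z1; rewrite le_min => /andP[].
have ZZ : `|Z - Z'| <= 2 * q * M.
  apply: (le_trans Z2); rewrite ler_wpM2r// ler_wpM2l//.
  by rewrite le_min !ge_min lexx sD orbT.
have trig (f : R -> R) : (forall x y : R, `|f x - f y| <= `|x - y|) -> (forall x : R, `|f x| <= 1) ->
    `|f (lam * beta) - f (lam' * beta)| <= 2 * q.
  move=> fl f1.
  have h1 : `|f (lam * beta) - f (lam' * beta)| <= 2.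
    by apply: (le_trans (ler_normB _ _)); apply: lerD.
  have h2 : `|f (lam * beta) - f (lam' * beta)| <= D.
    by apply: (le_trans (fl _ _)); rewrite distrC.
  rewrite /q /Num.min; case: ifP => _; first by rewrite mulr1.
  by apply: (le_trans h2); have := D0; lra.
have hc := trig cos (@lipschitz_cos R) (@abs_cos_le1 R).
have hs := trig sin (@lipschitz_sin R) (@abs_sin_le1 R).
set c := cos (lam * beta) in hc *; set c' := cos (lam' * beta) in hc *.
set sn := sin (lam * beta) in hs *; set sn' := sin (lam' * beta) in hs *.
have cs1 : c' ^+ 2 + sn' ^+ 2 = 1 by exact: cos2Dsin2.
have sq (y z : R) : `|y| <= z -> y ^+ 2 <= z ^+ 2.
  by move=> yz; rewrite -real_normK ?num_real// lerXn2r ?nnegrE// (le_trans _ yz).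
have {}hc := sq _ _ hc; have {}hs := sq _ _ hs; have {}ZM := sq _ _ ZM; have {}ZZ := sq _ _ ZZ.
have two (y z : R) : (y + z) ^+ 2 <= 2 * y ^+ 2 + 2 * z ^+ 2.
  by rewrite -subr_ge0 (_ : _ - _ = (y - z) ^+ 2) ?sqr_ge0//; ring.
have -> : - (sn * Z) - - (sn' * Z') = - ((sn - sn') * Z + sn' * (Z - Z')) by ring.
have -> : c * Z - c' * Z' = (c - c') * Z + c' * (Z - Z') by ring.
rewrite sqrrN.
apply: (le_trans (lerD (two _ _) (two _ _))).
rewrite [leLHS](_ : _ = 2 * ((c - c') ^+ 2 + (sn - sn') ^+ 2) * Z ^+ 2 +
  2 * (c' ^+ 2 + sn' ^+ 2) * (Z - Z') ^+ 2); last by ring.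
rewrite cs1 mulr1.
have h : 2 * ((c - c') ^+ 2 + (sn - sn') ^+ 2) * Z ^+ 2 <= 2 * (2 * (2 * q) ^+ 2) * M ^+ 2.
  apply: ler_pM => //; rewrite ?sqr_ge0// ?mulr_ge0 ?addr_ge0 ?sqr_ge0//.
  by rewrite ler_wpM2l// mulr_natl mulr2n lerD.
apply: (le_trans (lerD h (ler_wpM2l _ ZZ))) => //.
by rewrite -subr_ge0 (_ : _ - _ = 0) ?lexx//; ring.
Qed.

End one_frame.
End sigma_hat_bounds.

(** * Interpolated power bounds *)

Section power_bookkeeping.
Context {R : realType}.
Implicit Types (c M l n p h : R).

(** The power [2/5] of the decay is kept because [(5/6) (2/5) = 1/3]. The resulting [p^(-1/3)] is
    then worsened to [p^(-5/3)], using [p <= 1], in order to have the same weight as for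
    increments. *)
Lemma min1_decay_le c M l n p : 0 < c -> 0 <= M -> 0 < l -> 0 < n -> 0 < p -> p <= 1 ->
  Num.min 1 ((c * (l * n) * p) `^ (- (5 / 6)) * M) ^+ 2 <=
  c `^ (- 3^-1) * M `^ (2 / 5) * (l * n) `^ (- 3^-1) * (p ^+ 2) `^ (- (5 / 6)).
Proof.
move=> c0 M0 l0 n0 p0 p1.
have cln0 : 0 < c * (l * n) by rewrite !mulr_gt0.
set X := _ * M; have X0 : 0 <= X by rewrite mulr_ge0 ?powR_ge0.
have m0 : 0 <= Num.min 1 X by rewrite le_min ler01.
apply: (@le_trans _ _ (X `^ (2 / 5))).
  apply: (@le_trans _ _ ((X `^ (5^-1)) ^+ 2)).
    by rewrite lerXn2r ?nnegrE ?powR_ge0// min1_le_powR//; lra.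
  by rewrite -powR_mulrn ?powR_ge0// -powRrM (_ : 5^-1 * 2%:R = 2 / 5 :> R)//; field.
rewrite /X powRM ?powR_ge0// -powRrM (_ : - (5 / 6) * (2 / 5) = - 3^-1 :> R); last by field.
rewrite powRM ?(ltW cln0) ?(ltW p0)// powRM ?(ltW c0) ?mulr_ge0 ?(ltW l0) ?(ltW n0)//.
rewrite -[p ^+ 2]powR_mulrn ?(ltW p0)// -powRrM (_ : 2%:R * - (5 / 6) = - (5 / 3) :> R); last by field.
have h : p `^ (- 3^-1) <= p `^ (- (5 / 3)) by apply: ger_powR; [rewrite p0 p1 | lra].
rewrite (_ : _ * M `^ (2 / 5) = c `^ (- 3^-1) * M `^ (2 / 5) * (l * n) `^ (- 3^-1) * p `^ (- 3^-1)); last by ring.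
by rewrite ler_wpM2l// !mulr_ge0 ?powR_ge0.
Qed.

(** The power [4/3] of the increment turns [(l n)^(-5/3)] into [(l n)^(-1/3)], the decay found for
    the function itself. *)
Lemma min1_diff_le c M l n p h K : 0 < c -> 0 <= M -> 0 < l -> 0 < n -> 0 < p -> 0 <= h -> 0 <= K ->
  Num.min 1 (K * n * (h * l)) ^+ 2 * ((c * (l * n) * p) `^ (- (5 / 6)) * M) ^+ 2 <=
  K `^ (4 / 3) * M ^+ 2 * c `^ (- (5 / 3)) * h `^ (4 / 3) * (l * n) `^ (- 3^-1) * (p ^+ 2) `^ (- (5 / 6)).
Proof.
move=> c0 M0 l0 n0 p0 h0 K0.
have ln0 : 0 < l * n by rewrite mulr_gt0.
have cln0 : 0 < c * (l * n) by rewrite !mulr_gt0.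
rewrite (_ : K * n * (h * l) = K * h * (l * n)); last by ring.
set Y := K * h * (l * n).
have Y0 : 0 <= Y by rewrite !mulr_ge0// ltW.
have m0 : 0 <= Num.min 1 Y by rewrite le_min ler01.
apply: (@le_trans _ _ (Y `^ (4 / 3) * ((c * (l * n) * p) `^ (- (5 / 6)) * M) ^+ 2)).
  rewrite ler_wpM2r ?sqr_ge0//.
  apply: (@le_trans _ _ ((Y `^ (2 / 3)) ^+ 2)).
    by rewrite lerXn2r ?nnegrE ?powR_ge0// min1_le_powR//; lra.
  by rewrite -powR_mulrn ?powR_ge0// -powRrM (_ : 2 / 3 * 2%:R = 4 / 3 :> R)//; field.
rewrite exprMn -[(_ `^ (- (5 / 6))) ^+ 2]powR_mulrn ?powR_ge0// -powRrM (_ : - (5 / 6) * 2%:R = - (5 / 3) :> R); last by field.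
rewrite -[p ^+ 2]powR_mulrn ?(ltW p0)// -powRrM (_ : 2%:R * - (5 / 6) = - (5 / 3) :> R); last by field.
rewrite /Y !powRM ?mulr_ge0 ?(ltW p0) ?(ltW c0) ?(ltW l0) ?(ltW n0)//.
have e (y : R) : 0 < y -> y `^ (4 / 3) * y `^ (- (5 / 3)) = y `^ (- 3^-1).
  move=> y0; rewrite -powRD ?(gt_eqF y0) ?implybT//; by congr (_ `^ _); field.
by rewrite -(e l)// -(e n)// -subr_ge0 (_ : _ - _ = 0) ?lexx//; ring.
Qed.

End power_bookkeeping.

(** * The weight [pw] and its averages over frames *)

Section sigma_hat_pw.
Context {R : realType} {d k : nat}.
Variable v : nat -> 'rV[R]_d.
Hypothesis vfree : row_free (\matrix_(i < k) v i.+1).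
Implicit Types (m : nat) (a : frames R d) (xi x u : 'rV[R]_d).

Definition perp2 m a u : R := dotv (perp m a u) (perp m a u).

Lemma perp2_ge0 m a u : 0 <= perp2 m a u. Proof. exact: dotv_ge0. Qed.

Definition radial_freq m : R := 2 * pi * Num.sqrt (rad2 v m).

(** The sum of the constants for size and for increments, the latter with the 24 of [sh_diff_le].
    The summand 1 makes it strictly positive, so that its product with [pw = +oo] is [+oo]. *)
Definition sigma_hat_cst m : R :=
  1 + radial_freq m `^ (- 3^-1) * decay_cst (d := d) `^ (2 / 5) +
  24 * (phase_lip v m `^ (4 / 3) * decay_cst (d := d) ^+ 2 * radial_freq m `^ (- (5 / 3))).

Let Mz0 : 0 <= (decay_cst (d := d) : R).
Proof. by rewrite fine_ge0// /decay_moment mule_ge0 ?lee_fin ?mulr_ge0 ?(le_trans ler01 (@c4_ge1 R))// adde_ge0// mule_ge0 ?c56_ge0 ?m2_ge0. Qed.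

Let C20 m : 0 <= phase_lip v m.
Proof. by rewrite !mulr_ge0 ?pi_ge0// addr_ge0 ?vnorm_ge0 ?sqrtr_ge0. Qed.

Let t1 m : 0 <= radial_freq m `^ (- 3^-1) * decay_cst (d := d) `^ (2 / 5).
Proof. by rewrite mulr_ge0 ?powR_ge0. Qed.

Let t2 m : 0 <= 24 * (phase_lip v m `^ (4 / 3) * decay_cst (d := d) ^+ 2 * radial_freq m `^ (- (5 / 3))).
Proof. by rewrite !mulr_ge0 ?powR_ge0 ?sqr_ge0. Qed.

Lemma sigma_hat_cst_gt0 m : 0 < sigma_hat_cst m.
Proof. by rewrite /sigma_hat_cst -addrA ltr_pwDl// addr_ge0. Qed.

Section fixed.
Variables (m : nat) (a : frames R d) (xi : 'rV[R]_d).
Hypotheses (mk : (m < k)%N) (md : (m + 3 <= d)%N) (am : adm v m a) (xi0 : xi != 0).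
Let n := vnorm xi.
Let u := n^-1 *: xi.

Let n0 : 0 < n.
Proof. by rewrite lt_neqAle vnorm_ge0 eq_sym vnorm_eq0 xi0. Qed.

Let cs0 : 0 < radial_freq m.
Proof. by rewrite !mulr_gt0 ?pi_gt0// sqrtr_gt0 (rad2_gt0 vfree). Qed.

Let uu : dotv u u = 1.
Proof. by rewrite dotvZl dotvZr -vnorm_sqr -/n; field; rewrite gt_eqF. Qed.

Let pu : vnorm (perp m a u) <= 1.
Proof.
rewrite /vnorm -sqrtr1 ler_sqrt// -uu; apply: dotv_perp_le.
exact (adm_unit vfree (ltnW mk) am).
Qed.

Let pxiE lam : 2 * pi * lam * Num.sqrt (rad2 v m) * vnorm (perp m a xi) =
  radial_freq m * (lam * n) * vnorm (perp m a u).
Proof.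
rewrite /u perpZ vnormZ gtr0_norm ?invr_gt0// /radial_freq; field.
by rewrite gt_eqF.
Qed.

Let pp0 : perp m a xi != 0 -> 0 < vnorm (perp m a u).
Proof.
move=> px; rewrite lt_neqAle vnorm_ge0 andbT eq_sym vnorm_eq0 /u perpZ scaler_eq0 negb_or px andbT.
by rewrite invr_eq0 gt_eqF.
Qed.

Let pwE : perp m a xi != 0 -> pw (perp2 m a u) = ((vnorm (perp m a u) ^+ 2) `^ (- (5 / 6)))%:E.
Proof. by move=> px; rewrite /pw /perp2 -vnorm_sqr gt_eqF// exprn_gt0// pp0. Qed.

Let pw0 : perp m a xi = 0 -> pw (perp2 m a u) = +oo%E.
Proof. by move=> px; rewrite /pw /perp2 /u perpZ px scaler0 dotv0l eqxx. Qed.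

Lemma sh_sqr_pw lam : 0 < lam ->
  ((shR v m a (lam *: xi) ^+ 2 + shI v m a (lam *: xi) ^+ 2)%:E <=
   (sigma_hat_cst m * (lam * n) `^ (- 3^-1))%:E * pw (perp2 m a u))%E.
Proof.
move=> l0; have [px|px] := eqVneq (perp m a xi) 0.
  by rewrite pw0// gt0_muley ?leey// lte_fin mulr_gt0 ?sigma_hat_cst_gt0 ?powR_gt0 ?mulr_gt0.
rewrite pwE// -EFinM lee_fin.
apply: (le_trans (sh_sqr_le vfree mk md am px l0)); rewrite pxiE.
apply: (le_trans (min1_decay_le cs0 Mz0 l0 n0 (pp0 px) pu)).
rewrite ler_wpM2r ?powR_ge0// ler_wpM2r ?powR_ge0// /sigma_hat_cst.
rewrite -addrA [1 + _]addrC -addrA lerDl addr_ge0//.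
Qed.

Lemma sh_diff_pw lam lam' h : 0 < lam -> lam <= lam' -> 0 < h -> lam' - lam <= h * lam ->
  (((shR v m a (lam *: xi) - shR v m a (lam' *: xi)) ^+ 2 +
    (shI v m a (lam *: xi) - shI v m a (lam' *: xi)) ^+ 2)%:E <=
   (sigma_hat_cst m * h `^ (4 / 3) * (lam * n) `^ (- 3^-1))%:E * pw (perp2 m a u))%E.
Proof.
move=> l0 ll' h0 hl; have [px|px] := eqVneq (perp m a xi) 0.
  by rewrite pw0// gt0_muley ?leey// lte_fin !mulr_gt0 ?sigma_hat_cst_gt0 ?powR_gt0 ?mulr_gt0.
rewrite pwE// -EFinM lee_fin.
apply: (le_trans (sh_diff_le vfree mk md am px l0 ll')); rewrite pxiE -mulrA.
have := min1_diff_le cs0 Mz0 l0 n0 (pp0 px) (ltW h0) (C20 m).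
set Y := _ ^+ 2 * _ => hY.
apply: (@le_trans _ _ (24 * Y)).
  rewrite ler_wpM2l// /Y ler_wpM2r ?sqr_ge0// lerXn2r ?nnegrE ?le_min ?ler01//=.
  - by apply: mulr_ge0; [rewrite mulr_ge0// vnorm_ge0|rewrite subr_ge0].
  - by apply: mulr_ge0; apply: mulr_ge0 => //; exact: ltW.
  - by rewrite !ge_min lexx/= ler_wpM2l ?orbT// mulr_ge0// ltW.
apply: (@le_trans _ _ (24 * (phase_lip v m `^ (4 / 3) * decay_cst (d:=d) ^+ 2 * radial_freq m `^ (- (5 / 3))) *
   (h `^ (4 / 3) * (lam * n) `^ (- 3^-1) * (vnorm (perp m a u) ^+ 2) `^ (- (5 / 6))))).
  by rewrite (le_trans (ler_wpM2l _ hY))// !mulrA lexx.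
rewrite -[leRHS]mulrA -[leRHS]mulrA (mulrA (h `^ _)) ler_wpM2r ?mulr_ge0 ?powR_ge0//.
by rewrite /sigma_hat_cst lerDr addr_ge0.
Qed.

End fixed.

Local Open Scope ereal_scope.

(** The expectation of [(1 + t^2) (1 + pw |a| pw |b|)] for independent normal [t], [a], [b],
    increased by 1. *)
Definition pw_step_cst : R := (1 + fine (m2 + m2 * (c56 * c56) : \bar R))%R.

Lemma pw_step_cst_ge1 : (1 <= pw_step_cst)%R.
Proof. by rewrite lerDl fine_ge0// adde_ge0 ?mule_ge0 ?m2_ge0 ?c56_ge0. Qed.

(** [Q / (t^2 + Q)] is at least [min(Q, 1) / (1 + t^2)], which separates the variables; then
    [(1 + t^2)^(5/6) <= 1 + t^2]. *)
Lemma pw_ratio_le (Q t : R) : (0 <= Q)%R ->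
  (Q != 0)%R -> pw (Q / (t ^+ 2 + Q))%R <= (1 + t ^+ 2)%:E * (1 + pw Q).
Proof.
move=> Q0 Qn; have Qp : (0 < Q)%R by rewrite lt_neqAle eq_sym Qn.
have t0 := sqr_ge0 t.
have tQ : (0 < t ^+ 2 + Q)%R by lra.
have u0 : (0 < 1 + t ^+ 2)%R by lra.
pose q := Num.min Q 1%R.
have q0 : (0 < q)%R by rewrite lt_min Qp ltr01.
have le1 : (q * (1 + t ^+ 2)^-1 <= Q / (t ^+ 2 + Q))%R.
  rewrite ler_pdivrMr// mulrAC ler_pdivlMr// /q; have [Q1|Q1] := leP Q 1%R.
    by rewrite ler_wpM2l//; lra.
  by rewrite mul1r; nra.
apply: (le_trans (pw_anti _ le1)); first by rewrite mulr_ge0 ?(ltW q0) ?invr_ge0 ?(ltW u0).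
rewrite pwM ?(ltW q0) ?invr_ge0 ?(ltW u0)// muleC; apply: lee_pmul; rewrite ?pw_ge0//.
  rewrite /pw invr_eq0 (gt_eqF u0) lee_fin -powR_inv1 ?(ltW u0)// -powRrM.
  rewrite -[leRHS]powRr1 ?(ltW u0)//; apply: ler_powR; lra.
rewrite /q; have [Q1|Q1] := leP Q 1%R; first by rewrite leeDr.
by rewrite pw1 leeDl ?pw_ge0.
Qed.

Section pw_step.
Variables (m : nat) (a : frames R d) (u : 'rV[R]_d).
Hypotheses (mk : (m < k)%N) (md : (m + 3 <= d)%N) (am : adm v m a).

(** [F] is controlled only where the next frame is admissible, that is for [perp m a x != 0]. The
    exceptional points have [Q = 0], hence [dotv x e2 = 0], and there the majorant [b] is infinite;
    so the bound holds at every point. *)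
Lemma integral_pw_next (F : 'rV[R]_d -> \bar R) (C0 : R) : (0 < C0)%R ->
  (forall x, 0 <= F x) ->
  (forall x, perp m a x != 0%R ->
    F x <= C0%:E * pw (perp2 m.+1 (updf a m (fpoint v m a x)) u)) ->
  \int[gam d]_x F x <= (C0 * pw_step_cst)%:E * pw (perp2 m a u).
Proof.
move=> C00 F0 FC; have gu := adm_unit vfree (ltnW mk) am.
have C30 : (0 < pw_step_cst)%R by exact: lt_le_trans ltr01 pw_step_cst_ge1.
have [pu|pu] := eqVneq (perp m a u) 0%R.
  by rewrite /perp2 pu dotv0l {1}/pw eqxx gt0_muley ?leey// lte_fin mulr_gt0.
set p := vnorm (perp m a u); pose e := (p^-1 *: perp m a u)%R.
have p0 : (0 < p)%R by rewrite lt_neqAle vnorm_ge0 eq_sym vnorm_eq0 pu.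
have e1 : (dotv e e = 1)%R by rewrite dotvZl dotvZr -vnorm_sqr -/p; field; rewrite gt_eqF.
have ea : perp m a e = e by rewrite /e perpZ perp_perp.
have [e2 [e3 [e22 e33 e12 e13 [e23 pe2 pe3]]]] := exists_orthonormal3 vfree mk md am e.
set P := pw (perp2 m a u).
have Pf : P = (fine P)%:E.
  by rewrite /P /pw /perp2 -vnorm_sqr gt_eqF// exprn_gt0.
have P0 : (0 <= fine P)%R by rewrite fine_ge0// pw_ge0.
have Pp : (0 < fine P)%R.
  by rewrite -lte_fin -Pf pw_gt0// perp2_ge0.
(* This is [(1 + t^2) (1 + pw |x.e2| pw |x.e3|)] with [t = dotv x e], expanded so that the two
   expectations are [m2] and [m2 * c56^2]. *)
pose b x : \bar R := (1 + dotv x e ^+ 2)%:E + (1 + dotv x e ^+ 2)%:E * (pw `|dotv x e2|%R * pw `|dotv x e3|%R).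
have d0 x : (0 < 1 + dotv x e ^+ 2)%R by rewrite ltr_pwDl// sqr_ge0.
have key x : F x <= (C0 * fine P)%:E * b x.
  have Qge := Qf_ge e1 ea x e22 e33 e12 e13 e23 pe2 pe3.
  have [Q0|Qn] := eqVneq (Qf m a (x - dotv x e *: e)) 0%R.
    suff -> : b x = +oo by rewrite gt0_muley ?leey// lte_fin mulr_gt0.
    have x2 : (dotv x e2 = 0)%R.
      apply/eqP; rewrite -sqrf_eq0; apply/eqP/le_anti; rewrite sqr_ge0 andbT.
      by move: Qge; rewrite Q0; apply: le_trans; rewrite lerDl sqr_ge0.
    rewrite /b x2 normr0 {1}/pw eqxx gt0_mulye; last by rewrite pw_gt0.
    by rewrite gt0_muley ?lte_fin.
  have Q0 := Qf_ge0 m a (x - dotv x e *: e)%R.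
  have QE := Qf_split e1 ea x.
  have px : perp m a x != 0%R.
    apply: contra_neq Qn => px; apply/le_anti; rewrite Q0 andbT QE px dotv0l sub0r.
    by rewrite oppr_le0 sqr_ge0.
  apply: (le_trans (FC _ px)).
  rewrite EFinM -muleA lee_pmul2l ?fin_numE ?lte_fin//.
  have -> : perp2 m.+1 (updf a m (fpoint v m a x)) u =
     (perp2 m a u * (Qf m a (x - dotv x e *: e) / (dotv x e ^+ 2 + Qf m a (x - dotv x e *: e))))%R.
    rewrite /perp2 (perp_next_norm vfree mk am px) QE [(dotv x e ^+ 2 + _)%R]addrC subrK.
    rewrite dotvZr -(dotv_perp m a u x).
    have -> : (dotv (perp m a u) x = p * dotv x e)%R.
      by rewrite (dotvZr _ x) (dotvC x) mulrA mulfV ?mul1r// gt_eqF.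
    rewrite -!vnorm_sqr -/p; field.
    by rewrite vnorm_eq0.
  rewrite pwM ?perp2_ge0 ?divr_ge0 ?addr_ge0 ?sqr_ge0// -/P {1}Pf.
  rewrite lee_pmul2l ?lte_fin//.
  apply: (le_trans (pw_ratio_le _ Q0 Qn)).
  rewrite ge0_muleDr ?pw_ge0// mule1 /b leeD2lE//.
  by rewrite lee_pmul2l ?lte_fin// pw_sum_sqr_le.
have mb1 : measurable_fun setT (fun x : 'rV[R]_d => (1 + dotv x e ^+ 2)%:E).
  by apply/measurable_EFinP; apply: measurable_funD => //; apply: measurable_funX; exact: measurable_dotv.
have mb2 : measurable_fun setT (fun x : 'rV[R]_d => (1 + dotv x e ^+ 2)%:E * (pw `|dotv x e2|%R * pw `|dotv x e3|%R)).
  by apply: emeasurable_funM => //; apply: emeasurable_funM; exact: measurable_pw_dotv.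
have b1 (x : 'rV[R]_d) : 0 <= (1 + dotv x e ^+ 2)%:E by rewrite lee_fin ltW.
have b2 (x : 'rV[R]_d) : 0 <= (1 + dotv x e ^+ 2)%:E * (pw `|dotv x e2|%R * pw `|dotv x e3|%R).
  by rewrite !mule_ge0 ?pw_ge0.
apply: (le_trans (le_integralT (gam d) F0 key)).
rewrite ge0_integralZl//; last 3 first.
- exact: emeasurable_funD.
- by move=> x _; rewrite adde_ge0.
- by rewrite lee_fin mulr_ge0// ltW.
rewrite ge0_integralD// gauss_pw3//.
rewrite (@gauss_coord _ _ e (fun t => (1 + t ^+ 2)%:E))//; last first.
- by move=> t; rewrite lee_fin addr_ge0 ?sqr_ge0.
- by apply/measurable_EFinP; apply: measurable_funD => //; exact: measurable_funX.
rewrite -/m2 Pf mulrC (mulrC C0) !EFinM -!muleA; rewrite muleC -!muleA; rewrite [X in _ <= X]muleCA.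
rewrite lee_pmul2l ?lte_fin//.
rewrite /= lee_pmul2r ?lte_fin//.
have f1 : (c56 : \bar R) \is a fin_num by rewrite ge0_fin_numE ?c56_lty ?c56_ge0.
have f2 : (m2 : \bar R) \is a fin_num by rewrite ge0_fin_numE ?m2_lty ?m2_ge0.
rewrite /pw_step_cst EFinD fineK ?leeDr// fin_numD f2/= !fin_numM//.
Qed.

End pw_step.

(** Each averaging removes the last vector of the frame at the price of a factor [pw_step_cst],
    until the weight sits on the initial frame. The bound on [G] is asked for admissible frames
    only, and admissibility is propagated by [adm_next]. *)
Lemma frame_avg_pw n m a u (G : frames R d -> \bar R) (C0 : R) :
  (m + n <= k)%N -> (m + n + 2 <= d)%N -> adm v m a -> (0 < C0)%R ->
  (forall b, 0 <= G b) ->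
  (forall b, adm v (m + n) b -> G b <= C0%:E * pw (perp2 (m + n) b u)) ->
  frame_avg v n m a G <= (C0 * pw_step_cst ^+ n)%:E * pw (perp2 m a u).
Proof.
elim: n m a => [|n IH] m a mk md am C00 G0 GC /=.
  by rewrite mulr1; move: GC; rewrite addn0; exact.
have mk' : (m < k)%N by rewrite (leq_trans _ mk)// addnS ltnS leq_addr.
have md' : (m + 3 <= d)%N by rewrite (leq_trans _ md)// -addnA leq_add2l addSn !ltnS leq_addl.
have C30 : (0 < pw_step_cst)%R by exact: lt_le_trans ltr01 pw_step_cst_ge1.
rewrite exprSr mulrA.
apply: (@integral_pw_next m a u mk' md' am (fun x => frame_avg v n m.+1 (updf a m (fpoint v m a x)) G)); first by rewrite mulr_gt0// exprn_gt0.
  by move=> x; exact: frame_avg_ge0.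
move=> x px; apply: IH => //; rewrite ?addSnnS//.
exact: (adm_next vfree mk' am px).
Qed.

End sigma_hat_pw.

(** * The inequality between a function and its Fourier transform *)

Section laplace_weight.
Context {R : realType}.
Local Notation mR := (measurableTypeR R).
Local Notation mu := (@lebesgue_measure R).
Variable eps : R.
Hypothesis eps0 : 0 < eps.

(** The product of [lapw] with a cosine has an elementary primitive, its transform is the positive
    kernel [cauchy], and the weights increase to 1 as [eps] decreases to 0. *)
Definition lapw (t : R) : R := expR (- (eps * `|t|)).

Lemma lapw_ge0 t : 0 <= lapw t. Proof. exact: expR_ge0. Qed.

(** With [y = eps |t|], [exp y = (exp (y/2))^2 >= 1 + y^2/4]. *)
Lemma lapw_le t : lapw t <= (1 + 4 / eps ^+ 2) / (1 + t ^+ 2).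
Proof.
have e2 : 0 < eps ^+ 2 by rewrite exprn_gt0.
have t0 := sqr_ge0 t; have y0 : 0 <= eps * `|t| by rewrite mulr_ge0// ltW.
have C0 : 0 < 1 + 4 / eps ^+ 2 by rewrite ltr_wpDr// divr_ge0// ltW.
have D0 : 0 < 1 + t ^+ 2 by rewrite ltr_wpDr.
rewrite /lapw expRN -[leRHS]invrK invf_div lef_pV2 ?posrE ?expR_gt0 ?divr_gt0//.
rewrite ler_pdivrMr//.
have : 1 + (eps * `|t|) ^+ 2 / 4 <= expR (eps * `|t|).
  have -> : eps * `|t| = 2%:R * (eps * `|t| / 2) by field.
  rewrite expRM_natl.
  have h : 1 + eps * `|t| / 2 <= expR (eps * `|t| / 2) by exact: expR_ge1Dx.
  have h0 : 0 <= eps * `|t| / 2 by rewrite divr_ge0.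
  apply: (@le_trans _ _ ((1 + eps * `|t| / 2) ^+ 2)).
    move: h0; set z := _ / 2; move=> z0; rewrite (_ : (2%:R * z) ^+ 2 / 4 = z ^+ 2); last by field.
    by rewrite sqrrD expr1n mul1r; lra.
  by rewrite lerXn2r ?nnegrE ?expR_ge0// addr_ge0.
move=> h; rewrite (le_trans _ (ler_wpM2r (ltW C0) h))//.
rewrite exprMn real_normK ?num_real//.
rewrite (_ : (1 + eps ^+ 2 * t ^+ 2 / 4) * (1 + 4 / eps ^+ 2) =
   (1 + t ^+ 2) + 4 / eps ^+ 2 + eps ^+ 2 * t ^+ 2 / 4); last by field; rewrite gt_eqF.
rewrite -addrA lerDl addr_ge0// divr_ge0// ?(ltW e2)//.
by rewrite mulr_ge0// ltW.
Qed.

Lemma continuous_lapw : continuous lapw.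
Proof.
move=> t; rewrite /lapw; apply: continuous_comp; last exact: continuous_expR.
apply: continuousN; apply: continuousM; first exact: cvg_cst.
exact: norm_continuous.
Qed.

Lemma measurable_lapw : measurable_fun setT lapw.
Proof. by apply: continuous_measurable_fun; exact: continuous_lapw. Qed.

Lemma integrable_lapwM (f : R -> R) : measurable_fun setT f -> (forall t, `|f t| <= 2) ->
  mu.-integrable setT (EFin \o (fun t => lapw t * f t)).
Proof.
move=> mf f2; apply: (@quad_dominated_integrable _ _ ((1 + 4 / eps ^+ 2) * 2)).
  by apply: measurable_funM => //; exact: measurable_lapw.
move=> t; rewrite normrM ger0_norm ?lapw_ge0// mulrAC ler_pM ?lapw_ge0//.
exact: lapw_le.
Qed.

Let D (eta : R) := eps ^+ 2 + eta ^+ 2.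
Let D0 eta : 0 < D eta.
Proof. by rewrite ltr_pwDl ?sqr_ge0// exprn_gt0. Qed.

(** The shift by 1 makes the integrand nonnegative, so that evenness reduces the integral to
    [t >= 0], where [H] is an explicit primitive; the integral with the cosine alone is recovered by
    difference. *)
Let h eta (t : R) : R := expR (- (eps * t)) * (1 + cos (eta * t)).
Let H eta (t : R) : R := expR (- (eps * t)) *
  (- eps^-1 + (eta * sin (eta * t) - eps * cos (eta * t)) / D eta).

Let dH eta (t : R) : is_derive t (1 : R) (H eta) (h eta t).
Proof.
have dl (c : R) : is_derive t (1 : R) (fun t => c * t) c.
  by apply: is_derive_eq; rewrite /GRing.scale /= mulr1.
have dN : is_derive t (1 : R) (fun t => - (eps * t)) (- eps).
  exact: (is_deriveN (dl eps)).
have dE := @is_derive1_comp R expR (fun t => - (eps * t)) t _ _ (is_derive_expR _) dN.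
have dS := @is_derive1_comp R (@sin R) (fun t => eta * t) t _ _ (is_derive_sin _) (dl eta).
have dC := @is_derive1_comp R (@cos R) (fun t => eta * t) t _ _ (is_derive_cos _) (dl eta).
have dSC := is_deriveB (is_deriveZ eta dS) (is_deriveZ eps dC).
have dI := is_deriveD (is_derive_cst (- eps^-1) t (1 : R)) (is_deriveZ (D eta)^-1 dSC).
have dd := is_deriveM dE dI.
have -> : H eta = (fun t0 : R => expR (- (eps * t0))) * (cst (- eps^-1) +
   ((D eta)^-1 *: ((eta *: fun t0 : R => sin (eta * t0)) - (eps *: fun t0 : R => cos (eta * t0))))).
  apply/funext => x; rewrite /H /= !fctE /= /GRing.scale /=; congr (_ * (_ + _)).
  exact: mulrC.
apply: (is_derive_eq dd); rewrite /h /= !fctE /D.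
change (expR (- (eps * t)) * (0 + (eps ^+ 2 + eta ^+ 2)^-1 *
   (eta * (cos (eta * t) * eta) - eps * (- sin (eta * t) * eta))) +
  (- eps^-1 + (eps ^+ 2 + eta ^+ 2)^-1 * (eta * sin (eta * t) - eps * cos (eta * t))) *
  (expR (- (eps * t)) * - eps) = expR (- (eps * t)) * (1 + cos (eta * t))).
have D0' := D0 eta; rewrite /D in D0'.
by field; rewrite !gt_eqF.
Qed.

Let ch eta : continuous (h eta).
Proof.
have cl (c : R) : continuous ( *%R c) by move=> x; exact: mulrl_continuous.
move=> x; rewrite /h; apply: (@continuousM R R (fun t => expR (- (eps * t))) (fun t => 1 + cos (eta * t))).
  apply: continuous_comp; last exact: continuous_expR.
  by apply: continuousN; exact: cl.
apply: continuousD; first exact: cvg_cst.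
by apply: continuous_comp; [exact: cl|exact: continuous_cos].
Qed.

Let lapw_h eta t : 0 <= t -> lapw t * (1 + cos (eta * t)) = h eta t.
Proof. by move=> t0; rewrite /lapw /h ger0_norm. Qed.

Let mcos (eta : R) : measurable_fun setT (fun t : R => cos (eta * t)).
Proof. by apply: measurable_cos_comp; exact: measurable_funM. Qed.

Let i1 eta : mu.-integrable setT (EFin \o (fun t => lapw t * (1 + cos (eta * t)))).
Proof.
apply: integrable_lapwM.
  by apply: measurable_funD => //; exact: mcos.
move=> t; rewrite (le_trans (ler_normD _ _))// normr1 lerD2l//.
exact: abs_cos_le1.
Qed.

Let Hcvg eta : H eta n%:R @[n --> \oo] --> (0 : R).
Proof.
pose C := (eps^-1 + (`|eta| + eps) / D eta).
have HC t : `|(H eta \o Num.norm) t| <= ((1 + 4 / eps ^+ 2) * C) / (1 + t ^+ 2).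
  rewrite /H /= normrM ger0_norm ?expR_ge0// mulrAC ler_pM ?expR_ge0//; first exact: lapw_le.
  rewrite (le_trans (ler_normD _ _))// normrN ger0_norm ?invr_ge0 ?(ltW eps0)// lerD2l.
  rewrite normrM normfV (gtr0_norm (D0 eta)) ler_pM2r ?invr_gt0 ?D0//.
  rewrite (le_trans (ler_normB _ _))// !normrM (gtr0_norm eps0) lerD//.
    by rewrite ler_piMr// abs_sin_le1.
  by rewrite ler_piMr ?(ltW eps0)// abs_cos_le1.
have [H1 _] := quad_decay_cvg0 HC.
by move: H1; under eq_fun do rewrite /= ger0_norm//.
Qed.

Let integral_lapw1 eta :
  (\int[mu]_t (lapw t * (1 + cos (eta * t)))%:E = (2 / eps + 2 * eps / D eta)%:E)%E.
Proof.
rewrite ge0_symfun_integralT.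
- rewrite -set_itvcy (_ : (\int[mu]_(x in `[0%R, +oo[) _ = (- H eta 0)%:E)%E).
    rewrite /H !mulr0 oppr0 expR0 sin0 cos0 -EFinM; congr EFin.
    by rewrite mulr0 sub0r mulr1 mul1r; field; rewrite !gt_eqF.
  rewrite -(integral_derive0y (dH eta) (ch (eta := eta)))//.
  + by apply: eq_integral => t; rewrite inE /= in_itv /= andbT => t0; rewrite lapw_h.
  + have i0y : mu.-integrable `[0%R, +oo[ (EFin \o (fun t => lapw t * (1 + cos (eta * t)))).
      by apply: (integrableS measurableT _ _ (i1 eta)) => //; exact: measurable_itv.
    move: i0y; apply: eq_integrable => // t; rewrite inE /= in_itv /= andbT => t0.
    by rewrite /= lapw_h.
- by move=> t; rewrite mulr_ge0 ?lapw_ge0//; have := cos_geN1 (eta * t); lra.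
- move=> x; apply: continuousM; first exact: continuous_lapw.
  apply: continuousD; first exact: cvg_cst.
  apply: continuous_comp; last exact: continuous_cos.
  apply: continuousM; first exact: cvg_cst.
  exact: cvg_id.
- by move=> t /=; rewrite /lapw normrN mulrN cosN.
Qed.

Lemma integral_lapw : (\int[mu]_t (lapw t)%:E = (2 / eps)%:E)%E.
Proof.
have := integral_lapw1 0.
under eq_integral do rewrite mul0r cos0 mulrC EFinM.
rewrite ge0_integralZl//; last 2 first.
- by apply/measurable_EFinP; exact: measurable_lapw.
- by move=> t _; rewrite lee_fin lapw_ge0.
rewrite /D expr0n /= addr0 => /(congr1 (fun x => ((2^-1)%:E * x)%E)).
rewrite muleA -EFinM (_ : 2^-1 * (1 + 1) = 1 :> R); last by field.
by rewrite mul1e => ->; rewrite -EFinM; congr EFin; field; rewrite gt_eqF.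
Qed.

Lemma integrable_lapw : mu.-integrable setT (EFin \o lapw).
Proof.
have := @integrable_lapwM (cst 1) (measurable_cst _).
rewrite (_ : (fun t => lapw t * cst 1 t) = lapw); last by apply/funext => t; rewrite mulr1.
by apply => t; rewrite normr1 ler1n.
Qed.

Lemma integral_lapw_cos eta :
  (\int[mu]_t (lapw t * cos (eta * t))%:E = (2 * eps / (eps ^+ 2 + eta ^+ 2))%:E)%E.
Proof.
transitivity (\int[mu]_t ((lapw t * (1 + cos (eta * t)))%:E - (lapw t)%:E))%E.
  by apply: eq_integral => t _; rewrite -EFinB; congr EFin; ring.
rewrite integralB//; last 2 first.
- exact: i1.
- exact: integrable_lapw.
by rewrite integral_lapw1 integral_lapw -EFinB addrC addKr.
Qed.

Lemma integral_lapw_sin eta : (\int[mu]_t (lapw t * sin (eta * t))%:E = 0)%E.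
Proof.
have ms (c : R) : measurable_fun setT (fun t : R => 1 + c * sin (eta * t)).
  apply: measurable_funD => //; apply: measurable_funM => //.
  by apply: measurable_sin_comp; exact: measurable_funM.
have mls (c : R) : measurable_fun setT (fun t : mR => lapw t * (1 + c * sin (eta * t))).
  by apply: measurable_funM; [exact: measurable_lapw|exact: ms].
have is1 (c : R) : `|c| = 1 -> mu.-integrable setT (EFin \o (fun t => lapw t * (1 + c * sin (eta * t)))).
  move=> c1; apply: integrable_lapwM; first exact: ms.
  move=> t; rewrite (le_trans (ler_normD _ _))// normr1 lerD2l// normrM c1 mul1r.
  exact: abs_sin_le1.
have e (c : R) : `|c| = 1 -> (\int[mu]_t (lapw t * (1 + c * sin (eta * t)))%:E =
    (2 / eps)%:E + c%:E * \int[mu]_t (lapw t * sin (eta * t))%:E)%E.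
  move=> c1; have iS : mu.-integrable setT (EFin \o (fun t => lapw t * sin (eta * t))).
    apply: integrable_lapwM; first by apply: measurable_sin_comp; exact: measurable_funM.
    by move=> t; rewrite (le_trans (abs_sin_le1 _))// ler1n.
  rewrite -integral_lapw -integralZl// -integralD//.
  - by apply: eq_integral => t _; rewrite -EFinM -EFinD; congr EFin; ring.
  - exact: integrable_lapw.
  - exact: (integrableZl measurableT c iS).
have sym : (\int[mu]_t (lapw t * (1 + 1 * sin (eta * t)))%:E = \int[mu]_t (lapw t * (1 + -1 * sin (eta * t)))%:E)%E.
  rewrite -[LHS]ge0_integral_oppr.
  - by apply: eq_integral => t _; rewrite /lapw normrN mulrN sinN mul1r mulN1r.
  - by apply/measurable_EFinP; exact: mls.
  - by move=> t; rewrite lee_fin mulr_ge0 ?lapw_ge0//; have := sin_geN1 (eta * t); lra.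
move: sym; rewrite !e ?normr1 ?normrN1//.
have : (\int[mu]_t (lapw t * sin (eta * t))%:E \is a fin_num)%E.
  apply: integrable_fin_num => //.
  apply: integrable_lapwM; first by apply: measurable_sin_comp; exact: measurable_funM.
  by move=> t; rewrite (le_trans (abs_sin_le1 _))// ler1n.
case: (integral _ _ _) => // r _; rewrite -!EFinM -!EFinD => -[] rr.
by congr EFin; lra.
Qed.

End laplace_weight.

Section dominated_fubini.
Context {R : realType} {d1 d2 : measure_display} {T1 : measurableType d1} {T2 : measurableType d2}.
Variables (m1 : {sigma_finite_measure set T1 -> \bar R}) (m2 : {sigma_finite_measure set T2 -> \bar R}).
Variables (f : T1 * T2 -> R) (a : T1 -> R) (b : T2 -> R).
Hypotheses (mf : measurable_fun setT f) (ia : m1.-integrable setT (EFin \o a))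
  (ib : m2.-integrable setT (EFin \o b)) (a0 : forall x, 0 <= a x) (b0 : forall y, 0 <= b y).
Hypothesis fab : forall x y, `|f (x, y)| <= a x * b y.
Local Open Scope ereal_scope.

Lemma dominated_integrable_prod : (m1 \x m2).-integrable setT (EFin \o f).
Proof.
apply/integrable12ltyP; first exact/measurable_EFinP.
have ma := measurable_int _ ia; have mb := measurable_int _ ib.
apply: (@le_lt_trans _ _ (\int[m1]_x ((a x)%:E * \int[m2]_y (b y)%:E))).
  apply: le_integralT => x; first by apply: integral_ge0.
  rewrite -ge0_integralZl//; last 2 first.
  - by move=> y _; rewrite lee_fin.
  - by rewrite lee_fin.
  by apply: le_integralT => y //=; rewrite -EFinM lee_fin.
have bf : \int[m2]_y (b y)%:E \is a fin_num by apply: integrable_fin_num.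
have af : \int[m1]_x (a x)%:E \is a fin_num by apply: integrable_fin_num.
rewrite -(fineK bf) ge0_integralZr//; last 2 first.
- by move=> x _; rewrite lee_fin.
- by rewrite fineK// integral_ge0// => y _; rewrite lee_fin.
by rewrite -(fineK af) -EFinM ltry.
Qed.

Lemma dominated_fubini : \int[m1]_x \int[m2]_y (f (x, y))%:E = \int[m2]_y \int[m1]_x (f (x, y))%:E.
Proof.
have h := dominated_integrable_prod.
transitivity (\int[m1 \x m2]_z (EFin \o f) z); first exact: (integral12_prod_meas1 h).
by rewrite -(integral21_prod_meas1 h).
Qed.

Lemma dominated_measurable : measurable_fun setT (fun y => \int[m1]_x (f (x, y))%:E).
Proof. exact: (measurable_fubini_G dominated_integrable_prod). Qed.

End dominated_fubini.

Section integral_with_parameter.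
Context {R : realType} {dT dX : measure_display} {T : measurableType dT} {X : measurableType dX}.
Variables (mu : {sigma_finite_measure set X -> \bar R}) (F : T * X -> R) (h : X -> R).
Hypotheses (mF : measurable_fun setT F) (ih : mu.-integrable setT (EFin \o h)).
Hypothesis Fh : forall t x, `|F (t, x)| <= h x.

(* Adding the majorant makes the integrand nonnegative, so that Tonelli applies. *)
Lemma measurable_param_integral : measurable_fun setT (fun t => \int[mu]_x F (t, x)).
Proof.
have mh : measurable_fun setT h by apply/measurable_EFinP; exact: measurable_int ih.
have iF t : mu.-integrable setT (EFin \o (fun x => F (t, x))).
  apply: (le_integrable measurableT _ _ ih).
    by apply/measurable_EFinP; exact: (measurableT_comp mF (measurable_pair1 t)).
  by move=> x _ /=; rewrite lee_fin (le_trans (Fh t x))// ler_norm.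
have -> : (fun t => \int[mu]_x F (t, x)) =
    (fun t => fine (\int[mu]_x (F (t, x) + h x)%:E)%E - \int[mu]_x h x).
  apply/funext => t; have := RintegralD measurableT (iF t) ih.
  by rewrite /Rintegral => ->; rewrite addrK.
apply: measurable_funB => //.
apply: (measurableT_comp (fine_measurable measurableT)).
apply: (@measurable_fun_fubini_tonelli_F _ _ _ _ _ mu (fun p : T * X => (F p + h p.2)%:E)).
  by apply/measurable_EFinP; apply: measurable_funD => //; exact: measurableT_comp.
by move=> [t x]; rewrite lee_fin; have := Fh t x; rewrite ler_norml => /andP[]/=; lra.
Qed.

End integral_with_parameter.

Section snoc_coordinates.
Context {R : realType}.

Lemma row_snoc_max n (t : R) (x : 'rV[R]_n) : row_snoc (t, x) 0 ord_max = t.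
Proof. by rewrite mxE unlift_none. Qed.

Lemma row_snoc_widen n (t : R) (x : 'rV[R]_n) (i : 'I_n) :
  row_snoc (t, x) 0 (widen_ord (leqnSn n) i) = x 0 i.
Proof.
rewrite mxE (_ : widen_ord _ i = lift ord_max i) ?liftK//.
by apply: val_inj; rewrite /= /bump leqNgt ltn_ord.
Qed.

Lemma dotv_snoc n (t s : R) (x y : 'rV[R]_n) :
  dotv (row_snoc (t, x)) (row_snoc (s, y)) = dotv x y + t * s.
Proof.
rewrite /dotv big_ord_recr /= !row_snoc_max; congr (_ + _).
by apply: eq_bigr => i _; rewrite !row_snoc_widen.
Qed.

End snoc_coordinates.

(** * The kernel dual to the exponential weight *)

Section cauchy_kernel.
Context {R : realType}.
Local Notation mR := (measurableTypeR R).
Local Notation mu := (@lebesgue_measure R).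
Variable eps : R.
Hypothesis eps0 : 0 < eps.

(** The Poisson kernel of the line: the value of [integral_lapw_cos] at frequency [2 pi s]. *)
Definition cauchy (s : R) : R := 2 * eps / (eps ^+ 2 + (2 * pi * s) ^+ 2).

Let D0 (s : R) : 0 < eps ^+ 2 + (2 * pi * s) ^+ 2.
Proof. by rewrite ltr_pwDl ?sqr_ge0// exprn_gt0. Qed.

Lemma cauchy_ge0 s : 0 <= cauchy s.
Proof. by rewrite divr_ge0 ?mulr_ge0 ?(ltW eps0) ?(ltW (D0 s)). Qed.

(** A primitive of [cauchy], normalised by [-1/2] to vanish at [+oo]. *)
Let H (t : R) : R := pi^-1 * atan (2 * pi / eps * t) - 2^-1.

Let dH (t : R) : is_derive t (1 : R) H (cauchy t).
Proof.
have dl (c : R) : is_derive t (1 : R) (fun t => c * t) c.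
  by apply: is_derive_eq; rewrite /GRing.scale /= mulr1.
have dA := @is_derive1_comp R (@atan R) (fun t => 2 * pi / eps * t) t _ _ (is_derive1_atan _) (dl _).
have dd := is_deriveB (is_deriveZ pi^-1 dA) (is_derive_cst (2^-1 : R) t (1 : R)).
apply: (is_derive_eq dd); rewrite /GRing.scale /= subr0 /cauchy.
have p0 := @pi_gt0 R; have D0' := D0 t.
have -> : 1 + (2 * pi / eps * t) ^+ 2 = (eps ^+ 2 + (2 * pi * t) ^+ 2) / eps ^+ 2.
  by field; rewrite gt_eqF.
move: D0'; move: (_ + _ ^+ 2) => D' D0'.
move: p0; move: (@pi R) => p p0.
by field; rewrite (gt_eqF p0) (gt_eqF eps0) (gt_eqF D0').
Qed.

Lemma continuous_cauchy : continuous cauchy.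
Proof.
move=> t; rewrite /cauchy; apply: (@continuousM R R (cst (2 * eps)) (fun s => (eps ^+ 2 + (2 * pi * s) ^+ 2)^-1)).
  exact: cvg_cst.
apply: continuousV; first by rewrite gt_eqF.
apply: (@continuousD R R R (cst (eps ^+ 2)) (fun s => (2 * pi * s) ^+ 2)); first exact: cvg_cst.
apply: (@continuous_comp R R R (fun s => 2 * pi * s) (fun y => y ^+ 2)); last exact: exprn_continuous.
exact: mulrl_continuous.
Qed.

Lemma measurable_cauchy : measurable_fun setT cauchy.
Proof. by apply: continuous_measurable_fun; exact: continuous_cauchy. Qed.

Lemma integrable_cauchy : mu.-integrable setT (EFin \o cauchy).
Proof.
apply: (@quad_dominated_integrable _ _ (2 * eps * (1 + eps ^- 2))); first exact: measurable_cauchy.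
move=> t; rewrite ger0_norm ?cauchy_ge0// /cauchy -[leRHS]mulrA ler_wpM2l ?mulr_ge0 ?(ltW eps0)//.
have e2 : 0 < eps ^+ 2 by rewrite exprn_gt0.
have t0 := sqr_ge0 t.
have t1 : 0 < 1 + t ^+ 2 by rewrite ltr_pwDl.
rewrite -div1r ler_pdivrMr// mulrAC ler_pdivlMr// mul1r.
have p1 : 1 <= (2 * pi : R) ^+ 2.
  by rewrite expr_ge1// ?mulr_ge0 ?pi_ge0//; have := @pi_ge2 R; lra.
apply: (@le_trans _ _ ((1 + eps ^- 2) * (eps ^+ 2 + t ^+ 2))); last first.
  rewrite ler_wpM2l ?addr_ge0 ?invr_ge0 ?(ltW e2)// lerD2l exprMn.
  by rewrite ler_peMl.
rewrite (_ : _ * _ = 1 + t ^+ 2 + (eps ^+ 2 + t ^+ 2 / eps ^+ 2)); last by field; rewrite gt_eqF.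
by rewrite lerDl addr_ge0 ?divr_ge0 ?(ltW e2).
Qed.

Lemma integral_cauchy : (\int[mu]_t (cauchy t)%:E = 1)%E.
Proof.
rewrite ge0_symfun_integralT.
- rewrite -set_itvcy (_ : (\int[mu]_(x in `[0%R, +oo[) _ = (- H 0)%:E)%E).
    by rewrite /H mulr0 atan0 mulr0 sub0r opprK -EFinM mulfV.
  apply: (integral_derive0y dH continuous_cauchy).
    by apply: (integrableS measurableT _ _ integrable_cauchy) => //; exact: measurable_itv.
  rewrite /H -(subrr (2^-1)); apply: cvgB; last exact: cvg_cst.
  rewrite [X in _ --> X](_ : _ = pi^-1 * (pi / 2)); last first.
    by rewrite mulrA mulVf ?mul1r// gt_eqF ?pi_gt0.
  apply: cvgM; first exact: cvg_cst.
  apply: (cvg_comp _ _ _ (@cvgy_atan R)).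
  have c0 : 0 < 2 * pi / eps by rewrite divr_gt0// mulr_gt0// pi_gt0.
  have cy : (2 * pi / eps * x @[x --> +oo%R] --> +oo%R) by exact: (gt0_cvgMry c0).
  exact: (cvg_comp _ _ (@cvgr_idn R) cy).
- exact: cauchy_ge0.
- exact: continuous_cauchy.
- by move=> t /=; rewrite /cauchy mulrN sqrrN.
Qed.

Definition lapwv n (x : 'rV[R]_n) : R := \prod_(i < n) lapw eps (x 0 i).
Definition cauchyv n (x : 'rV[R]_n) : R := \prod_(i < n) cauchy (x 0 i).

Lemma lapwv_ge0 n (x : 'rV[R]_n) : 0 <= lapwv x.
Proof. by rewrite prodr_ge0// => i _; exact: lapw_ge0. Qed.

Lemma cauchyv_ge0 n (x : 'rV[R]_n) : 0 <= cauchyv x.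
Proof. by rewrite prodr_ge0// => i _; exact: cauchy_ge0. Qed.

Lemma cauchyvN n (x : 'rV[R]_n) : cauchyv (- x) = cauchyv x.
Proof. by apply: eq_bigr => i _; rewrite mxE /cauchy mulrN sqrrN. Qed.

Lemma measurable_lapwv n : measurable_fun setT (@lapwv n).
Proof.
apply: measurable_prod => i _ /=.
exact: (measurableT_comp (measurable_lapw _) (measurable_coord _ _)).
Qed.

Lemma measurable_cauchyv n : measurable_fun setT (@cauchyv n).
Proof.
apply: measurable_prod => i _ /=.
exact: (measurableT_comp measurable_cauchy (measurable_coord _ _)).
Qed.

Lemma integral_cauchyv n : (\int[leb n]_x (cauchyv x)%:E = 1)%E.
Proof.
rewrite (@ge0_integral_rV_prod R leb1 n (fun=> cauchy) (fun=> 1)).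
- by rewrite big1.
- by move=> _; exact: measurable_cauchy.
- by move=> _; exact: cauchy_ge0.
- by move=> _; exact: integral_cauchy.
Qed.

Lemma integrable_lapwvM n (f : 'rV[R]_n -> R) : measurable_fun setT f -> (forall x, `|f x| <= 1) ->
  (leb n).-integrable setT (EFin \o (fun x => lapwv x * f x)).
Proof.
move=> mf f1; apply: (@dominated_integrable_rV _ _ _ (lapw eps) 1).
- by apply: measurable_funM => //; exact: measurable_lapwv.
- exact: measurable_lapw.
- by move=> t; exact: lapw_ge0.
- by rewrite integral_lapw// ltry.
- by move=> x; rewrite normrM ger0_norm ?lapwv_ge0// mul1r ler_piMr ?lapwv_ge0.
Qed.

Lemma integrable_lapwv n : (leb n).-integrable setT (EFin \o (@lapwv n)).
Proof.
have := @integrable_lapwvM n (cst 1) (measurable_cst _).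
rewrite (_ : (fun x => lapwv x * cst 1 x) = (@lapwv n)); last by apply/funext => t; rewrite mulr1.
by apply => t; rewrite normr1.
Qed.

Let mphase n (z : 'rV[R]_n) : measurable_fun setT (fun x => 2 * pi * dotv x z).
Proof. by apply: measurable_funM => //; exact: measurable_dotv. Qed.

Let mcosp n (z : 'rV[R]_n) : measurable_fun setT (fun x => cos (2 * pi * dotv x z)).
Proof. by apply: measurable_cos_comp; exact: mphase. Qed.

Let msinp n (z : 'rV[R]_n) : measurable_fun setT (fun x => sin (2 * pi * dotv x z)).
Proof. by apply: measurable_sin_comp; exact: mphase. Qed.

(** Cosine and sine are treated together, because adding a coordinate mixes them through the
    addition formulas. *)
Lemma integral_lapwv_trig n (z : 'rV[R]_n) :
  (\int[leb n]_x (lapwv x * cos (2 * pi * dotv x z))%:E = (cauchyv z)%:E)%E /\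
  (\int[leb n]_x (lapwv x * sin (2 * pi * dotv x z))%:E = 0)%E.
Proof.
elim: n z => [|n IH] z.
  have mw := @measurable_lapwv 0.
  rewrite !ge0_integral_rV0; last 2 first.
  - by apply/measurable_EFinP; apply: measurable_funM => //; exact: msinp.
  - by apply/measurable_EFinP; apply: measurable_funM => //; exact: mcosp.
  by rewrite /lapwv /cauchyv /dotv !big_ord0 mulr0 cos0 sin0 mulr1 mulr0.
have [s [y ->]] : exists s y, z = row_snoc (s, y).
  by exists (row_unsnoc z).1, (row_unsnoc z).2; rewrite -[LHS]row_unsnocK; case: (row_unsnoc z).
have {IH}[Ic Is] := IH y.
have iC : (leb n).-integrable setT (EFin \o (fun x => lapwv x * cos (2 * pi * dotv x y))).
  by apply: integrable_lapwvM => [|x]; [exact: mcosp|exact: abs_cos_le1].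
have iS : (leb n).-integrable setT (EFin \o (fun x => lapwv x * sin (2 * pi * dotv x y))).
  by apply: integrable_lapwvM => [|x]; [exact: msinp|exact: abs_sin_le1].
have lin (p q : R) : (\int[leb n]_x (p * (lapwv x * cos (2 * pi * dotv x y)) +
    q * (lapwv x * sin (2 * pi * dotv x y)))%:E = (p * cauchyv y)%:E)%E.
  under eq_integral do rewrite EFinD.
  rewrite integralD//; last 2 first.
  - exact: (integrableZl measurableT p iC).
  - exact: (integrableZl measurableT q iS).
  under eq_integral do rewrite EFinM.
  under [X in (_ + X)%E]eq_integral do rewrite EFinM.
  by rewrite !integralZl// Ic Is mule0 adde0.
have wE t x : lapwv (row_snoc (t, x)) = lapwv x * lapw eps t.
  rewrite /lapwv big_ord_recr /= row_snoc_max; congr (_ * _).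
  by apply: eq_bigr => i _; rewrite row_snoc_widen.
have cE : cauchyv (row_snoc (s, y)) = cauchyv y * cauchy s.
  rewrite /cauchyv big_ord_recr /= row_snoc_max; congr (_ * _).
  by apply: eq_bigr => i _; rewrite row_snoc_widen.
have mw := @measurable_lapwv n.+1.
split.
  rewrite integral_rV_snoc; last 2 first.
  - by apply: measurable_funM => //; exact: mcosp.
  - by apply: integrable_lapwvM => [|x]; [exact: mcosp|exact: abs_cos_le1].
  transitivity (\int[mu]_t ((cauchyv y)%:E * (lapw eps t * cos (2 * pi * s * t))%:E))%E.
    apply: eq_integral => t _; rewrite -EFinM (mulrC (cauchyv y)) -(lin _ (- (lapw eps t * sin (2 * pi * s * t)))).
    apply: eq_integral => x _; rewrite wE dotv_snoc mulrDr cosD.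
    by rewrite (_ : 2 * pi * (t * s) = 2 * pi * s * t); [congr EFin; ring|ring].
  rewrite integralZl//; last first.
    apply: integrable_lapwM => //; first by apply: measurable_cos_comp; exact: measurable_funM.
    by move=> t; rewrite (le_trans (abs_cos_le1 _))// ler1n.
  by rewrite integral_lapw_cos// -EFinM cE.
rewrite integral_rV_snoc; last 2 first.
- by apply: measurable_funM => //; exact: msinp.
- by apply: integrable_lapwvM => [|x]; [exact: msinp|exact: abs_sin_le1].
transitivity (\int[mu]_t ((cauchyv y)%:E * (lapw eps t * sin (2 * pi * s * t))%:E))%E.
  apply: eq_integral => t _; rewrite -EFinM (mulrC (cauchyv y)) -(lin _ (lapw eps t * cos (2 * pi * s * t))).
  apply: eq_integral => x _; rewrite wE dotv_snoc mulrDr sinD.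
  by rewrite (_ : 2 * pi * (t * s) = 2 * pi * s * t); [congr EFin; ring|ring].
rewrite integralZl//; last first.
  apply: integrable_lapwM => //; first by apply: measurable_sin_comp; exact: measurable_funM.
  by move=> t; rewrite (le_trans (abs_sin_le1 _))// ler1n.
by rewrite integral_lapw_sin// mule0.
Qed.

End cauchy_kernel.

(** * Comparison of the energies of a function and of its transform *)

Section bessel.
Context {R : realType} {n : nat}.
Variables g1 g2 : 'rV[R]_n -> R.
Hypotheses (mg1 : measurable_fun setT g1) (mg2 : measurable_fun setT g2).
Hypotheses (ig1 : (leb n).-integrable setT (EFin \o g1)) (ig2 : (leb n).-integrable setT (EFin \o g2)).
Implicit Types xi x y : 'rV[R]_n.

(** For [g = g1 + i g2], [trC] and [trS] are the real and imaginary parts of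
    [g x * exp (- 2 i pi x.xi)]. *)
Definition trC xi x : R := g1 x * cos (2 * pi * dotv x xi) + g2 x * sin (2 * pi * dotv x xi).
Definition trS xi x : R := g2 x * cos (2 * pi * dotv x xi) - g1 x * sin (2 * pi * dotv x xi).
Definition trR xi : R := \int[leb n]_x trC xi x.
Definition trI xi : R := \int[leb n]_x trS xi x.

Let h x := `|g1 x| + `|g2 x|.
Let h0 x : 0 <= h x. Proof. by rewrite addr_ge0. Qed.

Let mh : measurable_fun setT h.
Proof. by apply: measurable_funD; exact: measurableT_comp. Qed.

Let ih : (leb n).-integrable setT (EFin \o h).
Proof.
have i1 := integrable_abse ig1; have i2 := integrable_abse ig2.
by have := integrableD measurableT i1 i2; apply: eq_integrable.
Qed.

Let trC_le xi x : `|trC xi x| <= h x.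
Proof.
rewrite (le_trans (ler_normD _ _))// !normrM lerD//.
  by rewrite ler_piMr// abs_cos_le1.
by rewrite ler_piMr// abs_sin_le1.
Qed.

Let trS_le xi x : `|trS xi x| <= h x.
Proof.
rewrite (le_trans (ler_normB _ _))// !normrM addrC lerD//.
  by rewrite ler_piMr// abs_sin_le1.
by rewrite ler_piMr// abs_cos_le1.
Qed.

Section joint_measurability.
Context {dsp : measure_display} {U : measurableType dsp}.
Variables xi x : U -> 'rV[R]_n.
Hypotheses (mxi : measurable_fun setT xi) (mx : measurable_fun setT x).

Let mph : measurable_fun setT (fun u => 2 * pi * dotv (x u) (xi u)).
Proof. by apply: measurable_funM => //; exact: measurable_dotv. Qed.

Lemma measurable_trC : measurable_fun setT (fun u => trC (xi u) (x u)).
Proof.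
apply: measurable_funD; apply: measurable_funM.
- exact: (measurableT_comp mg1).
- exact: measurable_cos_comp.
- exact: (measurableT_comp mg2).
- exact: measurable_sin_comp.
Qed.

Lemma measurable_trS : measurable_fun setT (fun u => trS (xi u) (x u)).
Proof.
apply: measurable_funB; apply: measurable_funM.
- exact: (measurableT_comp mg2).
- exact: measurable_cos_comp.
- exact: (measurableT_comp mg1).
- exact: measurable_sin_comp.
Qed.

End joint_measurability.

Let iC xi : (leb n).-integrable setT (EFin \o trC xi).
Proof.
apply: (le_integrable measurableT _ _ ih).
  by apply/measurable_EFinP; exact: (measurable_trC (xi := fun=> xi)).
by move=> x _ /=; rewrite lee_fin (ger0_norm (h0 x)).
Qed.

Let iS xi : (leb n).-integrable setT (EFin \o trS xi).
Proof.
apply: (le_integrable measurableT _ _ ih).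
  by apply/measurable_EFinP; exact: (measurable_trS (xi := fun=> xi)).
by move=> x _ /=; rewrite lee_fin (ger0_norm (h0 x)).
Qed.

Let N := \int[leb n]_x h x.

Let trR_le xi : `|trR xi| <= N.
Proof. by apply: Rintegral_norm_le => //; exact: (measurable_trC (xi := fun=> xi)). Qed.

Let trI_le xi : `|trI xi| <= N.
Proof. by apply: Rintegral_norm_le => //; exact: (measurable_trS (xi := fun=> xi)). Qed.

Let trRE xi : (\int[leb n]_x (trC xi x)%:E = (trR xi)%:E)%E.
Proof. by rewrite /trR /Rintegral fineK//; apply: integrable_fin_num => //; exact: iC. Qed.

Let trIE xi : (\int[leb n]_x (trS xi x)%:E = (trI xi)%:E)%E.
Proof. by rewrite /trI /Rintegral fineK//; apply: integrable_fin_num => //; exact: iS. Qed.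

Lemma measurable_trR : measurable_fun setT trR.
Proof.
apply: (measurable_param_integral (F := fun p : 'rV[R]_n * 'rV[R]_n => trC p.1 p.2) _ ih) => [|xi x].
  exact: measurable_trC.
exact: trC_le.
Qed.

Lemma measurable_trI : measurable_fun setT trI.
Proof.
apply: (measurable_param_integral (F := fun p : 'rV[R]_n * 'rV[R]_n => trS p.1 p.2) _ ih) => [|xi x].
  exact: measurable_trS.
exact: trS_le.
Qed.

(** The real part of [g x] times the conjugate of [g y]. *)
Let A x y := g1 x * g1 y + g2 x * g2 y.
Let sq x := g1 x ^+ 2 + g2 x ^+ 2.

Let A_le x y : `|A x y| <= 2^-1 * (sq x + sq y).
Proof.
have a (p q : R) : `|p * q| <= 2^-1 * (p ^+ 2 + q ^+ 2).
  rewrite ler_norml; apply/andP; split.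
    by have := sqr_ge0 (p + q); rewrite sqrrD; lra.
  by have := sqr_ge0 (p - q); rewrite sqrrB; lra.
rewrite (le_trans (ler_normD _ _))// (le_trans (lerD (a _ _) (a _ _)))//.
by rewrite /sq; lra.
Qed.

Let msq : measurable_fun setT sq.
Proof. by apply: measurable_funD; exact: measurable_funX. Qed.

Section fixed_eps.
Variable eps : R.
Hypothesis eps0 : 0 < eps.
Let w := @lapwv R eps n.
Let K := @cauchyv R eps n.

Let w0 x : 0 <= w x. Proof. exact: lapwv_ge0. Qed.
Let mw : measurable_fun setT w. Proof. exact: measurable_lapwv. Qed.
Let iw : (leb n).-integrable setT (EFin \o w). Proof. exact: integrable_lapwv. Qed.
Let mK : measurable_fun setT K. Proof. exact: measurable_cauchyv. Qed.
Let K0 x : 0 <= K x. Proof. exact: cauchyv_ge0. Qed.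
Let N0 : 0 <= N. Proof. exact: le_trans (trR_le 0). Qed.

(** The quantity [w |g^|^2] is unfolded in two stages: [f1] restores it when integrated in [x]
    ([inner1]), and [f2 x] restores [f1] when integrated in [y] ([inner2]). Fubini's theorem is thus
    only applied to functions of two variables. *)
Let f1 (p : 'rV[R]_n * 'rV[R]_n) : R :=
  w p.1 * (trR p.1 * trC p.1 p.2 + trI p.1 * trS p.1 p.2).

Let mf1 : measurable_fun setT f1.
Proof.
apply: measurable_funM; first exact: (measurableT_comp mw).
apply: measurable_funD; apply: measurable_funM.
- exact: (measurableT_comp measurable_trR).
- exact: measurable_trC.
- exact: (measurableT_comp measurable_trI).
- exact: measurable_trS.
Qed.

Let f1_le xi x : `|f1 (xi, x)| <= (2 * N * w xi) * h x.
Proof.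
rewrite /f1 /= normrM (ger0_norm (w0 xi)) (mulrC (2 * N)) -mulrA ler_wpM2l//.
rewrite (le_trans (ler_normD _ _))// !normrM (_ : 2 * N * h x = N * h x + N * h x); last by ring.
by rewrite lerD// ler_pM.
Qed.

Let f2 x (p : 'rV[R]_n * 'rV[R]_n) : R :=
  w p.1 * (trC p.1 x * trC p.1 p.2 + trS p.1 x * trS p.1 p.2).

Let mf2 x : measurable_fun setT (f2 x).
Proof.
apply: measurable_funM; first exact: (measurableT_comp mw).
apply: measurable_funD; apply: measurable_funM.
- exact: (measurable_trC (x := fun=> x)).
- exact: measurable_trC.
- exact: (measurable_trS (x := fun=> x)).
- exact: measurable_trS.
Qed.

Let f2_le x xi y : `|f2 x (xi, y)| <= (2 * h x * w xi) * h y.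
Proof.
rewrite /f2 /= normrM (ger0_norm (w0 xi)) (mulrC (2 * h x)) -mulrA ler_wpM2l//.
rewrite (le_trans (ler_normD _ _))// !normrM (_ : 2 * h x * h y = h x * h y + h x * h y); last by ring.
by rewrite lerD// ler_pM.
Qed.

Let iwZ (c : R) : 0 <= c -> (leb n).-integrable setT (EFin \o (fun xi => c * w xi)).
Proof. by move=> c0; exact: (integrableZl measurableT c iw). Qed.

Local Open Scope ereal_scope.

Let inner1 xi : \int[leb n]_x (f1 (xi, x))%:E = (w xi * (trR xi ^+ 2 + trI xi ^+ 2))%:E.
Proof.
rewrite /f1 /=; under eq_integral do rewrite EFinM.
rewrite integralZl//; last first.
  apply: (integrableD measurableT (integrableZl measurableT (trR xi) (iC xi))
    (integrableZl measurableT (trI xi) (iS xi))).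
under eq_integral do rewrite EFinD.
rewrite integralD//; last 2 first.
- exact: (integrableZl measurableT (trR xi) (iC xi)).
- exact: (integrableZl measurableT (trI xi) (iS xi)).
under eq_integral do rewrite EFinM.
under [X in _ * (_ + X)]eq_integral do rewrite EFinM.
rewrite !integralZl//; last 2 first.
- exact: iS.
- exact: iC.
by rewrite trRE trIE !expr2 EFinM EFinD !EFinM.
Qed.

Let inner2 x xi : \int[leb n]_y (f2 x (xi, y))%:E = (f1 (xi, x))%:E.
Proof.
rewrite /f2 /=; under eq_integral do rewrite EFinM.
rewrite integralZl//; last first.
  apply: (integrableD measurableT (integrableZl measurableT (trC xi x) (iC xi))
    (integrableZl measurableT (trS xi x) (iS xi))).
under eq_integral do rewrite EFinD.
rewrite integralD//; last 2 first.
- exact: (integrableZl measurableT (trC xi x) (iC xi)).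
- exact: (integrableZl measurableT (trS xi x) (iS xi)).
under eq_integral do rewrite EFinM.
under [X in _ * (_ + X)]eq_integral do rewrite EFinM.
rewrite !integralZl//; last 2 first.
- exact: iS.
- exact: iC.
by rewrite trRE trIE /f1 /= (mulrC (trR xi)) (mulrC (trI xi)) EFinM EFinD !EFinM.
Qed.

Let inner3 x y : \int[leb n]_xi (f2 x (xi, y))%:E = (A x y * K (x - y)%R)%:E.
Proof.
have [Ic Is] := integral_lapwv_trig eps0 (x - y)%R.
have mph : measurable_fun setT (fun xi : 'rV[R]_n => 2 * pi * dotv xi (x - y))%R.
  by apply: measurable_funM => //; exact: measurable_dotv.
have ic : (leb n).-integrable setT (EFin \o (fun xi => w xi * cos (2 * pi * dotv xi (x - y)))%R).
  by apply: (integrable_lapwvM eps0) => [|z]; [exact: measurable_cos_comp|exact: abs_cos_le1].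
have is' : (leb n).-integrable setT (EFin \o (fun xi => w xi * sin (2 * pi * dotv xi (x - y)))%R).
  by apply: (integrable_lapwvM eps0) => [|z]; [exact: measurable_sin_comp|exact: abs_sin_le1].
pose B : R := (g1 x * g2 y * (-1) + g2 x * g1 y)%R.
transitivity (\int[leb n]_xi ((A x y)%:E * (w xi * cos (2 * pi * dotv xi (x - y)))%:E +
   B%:E * (w xi * sin (2 * pi * dotv xi (x - y)))%:E)).
  apply: eq_integral => xi _; rewrite -!EFinM -EFinD; congr EFin.
  have -> : (2 * pi * dotv xi (x - y) = 2 * pi * dotv x xi - 2 * pi * dotv y xi)%R.
    by rewrite dotvBr mulrBr !(dotvC xi).
  by rewrite /f2 /= /trC /trS cosB sinB /A /B; ring.
rewrite integralD//; last 2 first.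
- exact: (integrableZl measurableT _ ic).
- exact: (integrableZl measurableT _ is').
by rewrite !integralZl// Ic Is mule0 adde0 -EFinM.
Qed.

Let phi x : \int[leb n]_xi (f1 (xi, x))%:E = \int[leb n]_y (A x y * K (x - y)%R)%:E.
Proof.
under eq_integral do rewrite -inner2.
rewrite (dominated_fubini (mf2 x) (iwZ _) ih _ h0 (f2_le x)).
- by apply: eq_integral => y _; exact: inner3.
- by rewrite mulr_ge0.
- by move=> xi; rewrite !mulr_ge0.
Qed.

Let intK x : \int[leb n]_y (K (x - y)%R)%:E = 1.
Proof.
rewrite -(integral_cauchyv eps0 n) -[RHS](@ge0_integral_shiftv _ _ _ (- x)%R)//.
- by apply: eq_integral => y _; rewrite -cauchyvN opprB.
- exact/measurable_EFinP.
Qed.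

Let intK' y : \int[leb n]_x (K (x - y)%R)%:E = 1.
Proof.
rewrite -(integral_cauchyv eps0 n) (@ge0_integral_shiftv _ _ (fun x => (K x)%:E))//.
- exact/measurable_EFinP.
Qed.

(** Schur's test: integrating [xi] out leaves the form with kernel [K (x - y)], and [|A x y|] is at
    most half the sum of the squares at [x] and [y]. As [K] has mass one in each variable, the two
    halves add up to the energy of [g]. *)
Lemma bessel_lapw : \int[leb n]_xi (w xi * (trR xi ^+ 2 + trI xi ^+ 2))%:E <=
  \int[leb n]_x (sq x)%:E.
Proof.
have N20 : (0 <= 2 * N)%R by rewrite mulr_ge0.
have a0 xi : (0 <= 2 * N * w xi)%R by rewrite mulr_ge0.
under eq_integral do rewrite -inner1.
rewrite (dominated_fubini mf1 (iwZ N20) ih a0 h0 f1_le).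
have mphi := dominated_measurable mf1 (iwZ N20) ih a0 h0 f1_le.
apply: (le_trans (lee_abs _)); apply: (le_trans (le_abse_integral _ measurableT mphi)).
pose J (p : 'rV[R]_n * 'rV[R]_n) : \bar R := (2^-1 * sq p.1 * K (p.1 - p.2))%:E.
pose J' (p : 'rV[R]_n * 'rV[R]_n) : \bar R := (2^-1 * sq p.2 * K (p.1 - p.2))%:E.
have sq0 x : (0 <= sq x)%R by rewrite addr_ge0 ?sqr_ge0.
have J0 p : 0 <= J p by rewrite lee_fin !mulr_ge0.
have J'0 p : 0 <= J' p by rewrite lee_fin !mulr_ge0.
have mKd : measurable_fun setT (fun p : 'rV[R]_n * 'rV[R]_n => K (p.1 - p.2)%R).
  by apply: (measurableT_comp mK); exact: measurable_subv.
have mJ : measurable_fun setT J.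
  apply/measurable_EFinP; apply: measurable_funM => //; apply: measurable_funM => //.
  exact: (measurableT_comp msq).
have mJ' : measurable_fun setT J'.
  apply/measurable_EFinP; apply: measurable_funM => //; apply: measurable_funM => //.
  exact: (measurableT_comp msq).
have mJx x : measurable_fun setT (fun y => J (x, y)) by exact: (measurableT_comp mJ (measurable_pair1 x)).
have mJ'x x : measurable_fun setT (fun y => J' (x, y)) by exact: (measurableT_comp mJ' (measurable_pair1 x)).
apply: (@le_trans _ _ (\int[leb n]_x (\int[leb n]_y J (x, y) + \int[leb n]_y J' (x, y)))).
  apply: le_integralT => // x; rewrite phi.
  have mAK : measurable_fun setT (fun y => (A x y * K (x - y)%R)%:E).
    apply/measurable_EFinP; apply: measurable_funM.
      by apply: measurable_funD; apply: measurable_funM.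
    by apply: (measurableT_comp mK); exact: measurable_subv.
  apply: (le_trans (le_abse_integral _ measurableT mAK)).
  rewrite -ge0_integralD//.
  apply: le_integralT => // y; rewrite /= -EFinD lee_fin normrM (ger0_norm (K0 _)).
  by rewrite -mulrDl -mulrDr ler_wpM2r// A_le.
have mF := @measurable_fun_fubini_tonelli_F _ _ _ _ _ (leb n) J mJ J0.
have mF' := @measurable_fun_fubini_tonelli_F _ _ _ _ _ (leb n) J' mJ' J'0.
rewrite ge0_integralD//; last 2 first.
- by move=> x _; apply: integral_ge0.
- by move=> x _; apply: integral_ge0.
rewrite [X in _ + X](@fubini_tonelli _ _ _ _ _ (leb n) (leb n) J' mJ' J'0).
have half x : \int[leb n]_y J (x, y) = (2^-1 * sq x)%:E.
  rewrite /J /=; under eq_integral do rewrite EFinM.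
  rewrite ge0_integralZl ?intK ?mule1//.
  - apply/measurable_EFinP; apply: (measurableT_comp mK); exact: measurable_subv.
  - by move=> y _; rewrite lee_fin.
  - by rewrite lee_fin mulr_ge0.
have half' y : \int[leb n]_x J' (x, y) = (2^-1 * sq y)%:E.
  rewrite /J' /=; under eq_integral do rewrite EFinM.
  rewrite ge0_integralZl ?intK' ?mule1//.
  - apply/measurable_EFinP; apply: (measurableT_comp mK); exact: measurable_subv.
  - by move=> x _; rewrite lee_fin.
  - by rewrite lee_fin mulr_ge0.
under eq_integral do rewrite half.
under [X in _ + X]eq_integral do rewrite half'.
rewrite -ge0_integralD//; last 4 first.
- by move=> x _; rewrite lee_fin mulr_ge0.
- by apply/measurable_EFinP; exact: measurable_funM.
- by move=> x _; rewrite lee_fin mulr_ge0.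
- by apply/measurable_EFinP; exact: measurable_funM.
apply: le_integralT => x; first by rewrite adde_ge0// lee_fin mulr_ge0.
by rewrite -EFinD lee_fin; lra.
Qed.

End fixed_eps.

Local Open Scope ereal_scope.

Lemma bessel_inequality : \int[leb n]_xi (trR xi ^+ 2 + trI xi ^+ 2)%:E <=
  \int[leb n]_x (g1 x ^+ 2 + g2 x ^+ 2)%:E.
Proof.
(* With [eps = 1 / (m + 1)] the weights increase to 1, which puts the limit within reach of monotone
   convergence. *)
pose u m xi : \bar R := (lapwv m.+1%:R^-1 xi * (trR xi ^+ 2 + trI xi ^+ 2))%:E.
have F0 xi : (0 <= trR xi ^+ 2 + trI xi ^+ 2)%R by rewrite addr_ge0 ?sqr_ge0.
have mF : measurable_fun setT (fun xi => trR xi ^+ 2 + trI xi ^+ 2)%R.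
  by apply: measurable_funD; apply: measurable_funX; [exact: measurable_trR|exact: measurable_trI].
have e0 m : (0 < m.+1%:R^-1 :> R)%R by rewrite invr_gt0.
have mu_ m : measurable_fun setT (u m).
  by apply/measurable_EFinP; apply: measurable_funM => //; exact: measurable_lapwv.
have u0 m xi : setT xi -> 0 <= u m xi by rewrite lee_fin mulr_ge0// lapwv_ge0.
have und xi : setT xi -> {homo u ^~ xi : n0 m / (n0 <= m)%N >-> n0 <= m}.
  move=> _ p q pq; rewrite lee_fin ler_wpM2r// /lapwv ler_prod// => i _.
  rewrite lapw_ge0 ler_expR lerN2 ler_wpM2r// lef_pV2 ?posrE//.
  by rewrite ler_nat.
have wcvg (xi : 'rV[R]_n) : lapwv m.+1%:R^-1 xi @[m --> \oo] --> (1 : R)%R.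
  rewrite (_ : (fun m : nat => lapwv _ _) =
    (fun m : nat => expR (- (m.+1%:R^-1 * \sum_(i < n) `|xi 0%R i|)))%R); last first.
    by apply/funext => m; rewrite /lapwv /lapw -expR_sum sumrN -mulr_sumr.
  rewrite [X in _ --> X](_ : _ = expR (- (0 * \sum_(i < n) `|xi 0%R i|)))%R; last first.
    by rewrite mul0r oppr0 expR0.
  apply: (cvg_comp _ expR); last exact: continuous_expR.
  apply: cvgN; apply: cvgM; last exact: cvg_cst.
  exact: cvg_harmonic.
have ucvg xi : u ^~ xi @ \oo --> (trR xi ^+ 2 + trI xi ^+ 2)%:E.
  apply: cvg_EFin; first by near=> m.
  by rewrite -[X in _ --> X]mul1r; apply: cvgM; [exact: wcvg|exact: cvg_cst].
have := cvg_monotone_convergence measurableT mu_ u0 und.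
have -> : (fun xi => limn (u ^~ xi)) = (fun xi => (trR xi ^+ 2 + trI xi ^+ 2)%:E).
  by apply/funext => xi; apply/cvg_lim => //; exact: ucvg.
move=> /(_ (leb n)) c; rewrite -(cvg_lim _ c)//; apply: lime_le; first by apply: (cvgP _ c).
by near=> m; exact: bessel_lapw.
Unshelve. all: by end_near. Qed.

End bessel.

(** * Schwartz functions *)

Section continuous_measurable.
Context {R : realType} {n : nat}.

Let rnd (k : nat) (x : 'rV[R]_n) : 'rV[R]_n :=
  \row_i ((Num.floor (k.+1%:R * x 0 i))%:~R / k.+1%:R).

Let rnd_cvg x : rnd k x @[k --> \oo] --> x.
Proof.
apply/cvg_ballP => e e0; near=> k; split=> [//|i j]; rewrite (ord1 i) mxE /ball /=.
have k0 : (0 : R) < k.+1%:R by [].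
have := floor_itv (k.+1%:R * x 0 j); set z := (Num.floor _)%:~R => /andP[z1 z2].
have ke : k.+1%:R^-1 < e.
  near: k; have := @cvg_harmonic R; move=> /cvgrPdist_lt /(_ e e0); apply: filterS => k.
  by rewrite sub0r normrN ger0_norm ?invr_ge0.
apply: le_lt_trans ke.
rewrite ger0_norm; last by rewrite subr_ge0 ler_pdivrMr// mulrC.
rewrite lerBlDr -[X in X + _]mul1r -mulrDl ler_pdivlMr// mulrC addrC.
by move: z2; rewrite intrD1 => /ltW.
Unshelve. all: by end_near. Qed.

(** [g] is the limit of its compositions with the rounding [rnd k] to the grid of mesh
    [1 / (k + 1)]. These are constant on countably many boxes, and boxes are measurable for the
    sigma-algebra of the coordinates. *)
Lemma continuous_measurable_rV (g : 'rV[R]_n -> R) : continuous g -> measurable_fun setT g.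
Proof.
move=> cg; apply: (measurable_fun_cvg (h := fun k x => g (rnd k x))); last first.
  by move=> x _; apply: (cvg_comp _ _ (rnd_cvg (x := x))); exact: cg.
move=> k _ Y mY; rewrite setTI.
pose emb (z : 'rV[int]_n) : 'rV[R]_n := \row_i ((z 0 i)%:~R / k.+1%:R).
pose box (z : 'rV[int]_n) : set 'rV[R]_n := \bigcap_(i in [set: 'I_n])
  (fun x : 'rV[R]_n => x 0 i) @^-1` `[(z 0 i)%:~R / k.+1%:R, (z 0 i + 1)%:~R / k.+1%:R[.
have -> : (fun x => g (rnd k x)) @^-1` Y =
    \bigcup_z (if `[< Y (g (emb z)) >] then box z else set0).
  have flE (x : 'rV[R]_n) z : box z x -> rnd k x = emb z.
    move=> bx; apply/rowP => i; rewrite !mxE; congr (_%:~R / _).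
    have := bx i I; rewrite /= in_itv /= => /andP[b1 b2].
    by apply: floor_def; rewrite mulrC -ler_pdivrMr// b1/= -ltr_pdivlMr.
  apply/seteqP; split => x /=.
    move=> Yx; exists (\row_i Num.floor (k.+1%:R * x 0 i)) => //.
    have bx : box (\row_i Num.floor (k.+1%:R * x 0 i)) x.
      move=> i _; rewrite /= in_itv /= mxE.
      have := floor_itv (k.+1%:R * x 0 i) => /andP[z1 z2].
      by rewrite ler_pdivrMr// ltr_pdivlMr// (mulrC (x 0 i)) z1.
    by rewrite asboolT // -(flE _ _ bx).
  move=> [z _]; case: asboolP => // Yz bx.
  by rewrite (flE _ _ bx).
apply: countable_bigcupT_measurable; first exact: countableP.
move=> z; case: asboolP => // _; apply: fin_bigcap_measurable => // i _.
rewrite -[X in measurable X]setTI; exact: measurable_coord.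
Qed.

End continuous_measurable.

Section dominated.
Context {R : realType} {dsp : measure_display} {T : measurableType dsp}.
Variables (mu : {measure set T -> \bar R}) (f_ : (T -> R)^nat) (f h : T -> R).
Hypotheses (mf : forall i, measurable_fun setT (f_ i))
  (cf : forall x, f_ ^~ x @ \oo --> f x) (ih : mu.-integrable setT (EFin \o h))
  (fh : forall i x, `|f_ i x| <= h x).

Lemma cvg_Rintegral : (\int[mu]_x f_ i x) @[i --> \oo] --> \int[mu]_x f x.
Proof.
have mf' : measurable_fun setT f by apply: (measurable_fun_cvg mf) => x _; exact: cf.
have [||||] := @dominated_convergence _ _ _ mu setT measurableT
  (fun i => EFin \o f_ i) (EFin \o f) (EFin \o h) _ _ _ ih.
- by move=> i; apply/measurable_EFinP.
- by apply/measurable_EFinP.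
- by apply: aeW => x _; apply: cvg_EFin; [near=> i|exact: cf].
- by apply: aeW => x i _; rewrite lee_fin.
move=> iF _ c; rewrite /Rintegral; apply: fine_cvg.
by rewrite fineK//; apply: integrable_fin_num.
Unshelve. all: by end_near. Qed.

End dominated.

(** * An integrable majorant in product form *)

Section quad_weight.
Context {R : realType}.
Local Notation mu := (@lebesgue_measure R).

(** The product of the [qd] replaces a power of [1 + |x|] as majorant of Schwartz functions, because
    the identification of [intRd] with a Lebesgue integral works with products. *)
Definition qd (t : R) : R := (1 + t ^+ 2)^-1.
Definition qdv n (x : 'rV[R]_n) : R := \prod_(i < n) qd (x 0 i).

Lemma qd_gt0 t : 0 < qd t.
Proof. by rewrite invr_gt0 ltr_pwDl ?sqr_ge0. Qed.

Lemma qd_ge0 t : 0 <= qd t. Proof. exact/ltW/qd_gt0. Qed.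

Lemma qdv_ge0 n (x : 'rV[R]_n) : 0 <= qdv x.
Proof. by rewrite prodr_ge0// => i _; exact: qd_ge0. Qed.

Lemma integral_qd_lty : (\int[mu]_t (qd t)%:E < +oo)%E.
Proof. by rewrite /qd integral_oneDsqrV ltry. Qed.

Lemma measurable_qdv n : measurable_fun setT (@qdv n).
Proof.
apply: measurable_prod => i _ /=.
exact: (measurableT_comp (@measurable_oneDsqrV R) (measurable_coord _ _)).
Qed.

Section quad_dominated.
Variables (n : nat) (G : 'rV[R]_n -> R) (K : R).
Hypotheses (mG : measurable_fun setT G) (GK : forall x, `|G x| <= K * qdv x).

Lemma qd_integrable : (leb n).-integrable setT (EFin \o G).
Proof.
exact: (dominated_integrable_rV mG (@measurable_oneDsqrV R) qd_ge0 integral_qd_lty GK).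
Qed.

Lemma qd_intRdE : intRd (fun x => (G x)%:E) = (\int[leb n]_x (G x)%:E)%E.
Proof.
exact: (dominated_intRdE mG (@measurable_oneDsqrV R) qd_ge0 integral_qd_lty GK).
Qed.

End quad_dominated.

Lemma integrable_qdv n (K : R) : (leb n).-integrable setT (EFin \o (fun x => K * qdv x)).
Proof.
apply: (@qd_integrable n _ `|K|).
  by apply: measurable_funM => //; exact: measurable_qdv.
by move=> x; rewrite normrM (ger0_norm (qdv_ge0 x)).
Qed.

Lemma qdv_shift_le n (x c : 'rV[R]_n) : (forall i, `|c 0 i| <= 1) -> qdv (x + c) <= 3 ^+ n * qdv x.
Proof.
move=> c1; rewrite -[n in 3 ^+ n]card_ord -prodr_const -big_split /=.
apply: ler_prod => i _; rewrite qd_ge0 mxE /= /qd.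
have a0 := sqr_ge0 (x 0 i); have b0 := sqr_ge0 (x 0 i + c 0 i).
have c2 : c 0 i ^+ 2 <= 1 by rewrite -real_normK ?num_real// exprn_ile1.
rewrite -[leLHS]div1r ler_pdivrMr ?ltr_pwDl// mulrAC ler_pdivlMr ?ltr_pwDl// mul1r.
have : 0 <= (x 0 i + c 0 i + c 0 i) ^+ 2 by exact: sqr_ge0.
move: a0 b0 c2; move: (x 0 i) (c 0 i) => p q; rewrite !expr2; nra.
Qed.

(** Each of the [n] factors absorbs two powers of [1 + r]. *)
Lemma qdv_decay n (x : 'rV[R]_n) (r : R) : (forall i, `|x 0 i| <= r) ->
  1 <= qdv x * (1 + r) ^+ (2 * n).
Proof.
move=> xr; rewrite exprM -[n in _ ^+ n]card_ord -prodr_const -big_split /=.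
rewrite -[leLHS](_ : \prod_(i < n) 1 = 1); last by rewrite big1.
apply: ler_prod => i _; rewrite ler01 /= /qd mulrC ler_pdivlMr ?ltr_pwDl ?sqr_ge0// mul1r.
have r0 : 0 <= r by exact: le_trans (xr i).
rewrite sqrrD expr1n mul1r -real_normK ?num_real//.
have : `|x 0 i| ^+ 2 <= r ^+ 2 by rewrite lerXn2r ?nnegrE.
lra.
Qed.

Lemma qdv_bound n (F : 'rV[R]_n -> R) (r : 'rV[R]_n -> R) (K : R) :
  (forall (x : 'rV[R]_n) i, `|x 0 i| <= r x) ->
  (forall x, (1 + r x) ^+ (2 * n) * `|F x| <= K) ->
  forall x, `|F x| <= K * qdv x.
Proof.
move=> xr FK x; apply: (@le_trans _ _ (qdv x * (1 + r x) ^+ (2 * n) * `|F x|)).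
  by rewrite ler_peMl// qdv_decay.
by rewrite -mulrA mulrC ler_wpM2r ?qdv_ge0.
Qed.

End quad_weight.

(** * Directional derivatives and integration by parts *)

Section directional.
Context {R : realType} {n : nat}.
Implicit Types (G : 'rV[R]_n -> R) (x e : 'rV[R]_n).

Lemma is_derive_line G x e (t d : R) :
  is_derive (t *: e + x) e G d <-> is_derive t (1 : R) (fun s : R => G (s *: e + x)) d.
Proof.
have E : (fun h : R => h^-1 *: ((G \o shift (t *: e + x)) (h *: e) - G (t *: e + x))) =
   (fun h : R => h^-1 *: (((fun s : R => G (s *: e + x)) \o shift t) (h *: 1) - G (t *: e + x))).
  by apply/funext => h; rewrite /= /shift /= scalerDl addrA [h *: 1]mulr1.
split=> -[d1 d2]; apply: DeriveDef.
- by rewrite /derivable -E.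
- by rewrite -d2 /derive -E.
- by rewrite /derivable E.
- by rewrite -d2 /derive E.
Qed.

Lemma is_derive_line0 G x e (d : R) :
  is_derive x e G d <-> is_derive (0 : R) (1 : R) (fun s : R => G (s *: e + x)) d.
Proof. by rewrite -is_derive_line scale0r add0r. Qed.

Lemma integral_shiftv (G : 'rV[R]_n -> R) (c : 'rV[R]_n) : measurable_fun setT G ->
  \int[leb n]_x G (x + c) = \int[leb n]_x G x.
Proof.
move=> mG; rewrite /Rintegral; congr fine; rewrite integralE [RHS]integralE.
have mE : measurable_fun setT (EFin \o G) by apply/measurable_EFinP.
congr (_ - _)%E.
  rewrite -[RHS](@ge0_integral_shiftv _ _ _ c)//.
    by apply: eq_integral => x _; rewrite !funeposE.
  exact: measurable_funepos.
rewrite -[RHS](@ge0_integral_shiftv _ _ _ c)//.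
  by apply: eq_integral => x _; rewrite !funenegE.
exact: measurable_funeneg.
Qed.

(** By translation invariance the integral of [G (t *: e + x)] does not depend on [t]; the claim
    follows by differentiating under the integral at [t = 0]. *)
Lemma integral_dir_derive0 (G dG : 'rV[R]_n -> R) (i : 'I_n) (K : R) :
  measurable_fun setT G -> measurable_fun setT dG ->
  (forall x, is_derive x (delta_mx 0 i) G (dG x)) ->
  (forall x, `|G x| <= K * qdv x) -> (forall x, `|dG x| <= K * qdv x) ->
  \int[leb n]_x dG x = 0.
Proof.
move=> mG mdG dGG GK dGK; pose e : 'rV[R]_n := delta_mx 0 i.
have K0 : 0 <= K.
  have q0 : 0 < qdv (0 : 'rV[R]_n) by apply: prodr_gt0 => j _; exact: qd_gt0.
  by have := le_trans (normr_ge0 _) (GK 0); rewrite pmulr_lge0.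
pose f (t : R) (x : 'rV[R]_n) := G (t *: e + x).
have mshift (H : 'rV[R]_n -> R) t : measurable_fun setT H -> measurable_fun setT (fun x => H (t *: e + x)).
  by move=> mH; apply: (measurableT_comp mH); exact: measurable_addv.
have te t j : `|t| < 1 -> `|(t *: e) 0 j| <= 1.
  move=> t1; rewrite !mxE eqxx /=; case: (j == i) => /=; rewrite ?mulr1 ?mulr0 ?normr0//.
  exact: ltW.
have df t x : is_derive t (1 : R) (f ^~ x) (dG (t *: e + x)).
  by apply/is_derive_line; exact: dGG.
(* For [|t| < 1] a translation costs at most a factor 3 per coordinate, so a single majorant serves
   for the whole interval. *)
have bnd (H : 'rV[R]_n -> R) t x : (forall x, `|H x| <= K * qdv x) -> `|t| < 1 ->
    `|H (t *: e + x)| <= K * 3 ^+ n * qdv x.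
  move=> HK t1; rewrite (le_trans (HK _))// -mulrA ler_wpM2l// addrC qdv_shift_le// => j.
  exact: te.
have := @differentiation_under_integral R _ _ (leb n) f setT measurableT 0 (-1) 1.
have Fc : (fun t : R => \int[leb n]_x f t x) = cst (\int[leb n]_x G x).
  apply/funext => t; rewrite /f -(integral_shiftv (t *: e) mG).
  by apply: eq_Rintegral => x _; rewrite addrC.
rewrite Fc => /(_ _ _ _ (fun x => K * 3 ^+ n * qdv x)) D.
have p1E t x : partial1of2 f t x = dG (t *: e + x).
  by rewrite /partial1of2 derive1E; apply: derive_val.
move: D; rewrite derive1_cst => D.
transitivity (\int[leb n]_x (partial1of2 f)^~ x 0).
  by apply: eq_Rintegral => x _; rewrite p1E scale0r add0r.
symmetry; apply: D.
- by rewrite /= in_itv /= ltrN10 ltr01.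
- move=> t; rewrite /= in_itv /= -ltr_norml => t1.
  apply: (@qd_integrable _ _ _ (K * 3 ^+ n)); first exact: mshift.
  by move=> x; exact: bnd.
- by move=> t x _ _; have [] := df t x.
- by move=> x; rewrite !mulr_ge0 ?exprn_ge0 ?qdv_ge0.
- exact: integrable_qdv.
- by move=> t x; rewrite /= in_itv /= -ltr_norml => t1 _; rewrite p1E; exact: bnd.
Qed.

Definition Ctr (h : 'rV[R]_n -> R) (xi : 'rV[R]_n) : R := \int[leb n]_x (h x * cos (2 * pi * dotv x xi)).
Definition Str (h : 'rV[R]_n -> R) (xi : 'rV[R]_n) : R := \int[leb n]_x (h x * sin (2 * pi * dotv x xi)).

Section by_parts.
Variables (h dh : 'rV[R]_n -> R) (i : 'I_n) (K : R).
Hypotheses (mh : measurable_fun setT h) (mdh : measurable_fun setT dh).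
Hypothesis dhh : forall x, is_derive x (delta_mx 0 i) h (dh x).
Hypotheses (hK : forall x, `|h x| <= K * qdv x) (dhK : forall x, `|dh x| <= K * qdv x).
Variable xi : 'rV[R]_n.
Let c := 2 * pi * xi 0 i.

Let mph : measurable_fun setT (fun x : 'rV[R]_n => 2 * pi * dotv x xi).
Proof. by apply: measurable_funM => //; exact: measurable_dotv. Qed.

Let phE (s : R) x : 2 * pi * dotv (s *: delta_mx 0 i + x) xi = c * s + 2 * pi * dotv x xi.
Proof.
rewrite dotvDl dotvZl (_ : dotv (delta_mx 0 i) xi = xi 0 i); first by rewrite /c; ring.
rewrite /dotv (bigD1 i)//= big1 => [|j ji]; first by rewrite !mxE !eqxx mul1r addr0.
by rewrite !mxE (negbTE ji) andbF mul0r.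
Qed.

Let dphase (f df : R -> R) x : (forall t : R, is_derive t (1 : R) f (df t)) ->
  is_derive (0 : R) (1 : R) (fun s : R => f (c * s + 2 * pi * dotv x xi)) (c * df (2 * pi * dotv x xi)).
Proof.
move=> dff.
have dl : is_derive (0 : R) (1 : R) (fun s : R => c * s + 2 * pi * dotv x xi) c.
  have d1 : is_derive (0 : R) (1 : R) (fun s : R => c * s) c.
    by apply: is_derive_eq; rewrite /GRing.scale /= mulr1.
  have dd := is_deriveD d1 (is_derive_cst (2 * pi * dotv x xi : R) (0 : R) (1 : R)).
  by apply: (is_derive_eq dd); rewrite addr0.
have dd := @is_derive1_comp R f (fun s : R => c * s + 2 * pi * dotv x xi) 0 _ _ (dff _) dl.
by apply: (is_derive_eq dd); rewrite mulr0 add0r mulrC.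
Qed.

Let dprod (f df : R -> R) x : (forall t : R, is_derive t (1 : R) f (df t)) ->
  is_derive x (delta_mx 0 i) (fun x => h x * f (2 * pi * dotv x xi))
    (dh x * f (2 * pi * dotv x xi) + c * (h x * df (2 * pi * dotv x xi))).
Proof.
move=> dff; apply/is_derive_line0.
have d1 : is_derive (0 : R) (1 : R) (fun s : R => h (s *: delta_mx 0 i + x)) (dh x).
  by apply/is_derive_line0; exact: dhh.
have dd := is_deriveM d1 (dphase x dff).
have -> : (fun s : R => h (s *: delta_mx 0 i + x) * f (2 * pi * dotv (s *: delta_mx 0 i + x) xi)) =
  (fun s : R => h (s *: delta_mx 0 i + x)) * (fun s : R => f (c * s + 2 * pi * dotv x xi)).
  by apply/funext => s; rewrite phE.
apply: (is_derive_eq dd); rewrite scale0r add0r mulr0 add0r /GRing.scale /=; ring.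
Qed.

Let K0 : 0 <= K.
Proof.
have q0 : 0 < qdv (0 : 'rV[R]_n) by apply: prodr_gt0 => j _; exact: qd_gt0.
by have := le_trans (normr_ge0 _) (hK 0); rewrite pmulr_lge0.
Qed.

Let parts (f df : R -> R) : (forall t : R, is_derive t (1 : R) f (df t)) ->
  (forall t, `|f t| <= 1) -> (forall t, `|df t| <= 1) ->
  measurable_fun setT f -> measurable_fun setT df ->
  \int[leb n]_x (dh x * f (2 * pi * dotv x xi)) + c * \int[leb n]_x (h x * df (2 * pi * dotv x xi)) = 0.
Proof.
move=> dff f1 df1 mf mdf.
have mfx : measurable_fun setT (fun x : 'rV[R]_n => f (2 * pi * dotv x xi)) by exact: (measurableT_comp mf).
have mdfx : measurable_fun setT (fun x : 'rV[R]_n => df (2 * pi * dotv x xi)) by exact: (measurableT_comp mdf).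
have b (u w : 'rV[R]_n -> R) x : (forall x, `|u x| <= K * qdv x) -> (forall x, `|w x| <= 1) -> `|u x * w x| <= K * qdv x.
  by move=> uK w1; rewrite normrM (le_trans _ (uK x))// ler_piMr.
have i1 : (leb n).-integrable setT (EFin \o (fun x => dh x * f (2 * pi * dotv x xi))).
  by apply: (@qd_integrable _ _ _ K) => [|x]; [exact: measurable_funM|exact: (b dh (fun x => f (2 * pi * dotv x xi)))].
have i2 : (leb n).-integrable setT (EFin \o (fun x => h x * df (2 * pi * dotv x xi))).
  by apply: (@qd_integrable _ _ _ K) => [|x]; [exact: measurable_funM|exact: (b h (fun x => df (2 * pi * dotv x xi)))].
rewrite -RintegralZl// -RintegralD//; last exact: (integrableZl measurableT c i2).
apply: (@integral_dir_derive0 (fun x => h x * f (2 * pi * dotv x xi)) _ i ((1 + `|c|) * K)).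
- exact: measurable_funM.
- by apply: measurable_funD; do ?apply: measurable_funM.
- by move=> x; exact: dprod.
- move=> x; rewrite (le_trans (b h (fun x => f (2 * pi * dotv x xi)) x hK _))//.
  by rewrite -[leRHS]mulrA ler_peMl ?mulr_ge0 ?qdv_ge0// lerDl.
- move=> x; apply: (@le_trans _ _ (K * qdv x + `|c| * (K * qdv x))); last first.
    by rewrite -[leRHS]mulrA [leRHS]mulrDl mul1r.
  rewrite (le_trans (ler_normD _ _))// lerD//.
    exact: (b dh (fun x => f (2 * pi * dotv x xi))).
  rewrite normrM ler_wpM2l//; exact: (b h (fun x => df (2 * pi * dotv x xi))).
Qed.

Lemma Ctr_derive : Ctr dh xi = c * Str h xi.
Proof.
have := @parts cos (fun t => - sin t) (@is_derive_cos R) (@abs_cos_le1 R) _ _ _.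
rewrite -/(Ctr dh xi) => /(_ _ _ _) P.
apply/eqP; rewrite -subr_eq0; apply/eqP; rewrite -[RHS]P.
- congr (_ + _); rewrite -mulrN; congr (_ * _).
  rewrite /Str -mulN1r -RintegralZl//.
    by apply: eq_Rintegral => x _; rewrite mulN1r mulrN.
  apply: (@qd_integrable _ _ _ K) => [|x].
    by apply: measurable_funM => //; exact: measurable_sin_comp.
  by rewrite normrM (le_trans _ (hK x))// ler_piMr// abs_sin_le1.
- by move=> t; rewrite normrN abs_sin_le1.
- exact: (measurable_cos_comp (f := fun t : R => t)).
- by apply: measurableT_comp => //; exact: (measurable_sin_comp (f := fun t : R => t)).
Qed.

Lemma Str_derive : Str dh xi = - (c * Ctr h xi).
Proof.
have := @parts sin cos (@is_derive_sin R) (@abs_sin_le1 R) (@abs_cos_le1 R).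
move=> /(_ (measurable_sin_comp (f := fun t : R => t) _) (measurable_cos_comp (f := fun t : R => t) _)).
by rewrite -/(Str dh xi) -/(Ctr h xi) => P; apply/eqP; rewrite -addr_eq0 P.
Qed.

End by_parts.

Lemma abs_trig_le (h : 'rV[R]_n -> R) (K : R) (f : R -> R) xi : measurable_fun setT h ->
  (forall x, `|h x| <= K * qdv x) -> measurable_fun setT f -> (forall t, `|f t| <= 1) ->
  `|\int[leb n]_x (h x * f (2 * pi * dotv x xi))| <= \int[leb n]_x (K * qdv x).
Proof.
move=> mh hK mf f1; apply: Rintegral_norm_le.
- apply: measurable_funM => //; apply: (measurableT_comp mf).
  by apply: measurable_funM => //; exact: measurable_dotv.
- exact: integrable_qdv.
- by move=> x; rewrite normrM (le_trans _ (hK x))// ler_piMr.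
Qed.

End directional.

Section schwartz_decay.
Context {R : realType} {n : nat}.
Implicit Types (h : 'rV[R]_n -> R) (x xi : 'rV[R]_n).

Definition schwartzR h := smoothR h /\ rapidR h.

Lemma schwartzR_derive h (i : 'I_n) : schwartzR h -> schwartzR (Defs.iterD [:: i] h).
Proof.
have E s : Defs.iterD s (Defs.iterD [:: i] h) = Defs.iterD (rcons s i) h.
  by elim: s => [|j s IH] //=; apply/funext => x; rewrite IH.
move=> [sh rh]; split => [s|s N]; rewrite E; [exact: sh|exact: rh].
Qed.

Lemma abs_coord_le_vnorm x i : `|x 0 i| <= vnorm x.
Proof.
rewrite -sqrtr_sqr /vnorm ler_sqrt ?dotv_ge0// /dotv (bigD1 i)//= expr2 lerDl.
by apply: sumr_ge0 => j _; rewrite -expr2 sqr_ge0.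
Qed.

Lemma schwartzR_measurable h : schwartzR h -> measurable_fun setT h.
Proof. by move=> [sh _]; apply: continuous_measurable_rV; have [] := sh [::]. Qed.

Lemma schwartzR_bound h : schwartzR h -> exists K, forall x, `|h x| <= K * qdv x.
Proof.
move=> [_ rh]; have [K HK] := rh [::] (2 * n)%N; exists K.
by apply: (qdv_bound (r := @vnorm R n)) HK; exact: abs_coord_le_vnorm.
Qed.

Lemma schwartzR_parts h (i : 'I_n) xi : schwartzR h ->
  `|xi 0 i| * (`|Ctr h xi| + `|Str h xi|) <= `|Ctr (Defs.iterD [:: i] h) xi| + `|Str (Defs.iterD [:: i] h) xi|.
Proof.
move=> sh; have sdh := schwartzR_derive i sh.
have [K1 hK1] := schwartzR_bound sh; have [K2 hK2] := schwartzR_bound sdh.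
have K1' x : `|h x| <= Num.max K1 K2 * qdv x.
  by rewrite (le_trans (hK1 x))// ler_wpM2r ?qdv_ge0// le_max lexx.
have K2' x : `|Defs.iterD [:: i] h x| <= Num.max K1 K2 * qdv x.
  by rewrite (le_trans (hK2 x))// ler_wpM2r ?qdv_ge0// le_max lexx orbT.
have dh x : is_derive x (delta_mx 0 i) h (Defs.iterD [:: i] h x).
  by apply: DeriveDef => //; have [+ _] := sh; move=> /(_ [::])[_]; apply.
have mh := schwartzR_measurable sh; have mdh := schwartzR_measurable sdh.
rewrite (Ctr_derive mh mdh dh K1' K2' xi) (Str_derive mh mdh dh K1' K2' xi).
rewrite normrN [`|_ * Str _ _|]normrM [`|_ * Ctr _ _|]normrM -mulrDr addrC ler_wpM2r ?addr_ge0//.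
rewrite normrM ler_peMl// ger0_norm ?mulr_ge0 ?pi_ge0//; have := @pi_ge2 R; lra.
Qed.

(** Each additional power costs one derivative ([schwartzR_parts]). The sum of the absolute values
    of the coordinates is used as norm since it distributes over the directions. *)
Lemma schwartzR_decay N h : schwartzR h -> exists K, forall xi,
  (1 + \sum_i `|xi 0 i|) ^+ N * (`|Ctr h xi| + `|Str h xi|) <= K.
Proof.
elim: N h => [|N IH] h sh.
  have [K hK] := schwartzR_bound sh; have mh := schwartzR_measurable sh.
  exists (\int[leb n]_x (K * qdv x) + \int[leb n]_x (K * qdv x)) => xi.
  rewrite expr0 mul1r lerD//.
    by apply: (abs_trig_le xi mh hK) => [|t]; [exact: (measurable_cos_comp (f := fun t : R => t))|exact: abs_cos_le1].
  by apply: (abs_trig_le xi mh hK) => [|t]; [exact: (measurable_sin_comp (f := fun t : R => t))|exact: abs_sin_le1].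
have [K HK] := IH h sh.
have [Ki HKi] := choice (fun i => IH _ (schwartzR_derive i sh)).
exists (K + \sum_i Ki i) => xi.
have s0 : 0 <= (1 + \sum_i `|xi 0 i|) ^+ N by rewrite exprn_ge0// addr_ge0// sumr_ge0.
rewrite exprSr -mulrA mulrDl mul1r mulrDr lerD// mulr_suml mulr_sumr ler_sum// => i _.
by rewrite (le_trans _ (HKi i xi))// ler_wpM2l// schwartzR_parts.
Qed.

Lemma schwartzR_trig_bound h : schwartzR h -> exists K, forall xi,
  `|Ctr h xi| + `|Str h xi| <= K * qdv xi.
Proof.
move=> /(schwartzR_decay (2 * n)) [K HK]; exists K => xi.
rewrite -[leLHS]ger0_norm ?addr_ge0//.
apply: (qdv_bound (F := fun xi => `|Ctr h xi| + `|Str h xi|) (r := fun x => \sum_i `|x 0 i|)).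
- by move=> x i; rewrite (bigD1 i)//= lerDl sumr_ge0.
- by move=> x; rewrite ger0_norm ?addr_ge0.
Qed.

End schwartz_decay.

(** * Multiplier operators averaged over frames *)

Section frame_average.
Context {R : realType} {d : nat} (v : nat -> 'rV[R]_d).
Local Open Scope ereal_scope.
Implicit Types (n m : nat) (a b : frames R d).

Lemma frame_avg_cvg n m a (h_ : (frames R d -> \bar R)^nat) h (C : R) :
  (forall i, measurable_fun setT (h_ i)) -> (forall i b, 0 <= h_ i b) ->
  (forall i b, h_ i b <= C%:E) -> (forall b, h_ ^~ b @ \oo --> h b) ->
  frame_avg v n m a (h_ i) @[i --> \oo] --> frame_avg v n m a h.
Proof.
move=> mh h0 hC ch; elim: n m a => [|n IH] m a /=; first exact: ch.
apply: (@dominated_cvg _ _ _ (gam d) setT measurableT _ _ (cst C%:E)).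
- by move=> i; exact: measurable_frame_avg1.
- by move=> x _; exact: IH.
- by [].
- apply/integrableP; split => //.
  by under eq_integral do rewrite /= /cst; rewrite integral_gam_cst ltry.
- move=> i x _; rewrite gee0_abs; last exact: frame_avg_ge0.
  rewrite -[leRHS](frame_avg_cst v n m.+1 (updf a m (fpoint v m a x))).
  exact: le_frame_avg.
Qed.

Lemma frame_avg_le_cst n m a G (C : R) : (forall b, 0 <= G b) -> (forall b, G b <= C%:E) ->
  frame_avg v n m a G <= C%:E.
Proof. by move=> G0 GC; rewrite -[leRHS](frame_avg_cst v n m a); exact: le_frame_avg. Qed.

(** With [c] the average of [h], average the inequality [2 c h <= h^2 + c^2]; the upper bound on [h]
    ensures that [c] is finite. *)
Lemma frame_avg_jensen n m a (h : frames R d -> R) (C : R) : measurable_fun setT h ->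
  (forall b, (0 <= h b)%R) -> (forall b, (h b <= C)%R) ->
  frame_avg v n m a (EFin \o h) * frame_avg v n m a (EFin \o h) <= frame_avg v n m a (fun b => (h b ^+ 2)%:E).
Proof.
move=> mh h0 hC.
have mE : measurable_fun setT (EFin \o h) by apply/measurable_EFinP.
have F0 : 0 <= frame_avg v n m a (EFin \o h) by apply: frame_avg_ge0 => b; rewrite lee_fin.
have Ff : frame_avg v n m a (EFin \o h) \is a fin_num.
  rewrite ge0_fin_numE//; apply: (@le_lt_trans _ _ C%:E); last exact: ltry.
  by apply: frame_avg_le_cst => b; rewrite lee_fin.
set c := fine (frame_avg v n m a (EFin \o h)).
have cE : frame_avg v n m a (EFin \o h) = c%:E by rewrite fineK.
have c0 : (0 <= c)%R by rewrite fine_ge0.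
have m2h : measurable_fun setT (fun b => (h b ^+ 2)%:E).
  by apply/measurable_EFinP; exact: measurable_funX.
have sq0 b : 0 <= (h b ^+ 2)%:E by rewrite lee_fin sqr_ge0.
have : frame_avg v n m a (fun b => (2 * c)%:E * (EFin \o h) b) <=
    frame_avg v n m a (fun b => (h b ^+ 2)%:E + (c ^+ 2)%:E).
  apply: le_frame_avg => b; first by rewrite -EFinM lee_fin !mulr_ge0.
  by rewrite -EFinM -EFinD lee_fin; have := sqr_ge0 (h b - c)%R; rewrite sqrrB; lra.
rewrite (@frame_avgZl _ _ v n m a _ (EFin \o h)) ?mulr_ge0//.
rewrite (@frame_avgD _ _ v n m a (fun b => (h b ^+ 2)%:E) (fun=> (c ^+ 2)%:E))//; last by rewrite lee_fin sqr_ge0.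
rewrite frame_avg_cst cE -EFinM -(@leeBlDr _ _ (c ^+ 2)%:E)// -EFinB.
by apply: le_trans; rewrite lee_fin; lra.
Qed.

End frame_average.

Section fourier_formulas.
Context {R : realType} {d : nat}.
Implicit Types (f g : 'rV[R]_d -> R[i]) (x xi : 'rV[R]_d).

Lemma Re_mul_expi (z : R[i]) t :
  complex.Re (z * expi t) = complex.Re z * cos t - complex.Im z * sin t.
Proof. by case: z. Qed.

Lemma Im_mul_expi (z : R[i]) t :
  complex.Im (z * expi t) = complex.Im z * cos t + complex.Re z * sin t.
Proof. by case: z => p q; rewrite /= addrC. Qed.

Section quad_dominated_symbols.
Variables (g1 g2 : 'rV[R]_d -> R) (K : R).
Hypotheses (mg1 : measurable_fun setT g1) (mg2 : measurable_fun setT g2).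
Hypotheses (g1K : forall x, `|g1 x| <= K * qdv x) (g2K : forall x, `|g2 x| <= K * qdv x).

Lemma trC_qd xi x : `|trC g1 g2 xi x| <= (K + K) * qdv x.
Proof.
rewrite (le_trans (ler_normD _ _))// [leRHS]mulrDl !normrM lerD//.
  by rewrite (le_trans _ (g1K x))// ler_piMr// abs_cos_le1.
by rewrite (le_trans _ (g2K x))// ler_piMr// abs_sin_le1.
Qed.

Lemma trS_qd xi x : `|trS g1 g2 xi x| <= (K + K) * qdv x.
Proof.
rewrite (le_trans (ler_normB _ _))// [leRHS]mulrDl !normrM lerD//.
  by rewrite (le_trans _ (g2K x))// ler_piMr// abs_cos_le1.
by rewrite (le_trans _ (g1K x))// ler_piMr// abs_sin_le1.
Qed.

Lemma intRd_trC xi : fine (intRd (fun x => (trC g1 g2 xi x)%:E)) = trR g1 g2 xi.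
Proof.
rewrite (qd_intRdE (K := K + K))//; first exact: (measurable_trC mg1 mg2 (xi := fun=> xi)).
exact: trC_qd.
Qed.

Lemma intRd_trS xi : fine (intRd (fun x => (trS g1 g2 xi x)%:E)) = trI g1 g2 xi.
Proof.
rewrite (qd_intRdE (K := K + K))//; first exact: (measurable_trS mg1 mg2 (xi := fun=> xi)).
exact: trS_qd.
Qed.

Lemma qd_bessel : (\int[leb d]_xi (trR g1 g2 xi ^+ 2 + trI g1 g2 xi ^+ 2)%:E <=
  \int[leb d]_x (g1 x ^+ 2 + g2 x ^+ 2)%:E)%E.
Proof. by apply: bessel_inequality => //; apply: (qd_integrable (K := K)). Qed.

End quad_dominated_symbols.

Lemma fourierE f (K : R) xi :
  measurable_fun setT (fun x => complex.Re (f x)) -> measurable_fun setT (fun x => complex.Im (f x)) ->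
  (forall x, `|complex.Re (f x)| <= K * qdv x) -> (forall x, `|complex.Im (f x)| <= K * qdv x) ->
  fourier f xi = (trR (fun x => complex.Re (f x)) (fun x => complex.Im (f x)) xi +i*
    trI (fun x => complex.Re (f x)) (fun x => complex.Im (f x)) xi)%C.
Proof.
move=> m1 m2 K1 K2; rewrite /fourier /cintRd; congr (_ +i* _)%C.
  rewrite -(intRd_trC m1 m2 K1 K2); congr (fine (intRd _)); apply/funext => x.
  by rewrite Re_mul_expi cosN sinN mulrN opprK.
rewrite -(intRd_trS m1 m2 K1 K2); congr (fine (intRd _)); apply/funext => x.
by rewrite Im_mul_expi cosN sinN mulrN.
Qed.

(** A modulus is unchanged by conjugation, so the inverse transform of [g] may be replaced by the
    direct transform of its conjugate and a single Bessel inequality serves for both. *)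
Lemma inv_fourierE g (K : R) x :
  measurable_fun setT (fun x => complex.Re (g x)) -> measurable_fun setT (fun x => complex.Im (g x)) ->
  (forall x, `|complex.Re (g x)| <= K * qdv x) -> (forall x, `|complex.Im (g x)| <= K * qdv x) ->
  cabs (inv_fourier g x) = Num.sqrt
   (trR (fun x => complex.Re (g x)) (fun x => - complex.Im (g x)) x ^+ 2 +
    trI (fun x => complex.Re (g x)) (fun x => - complex.Im (g x)) x ^+ 2).
Proof.
move=> m1 m2 K1 K2.
have m2' : measurable_fun setT (fun x => - complex.Im (g x)) by exact: measurableT_comp.
have K2' z : `|- complex.Im (g z)| <= K * qdv z by rewrite normrN.
rewrite /inv_fourier /cintRd /cabs /=; congr (Num.sqrt (_ ^+ 2 + _)).
  rewrite -(intRd_trC m1 m2' K1 K2'); congr (fine (intRd _)); apply/funext => xi.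
  by rewrite Re_mul_expi (dotvC x xi) /trC mulNr.
rewrite -sqrrN; congr (_ ^+ 2).
rewrite -(intRd_trS m1 m2' K1 K2').
have -> : (fun xi => (complex.Im (g xi * expi (2 * pi * dotv x xi)))%:E) =
    (fun xi => (-1 * trS (fun x => complex.Re (g x)) (fun x => - complex.Im (g x)) x xi)%:E).
  apply/funext => xi; rewrite Im_mul_expi (dotvC x xi) /trS; congr EFin; ring.
have mS := measurable_trS m1 m2' (xi := fun=> x) (measurable_cst _) (@measurable_id _ _ _).
rewrite !(qd_intRdE (K := K + K))//; last 3 first.
- exact: measurable_funM.
- by move=> y; rewrite mulN1r normrN; exact: trS_qd.
- exact: trS_qd.
rewrite -[in RHS](@opprK _ (fine (\int[leb d]_x0 _)%E)); congr (- _).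
have iS : (leb d).-integrable setT (EFin \o trS (fun x => complex.Re (g x)) (fun x => - complex.Im (g x)) x).
  by apply: (qd_integrable (K := K + K)) => //; exact: trS_qd.
have := @RintegralZl _ _ _ (leb d) setT _ (-1) measurableT iS.
by rewrite /Rintegral mulN1r => ->; rewrite ?opprK.
Qed.

Lemma hypot_triangle (a b c e : R) :
  Num.sqrt ((a + c) ^+ 2 + (b + e) ^+ 2) <= Num.sqrt (a ^+ 2 + b ^+ 2) + Num.sqrt (c ^+ 2 + e ^+ 2).
Proof.
set u := Num.sqrt (a ^+ 2 + b ^+ 2); set w := Num.sqrt (c ^+ 2 + e ^+ 2).
have u0 : 0 <= u := sqrtr_ge0 _; have w0 : 0 <= w := sqrtr_ge0 _.
have u2 : u ^+ 2 = a ^+ 2 + b ^+ 2 by rewrite sqr_sqrtr// addr_ge0 ?sqr_ge0.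
have w2 : w ^+ 2 = c ^+ 2 + e ^+ 2 by rewrite sqr_sqrtr// addr_ge0 ?sqr_ge0.
have cs : a * c + b * e <= u * w.
  rewrite (le_trans (ler_norm _))// -(@ler_pXn2r _ 2)// ?nnegrE ?mulr_ge0//.
  rewrite real_normK ?num_real// exprMn u2 w2 -subr_ge0.
  by rewrite (_ : _ - _ = (a * e - b * c) ^+ 2) ?sqr_ge0//; ring.
rewrite -[leRHS]ger0_norm ?addr_ge0// -sqrtr_sqr ler_sqrt ?sqr_ge0//.
rewrite [leRHS]sqrrD u2 w2 (_ : _ + _ = a ^+ 2 + b ^+ 2 + (a * c + b * e) *+ 2 + (c ^+ 2 + e ^+ 2)); last by ring.
by rewrite lerD2r lerD2l lerMn2r cs orbT.
Qed.

End fourier_formulas.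

(** * Multipliers depending on a frame *)

Section multiplier_family.
Context {R : realType} {d : nat} (v : nat -> 'rV[R]_d).
Variables (p1 p2 : 'rV[R]_d -> R) (K : R).
Hypotheses (mp1 : measurable_fun setT p1) (mp2 : measurable_fun setT p2).
Hypotheses (p1K : forall x, `|p1 x| <= K * qdv x) (p2K : forall x, `|p2 x| <= K * qdv x).
Implicit Types (a b : frames R d) (x xi : 'rV[R]_d).

Section symbol.
Variables s1 s2 : frames R d -> 'rV[R]_d -> R.

(* The multiplier is [(p1 + i p2) (s1 + i s2) = sym1 - i sym2]; the conjugate turns the
   inverse Fourier transform into the Fourier transform [trR + i trI]. *)
Definition sym1 b xi := p1 xi * s1 b xi - p2 xi * s2 b xi.
Definition sym2 b xi := - (p1 xi * s2 b xi + p2 xi * s1 b xi).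
Definition opU b x := trR (sym1 b) (sym2 b) x.
Definition opV b x := trI (sym1 b) (sym2 b) x.
Definition opA b x := Num.sqrt (opU b x ^+ 2 + opV b x ^+ 2).

(** The bound 2 accommodates differences of two symbols that are bounded by 1, so the increments are
    covered by the same lemmas. *)
Definition good_symbol := [/\ measurable_fun setT (fun p : frames R d * 'rV[R]_d => s1 p.1 p.2),
  measurable_fun setT (fun p : frames R d * 'rV[R]_d => s2 p.1 p.2),
  forall b xi, `|s1 b xi| <= 2 & forall b xi, `|s2 b xi| <= 2].

Hypothesis gs : good_symbol.

Let ms1 : measurable_fun setT (fun p : frames R d * 'rV[R]_d => s1 p.1 p.2). Proof. by case: gs. Qed.
Let ms2 : measurable_fun setT (fun p : frames R d * 'rV[R]_d => s2 p.1 p.2). Proof. by case: gs. Qed.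
Let s1le b xi : `|s1 b xi| <= 2. Proof. by case: gs. Qed.
Let s2le b xi : `|s2 b xi| <= 2. Proof. by case: gs. Qed.

Let K4 : R := 2 * K + 2 * K.

Let prodle (p s : R) xi : `|p| <= K * qdv xi -> `|s| <= 2 -> `|p * s| <= 2 * K * qdv xi.
Proof. by move=> pK s2'; rewrite normrM mulrC -mulrA ler_pM. Qed.

Lemma sym1_le b xi : `|sym1 b xi| <= K4 * qdv xi.
Proof.
rewrite (le_trans (ler_normB _ _))// /K4 [leRHS]mulrDl lerD//.
  exact: prodle.
exact: prodle.
Qed.

Lemma sym2_le b xi : `|sym2 b xi| <= K4 * qdv xi.
Proof.
rewrite normrN (le_trans (ler_normD _ _))// /K4 [leRHS]mulrDl lerD//.
  exact: prodle.
exact: prodle.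
Qed.

Lemma measurable_sym1 : measurable_fun setT (fun p : frames R d * 'rV[R]_d => sym1 p.1 p.2).
Proof.
by apply: measurable_funB; apply: measurable_funM => //; exact: measurableT_comp.
Qed.

Lemma measurable_sym2 : measurable_fun setT (fun p : frames R d * 'rV[R]_d => sym2 p.1 p.2).
Proof.
apply: measurableT_comp => //.
by apply: measurable_funD; apply: measurable_funM => //; exact: measurableT_comp.
Qed.

Let msym1 b : measurable_fun setT (sym1 b).
Proof. exact: (measurableT_comp measurable_sym1 (measurable_pair1 b)). Qed.

Let msym2 b : measurable_fun setT (sym2 b).
Proof. exact: (measurableT_comp measurable_sym2 (measurable_pair1 b)). Qed.

Let T := (frames R d * 'rV[R]_d)%type.

Let mph : measurable_fun setT (fun q : T * 'rV[R]_d => 2 * pi * dotv q.2 q.1.2).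
Proof.
apply: measurable_funM => //; apply: measurable_dotv => //.
exact: (measurableT_comp measurable_snd measurable_fst).
Qed.

Let mbx : measurable_fun setT (fun q : T * 'rV[R]_d => (q.1.1, q.2)).
Proof.
apply: measurable_fun_pair => //.
exact: (measurableT_comp measurable_fst measurable_fst).
Qed.

Let mJ1 : measurable_fun setT (fun q : T * 'rV[R]_d => sym1 q.1.1 q.2).
Proof. exact: (measurableT_comp measurable_sym1 mbx). Qed.

Let mJ2 : measurable_fun setT (fun q : T * 'rV[R]_d => sym2 q.1.1 q.2).
Proof. exact: (measurableT_comp measurable_sym2 mbx). Qed.

Lemma measurable_opU : measurable_fun setT (fun q : T => opU q.1 q.2).
Proof.
apply: (measurable_param_integral (mu := leb d)
  (F := fun q : T * 'rV[R]_d => trC (sym1 q.1.1) (sym2 q.1.1) q.1.2 q.2) _ (integrable_qdv d (K4 + K4))).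
  apply: measurable_funD; apply: measurable_funM => //.
    exact: measurable_cos_comp.
  exact: measurable_sin_comp.
by move=> [b x] xi; apply: trC_qd; [exact: sym1_le|exact: sym2_le].
Qed.

Lemma measurable_opV : measurable_fun setT (fun q : T => opV q.1 q.2).
Proof.
apply: (measurable_param_integral (mu := leb d)
  (F := fun q : T * 'rV[R]_d => trS (sym1 q.1.1) (sym2 q.1.1) q.1.2 q.2) _ (integrable_qdv d (K4 + K4))).
  apply: measurable_funB; apply: measurable_funM => //.
    exact: measurable_cos_comp.
  exact: measurable_sin_comp.
by move=> [b x] xi; apply: trS_qd; [exact: sym1_le|exact: sym2_le].
Qed.

Lemma measurable_opA : measurable_fun setT (fun q : T => opA q.1 q.2).
Proof.
apply: (measurableT_comp (f := @Num.sqrt R)).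
  exact: continuous_measurable_fun (@sqrt_continuous R).
by apply: measurable_funD; apply: measurable_funX; [exact: measurable_opU|exact: measurable_opV].
Qed.

Lemma opA_ge0 b x : 0 <= opA b x. Proof. exact: sqrtr_ge0. Qed.

Lemma opA_sqr b x : opA b x ^+ 2 = opU b x ^+ 2 + opV b x ^+ 2.
Proof. by rewrite sqr_sqrtr// addr_ge0 ?sqr_ge0. Qed.

Definition opB : R := 2 * \int[leb d]_x ((K4 + K4) * qdv x).

Lemma opA_le b x : opA b x <= opB.
Proof.
set N := \int[leb d]_x ((K4 + K4) * qdv x).
have iq := integrable_qdv d (K4 + K4).
have U : `|opU b x| <= N.
  apply: Rintegral_norm_le => // [|xi].
    exact: (measurable_trC (msym1 b) (msym2 b) (xi := fun=> x)).
  by apply: trC_qd; [exact: sym1_le|exact: sym2_le].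
have V : `|opV b x| <= N.
  apply: Rintegral_norm_le => // [|xi].
    exact: (measurable_trS (msym1 b) (msym2 b) (xi := fun=> x)).
  by apply: trS_qd; [exact: sym1_le|exact: sym2_le].
have N0 : 0 <= N := le_trans (normr_ge0 _) U.
have sq y : `|y| <= N -> y ^+ 2 <= N ^+ 2.
  by move=> yN; rewrite -real_normK ?num_real// lerXn2r ?nnegrE.
rewrite -(@ler_pXn2r _ 2)// ?nnegrE ?opA_ge0 ?mulr_ge0// opA_sqr.
rewrite (le_trans (lerD (sq _ U) (sq _ V)))// exprMn -/N.
by have := sqr_ge0 N; lra.
Qed.

Local Open Scope ereal_scope.

Lemma op_bessel b : \int[leb d]_x (opA b x ^+ 2)%:E <=
  \int[leb d]_xi ((p1 xi ^+ 2 + p2 xi ^+ 2) * (s1 b xi ^+ 2 + s2 b xi ^+ 2))%:E.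
Proof.
under eq_integral do rewrite opA_sqr.
apply: (le_trans (qd_bessel (msym1 b) (msym2 b) (sym1_le b) (sym2_le b))).
rewrite le_eqVlt; apply/orP; left; apply/eqP; apply: eq_integral => xi _.
by rewrite /sym1 /sym2; congr EFin; ring.
Qed.

Variables (n m : nat) (a : frames R d).

Definition avgop x : \bar R := frame_avg v n m a (fun b => (opA b x)%:E).

Let mopA_x x : measurable_fun setT (fun b => opA b x).
Proof.
apply: (measurableT_comp measurable_opA (g := fun b => (b, x))).
exact: measurable_fun_pair.
Qed.

Lemma avgop_ge0 x : 0 <= avgop x.
Proof. by apply: frame_avg_ge0 => b; rewrite lee_fin opA_ge0. Qed.

Lemma avgop_le x : avgop x <= opB%:E.
Proof. by apply: frame_avg_le_cst => b; rewrite lee_fin ?opA_ge0 ?opA_le. Qed.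

Lemma avgop_fin x : avgop x \is a fin_num.
Proof. by rewrite ge0_fin_numE ?avgop_ge0// (le_lt_trans (avgop_le x))// ltry. Qed.

Let mswap (f : frames R d * 'rV[R]_d -> R) : measurable_fun setT f ->
  measurable_fun setT (fun q : 'rV[R]_d * frames R d => f (q.2, q.1)).
Proof. by move=> mf; apply: (measurableT_comp mf); exact: measurable_fun_pair. Qed.

Let mH : measurable_fun setT (fun q : 'rV[R]_d * frames R d => (opA q.2 q.1)%:E).
Proof. by apply/measurable_EFinP; exact: (mswap measurable_opA). Qed.

Lemma measurable_avgop : measurable_fun setT avgop.
Proof.
have H0 (q : 'rV[R]_d * frames R d) : 0 <= (opA q.2 q.1)%:E by rewrite lee_fin opA_ge0.
have mF := @measurable_frame_avg _ _ v _ _ n m _ mH H0.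
apply: (measurableT_comp mF (g := fun x => (x, a))).
exact: measurable_fun_pair.
Qed.

Lemma avgop_L2 : \int[leb d]_x (avgop x * avgop x) <=
  \int[leb d]_xi ((p1 xi ^+ 2 + p2 xi ^+ 2)%:E *
    frame_avg v n m a (fun b => (s1 b xi ^+ 2 + s2 b xi ^+ 2)%:E)).
Proof.
apply: (@le_trans _ _ (\int[leb d]_x frame_avg v n m a (fun b => (opA b x ^+ 2)%:E))).
  apply: le_integralT => x; first by rewrite mule_ge0// avgop_ge0.
  by apply: (@frame_avg_jensen _ _ v n m a (fun b => opA b x) opB) => [|b|b]; [exact: mopA_x|exact: opA_ge0|exact: opA_le].
have mH2 : measurable_fun setT (fun q : 'rV[R]_d * frames R d => (opA q.2 q.1 ^+ 2)%:E).
  by apply/measurable_EFinP; apply: measurable_funX; exact: (mswap measurable_opA).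
rewrite (@frame_avg_tonelli _ _ v _ _ (leb d) n m a (fun q => (opA q.2 q.1 ^+ 2)%:E))//=; last first.
  by move=> q; rewrite lee_fin sqr_ge0.
have mS : measurable_fun setT (fun q : 'rV[R]_d * frames R d => (s1 q.2 q.1 ^+ 2 + s2 q.2 q.1 ^+ 2)%R).
  by apply: measurable_funD; apply: measurable_funX; [exact: (mswap ms1)|exact: (mswap ms2)].
apply: (@le_trans _ _ (frame_avg v n m a (fun b => \int[leb d]_xi ((p1 xi ^+ 2 + p2 xi ^+ 2) * (s1 b xi ^+ 2 + s2 b xi ^+ 2))%:E))).
  apply: le_frame_avg => b; last exact: op_bessel.
  by apply: integral_ge0 => x _; rewrite lee_fin sqr_ge0.
rewrite -(@frame_avg_tonelli _ _ v _ _ (leb d) n m a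
  (fun q => ((p1 q.1 ^+ 2 + p2 q.1 ^+ 2) * (s1 q.2 q.1 ^+ 2 + s2 q.2 q.1 ^+ 2))%:E))//=; last 2 first.
- apply/measurable_EFinP; apply: measurable_funM => //.
  by apply: measurable_funD; apply: measurable_funX; exact: measurableT_comp.
- by move=> q; rewrite lee_fin mulr_ge0// addr_ge0 ?sqr_ge0.
rewrite le_eqVlt; apply/orP; left; apply/eqP; apply: eq_integral => xi _.
under eq_fun do rewrite EFinM.
rewrite frame_avgZl//.
- by rewrite addr_ge0 ?sqr_ge0.
- apply/measurable_EFinP; apply: (measurableT_comp mS (g := fun b => (xi, b))).
  exact: measurable_fun_pair.
- by move=> b; rewrite lee_fin addr_ge0 ?sqr_ge0.
Qed.

End symbol.

Section two_symbols.
Variables s1 s2 t1 t2 : frames R d -> 'rV[R]_d -> R.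
Hypotheses (gs : good_symbol s1 s2) (gt : good_symbol t1 t2).
Let d1 b xi := t1 b xi - s1 b xi.
Let d2 b xi := t2 b xi - s2 b xi.
Hypothesis gd : good_symbol d1 d2.
Variables (n m : nat) (a : frames R d).

Let q1 c1 c2 (gc : good_symbol c1 c2) b : measurable_fun setT (sym1 c1 c2 b).
Proof. exact: (measurableT_comp (measurable_sym1 gc) (measurable_pair1 b)). Qed.

Let q2 c1 c2 (gc : good_symbol c1 c2) b : measurable_fun setT (sym2 c1 c2 b).
Proof. exact: (measurableT_comp (measurable_sym2 gc) (measurable_pair1 b)). Qed.

Let iC c1 c2 (gc : good_symbol c1 c2) b x :
  (leb d).-integrable setT (EFin \o trC (sym1 c1 c2 b) (sym2 c1 c2 b) x).
Proof.
apply: qd_integrable; last by apply: trC_qd; [exact: (sym1_le gc)|exact: (sym2_le gc)].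
exact: (measurable_trC (q1 gc b) (q2 gc b) (xi := fun=> x)).
Qed.

Let iS c1 c2 (gc : good_symbol c1 c2) b x :
  (leb d).-integrable setT (EFin \o trS (sym1 c1 c2 b) (sym2 c1 c2 b) x).
Proof.
apply: qd_integrable; last by apply: trS_qd; [exact: (sym1_le gc)|exact: (sym2_le gc)].
exact: (measurable_trS (q1 gc b) (q2 gc b) (xi := fun=> x)).
Qed.

Lemma opA_triangle b x : opA t1 t2 b x <= opA s1 s2 b x + opA d1 d2 b x.
Proof.
have -> : opA t1 t2 b x = Num.sqrt ((opU s1 s2 b x + opU d1 d2 b x) ^+ 2 + (opV s1 s2 b x + opV d1 d2 b x) ^+ 2).
  rewrite /opA; congr (Num.sqrt (_ ^+ 2 + _ ^+ 2)).
    rewrite /opU /trR -RintegralD//; [|exact: (iC gs)|exact: (iC gd)].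
    by apply: eq_Rintegral => xi _; rewrite /trC /sym1 /sym2 /d1 /d2; ring.
  rewrite /opV /trI -RintegralD//; [|exact: (iS gs)|exact: (iS gd)].
  by apply: eq_Rintegral => xi _; rewrite /trS /sym1 /sym2 /d1 /d2; ring.
exact: hypot_triangle.
Qed.

Lemma avgop_triangle x : (avgop t1 t2 n m a x <= avgop s1 s2 n m a x + avgop d1 d2 n m a x)%E.
Proof.
have mx c1 c2 (gc : good_symbol c1 c2) : measurable_fun setT (fun b => (opA c1 c2 b x)%:E).
  apply/measurable_EFinP; apply: (measurableT_comp (measurable_opA gc) (g := fun b => (b, x))).
  exact: measurable_fun_pair.
rewrite /avgop -frame_avgD.
- apply: le_frame_avg => b; first by rewrite lee_fin opA_ge0.
  by rewrite -EFinD lee_fin opA_triangle.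
- exact: mx.
- exact: mx.
- by move=> b; rewrite lee_fin opA_ge0.
- by move=> b; rewrite lee_fin opA_ge0.
Qed.

End two_symbols.

Section symbol_limit.
Variables (s1_ s2_ : nat -> frames R d -> 'rV[R]_d -> R) (s1 s2 : frames R d -> 'rV[R]_d -> R).
Hypothesis gs_ : forall i, good_symbol (s1_ i) (s2_ i).
Hypotheses (c1 : forall b xi, s1_ i b xi @[i --> \oo] --> s1 b xi)
  (c2 : forall b xi, s2_ i b xi @[i --> \oo] --> s2 b xi).
Variables (n m : nat) (a : frames R d).

(** Continuity in the symbol at each fixed [x]; it is what carries bounds at dyadic values of [lam]
    over to all values. *)
Lemma avgop_cvg x : avgop (s1_ i) (s2_ i) n m a x @[i --> \oo] --> avgop s1 s2 n m a x.
Proof.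
apply: (@frame_avg_cvg _ _ v n m a _ _ opB) => [i|i b|i b|b].
- apply/measurable_EFinP; apply: (measurableT_comp (measurable_opA (gs_ i)) (g := fun b => (b, x))).
  exact: measurable_fun_pair.
- by rewrite lee_fin opA_ge0.
- by rewrite lee_fin (opA_le (gs_ i)).
apply: cvg_EFin; first by near=> i.
have q1 i : measurable_fun setT (sym1 (s1_ i) (s2_ i) b).
  exact: (measurableT_comp (measurable_sym1 (gs_ i)) (measurable_pair1 b)).
have q2 i : measurable_fun setT (sym2 (s1_ i) (s2_ i) b).
  exact: (measurableT_comp (measurable_sym2 (gs_ i)) (measurable_pair1 b)).
have y1 xi : sym1 (s1_ i) (s2_ i) b xi @[i --> \oo] --> sym1 s1 s2 b xi.
  by apply: cvgB; apply: cvgM; do ?exact: cvg_cst.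
have y2 xi : sym2 (s1_ i) (s2_ i) b xi @[i --> \oo] --> sym2 s1 s2 b xi.
  by apply: cvgN; apply: cvgD; apply: cvgM; do ?exact: cvg_cst.
have cU : opU (s1_ i) (s2_ i) b x @[i --> \oo] --> opU s1 s2 b x.
  apply: (cvg_Rintegral _ _ (integrable_qdv d _)).
  - by move=> i; exact: (measurable_trC (q1 i) (q2 i) (xi := fun=> x)).
  - by move=> xi; apply: cvgD; apply: cvgM; do ?exact: cvg_cst.
  - by move=> i xi; apply: trC_qd; [exact: (sym1_le (gs_ i))|exact: (sym2_le (gs_ i))].
have cV : opV (s1_ i) (s2_ i) b x @[i --> \oo] --> opV s1 s2 b x.
  apply: (cvg_Rintegral _ _ (integrable_qdv d _)).
  - by move=> i; exact: (measurable_trS (q1 i) (q2 i) (xi := fun=> x)).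
  - by move=> xi; apply: cvgB; apply: cvgM; do ?exact: cvg_cst.
  - by move=> i xi; apply: trS_qd; [exact: (sym1_le (gs_ i))|exact: (sym2_le (gs_ i))].
apply: (cvg_comp _ (@Num.sqrt R)); last exact: sqrt_continuous.
by apply: cvgD; rewrite !expr2; apply: cvgM.
Unshelve. all: by end_near. Qed.

End symbol_limit.

End multiplier_family.

(** * The spherical symbols and their averaged decay *)

Section spherical_symbols.
Context {R : realType} {d k : nat}.
Variable v : nat -> 'rV[R]_d.
Hypothesis vfree : row_free (\matrix_(i < k) v i.+1).
Implicit Types (m : nat) (a b : frames R d) (xi x : 'rV[R]_d) (lam : R).

Definition S1 m lam b xi : R := shR v m b (lam *: xi).
Definition S2 m lam b xi : R := shI v m b (lam *: xi).

Let i1 : (gam d).-integrable setT (EFin \o cst (1 : R)).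
Proof. by apply: (@bounded_integrable_gam _ _ _ 1) => // x; rewrite normr1. Qed.

Let int1 : \int[gam d]_x (cst (1 : R) x) = 1.
Proof. by rewrite /Rintegral (_ : integral _ _ _ = 1%E)//; exact: (@integral_gam_cst R d 1%E). Qed.

Let T := (frames R d * 'rV[R]_d)%type.

Let mph m lam : measurable_fun setT (fun q : T * 'rV[R]_d =>
  2 * pi * dotv (fpoint v m q.1.1 q.2) (lam *: q.1.2)).
Proof.
apply: measurable_funM => //; apply: measurable_dotv.
  by apply: measurable_fpoint => //; exact: (measurableT_comp measurable_fst measurable_fst).
by apply: measurable_scalev => //; exact: (measurableT_comp measurable_snd measurable_fst).
Qed.

Let mph1 m b xi : measurable_fun setT (fun x => 2 * pi * dotv (fpoint v m b x) xi).
Proof. exact: measurable_sph_phase. Qed.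

Let mS1 m lam : measurable_fun setT (fun q : T => S1 m lam q.1 q.2).
Proof.
apply: (measurable_param_integral (mu := gam d) (h := cst 1)
  (F := fun q : T * 'rV[R]_d => cos (2 * pi * dotv (fpoint v m q.1.1 q.2) (lam *: q.1.2)))) => //.
  exact: measurable_cos_comp.
by move=> q x; exact: abs_cos_le1.
Qed.

Let mS2 m lam : measurable_fun setT (fun q : T => S2 m lam q.1 q.2).
Proof.
apply: measurableT_comp => //.
apply: (measurable_param_integral (mu := gam d) (h := cst 1)
  (F := fun q : T * 'rV[R]_d => sin (2 * pi * dotv (fpoint v m q.1.1 q.2) (lam *: q.1.2)))) => //.
  exact: measurable_sin_comp.
by move=> q x; exact: abs_sin_le1.
Qed.

Let S1_le m lam b xi : `|S1 m lam b xi| <= 1.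
Proof.
rewrite -[leRHS]int1; apply: Rintegral_norm_le => // [|x]; last exact: abs_cos_le1.
by apply: measurable_cos_comp; exact: mph1.
Qed.

Let S2_le m lam b xi : `|S2 m lam b xi| <= 1.
Proof.
rewrite normrN -[leRHS]int1; apply: Rintegral_norm_le => // [|x]; last exact: abs_sin_le1.
by apply: measurable_sin_comp; exact: mph1.
Qed.

Lemma good_S m lam : good_symbol (S1 m lam) (S2 m lam).
Proof.
split => [||b xi|b xi]; [exact: mS1|exact: mS2| |].
- by rewrite (le_trans (S1_le _ _ _ _))// ler1n.
- by rewrite (le_trans (S2_le _ _ _ _))// ler1n.
Qed.

Lemma good_SB m lam lam' : good_symbol (fun b xi => S1 m lam' b xi - S1 m lam b xi)
  (fun b xi => S2 m lam' b xi - S2 m lam b xi).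
Proof.
split => [||b xi|b xi].
- by apply: measurable_funB; exact: mS1.
- by apply: measurable_funB; exact: mS2.
- by rewrite (le_trans (ler_normB _ _))// lerD.
- by rewrite (le_trans (ler_normB _ _))// lerD.
Qed.

Let phase_cvg (l_ : nat -> R) lam x (y : 'rV[R]_d) : l_ i @[i --> \oo] --> lam ->
  2 * pi * dotv x (l_ i *: y) @[i --> \oo] --> 2 * pi * dotv x (lam *: y).
Proof.
move=> cl; under eq_fun do rewrite dotvZr.
by rewrite dotvZr; apply: cvgM; [exact: cvg_cst|apply: cvgM => //; exact: cvg_cst].
Qed.

Lemma S1_cvg m (l_ : nat -> R) lam b xi : l_ i @[i --> \oo] --> lam ->
  S1 m (l_ i) b xi @[i --> \oo] --> S1 m lam b xi.
Proof.
move=> cl; apply: (cvg_Rintegral _ _ i1) => [i|x|i x].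
- by apply: measurable_cos_comp; exact: mph1.
- have h := @phase_cvg l_ lam (fpoint v m b x) xi cl.
  exact: (continuous_cvg _ (@continuous_cos R _) h).
- exact: abs_cos_le1.
Qed.

Lemma S2_cvg m (l_ : nat -> R) lam b xi : l_ i @[i --> \oo] --> lam ->
  S2 m (l_ i) b xi @[i --> \oo] --> S2 m lam b xi.
Proof.
move=> cl; apply: cvgN; apply: (cvg_Rintegral _ _ i1) => [i|x|i x].
- by apply: measurable_sin_comp; exact: mph1.
- have h := @phase_cvg l_ lam (fpoint v m b x) xi cl.
  exact: (continuous_cvg _ (@continuous_sin R _) h).
- exact: abs_sin_le1.
Qed.

Section averaged_decay.
Variable m : nat.
Hypotheses (mk : (m < k)%N) (md : (m + 3 <= d)%N).
Local Open Scope ereal_scope.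

(** Averaging starts from the empty frame, whose projection [perp] is the identity: the weight of a
    unit vector is then [pw 1 = 1]. *)
Let frame_avg_pw0 xi (G : frames R d -> \bar R) a (C0 : R) : xi != 0%R -> (0 < C0)%R ->
  (forall b, 0 <= G b) ->
  (forall b, adm v m b -> G b <= C0%:E * pw (perp2 m b ((vnorm xi)^-1 *: xi))) ->
  frame_avg v m 0 a G <= (C0 * pw_step_cst ^+ m)%:E.
Proof.
move=> xi0 C00 G0 GC.
have a0 : adm v 0 a by [].
have n0 : (vnorm xi != 0)%R by rewrite vnorm_eq0.
have mk' : (0 + m <= k)%N by rewrite add0n ltnW.
have md' : (0 + m + 2 <= d)%N by rewrite add0n (leq_trans _ md)// leq_add2l.
apply: (le_trans (frame_avg_pw vfree (u := ((vnorm xi)^-1 *: xi)%R) mk' md' a0 C00 G0 GC)).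
rewrite /perp2 perp_id//; last exact (adm_unit vfree (leq0n k) a0).
rewrite (_ : dotv _ _ = 1)%R ?pw1 ?mule1//.
by rewrite dotvZl dotvZr -vnorm_sqr; field.
Qed.

Lemma frame_avg_S_le xi a lam : xi != 0%R -> (0 < lam)%R ->
  frame_avg v m 0 a (fun b => (S1 m lam b xi ^+ 2 + S2 m lam b xi ^+ 2)%:E) <=
  (sigma_hat_cst v m * pw_step_cst ^+ m * (lam * vnorm xi) `^ (- 3^-1))%:E.
Proof.
move=> xi0 l0; have n0 : (0 < vnorm xi)%R by rewrite lt_neqAle vnorm_ge0 eq_sym vnorm_eq0 xi0.
rewrite (mulrAC (sigma_hat_cst v m)); apply: (frame_avg_pw0 a xi0).
- by rewrite mulr_gt0 ?sigma_hat_cst_gt0// powR_gt0// mulr_gt0.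
- by move=> b; rewrite lee_fin addr_ge0 ?sqr_ge0.
- by move=> b ab; exact: (sh_sqr_pw vfree mk md ab xi0 l0).
Qed.

Lemma frame_avg_SB_le xi a lam lam' h : xi != 0%R -> (0 < lam)%R -> (lam <= lam')%R -> (0 < h)%R ->
  (lam' - lam <= h * lam)%R ->
  frame_avg v m 0 a (fun b => ((S1 m lam' b xi - S1 m lam b xi) ^+ 2 + (S2 m lam' b xi - S2 m lam b xi) ^+ 2)%:E) <=
  (sigma_hat_cst v m * pw_step_cst ^+ m * h `^ (4 / 3) * (lam * vnorm xi) `^ (- 3^-1))%:E.
Proof.
move=> xi0 l0 ll h0 hl; have n0 : (0 < vnorm xi)%R by rewrite lt_neqAle vnorm_ge0 eq_sym vnorm_eq0 xi0.
rewrite (_ : (_ * _ * _ * _)%R = (sigma_hat_cst v m * h `^ (4 / 3) * (lam * vnorm xi) `^ (- 3^-1) * pw_step_cst ^+ m)%R); last by ring.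
apply: (frame_avg_pw0 a xi0).
- by rewrite !mulr_gt0 ?sigma_hat_cst_gt0// powR_gt0// mulr_gt0.
- by move=> b; rewrite lee_fin addr_ge0 ?sqr_ge0.
- move=> b ab; apply: le_trans (sh_diff_pw vfree mk md ab xi0 l0 ll h0 hl).
  rewrite lee_fin /S1 /S2 -(opprB (shR v m b (lam *: xi))) sqrrN.
  by rewrite -(opprB (shI v m b (lam *: xi))) sqrrN.
Qed.

End averaged_decay.
End spherical_symbols.

Section schwartz_multiplier.
Context {R : realType} {d k : nat}.
Variable v : nat -> 'rV[R]_d.
Hypothesis vfree : row_free (\matrix_(i < k) v i.+1).
Variables (mL f : 'rV[R]_d -> R[i]) (B L : R).
Hypotheses (smL : smoothC mL) (mLB : forall xi, cabs (mL xi) <= B * Num.min 1 (L * vnorm xi)).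
Hypotheses (L0 : 0 < L) (sf : schwartz f).
Implicit Types (x xi : 'rV[R]_d).

Let f1 x := complex.Re (f x).
Let f2 x := complex.Im (f x).
Let m1 x := complex.Re (mL x).
Let m2 x := complex.Im (mL x).

Let sf1 : schwartzR f1. Proof. by case: sf => -[s1 _] [r1 _]; split. Qed.
Let sf2 : schwartzR f2. Proof. by case: sf => -[_ s2] [_ r2]; split. Qed.

Let exK : exists K, (forall x, `|f1 x| <= K * qdv x) /\ (forall x, `|f2 x| <= K * qdv x).
Proof.
have [K1 H1] := schwartzR_bound sf1; have [K2 H2] := schwartzR_bound sf2.
exists (Num.max K1 K2); split => x.
  by rewrite (le_trans (H1 x))// ler_wpM2r ?qdv_ge0// le_max lexx.
by rewrite (le_trans (H2 x))// ler_wpM2r ?qdv_ge0// le_max lexx orbT.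
Qed.

Let mf1 : measurable_fun setT f1. Proof. exact: schwartzR_measurable. Qed.
Let mf2 : measurable_fun setT f2. Proof. exact: schwartzR_measurable. Qed.

Let FR := trR f1 f2.
Let FI := trI f1 f2.

Let fourier_fE xi : fourier f xi = (FR xi +i* FI xi)%C.
Proof. by have [K [K1 K2]] := exK; exact: (fourierE xi mf1 mf2 K1 K2). Qed.

Let i1 : (leb d).-integrable setT (EFin \o f1).
Proof. by have [K [K1 _]] := exK; exact: (qd_integrable mf1 K1). Qed.
Let i2 : (leb d).-integrable setT (EFin \o f2).
Proof. by have [K [_ K2]] := exK; exact: (qd_integrable mf2 K2). Qed.

Let mFR : measurable_fun setT FR. Proof. exact: measurable_trR. Qed.
Let mFI : measurable_fun setT FI. Proof. exact: measurable_trI. Qed.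

Let exKF : exists K, (forall x, `|FR x| <= K * qdv x) /\ (forall x, `|FI x| <= K * qdv x).
Proof.
have [K [K1 K2]] := exK.
have mph xi : measurable_fun setT (fun x : 'rV[R]_d => 2 * pi * dotv x xi).
  by apply: measurable_funM => //; exact: measurable_dotv.
have iC (g : 'rV[R]_d -> R) xi : measurable_fun setT g -> (forall x, `|g x| <= K * qdv x) ->
    (leb d).-integrable setT (EFin \o (fun x => g x * cos (2 * pi * dotv x xi))).
  move=> mg gK; apply: (qd_integrable (K := K)) => [|x].
    by apply: measurable_funM => //; exact: measurable_cos_comp.
  by rewrite normrM (le_trans _ (gK x))// ler_piMr// abs_cos_le1.
have iS (g : 'rV[R]_d -> R) xi : measurable_fun setT g -> (forall x, `|g x| <= K * qdv x) ->
    (leb d).-integrable setT (EFin \o (fun x => g x * sin (2 * pi * dotv x xi))).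
  move=> mg gK; apply: (qd_integrable (K := K)) => [|x].
    by apply: measurable_funM => //; exact: measurable_sin_comp.
  by rewrite normrM (le_trans _ (gK x))// ler_piMr// abs_sin_le1.
have RE xi : FR xi = Ctr f1 xi + Str f2 xi.
  by rewrite /FR /trR RintegralD//; [exact: iC|exact: iS].
have IE xi : FI xi = Ctr f2 xi - Str f1 xi.
  by rewrite /FI /trI RintegralB//; [exact: iC|exact: iS].
have [L1 H1] := schwartzR_trig_bound sf1; have [L2 H2] := schwartzR_trig_bound sf2.
exists (L1 + L2); split => x.
  rewrite RE (le_trans (ler_normD _ _))// [leRHS]mulrDl lerD//.
    by rewrite (le_trans _ (H1 x))// lerDl.
  by rewrite (le_trans _ (H2 x))// lerDr.
rewrite IE (le_trans (ler_normB _ _))// addrC [leRHS]mulrDl lerD//.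
  by rewrite (le_trans _ (H1 x))// lerDr.
by rewrite (le_trans _ (H2 x))// lerDl.
Qed.

Let mm1 : measurable_fun setT m1.
Proof. by apply: continuous_measurable_rV; have [+ _] := smL; move=> /(_ [::])[]. Qed.
Let mm2 : measurable_fun setT m2.
Proof. by apply: continuous_measurable_rV; have [_ +] := smL; move=> /(_ [::])[]. Qed.

Definition mLf1 xi := FR xi * m1 xi - FI xi * m2 xi.
Definition mLf2 xi := FR xi * m2 xi + FI xi * m1 xi.

Lemma measurable_mLf1 : measurable_fun setT mLf1.
Proof. by apply: measurable_funB; exact: measurable_funM. Qed.
Lemma measurable_mLf2 : measurable_fun setT mLf2.
Proof. by apply: measurable_funD; exact: measurable_funM. Qed.

Let cabs2 xi : cabs (mL xi) ^+ 2 = m1 xi ^+ 2 + m2 xi ^+ 2.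
Proof. by rewrite sqr_sqrtr// addr_ge0 ?sqr_ge0. Qed.

Let cabs_ge0 xi : 0 <= cabs (mL xi). Proof. exact: sqrtr_ge0. Qed.

Let mLB' xi : cabs (mL xi) <= `|B|.
Proof.
have q0 : 0 <= Num.min 1 (L * vnorm xi) by rewrite le_min ler01/= mulr_ge0 ?vnorm_ge0// ltW.
rewrite (le_trans (mLB xi))// (le_trans (ler_norm _))// normrM ler_piMr//.
by rewrite (ger0_norm q0) ge_min lexx.
Qed.

Let m1_le xi : `|m1 xi| <= `|B|.
Proof.
apply: le_trans (mLB' xi); rewrite -sqrtr_sqr /cabs ler_sqrt ?addr_ge0 ?sqr_ge0//.
by rewrite lerDl sqr_ge0.
Qed.

Let m2_le xi : `|m2 xi| <= `|B|.
Proof.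
apply: le_trans (mLB' xi); rewrite -sqrtr_sqr /cabs ler_sqrt ?addr_ge0 ?sqr_ge0//.
by rewrite lerDr sqr_ge0.
Qed.

Lemma exists_mLf_bound : exists K, (forall x, `|mLf1 x| <= K * qdv x) /\ (forall x, `|mLf2 x| <= K * qdv x).
Proof.
have [K [K1 K2]] := exKF.
have prod (g h : R) x : `|g| <= K * qdv x -> `|h| <= `|B| -> `|g * h| <= `|B| * K * qdv x.
  by move=> gK hB; rewrite normrM mulrC -mulrA ler_pM.
exists (`|B| * K + `|B| * K); split => x.
  by rewrite (le_trans (ler_normB _ _))// mulrDl lerD//; apply: prod.
by rewrite (le_trans (ler_normD _ _))// mulrDl lerD//; apply: prod.
Qed.

Lemma mLf_sqr xi : mLf1 xi ^+ 2 + mLf2 xi ^+ 2 = (FR xi ^+ 2 + FI xi ^+ 2) * cabs (mL xi) ^+ 2.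
Proof. by rewrite cabs2 /mLf1 /mLf2; ring. Qed.

(* This is where the gain [(L / lam)^(1/3)] comes from. *)
Lemma mL_decay xi lam : xi != 0 -> 0 < lam ->
  cabs (mL xi) ^+ 2 * (lam * vnorm xi) `^ (- 3^-1) <= B ^+ 2 * (L / lam) `^ (3^-1).
Proof.
move=> xi0 l0; have n0 : 0 < vnorm xi by rewrite lt_neqAle vnorm_ge0 eq_sym vnorm_eq0 xi0.
have y0 : 0 < L * vnorm xi by rewrite mulr_gt0.
have q0 : 0 <= Num.min 1 (L * vnorm xi) by rewrite le_min ler01/= ltW.
have h : cabs (mL xi) ^+ 2 <= B ^+ 2 * (L * vnorm xi) `^ (3^-1).
  apply: (@le_trans _ _ ((B * Num.min 1 (L * vnorm xi)) ^+ 2)).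
    by rewrite lerXn2r ?nnegrE// (le_trans (cabs_ge0 xi)).
  rewrite exprMn ler_wpM2l ?sqr_ge0//.
  apply: (@le_trans _ _ (((L * vnorm xi) `^ (6^-1)) ^+ 2)).
    by rewrite lerXn2r ?nnegrE ?powR_ge0// min1_le_powR ?(ltW y0)//; lra.
  by rewrite -powR_mulrn ?powR_ge0// -powRrM (_ : 6^-1 * 2%:R = 3^-1 :> R)//; field.
apply: (le_trans (ler_wpM2r (powR_ge0 _ _) h)); rewrite -mulrA ler_wpM2l ?sqr_ge0//.
have li0 : 0 <= lam^-1 by rewrite invr_ge0 ltW.
rewrite powRN (powRM _ (ltW L0) (ltW n0)) (powRM _ (ltW l0) (ltW n0)) (powRM _ (ltW L0) li0).
rewrite -[lam^-1]powR_inv1 ?(ltW l0)// -[(lam `^ (-1)) `^ _]powRrM mulN1r powRN.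
have p1 : 0 < vnorm xi `^ 3^-1 by rewrite powR_gt0.
have p2 : 0 < lam `^ 3^-1 by rewrite powR_gt0.
by rewrite le_eqVlt; apply/orP; left; apply/eqP; field; rewrite !gt_eqF.
Qed.

Lemma cabs_mult_opE (ys : seq 'rV[R]_d) lam x :
  cabs (mult_op v mL ys lam f x) =
  opA mLf1 mLf2 (S1 v (size ys) lam) (S2 v (size ys) lam) (nth 0 ys) x.
Proof.
have [K [K1 K2]] := exists_mLf_bound.
have gs := good_S v (size ys) lam.
pose g xi := fourier f xi * mL xi * sigma_hat v ys (lam *: xi).
have ReE xi : complex.Re (g xi) = sym1 mLf1 mLf2 (S1 v (size ys) lam) (S2 v (size ys) lam) (nth 0 ys) xi.
  by rewrite /g fourier_fE sigma_hatE /sym1 /mLf1 /mLf2 /m1 /m2; case: (mL xi).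
have ImE xi : complex.Im (g xi) = - sym2 mLf1 mLf2 (S1 v (size ys) lam) (S2 v (size ys) lam) (nth 0 ys) xi.
  by rewrite /g fourier_fE sigma_hatE /sym2 opprK /mLf1 /mLf2 /m1 /m2 /S1 /S2; case: (mL xi) => p q.
have ReE' := funext ReE; have ImE' := funext ImE.
have ms1 := measurableT_comp (measurable_sym1 measurable_mLf1 measurable_mLf2 gs) (measurable_pair1 (nth 0 ys : frames R d)).
have ms2 := measurableT_comp (measurable_sym2 measurable_mLf1 measurable_mLf2 gs) (measurable_pair1 (nth 0 ys : frames R d)).
rewrite /mult_op (@inv_fourierE _ _ g (2 * K + 2 * K)).
- rewrite ReE' (_ : (fun x0 => - _) = sym2 mLf1 mLf2 (S1 v (size ys) lam) (S2 v (size ys) lam) (nth 0 ys))//.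
  by apply/funext => xi; rewrite ImE opprK.
- by rewrite ReE'.
- by rewrite ImE'; apply: measurableT_comp.
- by move=> xi; rewrite ReE; exact: (sym1_le K1 K2 gs).
- by move=> xi; rewrite ImE normrN; exact: (sym2_le K1 K2 gs).
Qed.

Local Open Scope ereal_scope.

Definition energy : \bar R := \int[leb d]_x (f1 x ^+ 2 + f2 x ^+ 2)%:E.

Lemma energyE : intRd (fun x => (cabs (f x) ^+ 2)%:E) = energy.
Proof.
rewrite ge0_intRdE.
- by apply: eq_integral => x _; rewrite sqr_sqrtr// addr_ge0 ?sqr_ge0.
- rewrite (_ : (fun x => _) = (fun x => (f1 x ^+ 2 + f2 x ^+ 2)%:E)).
    by apply/measurable_EFinP; apply: measurable_funD; exact: measurable_funX.
  by apply/funext => x; rewrite sqr_sqrtr// addr_ge0 ?sqr_ge0.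
- by move=> x; rewrite lee_fin sqr_ge0.
Qed.

Lemma energy_ge0 : 0 <= energy.
Proof. by apply: integral_ge0 => x _; rewrite lee_fin addr_ge0 ?sqr_ge0. Qed.

Lemma energy_fin : energy \is a fin_num.
Proof.
have [K [K1 K2]] := exK.
apply: (@integrable_fin_num _ _ _ _ _ _ (EFin \o (fun x => f1 x ^+ 2 + f2 x ^+ 2)%R)) => //.
apply: (qd_integrable (K := (K ^+ 2 + K ^+ 2)%R)).
  by apply: measurable_funD; exact: measurable_funX.
have q1 (x : 'rV[R]_d) : (qdv x <= 1)%R.
  rewrite /qdv -[leRHS](_ : \prod_(i < d) 1 = 1)%R; last by rewrite big1.
  apply: ler_prod => i _; rewrite qd_ge0/= /qd invf_le1 ?lerDl ?sqr_ge0//.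
  by rewrite ltr_pwDl ?sqr_ge0.
have sq (y : R) x : (`|y| <= K * qdv x)%R -> (y ^+ 2 <= K ^+ 2 * qdv x)%R.
  move=> yK; rewrite -real_normK ?num_real//.
  apply: (@le_trans _ _ ((K * qdv x) ^+ 2)%R).
    by rewrite lerXn2r ?nnegrE// (le_trans _ yK).
  by rewrite exprMn ler_wpM2l ?sqr_ge0// expr2 ler_piMr ?qdv_ge0.
by move=> x; rewrite ger0_norm ?addr_ge0 ?sqr_ge0// mulrDl lerD// sq.
Qed.

(** Only the averaged decay of the symbol enters, so the statement applies to the spherical symbols
    as well as to their increments, with different [C]. *)
Lemma avgop_energy (s1 s2 : frames R d -> 'rV[R]_d -> R) (n m : nat) a (C lam : R) :
  good_symbol s1 s2 -> (0 <= C)%R -> (0 < lam)%R ->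
  (forall xi, xi != 0%R -> frame_avg v n m a (fun b => (s1 b xi ^+ 2 + s2 b xi ^+ 2)%:E) <=
     (C * (lam * vnorm xi) `^ (- 3^-1))%:E) ->
  \int[leb d]_x (avgop v mLf1 mLf2 s1 s2 n m a x * avgop v mLf1 mLf2 s1 s2 n m a x) <=
  (C * B ^+ 2 * (L / lam) `^ (3^-1))%:E * energy.
Proof.
move=> gs C0 l0 hC; have [K [K1 K2]] := exists_mLf_bound.
have F0 (G : frames R d -> \bar R) : (forall b, 0 <= G b) -> 0 <= frame_avg v n m a G by exact: frame_avg_ge0.
apply: (le_trans (avgop_L2 v measurable_mLf1 measurable_mLf2 K1 K2 gs n m a)).
set D : R := (C * B ^+ 2 * (L / lam) `^ (3^-1))%R.
have D0 : (0 <= D)%R by rewrite mulr_ge0 ?powR_ge0// mulr_ge0// sqr_ge0.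
apply: (@le_trans _ _ (\int[leb d]_xi (D%:E * (FR xi ^+ 2 + FI xi ^+ 2)%:E))).
  apply: le_integralT => xi.
    rewrite mule_ge0 ?F0//; first by rewrite lee_fin addr_ge0 ?sqr_ge0.
    by move=> b; rewrite lee_fin addr_ge0 ?sqr_ge0.
  have e0 : (0 <= FR xi ^+ 2 + FI xi ^+ 2)%R by rewrite addr_ge0 ?sqr_ge0.
  (* The origin is set apart since the decay hypothesis excludes it; there [mL] vanishes, by its
     bound in [L |xi|]. *)
  rewrite mLf_sqr; have [->|xi0] := eqVneq xi 0%R.
    have -> : (cabs (mL 0) = 0)%R.
      apply/le_anti; rewrite cabs_ge0 andbT (le_trans (mLB 0))//.
      have -> : vnorm (0 : 'rV[R]_d) = 0%R by apply/eqP; rewrite vnorm_eq0.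
      by rewrite mulr0 (_ : Num.min 1 0 = 0)%R ?mulr0//; apply/min_idPr.
    by rewrite expr0n mulr0 mul0e -EFinM lee_fin mulr_ge0// addr_ge0 ?sqr_ge0.
  apply: (le_trans (lee_wpmul2l _ (hC xi xi0))).
    by rewrite lee_fin mulr_ge0// sqr_ge0.
  rewrite -!EFinM lee_fin -mulrA mulrC ler_wpM2r//.
  rewrite mulrCA /D -mulrA ler_wpM2l//; exact: mL_decay.
rewrite ge0_integralZl//; last 2 first.
- by apply/measurable_EFinP; apply: measurable_funD; exact: measurable_funX.
- by move=> xi _; rewrite lee_fin addr_ge0 ?sqr_ge0.
by rewrite lee_wpmul2l ?lee_fin//; exact: bessel_inequality.
Qed.

End schwartz_multiplier.

(** * Chaining *)

Section dyadic_chaining.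
Context {R : realType}.

(** Cauchy-Schwarz with weights [s^r] and [s^-r], the geometric sum being at most [1 / (1 - s)]. *)
Lemma weighted_cauchy_schwarz (s : R) (x : nat -> R) n : 0 < s -> s < 1 ->
  (\sum_(r < n) x r) ^+ 2 <= (1 - s)^-1 * \sum_(r < n) s ^- r * x r ^+ 2.
Proof.
move=> s0 s1; have u0 : 0 < 1 - s by rewrite subr_gt0.
have T0 m : 0 <= \sum_(r < m) s ^- r * x r ^+ 2.
  by apply: sumr_ge0 => r _; rewrite mulr_ge0 ?sqr_ge0// invr_ge0 exprn_ge0// ltW.
suff h : (\sum_(r < n) x r) ^+ 2 <= (\sum_(r < n) s ^+ r) * \sum_(r < n) s ^- r * x r ^+ 2.
  apply: (le_trans h); rewrite ler_wpM2r//.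
  have -> : \sum_(r < n) s ^+ r = (1 - s ^+ n) / (1 - s).
    have := subrX1 s n; rewrite -(opprB 1 s) -(opprB 1 (s ^+ n)) mulNr => /oppr_inj ->.
    by rewrite mulrC mulKf// gt_eqF.
  by rewrite -[leRHS]mul1r ler_wpM2r ?invr_ge0 ?(ltW u0)// lerBlDr lerDl exprn_ge0// ltW.
elim: n => [|n IH]; first by rewrite !big_ord0 expr0n mul0r.
rewrite !big_ord_recr /=; move: IH (T0 n).
set X := \sum_(i < n) x i; set S := \sum_(i < n) s ^+ i; set T := \sum_(i < n) _ => IH T0'.
have S0 : 0 <= S by apply: sumr_ge0 => r _; rewrite exprn_ge0// ltW.
have p0 : 0 < s ^+ n by rewrite exprn_gt0.
move: p0; set p := s ^+ n => p0; set y := x n.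
have Z0 : 0 <= S * (p^-1 * y ^+ 2) + p * T.
  by rewrite addr_ge0// mulr_ge0// ?(ltW p0)// mulr_ge0 ?sqr_ge0// invr_ge0 ltW.
(* The cross term: [X^2 <= S T] by induction, and [4 S T y^2] is at most the square of the
   right-hand side because the difference is [(S y^2 / p - p T)^2]. *)
have h : 2 * (X * y) <= S * (p^-1 * y ^+ 2) + p * T.
  rewrite (le_trans (ler_norm _))// -(@ler_pXn2r _ 2)// ?nnegrE// real_normK ?num_real//.
  apply: (@le_trans _ _ (4 * (S * T) * y ^+ 2)).
    rewrite (_ : (2 * (X * y)) ^+ 2 = 4 * X ^+ 2 * y ^+ 2); last by ring.
    by rewrite ler_wpM2r ?sqr_ge0// ler_wpM2l.
  rewrite -subr_ge0 (_ : _ - _ = (S * (p^-1 * y ^+ 2) - p * T) ^+ 2) ?sqr_ge0//.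
  by field; rewrite gt_eqF.
rewrite (_ : (S + p) * (T + p^-1 * y ^+ 2) = S * T + (S * (p^-1 * y ^+ 2) + p * T) + y ^+ 2); last first.
  by field; rewrite gt_eqF.
by rewrite sqrrD lerD2r lerD// -mulr_natl.
Qed.

Variable a : R.
Hypothesis a0 : 0 < a.

Definition dyad (r p : nat) : R := a * (1 + p%:R / 2 ^+ r).

Lemma dyadS2 r p : dyad r.+1 (2 * p) = dyad r p.
Proof. by rewrite /dyad natrM exprS invfM; congr (_ * (1 + _)); field. Qed.

Lemma dyad_ge r p : a <= dyad r p.
Proof. by rewrite /dyad ler_peMr ?(ltW a0)// lerDl divr_ge0// exprn_ge0. Qed.

Lemma dyad_gt0 r p : 0 < dyad r p.
Proof. exact: lt_le_trans (dyad_ge r p). Qed.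

Lemma dyad_leS r p : dyad r p <= dyad r p.+1.
Proof. by rewrite /dyad ler_wpM2l ?(ltW a0)// lerD2l ler_wpM2r ?invr_ge0 ?exprn_ge0// ler_nat. Qed.

Lemma dyad_gap r p : dyad r p.+1 - dyad r p <= 2 ^- r * dyad r p.
Proof.
rewrite (_ : _ - _ = 2 ^- r * a); first by rewrite ler_wpM2l ?dyad_ge// invr_ge0 exprn_ge0.
by rewrite /dyad -natr1; field; rewrite expf_neq0.
Qed.

Section point.
Variable t : R.
Hypotheses (t0 : 0 <= t) (t1 : t < 1).

(** The integer formed by the first [i] binary digits of [t], so that [dk i / 2^i] approximates [t]
    from below. *)
Definition dk (i : nat) : nat := Num.truncn (2 ^+ i * t).

Let y0 i : 0 <= 2 ^+ i * t. Proof. by rewrite mulr_ge0 ?exprn_ge0. Qed.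

Let dk_itv i : (dk i)%:R <= 2 ^+ i * t < (dk i).+1%:R.
Proof. by have := truncn_itv (y0 i). Qed.

Lemma dk0 : dk 0 = 0%N.
Proof.
apply/eqP; rewrite -leqn0 -ltnS -(ltr_nat R).
by have /andP[h _] := dk_itv 0; rewrite (le_lt_trans h)// expr0 mul1r.
Qed.

Lemma dk_lt i : (dk i < 2 ^ i)%N.
Proof.
rewrite -(ltr_nat R) natrX; have /andP[h _] := dk_itv i; rewrite (le_lt_trans h)//.
by rewrite gtr_pMr// exprn_gt0.
Qed.

Lemma dkS i : dk i.+1 = (2 * dk i)%N \/ dk i.+1 = (2 * dk i).+1.
Proof.
have /andP[h1 h2] := dk_itv i; have /andP[g1 g2] := dk_itv i.+1.
have l1 : (2 * dk i <= dk i.+1)%N.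
  rewrite -ltnS -(ltr_nat R) (le_lt_trans _ g2)// natrM exprS -mulrA ler_wpM2l//.
have l2 : (dk i.+1 < 2 * (dk i).+1)%N.
  by rewrite -(ltr_nat R) (le_lt_trans g1)// natrM exprS -mulrA ltr_pM2l.
move: l1 l2; rewrite mulnS leq_eqVlt => /predU1P[->|]; first by left.
rewrite add2n ltnS => l1 l2; right; apply/eqP; rewrite eqn_leq l1 andbT -ltnS//.
Qed.

Lemma dyad_dk_cvg : dyad i (dk i) @[i --> \oo] --> a * (1 + t).
Proof.
apply: cvgM; first exact: cvg_cst.
apply: cvgD; first exact: cvg_cst.
apply: (@squeeze_cvgr _ _ _ _ (fun i => t - 2 ^- i) (cst t)).
- near=> i; have /andP[h1 h2] := dk_itv i.
  have p0 : (0 : R) < 2 ^+ i by rewrite exprn_gt0.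
  rewrite /cst ler_pdivrMr// (mulrC t) h1 andbT.
  rewrite lerBlDr -[X in _ <= _ + X]div1r -mulrDl ler_pdivlMr// mulrC natr1.
  exact: ltW.
- rewrite -[X in _ --> X]subr0; apply: cvgB; first exact: cvg_cst.
  rewrite (_ : (fun i => _) = (fun i => (2^-1 : R) ^+ i)); last by apply/funext => i; rewrite exprVn.
  by apply: cvg_expr; rewrite ger0_norm ?invf_lt1 ?ltr1n// invr_ge0.
- exact: cvg_cst.
Unshelve. all: by end_near. Qed.

Variables (A : R -> R) (D : R -> R -> R).
Hypotheses (A0 : forall l, 0 <= A l) (D0 : forall l l', 0 <= D l l').
Hypothesis AD : forall l l', A l' <= A l + D l l'.

(** Passing to the next binary digit moves the point by zero or one step of the finer grid. The
    increment met at each level is then bounded by the sum over all increments of that level, which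
    frees the right-hand side from [t]. The weights are those of [weighted_cauchy_schwarz] with
    [s = q6^-1]. *)
Lemma dyadic_chain i :
  A (dyad i (dk i)) ^+ 2 <= 2 * A a ^+ 2 + 2 * (1 - q6^-1)^-1 *
    \sum_(r < i) q6 ^+ r * \sum_(p < 2 ^ r.+1) D (dyad r.+1 p) (dyad r.+1 p.+1) ^+ 2.
Proof.
pose x r := D (dyad r.+1 (2 * dk r)) (dyad r.+1 (2 * dk r).+1).
have x0 r : 0 <= x r by exact: D0.
have step r : A (dyad r.+1 (dk r.+1)) <= A (dyad r (dk r)) + x r.
  case: (dkS r) => ->; last by rewrite -(dyadS2 r (dk r)).
  by rewrite dyadS2 lerDl.
have sum n : A (dyad n (dk n)) <= A a + \sum_(r < n) x r.
  elim: n => [|n IH]; first by rewrite big_ord0 addr0 dk0 /dyad mul0r addr0 mulr1.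
  by rewrite big_ord_recr /= addrA (le_trans (step n))// lerD2r.
have X0 : 0 <= \sum_(r < i) x r by exact: sumr_ge0.
apply: (@le_trans _ _ ((A a + \sum_(r < i) x r) ^+ 2)).
  by rewrite lerXn2r ?nnegrE ?addr_ge0.
apply: (@le_trans _ _ (2 * A a ^+ 2 + 2 * (\sum_(r < i) x r) ^+ 2)).
  by rewrite -subr_ge0 (_ : _ - _ = (A a - \sum_(r < i) x r) ^+ 2) ?sqr_ge0//; ring.
rewrite lerD2l -mulrA ler_wpM2l//.
have qV0 : 0 < (q6^-1 : R) by rewrite invr_gt0 q6_gt0.
apply: (le_trans (weighted_cauchy_schwarz x i qV0 (@q6V_lt1 R))).
rewrite ler_wpM2l ?invr_ge0 ?subr_ge0 ?(ltW (@q6V_lt1 R))//.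
apply: ler_sum => r _; rewrite exprVn invrK ler_wpM2l ?exprn_ge0 ?(ltW (@q6_gt0 R))//.
have kr : (2 * dk r < 2 ^ r.+1)%N by rewrite expnS ltn_pmul2l// dk_lt.
rewrite (bigD1 (Ordinal kr))//= lerDl sumr_ge0// => p _.
exact: sqr_ge0.
Qed.

End point.
End dyadic_chaining.

Section dyadic_blocks.
Context {R : realType}.

Lemma exists_dyadic_block (lam0 lam : R) : 0 < lam0 -> lam0 <= lam ->
  exists (l : nat) (t : R), [/\ 0 <= t, t < 1 & lam = 2 ^+ l * lam0 * (1 + t)].
Proof.
move=> l0 ll.
have ex : exists n, lam < 2 ^+ n * lam0.
  exists (Num.truncn (lam / lam0)).+1; rewrite -ltr_pdivrMr//.
  have y0 : 0 <= lam / lam0 by rewrite divr_ge0 ?ltW// (lt_le_trans l0).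
  have /andP[_ h] := truncn_itv y0; rewrite (lt_le_trans h)//.
  by rewrite -natrX ler_nat ltnW// ltn_expl.
case: (ex_minnP ex) => -[|l] ln nmin; first by move: ln; rewrite expr0 mul1r ltNge ll.
have lb : 2 ^+ l * lam0 <= lam.
  by rewrite leNgt; apply/negP => /nmin; rewrite ltnn.
have p0 : 0 < 2 ^+ l * lam0 by rewrite mulr_gt0// exprn_gt0.
exists l, (lam / (2 ^+ l * lam0) - 1); split.
- by rewrite subr_ge0 ler_pdivlMr// mul1r.
- by rewrite ltrBlDr ltr_pdivrMr// (lt_le_trans ln)// exprS -mulrA.
- by field; rewrite !gt_eqF// exprn_gt0.
Qed.

End dyadic_blocks.

Section dyadic_powers.
Context {R : realType}.

Lemma powR_dyadic (n k : nat) : (2 ^- n : R) `^ (k%:R / 6) = q6 ^- (k * n).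
Proof.
rewrite -(powR_invn n (ler0n R 2)) -powRrM -powR2_sixth -powRN; congr (_ `^ _).
by rewrite natrM; field.
Qed.

Lemma q6V_ge0 : 0 <= (q6^-1 : R).
Proof. by rewrite invr_ge0 ltW// q6_gt0. Qed.

(** At level [r] there are [2^(r+1)] increments, each of size [2^(-4 (r+1) / 3)]: this leaves
    [q6^(-2 (r+1))], half of whose exponent pays for the chaining weight [q6^r]. *)
Lemma chain_weight_le (r : nat) :
  q6 ^+ r * ((2 ^ r.+1)%:R * (2 ^- r.+1) `^ (4 / 3)) <= (q6^-1 : R) ^+ r.
Proof.
rewrite (_ : 4 / 3 = 8%:R / 6 :> R); last by field.
rewrite powR_dyadic natrX -{1}(@q6_expn6 R) -exprM exprVn.
have q0 := @q6_gt0 R.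
have qn e : q6 ^+ e != 0 :> R by rewrite expf_neq0// gt_eqF.
rewrite (mulnDl 6 2 r.+1 : (8 * _)%N = _) exprD invfM (mulrA (q6 ^+ (6 * _))) mulfV// mul1r.
rewrite ler_pdivrMr ?exprn_gt0// mulrC ler_pdivlMr ?exprn_gt0// -exprD ler_eXn2l ?(@q6_gt1 R)//.
by rewrite addnn -mul2n leq_mul2l leqnSn.
Qed.

End dyadic_powers.

(** * A measurable majorant of the maximal function *)

Section maximal_bound.
Context {R : realType} {d k : nat}.
Variable v : nat -> 'rV[R]_d.
Hypothesis vfree : row_free (\matrix_(i < k) v i.+1).
Variable m : nat.
Hypotheses (mk : (m < k)%N) (md : (m + 3 <= d)%N).
Variables (mL f : 'rV[R]_d -> R[i]) (B L : R).
Hypotheses (smL : smoothC mL) (mLB : forall xi, cabs (mL xi) <= B * Num.min 1 (L * vnorm xi)).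
Hypotheses (L0 : 0 < L) (sf : schwartz f).
Implicit Types (x xi : 'rV[R]_d) (lam a : R).

Let p1 := mLf1 mL f.
Let p2 := mLf2 mL f.
Let mp1 : measurable_fun setT p1. Proof. exact: measurable_mLf1. Qed.
Let mp2 : measurable_fun setT p2. Proof. exact: measurable_mLf2. Qed.
Let exK : exists K, (forall x, `|p1 x| <= K * qdv x) /\ (forall x, `|p2 x| <= K * qdv x).
Proof. exact: (exists_mLf_bound mLB L0 sf). Qed.
Let a0 : frames R d := nth 0 [::].

Let Av lam x : \bar R := avgop v p1 p2 (S1 v m lam) (S2 v m lam) m 0 a0 x.
Let Dv lam lam' x : \bar R := avgop v p1 p2 (fun b xi => S1 v m lam' b xi - S1 v m lam b xi)
  (fun b xi => S2 v m lam' b xi - S2 v m lam b xi) m 0 a0 x.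
Let Ar lam x : R := fine (Av lam x).
Let Dr lam lam' x : R := fine (Dv lam lam' x).

Let AvE lam x : Av lam x = (Ar lam x)%:E.
Proof. by have [K [K1 K2]] := exK; rewrite fineK//; exact: (avgop_fin v mp1 mp2 K1 K2 (good_S v m lam)). Qed.
Let DvE lam lam' x : Dv lam lam' x = (Dr lam lam' x)%:E.
Proof. by have [K [K1 K2]] := exK; rewrite fineK//; exact: (avgop_fin v mp1 mp2 K1 K2 (good_SB v m lam lam')). Qed.
Let Ar0 lam x : 0 <= Ar lam x.
Proof. by rewrite fine_ge0// avgop_ge0. Qed.
Let Dr0 lam lam' x : 0 <= Dr lam lam' x.
Proof. by rewrite fine_ge0// avgop_ge0. Qed.

Let ADr x lam lam' : Ar lam' x <= Ar lam x + Dr lam lam' x.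
Proof.
have [K [K1 K2]] := exK.
have := avgop_triangle v mp1 mp2 K1 K2 (good_S v m lam) (good_SB v m lam lam') m 0 a0 x.
by rewrite -/(Av lam' x) -/(Av lam x) -/(Dv lam lam' x) !AvE DvE -EFinD lee_fin.
Qed.

Let mAr lam : measurable_fun setT (Ar lam).
Proof.
have [K [K1 K2]] := exK; apply: (measurableT_comp (fine_measurable measurableT)).
exact: (measurable_avgop v mp1 mp2 K1 K2 (good_S v m lam)).
Qed.

Let mDr lam lam' : measurable_fun setT (Dr lam lam').
Proof.
have [K [K1 K2]] := exK; apply: (measurableT_comp (fine_measurable measurableT)).
exact: (measurable_avgop v mp1 mp2 K1 K2 (good_SB v m lam lam')).
Qed.

Let E := fine (energy f).
Let EE : energy f = E%:E. Proof. by rewrite fineK// energy_fin. Qed.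
Let E0 : 0 <= E. Proof. by rewrite fine_ge0// energy_ge0. Qed.

Let C4 : R := sigma_hat_cst v m * pw_step_cst ^+ m.
Let C40 : 0 <= C4.
Proof. by rewrite mulr_ge0 ?(ltW (sigma_hat_cst_gt0 _ _))// exprn_ge0// (le_trans ler01 (@pw_step_cst_ge1 R)). Qed.

Let Q a : R := C4 * B ^+ 2 * (L / a) `^ (3^-1) * E.
Let Q0 a : 0 <= Q a.
Proof. by rewrite mulr_ge0// mulr_ge0 ?powR_ge0// mulr_ge0// sqr_ge0. Qed.

Local Open Scope ereal_scope.

Let int_Ar lam : (0 < lam)%R -> \int[leb d]_x (Ar lam x ^+ 2)%:E <= (Q lam)%:E.
Proof.
move=> l0; rewrite /Q EFinM -EE.
under eq_integral do rewrite expr2 EFinM -AvE.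
apply: (avgop_energy smL mLB L0 sf (good_S v m lam) C40 l0) => xi xi0.
exact: (frame_avg_S_le vfree mk md a0 xi0 l0).
Qed.

Let Q_anti a lam : (0 < a)%R -> (a <= lam)%R -> (Q lam <= Q a)%R.
Proof.
move=> a1 al; have l1 := lt_le_trans a1 al.
have CB : (0 <= C4 * B ^+ 2)%R by rewrite (mulr_ge0 C40)// sqr_ge0.
rewrite ler_wpM2r// (ler_wpM2l CB)//.
rewrite ge0_ler_powR ?nnegrE ?invr_ge0// ?divr_ge0 ?(ltW L0) ?(ltW a1) ?(ltW l1)//.
by rewrite ler_wpM2l ?(ltW L0)// lef_pV2.
Qed.

Let int_Dr a r p : (0 < a)%R ->
  \int[leb d]_x (Dr (dyad a r p) (dyad a r p.+1) x ^+ 2)%:E <= (Q a * (2 ^- r) `^ (4 / 3))%:E.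
Proof.
move=> a1; have l1 := dyad_gt0 a1 r p.
have h0 : (0 < (2 ^- r : R))%R by rewrite invr_gt0 exprn_gt0.
set h43 := ((2 ^- r) `^ (4 / 3))%R; have h430 : (0 <= h43)%R by exact: powR_ge0.
apply: (@le_trans _ _ (Q (dyad a r p) * h43)%:E); last first.
  by rewrite lee_fin ler_wpM2r// Q_anti// dyad_ge.
rewrite (_ : (Q _ * h43)%R = (C4 * h43 * B ^+ 2 * (L / dyad a r p) `^ (3^-1) * E)%R); last by rewrite /Q; ring.
rewrite EFinM -EE; under eq_integral do rewrite expr2 EFinM -DvE.
apply: (avgop_energy smL mLB L0 sf (good_SB v m _ _) (mulr_ge0 C40 h430) l1) => xi xi0.
exact: (frame_avg_SB_le vfree mk md a0 xi0 l1 (dyad_leS a1 r p) h0 (dyad_gap a1 r p)).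
Qed.

Let c0 : R := (2 * (1 - q6^-1)^-1)%R.
Let c00 : (0 <= c0)%R.
Proof. by rewrite mulr_ge0// invr_ge0 subr_ge0 ltW// q6V_lt1. Qed.

Let wt a r x : \bar R :=
  (q6 ^+ r * \sum_(p < 2 ^ r.+1) Dr (dyad a r.+1 p) (dyad a r.+1 p.+1) x ^+ 2)%:E.
(** Dominates the squared average at [x] for all [lam] in [[a, 2 a)] simultaneously, without
    depending on [lam]. *)
Let W a x : \bar R := (2 * Ar a x ^+ 2)%:E + c0%:E * \sum_(0 <= r <oo) wt a r x.

Let wt0 a r x : 0 <= wt a r x.
Proof. by rewrite lee_fin mulr_ge0 ?exprn_ge0 ?(ltW (@q6_gt0 R))// sumr_ge0// => p _; exact: sqr_ge0. Qed.

Let swt0 a x : 0 <= \sum_(0 <= r <oo) wt a r x.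
Proof. by apply: nneseries_ge0 => r _ _; exact: wt0. Qed.

Let W0 a x : 0 <= W a x.
Proof. by rewrite adde_ge0 ?mule_ge0 ?swt0 ?lee_fin// mulr_ge0// sqr_ge0. Qed.

Let mwt a r : measurable_fun setT (wt a r).
Proof.
apply/measurable_EFinP; apply: measurable_funM => //.
by apply: measurable_sum => p; apply: measurable_funX; exact: mDr.
Qed.

Let mW a : measurable_fun setT (W a).
Proof.
apply: emeasurable_funD.
  by apply/measurable_EFinP; apply: measurable_funM => //; apply: measurable_funX; exact: mAr.
apply: emeasurable_funM => //.
by apply: ge0_emeasurable_sum => [r x _ _|r _]; [exact: wt0|exact: mwt].
Qed.

Let int_wt a r : (0 < a)%R -> \int[leb d]_x wt a r x <= (Q a * (q6^-1) ^+ r)%:E.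
Proof.
move=> a1; have q0 : (0 <= (q6 : R) ^+ r)%R by rewrite exprn_ge0// ltW// q6_gt0.
have mD p : measurable_fun setT (fun x => (Dr (dyad a r.+1 p) (dyad a r.+1 p.+1) x ^+ 2)%:E).
  by apply/measurable_EFinP; apply: measurable_funX; exact: mDr.
have D0 p x : 0 <= (Dr (dyad a r.+1 p) (dyad a r.+1 p.+1) x ^+ 2)%:E by rewrite lee_fin sqr_ge0.
rewrite /wt; under eq_integral do rewrite EFinM -sumEFin.
rewrite ge0_integralZl//; last 2 first.
- by apply: emeasurable_sum => p; exact: mD.
- by move=> x _; apply: sume_ge0 => p _; exact: D0.
rewrite (ge0_integral_sum _ measurableT (fun p : 'I_(2 ^ r.+1) => mD p) (fun p x _ => D0 p x)).
apply: (@le_trans _ _ ((q6 ^+ r)%:E * \sum_(p < 2 ^ r.+1) (Q a * (2 ^- r.+1) `^ (4 / 3))%:E)).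
  by rewrite lee_wpmul2l ?lee_fin//; apply: lee_sum => p _; exact: int_Dr.
rewrite sumEFin -EFinM lee_fin sumr_const card_ord -[X in (_ * X)%R]mulr_natl.
rewrite (_ : (q6 ^+ r * _)%R = (Q a * (q6 ^+ r * ((2 ^ r.+1)%:R * (2 ^- r.+1) `^ (4 / 3))))%R); last by ring.
by rewrite ler_wpM2l// chain_weight_le.
Qed.

Let c1 : R := (2 + c0 / (1 - q6^-1))%R.

Let int_W a : (0 < a)%R -> \int[leb d]_x W a x <= (c1 * Q a)%:E.
Proof.
move=> a1; rewrite /W ge0_integralD//; last 4 first.
- by move=> x _; rewrite lee_fin mulr_ge0// sqr_ge0.
- by apply/measurable_EFinP; apply: measurable_funM => //; apply: measurable_funX; exact: mAr.
- by move=> x _; rewrite mule_ge0 ?swt0// lee_fin.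
- apply: emeasurable_funM => //.
  by apply: ge0_emeasurable_sum => [r x _ _|r _]; [exact: wt0|exact: mwt].
rewrite /c1 mulrDl EFinD; apply: leeD.
  under eq_integral do rewrite EFinM.
  rewrite ge0_integralZl//; last 2 first.
  - by apply/measurable_EFinP; apply: measurable_funX; exact: mAr.
  - by move=> x _; rewrite lee_fin sqr_ge0.
  by rewrite EFinM lee_wpmul2l ?lee_fin// int_Ar.
rewrite ge0_integralZl//; last first.
  by apply: ge0_emeasurable_sum => [r x _ _|r _]; [exact: wt0|exact: mwt].
rewrite integral_nneseries//.
rewrite -(mulrA c0) (EFinM c0) lee_wpmul2l ?lee_fin//.
rewrite [X in _ <= X%:E]mulrC -nneseries_geometric ?q6V_lt1 ?q6V_ge0//.
apply: lee_nneseries => r; first by move=> _ _; apply: integral_ge0 => x _; exact: wt0.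
by move=> _; exact: int_wt.
Qed.

Variables lam0 : R.
Hypothesis l0 : (0 < lam0)%R.

Let ab l : R := (2 ^+ l * lam0)%R.
Let ab0 l : (0 < ab l)%R. Proof. by rewrite mulr_gt0// exprn_gt0. Qed.

(** Doubling [l] times gains [2^(-l/3) = q6^(-2 l)], of which [q6^(-l)] is enough for summing the
    blocks. *)
Let Qab l : (Q (ab l) <= Q lam0 * (q6^-1) ^+ l)%R.
Proof.
have i2 : (0 <= (2 ^- l : R))%R by rewrite invr_ge0 exprn_ge0.
have Ll : (0 <= L / lam0)%R by rewrite divr_ge0 ?ltW.
rewrite /Q (_ : (L / ab l = L / lam0 * 2 ^- l)%R); last first.
  by rewrite /ab; field; rewrite (gt_eqF l0) gt_eqF// exprn_gt0.
rewrite (powRM _ Ll i2) [X in (_ * (_ * X) * _ <= _)%R](_ : _ = q6 ^- (2 * l))%R; last first.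
  by rewrite -powR_dyadic; congr (_ `^ _)%R; field.
rewrite (mulrA (C4 * B ^+ 2)%R) [leLHS]mulrAC.
rewrite ler_wpM2l ?(Q0 lam0)// exprVn lef_pV2 ?posrE ?exprn_gt0 ?q6_gt0//.
by rewrite ler_eXn2l ?q6_gt1// leq_pmull.
Qed.

(** All blocks above [lam0] are summed, so the majorant, and with it the final constant, is
    independent of [lam1]. *)
Definition maximal_majorant x : \bar R := \sum_(0 <= l <oo) W (ab l) x.

Lemma maximal_majorant_ge0 x : 0 <= maximal_majorant x.
Proof. by apply: nneseries_ge0 => l _ _; exact: W0. Qed.

Lemma measurable_maximal_majorant : measurable_fun setT maximal_majorant.
Proof. by apply: ge0_emeasurable_sum => [l x _ _|l _]; [exact: W0|exact: mW]. Qed.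

Lemma integral_maximal_majorant : \int[leb d]_x maximal_majorant x <=
  ((2 + 2 * (1 - q6^-1)^-1 / (1 - q6^-1)) / (1 - q6^-1) * (sigma_hat_cst v m * pw_step_cst ^+ m * B ^+ 2 *
    (L / lam0) `^ (3^-1)))%:E * energy f.
Proof.
have c10 : (0 <= c1)%R.
  by rewrite addr_ge0// mulr_ge0// invr_ge0 subr_ge0 ltW// q6V_lt1.
rewrite integral_nneseries//.
rewrite EE -EFinM (_ : (_ * E)%R = (c1 * Q lam0 / (1 - q6^-1))%R); last by rewrite /Q /c1 /c0 /C4; ring.
rewrite -(nneseries_geometric (mulr_ge0 c10 (Q0 lam0)) (@q6V_ge0 R) (@q6V_lt1 R)).
apply: lee_nneseries => l; first by move=> _ _; apply: integral_ge0 => x _; exact: W0.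
move=> _; apply: (le_trans (int_W (ab0 l))).
by rewrite lee_fin -mulrA ler_wpM2l.
Qed.

Let chain_le a (t : R) x i : (0 <= t)%R -> (t < 1)%R -> (Ar (dyad a i (dk t i)) x ^+ 2)%:E <= W a x.
Proof.
move=> t0 t1.
have := dyadic_chain a t0 t1 (Ar0^~ x) (fun l l' => Dr0 l l' x) (ADr x) i.
rewrite -lee_fin => /le_trans; apply; rewrite EFinD /W leeD2lE// -/c0 EFinM.
rewrite lee_wpmul2l ?lee_fin//.
apply: le_trans (nneseries_lim_ge i (fun r _ _ => wt0 a r x)).
by rewrite big_mkord sumEFin.
Qed.

(** The dyadic points converge to [lam] inside its block, and the average is continuous along them;
    the bound at the dyadic points therefore passes to the limit. *)
Lemma sqrt_majorant lam x : (lam0 <= lam)%R -> maximal_majorant x \is a fin_num ->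
  Av lam x <= (Num.sqrt (fine (maximal_majorant x)))%:E.
Proof.
move=> ll fT; have [K [K1 K2]] := exK.
have [l [t [t0 t1 lE]]] := exists_dyadic_block l0 ll.
have lc : dyad (ab l) i (dk t i) @[i --> \oo] --> lam by rewrite lE; exact: dyad_dk_cvg.
have cA : Av (dyad (ab l) i (dk t i)) x @[i --> \oo] --> Av lam x.
  apply: (avgop_cvg mp1 mp2 K1 K2) => [i|b xi|b xi]; first exact: good_S.
    exact: S1_cvg.
  exact: S2_cvg.
rewrite -(cvg_lim _ cA)//; apply: lime_le; first by apply: (cvgP _ cA).
near=> i; rewrite AvE lee_fin.
rewrite -[leLHS]ger0_norm// -sqrtr_sqr ler_sqrt; last by rewrite fine_ge0// maximal_majorant_ge0.
rewrite -lee_fin fineK//; apply: (le_trans (chain_le (ab l) x i t0 t1)).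
rewrite /maximal_majorant.
apply: le_trans (nneseries_lim_ge l.+1 (fun l _ _ => W0 (ab l) x)).
rewrite big_nat_recr//= leeDr//; apply: sume_ge0 => r _; exact: W0.
Unshelve. all: by end_near. Qed.

Lemma frame_int_avgop lam x :
  frame_int v m [::] (fun ys => (cabs (mult_op v mL ys lam f x))%:E) = Av lam x.
Proof.
have [K [K1 K2]] := exK.
pose G n b := (opA p1 p2 (S1 v n lam) (S2 v n lam) b x)%:E.
have mG n : measurable_fun setT (G n).
  apply/measurable_EFinP.
  apply: (measurableT_comp (measurable_opA mp1 mp2 K1 K2 (good_S v n lam)) (g := fun b => (b, x))).
  exact: measurable_fun_pair.
have G0 n b : 0 <= G n b by rewrite lee_fin opA_ge0.
rewrite -[RHS](frame_intE v m [::] mG G0); congr frame_int.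
by apply/funext => ys; rewrite (cabs_mult_opE v smL mLB L0 sf).
Qed.

Lemma max_op_sqr_le lam1 x : (lam0 <= lam1)%R ->
  max_op v m.+1 lam0 lam1 mL f x * max_op v m.+1 lam0 lam1 mL f x <= maximal_majorant x.
Proof.
move=> l01; have M0 := maximal_majorant_ge0 x.
have [fT|] := boolP (maximal_majorant x \is a fin_num); last first.
  by rewrite ge0_fin_numE// ltey negbK => /eqP ->; rewrite leey.
have s0 : 0 <= max_op v m.+1 lam0 lam1 mL f x.
  apply: (@le_trans _ _ (Av lam0 x)); first exact: avgop_ge0.
  apply: ereal_sup_ubound; exists lam0; last exact: frame_int_avgop.
  by rewrite /= in_itv /= lexx.
have sup : max_op v m.+1 lam0 lam1 mL f x <= (Num.sqrt (fine (maximal_majorant x)))%:E.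
  apply: ge_ereal_sup => /= y [lam]; rewrite /= in_itv /= => /andP[ll _] <-.
  by rewrite frame_int_avgop; exact: sqrt_majorant.
apply: (le_trans (lee_pmul s0 s0 sup sup)).
by rewrite -EFinM -expr2 sqr_sqrtr ?fine_ge0// fineK.
Qed.

End maximal_bound.

Theorem theorem6p1 (R : realType) (d k : nat) (v : nat -> 'rV[R]_d) (B : R) :
  row_free (\matrix_(i < k) v i.+1) ->
  (forall (i : nat) (c : 'I_d), (1 <= i <= k)%N -> (k <= c)%N -> v i 0 c = 0) ->
  vnorm (v 1%N) = 1 ->
  exists C : R, forall (j : nat) (lam0 lam1 L : R)
      (mL : 'rV[R]_d -> R[i]) (f : 'rV[R]_d -> R[i]),
    (1 <= j <= k)%N -> (j + 2 <= d)%N ->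
    0 < lam0 -> lam0 <= lam1 -> 0 < L -> L <= lam0 ->
    smoothC mL ->
    (forall xi, cabs (mL xi) <= B * Num.min 1 (L * vnorm xi)) ->
    schwartz f ->
    (intRd (fun x => max_op v j lam0 lam1 mL f x * max_op v j lam0 lam1 mL f x)
     <= (C * (L / lam0) `^ (3^-1))%:E * intRd (fun x => (cabs (f x) ^+ 2)%:E))%E.
Proof.
move=> vfree _ _.
pose c : R := (2 + 2 * (1 - q6^-1)^-1 / (1 - q6^-1)) / (1 - q6^-1).
have u0 : 0 <= (1 - q6^-1)^-1 :> R by rewrite invr_ge0 subr_ge0 ltW// q6V_lt1.
have c0 : 0 <= c by rewrite mulr_ge0// addr_ge0// !mulr_ge0.
pose D m : R := c * (sigma_hat_cst v m * pw_step_cst ^+ m * B ^+ 2).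
have D0 m : 0 <= D m.
  rewrite mulr_ge0// mulr_ge0 ?sqr_ge0// mulr_ge0 ?(ltW (sigma_hat_cst_gt0 _ _))//.
  by rewrite exprn_ge0// (le_trans ler01 (@pw_step_cst_ge1 R)).
(* The constant must not depend on [j], so the constants for all the frame lengths [m = j - 1 < k]
   are added. *)
exists (\sum_(m < k) D m) => -[//|m] lam0 lam1 L mL f /= mk md l0 l01 L0 _ smL mLB sf.
have md' : (m + 3 <= d)%N by rewrite addnS -addSn.
rewrite (energyE sf).
have M0 := maximal_majorant_ge0 v m mL f lam0.
apply: (@le_trans _ _ (intRd (maximal_majorant v m mL f lam0))).
  apply: le_intRd => x; last exact: max_op_sqr_le.
  by rewrite -expe2 sqre_ge0.
rewrite ge0_intRdE//; last exact: measurable_maximal_majorant.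
apply: (le_trans (integral_maximal_majorant vfree mk md' smL mLB L0 sf l0)).
rewrite lee_wpmul2r ?energy_ge0// lee_fin mulrA ler_wpM2r ?powR_ge0//.
by rewrite (bigD1 (Ordinal mk))//= lerDl sumr_ge0.
Qed.
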